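(* Let $d\ge 1$, $K\ge 2$. Let $\boldsymbol X$ and $\boldsymbol Y$ be $[0,\infty)^d$-valued random vectors with standard Pareto margins that are multivariate regularly varying with exponent measures $\nu_X$ and $\nu_Y$, and suppose that the second-order condition (see context) holds for $\boldsymbol X$ with $\nu_X$ and second-order scale function $a_X$, and for $\boldsymbol Y$ with $\nu_Y$ and second-order scale function $a_Y$. Let $r$ be a risk functional and let $A_1,\dots,A_K$ be a partition of $\Omega_r=\{\boldsymbol x\in[0,\infty)^d: r(\boldsymbol x)>1\}$ that is admissible (see context), with $\nu_X(\partial A_j)=\nu_Y(\partial A_j)=0$ for $j=1,\dots,K$ and $\nu_X(\partial\Omega_r)=\nu_Y(\partial\Omega_r)=0$. Assume $\nu_X(\Omega_r),\nu_Y(\Omega_r)>0$ and that $$p_j=\frac{\nu_X(A_j)}{\nu_X(\Omega_r)}\in(0,1),\qquad q_j=\frac{\nu_Y(A_j)}{\nu_Y(\Omega_r)}\in(0,1),\qquad j=1,\dots,K.$$ Let $U_X(t)=\inf\{u:\mathbb P(\|\boldsymbol X\|_\infty>u)\le 1/t\}$ and $U_Y(t)=\inf\{u:\mathbb P(\|\boldsymbol Y\|_\infty>u)\le 1/t\}$. Let $k_n$ be a sequence of positive integers such that, as $n\to\infty$, $k_n\to\infty$, $k_n/n\to0$, $\sqrt{k_n}\,a_X\{U_X(n/k_n)\}\to0$ and $\sqrt{k_n}\,a_Y\{U_Y(n/k_n)\}\to0$. Let $\boldsymbol X_1,\dots,\boldsymbol X_n$ be i.i.d. copies of $\boldsymbol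 X$ and $\boldsymbol Y_1,\dots,\boldsymbol Y_n$ i.i.d. copies of $\boldsymbol Y$, the two samples being independent, and let $\hat D_K$ be the empirical Kullback--Leibler divergence computed from these samples with $k_n$ exceedances (see context). (i) If $p_j=q_j$ for all $j=1,\dots,K$ (null hypothesis), then $$\frac{k_n}{2}\hat D_K\ \stackrel{d}{\to}\ \chi^2(K-1),\qquad n\to\infty.$$ (ii) If $p_j\ne q_j$ for some $j\in\{1,\dots,K\}$ (alternative hypothesis), then $$\sqrt{k_n}\,\bigl(\hat D_K-D_K\bigr)\ \stackrel{d}{\to}\ N(0,\sigma^2),\qquad n\to\infty,$$ where $D_K=\sum_{j=1}^K(p_j-q_j)(\log p_j-\log q_j)$ and $$\sigma^2=\sum_{j=1}^K\Bigl\{D_{1j}^2\,p_j(1-p_j)+D_{2j}^2\,q_j(1-q_j)\Bigr\}-2\sum_{1\le j_1<j_2\le K}\Bigl(D_{1j_1}D_{1j_2}p_{j_1}p_{j_2}+D_{2j_1}D_{2j_2}q_{j_1}q_{j_2}\Bigr),$$ with $$D_{1j}=\log\frac{p_j}{q_j}+1-\frac{q_j}{p_j},\qquad D_{2j}=\log\frac{q_j}{p_j}+1-\frac{p_j}{q_j},\qquad 1\le j\le K.$$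
   Context: Standard Pareto margins: $\mathbb P(X_j>x)=1/x$ for $x\ge1$. Topological boundaries $\partial B$ are taken in $[0,\infty)^d$. Multivariate regular variation and exponent measure: $\boldsymbol X$ is multivariate regularly varying if there is a probability measure $\nu_X$ on $\{\boldsymbol x\in[0,\infty)^d:\|\boldsymbol x\|_\infty>1\}$ with $\lim_{u\to\infty}\mathbb P(\boldsymbol X/u\in B\mid\|\boldsymbol X\|_\infty>u)=\nu_X(B)$ for all Borel $B\subset\{\boldsymbol x\ge0:\|\boldsymbol x\|_\infty>1\}$ with $\nu_X(\partial B)=0$. It satisfies $\nu_X(tB)=t^{-1}\nu_X(B)$ for $t>1$. It is extended to a measure on $[0,\infty)^d\setminus\{0\}$ (the exponent measure, same notation) by $\nu_X(B)=t^{-1}\nu_X(t^{-1}B)$ for Borel $B$ bounded away from the origin and any $t\in(0,1]$ with $t^{-1}B\subset\{\|\boldsymbol x\|_\infty>1\}$ (the value does not depend on $t$); the extension is homogeneous of degree $-1$ for all $t>0$. Likewise $\nu_Y$ for $\boldsymbol Y$. Second-order condition for $\boldsymbol X$ with scale function $a_X$: $a_X(u)\to0$ as $u\to\infty$, and for every $\epsilon>0$ and every Borel set $B\subset[0,\infty)^d\setminus[0,\epsilon)^d$ with $\nu_X(\partial B)=0$, $$\frac{\mathbb P(\boldsymbol X/u\in B)}{\mathbb P(\|\boldsymbol X\|_\infty>u)}-\nu_X(B)=O(a_X(u)),\qquad u\to\infty.$$ Likewise for $\boldsymbol Y$ with $\nu_Y$, $a_Y$. Risk functional: a measurable function $r:[0,\infty)^d\to[0,\infty)$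 with $r(t\boldsymbol x)=t\,r(\boldsymbol x)$ for all $t>0$, $\boldsymbol x\in[0,\infty)^d$, such that $\Omega_r=\{\boldsymbol x\in[0,\infty)^d:r(\boldsymbol x)>1\}$ is bounded away from the origin. Admissible partition: let $\mathcal A_r$ be the collection of Borel sets $B\subset\Omega_r$ with $tB\subset B$ for all $t>1$. A partition $A_1,\dots,A_K$ of $\Omega_r$ is admissible if each $A_j$ can be expressed using a finite number of operations of union, intersection and complementation on sets in $\mathcal A_r$. Estimators: let $R^X_{1,n}\le\dots\le R^X_{n,n}$ be the order statistics of $r(\boldsymbol X_1),\dots,r(\boldsymbol X_n)$, and $$\hat p_j=\frac1{k_n}\sum_{i=1}^n\mathbf 1\{\boldsymbol X_i\in R^X_{n-k_n,n}A_j\},\qquad j=1,\dots,K.$$ Define $\hat q_j$ in the same way from $\boldsymbol Y_1,\dots,\boldsymbol Y_n$ (same $k_n$). Then $\hat D_K=\sum_{j=1}^K(\hat p_j-\hat q_j)(\log\hat p_j-\log\hat q_j)$ (on the event that some $\hat p_j$ or $\hat q_j$ vanishes, $\hat D_K$ may be assigned an arbitrary value). *)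

(* Defs.v *)
From HB Require Import structures.
From mathcomp Require Import all_boot all_order all_algebra.
From mathcomp Require Import finmap.
From mathcomp Require Import all_classical all_reals all_analysis.
From mathcomp Require Import measurable_realfun.

Set Implicit Arguments.
Unset Strict Implicit.
Unset Printing Implicit Defensive.

Import Order.TTheory GRing.Theory Num.Theory.
Import numFieldNormedType.Exports.

Local Open Scope classical_set_scope.
Local Open Scope ring_scope.

(** ** Generalities on random variables *)

Definition mutually_independent d d' (T : measurableType d)
    (E : measurableType d') (R : realType) (P : probability T R)
    (I : choiceType) (Z : I -> T -> E) : Prop :=
  forall (J : {fset I}) (B : I -> set E), (forall i, measurable (B i)) ->
    P (\bigcap_(i in [set` J]) (Z i @^-1` B i)) =
    (\prod_(i <- J) P (Z i @^-1` B i))%E.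

(* The laws are compared on measurable sets only: the value of a measure
   outside its sigma-algebra is junk. *)
Definition same_law d1 d2 d' (T1 : measurableType d1) (T2 : measurableType d2)
    (E : measurableType d') (R : realType)
    (P1 : probability T1 R) (P2 : probability T2 R)
    (Z1 : T1 -> E) (Z2 : T2 -> E) : Prop :=
  forall B : set E, measurable B -> P1 (Z1 @^-1` B) = P2 (Z2 @^-1` B).

(* Pointwise convergence of the distribution functions at the continuity
   points of the limit distribution function. *)
Definition cvg_in_distribution d (T : measurableType d) (R : realType)
    (P : probability T R) (Z : nat -> T -> R)
    (mu : probability (measurableTypeR R) R) : Prop :=
  forall x : R, {for x, continuous (fun y : R => mu (`]-oo, y]%classic : set R))} ->
    P [set w | Z n w <= x] @[n --> \oo] --> mu (`]-oo, x]%classic : set R).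

(* chi2 R m is the law of Z_1^2 + ... + Z_m^2 with Z_1, ..., Z_m independent
   and standard normal, built by adding one independent square at a time. *)
Section chi_squared.
Context {R : realType}.

Definition add_sq (z : measurableTypeR R * measurableTypeR R) :
  measurableTypeR R := (z.1 : R) + (z.2 : R) ^+ 2.

Lemma measurable_add_sq : measurable_fun setT add_sq.
Proof.
apply: measurable_funD; first exact: measurable_fst.
by apply: measurable_funX; exact: measurable_snd.
Qed.

HB.instance Definition _ := isMeasurableFun.Build _ _ _ _
  add_sq measurable_add_sq.

End chi_squared.

Fixpoint chi2 (R : realType) (m : nat) : probability (measurableTypeR R) R :=
  if m is m'.+1 then
    [the probability _ R of
       distribution
         [the probability _ R of (chi2 R m' \x normal_prob (0 : R) 1)%E]
         (@add_sq R)]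
  else [the probability _ R of @dirac _ (measurableTypeR R) 0 R].

(** ** The cone [0, oo)^d *)

(* The norm `|x| of x : 'rV[R]_d is the maximum norm. *)
Definition borel_rV (R : realType) (d : nat) : measurableType _ :=
  g_sigma_algebraType (@open 'rV[R]_d).

Section cone.
Context {R : realType} {d : nat}.
Implicit Types (A B : set 'rV[R]_d) (x : 'rV[R]_d) (t : R).

Definition borel B : Prop := measurable (B : set (borel_rV R d)).

Definition orthant : set 'rV[R]_d := [set x | forall j, 0 <= x ord0 j].

Definition dilation t B : set 'rV[R]_d := [set t *: x | x in B].

Definition bounded_away B : Prop :=
  exists2 e : R, 0 < e & B `<=` [set x | e <= `|x|].

(* Topological boundary of a subset of the orthant relative to the orthant;
   since the orthant is closed, the ambient closures are the relative ones. *)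
Definition boundary B : set 'rV[R]_d := closure B `&` closure (orthant `\` B).

Definition outside_unit : set 'rV[R]_d := orthant `&` [set x | 1 < `|x|].

End cone.

(** ** Multivariate regular variation *)

(* The filter u --> +oo, in the bundled form required by the =O_ notation. *)
Definition pinfty_filter (R : realType) : filter_on R :=
  FilterType (pinfty_nbhs R) _.

Section regular_variation.
Context {R : realType} {d : nat} {dT : measure_display} {T : measurableType dT}.
Variables (P : probability T R) (X : {RV P >-> borel_rV R d}).
Implicit Types (nu : {measure set (borel_rV R d) -> \bar R}) (a : R -> R).

(* Same map, with the alias borel_rV of the codomain removed. *)
Definition vec (w : T) : 'rV[R]_d := X w.

Definition orthant_valued : Prop := forall w, orthant (vec w).

Definition standard_pareto_margins : Prop :=
  forall (j : 'I_d) (x : R), 1 <= x ->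
    P [set w | x < vec w ord0 j] = (x^-1)%:E.

(* P(X / u \in B) and P(|X| > u) as real numbers. *)
Definition prob_scaled (u : R) (B : set 'rV[R]_d) : R :=
  fine (P [set w | B (u^-1 *: vec w)]).

Definition norm_tail (u : R) : R := fine (P [set w | u < `|vec w|]).

(* P(X / u \in B | |X| > u) *)
Definition cond_prob_scaled (u : R) (B : set 'rV[R]_d) : R :=
  fine (P [set w | B (u^-1 *: vec w) /\ u < `|vec w|]) / norm_tail u.

(* X is multivariate regularly varying with exponent measure nu.  The measure
   on [0, oo)^d \ {0} is encoded as a measure on R^d carried by that set. *)
Record regularly_varying nu : Prop := RegularlyVarying {
  rv_carried : nu (~` (orthant `\ (0 : 'rV[R]_d))) = 0%E ;
  rv_prob : nu outside_unit = 1%E ;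
  rv_cvg : forall B, borel B -> B `<=` outside_unit -> nu (boundary B) = 0%E ->
    cond_prob_scaled u B @[u --> +oo] --> fine (nu B) ;
  rv_extension : forall (B : set 'rV[R]_d) (t : R),
    borel B -> B `<=` orthant -> bounded_away B ->
    0 < t <= 1 -> dilation t^-1 B `<=` outside_unit ->
    nu B = ((t^-1)%:E * nu (dilation t^-1 B))%E }.

Definition second_order nu a : Prop :=
  a u @[u --> +oo] --> (0 : R) /\
  forall (e : R) (B : set 'rV[R]_d), 0 < e -> borel B ->
    B `<=` orthant `&` [set x | e <= `|x|] -> nu (boundary B) = 0%E ->
    (fun u : R => prob_scaled u B / norm_tail u - fine (nu B))
      =O_ (pinfty_filter R) a.

(* U(t) = inf {u : P(|X| > u) <= 1/t} *)
Definition tail_quantile (t : R) : R := inf [set u : R | norm_tail u <= t^-1].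

End regular_variation.

(** ** Risk functionals and admissible partitions *)

Section risk.
Context {R : realType} {d : nat}.
Implicit Types (r : 'rV[R]_d -> R) (A B : set 'rV[R]_d).

Definition risk_region r : set 'rV[R]_d := orthant `&` [set x | 1 < r x].

(* Only the restriction of r to the orthant is relevant. *)
Record risk_functional r : Prop := RiskFunctional {
  risk_measurable :
    measurable_fun (orthant : set (borel_rV R d)) (r : borel_rV R d -> R) ;
  risk_ge0 : forall x, orthant x -> 0 <= r x ;
  risk_homogeneous : forall t x, 0 < t -> orthant x -> r (t *: x) = t * r x ;
  risk_bounded_away : bounded_away (risk_region r) }.

Definition radial_class r : set (set 'rV[R]_d) :=
  [set B | [/\ borel B, B `<=` risk_region r &
               forall t : R, 1 < t -> dilation t B `<=` B]].

(* Sets obtained from G by finitely many unions, intersections and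
   complementations (in the orthant). *)
Inductive boolean_combination (G : set (set 'rV[R]_d)) : set 'rV[R]_d -> Prop :=
| BcGen B : G B -> boolean_combination G B
| BcUnion A B : boolean_combination G A -> boolean_combination G B ->
    boolean_combination G (A `|` B)
| BcInter A B : boolean_combination G A -> boolean_combination G B ->
    boolean_combination G (A `&` B)
| BcCompl B : boolean_combination G B ->
    boolean_combination G (orthant `\` B).

Definition admissible_partition K r (A : 'I_K -> set 'rV[R]_d) : Prop :=
  partition [set: 'I_K] A (risk_region r) /\
  forall j, boolean_combination (radial_class r) (A j).

(* nu(A) / nu(Omega_r) *)
Definition class_prob (nu : {measure set (borel_rV R d) -> \bar R}) r A : R :=
  fine (nu A) / fine (nu (risk_region r)).

End risk.

(** ** The empirical divergence *)

Section divergence.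
Context {R : realType} {K : nat}.
Implicit Types p q : 'I_K -> R.

Definition kl_divergence p q : R :=
  \sum_(j < K) (p j - q j) * (ln (p j) - ln (q j)).

(* D_{1j} is kl_grad p q j and D_{2j} is kl_grad q p j. *)
Definition kl_grad p q (j : 'I_K) : R := ln (p j / q j) + 1 - q j / p j.

(* Positive for distinct probability vectors p and q with positive entries, so
   the degenerate convention of normal_prob at standard deviation 0 does not
   come into play. *)
Definition kl_variance p q : R :=
  \sum_(j < K) (kl_grad p q j ^+ 2 * (p j * (1 - p j)) +
                kl_grad q p j ^+ 2 * (q j * (1 - q j)))
  - 2 * \sum_(j1 < K) \sum_(j2 < K | (j1 < j2)%N)
      (kl_grad p q j1 * kl_grad p q j2 * (p j1 * p j2) +
       kl_grad q p j1 * kl_grad q p j2 * (q j1 * q j2)).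

End divergence.

Section estimators.
Context {R : realType} {d : nat}.
Implicit Types (r : 'rV[R]_d -> R) (x : nat -> 'rV[R]_d).

(* The sample of size n is x 0, ..., x n.-1. *)

(* R_{i,n} for 1 <= i <= n: the i-th smallest of r (x 0), ..., r (x n.-1). *)
Definition order_statistic r x (n i : nat) : R :=
  nth 0 (sort <=%R [seq r (x l) | l <- iota 0 n]) i.-1.

Definition class_freq r x (n k : nat) (A : set 'rV[R]_d) : R :=
  k%:R^-1 *
  \sum_(i < n) \1_(dilation (order_statistic r x n (n - k)) A) (x i).

(* D is the empirical divergence between the samples x and y of size n with k
   exceedances. It is unconstrained if R_{n-k,n} does not exist or if one of
   the frequencies vanishes. *)
Definition is_empirical_kl K r (A : 'I_K -> set 'rV[R]_d) (n k : nat) x y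
    (D : R) : Prop :=
  let p j := class_freq r x n k (A j) in
  let q j := class_freq r y n k (A j) in
  (k < n)%N -> (forall j, p j != 0 /\ q j != 0) -> D = kl_divergence p q.

End estimators.

(* The two samples as one family; its mutual independence expresses that each
   sample is independent and that the two samples are independent. *)
Definition pooled (S : Type) (Xs Ys : nat -> S) (i : nat + nat) : S :=
  match i with inl l => Xs l | inr l => Ys l end.

(* Main.v *)
(* The O(a(u)) bound in the second-order condition is only assumed for each continuity
   set separately, but a gliding hump (Nikodym boundedness) argument makes it uniform,
   first over the continuity sets and then over all Borel sets bounded away from the
   origin. Hence the expected number of points X_i with X_i / u_n in B is, uniformly in
   B, a multiple of nu(B) up to o(sqrt k_n), and the levels of a fine grid of mesh of
   order 1 / sqrt k_n trap the order statistic (Chebyshev). The boolean combinations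
   A_j can only change inside a grid cell where one of their radial generators does, and
   these are monotone in the level; so the random level may be replaced by the
   deterministic one at which k_n exceedances are expected, and
   sqrt k_n (p^_j - p_j) = W_j + o_P(1) with W_j a normalized sum of the scores
   1[X_i in A_j] - p_j 1[X_i in Omega].
   Expanding the divergence leaves \sum_j (W^X_j - W^Y_j)^2 / (2 p_j) under the null
   hypothesis and a linear combination of the W_j under the alternative. The former is
   the squared norm of a vector with m = K - 1 uncorrelated coordinates, obtained from a
   Householder reflection sending (sqrt p_j)_j to the last basis vector. Both limit laws
   follow by Lindeberg's replacement, the law of a sum being an iterated averaging
   operator applied to a smooth test function: the steps are exchanged for signs
   +-1 / sqrt n on the coordinates, then for Gaussian increments. *)
From HB Require Import structures.
Require Import Defs.
From mathcomp Require Import all_boot all_order all_algebra.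
From mathcomp Require Import finmap.
From mathcomp Require Import all_classical all_reals all_analysis.
From mathcomp Require Import measurable_realfun.
From mathcomp Require Import ring lra zify.
Import Order.TTheory GRing.Theory Num.Theory.
Import numFieldNormedType.Exports.
Set Implicit Arguments.
Unset Strict Implicit.
Unset Printing Implicit Defensive.
Local Open Scope classical_set_scope.
Local Open Scope ring_scope.

(** * Sums of independent finitely supported variables *)

(** The constant and the threshold hidden in the second-order O depend on the set, whereas the sets
    to which it is applied (dilates at levels depending on n, and differences of such dilates) move
    with n; this is what forces uniformity over all Borel sets. Biases must be o(sqrt k_n), the
    order of the fluctuations being sqrt k_n; a rate o(k_n), which regular variation alone would
    give, is too weak. Once the level is deterministic, an observation enters only through its cell,
    one of K + 1 values. Laws are therefore finite lists, expectations of sums are iterates of an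
    operator on functions, and a limit theorem is a comparison of powers of two operators. The
    bounds are explicit in n because the law of a single step changes with n. No Gaussian vector
    appears: sign steps on different coordinates commute, so the sign walk splits into
    one-dimensional walks run one after another, each of which adds one square, and this is the
    recursion that defines [chi2]. *)

Section finite_laws.
Context {R : realType} {W : zmodType}.
Implicit Types (mu : seq (R * W)) (F G : W -> R).

(** A law is a list of pairs (weight, value), and [step mu F x] is the expectation of F (x + V) for
    V of law [mu]. Composing such operators gives expectations for sums of independent variables. *)
Definition step mu F : W -> R := fun x => \sum_(a <- mu) a.1 * F (x + a.2).

Definition is_law mu : Prop :=
  (forall a, a \in mu -> 0 <= a.1) /\ \sum_(a <- mu) a.1 = 1.

Lemma stepZ mu c F : step mu (fun x => c * F x) = fun x => c * step mu F x.
Proof.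
by apply/funext => x; rewrite /step mulr_sumr; apply: eq_bigr => a _; rewrite mulrCA.
Qed.

Lemma stepB mu F G : step mu (F \- G) = step mu F \- step mu G.
Proof.
by apply/funext => x; rewrite /step /= -sumrB; apply: eq_bigr => a _; rewrite mulrBr.
Qed.

Lemma ler_step mu F G : is_law mu -> (forall x, F x <= G x) ->
  forall x, step mu F x <= step mu G x.
Proof.
move=> [mu0 _] FG x; rewrite /step big_seq [leRHS]big_seq; apply: ler_sum => a amu.
by rewrite ler_wpM2l// mu0.
Qed.

Lemma step_bound mu F e : is_law mu -> (forall x, `|F x| <= e) ->
  forall x, `|step mu F x| <= e.
Proof.
move=> [mu0 mu1] Fe x; rewrite /step (le_trans (ler_norm_sum _ _ _))//.
rewrite -[leRHS]mul1r -mu1 mulr_suml big_seq [leRHS]big_seq; apply: ler_sum => a amu.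
by rewrite normrM ger0_norm ?mu0// ler_wpM2l ?mu0.
Qed.

Lemma stepC mu mu' F : step mu (step mu' F) = step mu' (step mu F).
Proof.
apply/funext => x; rewrite /step.
under eq_bigr do rewrite mulr_sumr.
rewrite exchange_big /=; apply: eq_bigr => a _; rewrite mulr_sumr.
by apply: eq_bigr => b _; rewrite mulrCA -!addrA (addrC a.2).
Qed.

Lemma iter_step_bound mu F e n : is_law mu -> (forall x, `|F x| <= e) ->
  forall x, `|iter n (step mu) F x| <= e.
Proof. by move=> h Fe; elim: n => // n IH x; rewrite iterS; apply: step_bound. Qed.

Lemma ler_iter_step mu F G n : is_law mu -> (forall x, F x <= G x) ->
  forall x, iter n (step mu) F x <= iter n (step mu) G x.
Proof. by move=> h FG; elim: n => // n IH x; rewrite !iterS; apply: ler_step. Qed.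

Lemma iter_stepB mu F G n :
  iter n (step mu) (F \- G) = iter n (step mu) F \- iter n (step mu) G.
Proof. by elim: n => // n IH; rewrite !iterS IH stepB. Qed.

Lemma iter_commute (E : Type) (S T : E -> E) (x : E) n :
  (forall y, S (T y) = T (S y)) ->
  iter n (S \o T) x = iter n S (iter n T x).
Proof.
move=> ST; elim: n => // n IH; rewrite !iterS /= IH.
congr S; elim: n {IH} (iter n T x) => // n IH y.
by rewrite !iterS -IH ST.
Qed.

Definition conv mu mu' : seq (R * W) :=
  [seq (a.1 * b.1, a.2 + b.2) | a <- mu, b <- mu'].

Lemma step_conv mu mu' : step (conv mu mu') = step mu \o step mu'.
Proof.
apply/funext => F; apply/funext => x; rewrite /step/= /conv big_allpairs_dep /=.
apply: eq_bigr => a _; rewrite mulr_sumr; apply: eq_bigr => b _.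
by rewrite mulrA addrA.
Qed.

Lemma sum_conv mu mu' (F : W -> R) :
  \sum_(c <- conv mu mu') c.1 * F c.2 =
  \sum_(a <- mu) a.1 * \sum_(b <- mu') b.1 * F (a.2 + b.2).
Proof.
rewrite /conv big_allpairs_dep /=; apply: eq_bigr => a _; rewrite mulr_sumr.
by apply: eq_bigr => b _; rewrite mulrA.
Qed.

Lemma conv_law mu mu' : is_law mu -> is_law mu' -> is_law (conv mu mu').
Proof.
move=> [p0 p1] [q0 q1]; split.
  move=> c /allpairsPdep[a [b [am bm ->]]] /=.
  by apply: mulr_ge0; [exact: p0|exact: q0].
have := sum_conv mu mu' (fun=> 1).
under eq_bigr do rewrite mulr1; move=> ->.
under eq_bigr => a _ do (under eq_bigr do rewrite mulr1; rewrite q1 mulr1).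
by [].
Qed.

(* Trotter's telescoping: T^n - T'^n = \sum_j T^(n-1-j) (T - T') T'^j, where the
   powers of T are contractions for the uniform norm. *)
Lemma trotter mu (T' : (W -> R) -> W -> R) F e n : is_law mu ->
  (forall j, (j < n)%N -> forall x,
     `|step mu (iter j T' F) x - T' (iter j T' F) x| <= e) ->
  forall x, `|iter n (step mu) F x - iter n T' F x| <= n%:R * e.
Proof.
move=> hmu; elim: n => [|n IH] H x; first by rewrite subrr normr0 mul0r.
rewrite !iterS.
have -> : step mu (iter n (step mu) F) x - T' (iter n T' F) x =
  step mu (iter n (step mu) F \- iter n T' F) x +
  (step mu (iter n T' F) x - T' (iter n T' F) x).
  by rewrite stepB /=; ring.
rewrite (le_trans (ler_normD _ _))// mulrS mulrDl mul1r addrC lerD ?H//.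
by apply: step_bound => // y; apply: IH => j jn; apply: H; exact: ltnW.
Qed.

End finite_laws.

(** * Lindeberg replacement for finitely supported vectors *)

Section multivariate_lindeberg.
Context {R : realType} {m : nat}.
Local Notation W := 'rV[R]_m.
Implicit Types (mu : seq (R * W)).

Definition norm1 (x : W) : R := \sum_i `|x 0 i|.

Lemma norm1_ge0 x : 0 <= norm1 x.
Proof. exact: sumr_ge0. Qed.

(* f has a second order Taylor expansion with a cubic remainder. *)
Definition smooth (M : R) (f : W -> R) (f1 : 'I_m -> W -> R) (f2 : 'I_m -> 'I_m -> W -> R) :=
  [/\ (forall i x, `|f1 i x| <= M), (forall i j x, `|f2 i j x| <= M) &
   (forall x h, `|f (x + h) - f x - \sum_i h 0 i * f1 i x
       - 2^-1 * \sum_i \sum_j h 0 i * h 0 j * f2 i j x| <= M * norm1 h ^+ 3)].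

Definition mean mu i : R := \sum_(a <- mu) a.1 * a.2 0 i.
Definition moment2 mu i j : R := \sum_(a <- mu) a.1 * (a.2 0 i * a.2 0 j).
Definition moment3 mu : R := \sum_(a <- mu) a.1 * norm1 a.2 ^+ 3.

(** The Taylor remainder is linear in f and averaging commutes with translation, so the remainder of
    [step mu f] is the average of that of f. One constant M thus serves all iterates. *)
Lemma smooth_step mu M f f1 f2 : is_law mu -> smooth M f f1 f2 ->
  smooth M (step mu f) (fun i => step mu (f1 i)) (fun i j => step mu (f2 i j)).
Proof.
move=> hmu [f1M f2M fT]; split.
- by move=> i x; apply: step_bound.
- by move=> i j x; apply: step_bound.
move=> x h.
pose g := fun y => f (y + h) - f y - \sum_i h 0 i * f1 i y
       - 2^-1 * \sum_i \sum_j h 0 i * h 0 j * f2 i j y.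
have -> : step mu f (x + h) - step mu f x - \sum_i h 0 i * step mu (f1 i) x
  - 2^-1 * \sum_i \sum_j h 0 i * h 0 j * step mu (f2 i j) x = step mu g x.
  rewrite /step /g.
  have E1 : \sum_i h 0 i * (\sum_(a <- mu) a.1 * f1 i (x + a.2)) =
     \sum_(a <- mu) a.1 * \sum_i h 0 i * f1 i (x + a.2).
    under eq_bigr do rewrite mulr_sumr.
    rewrite exchange_big /=; apply: eq_bigr => a _; rewrite mulr_sumr.
    by apply: eq_bigr => i _; rewrite mulrCA.
  have E2 : \sum_i \sum_j h 0 i * h 0 j * (\sum_(a <- mu) a.1 * f2 i j (x + a.2)) =
     \sum_(a <- mu) a.1 * \sum_i \sum_j h 0 i * h 0 j * f2 i j (x + a.2).
    under eq_bigr => i _.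
      under eq_bigr do rewrite mulr_sumr.
      rewrite exchange_big /=; over.
    rewrite exchange_big /=; apply: eq_bigr => a _; rewrite mulr_sumr.
    by apply: eq_bigr => i _; rewrite mulr_sumr; apply: eq_bigr => j _; rewrite mulrCA.
  rewrite E1 E2 mulr_sumr -!sumrB; apply: eq_bigr => a _.
  by rewrite (addrAC x h) !mulrBr (mulrCA 2^-1).
by apply: step_bound => // y; exact: fT.
Qed.

Lemma step_taylor mu M f f1 f2 x : is_law mu -> smooth M f f1 f2 ->
  `|step mu f x - f x - \sum_i mean mu i * f1 i x
    - 2^-1 * \sum_i \sum_j moment2 mu i j * f2 i j x| <= M * moment3 mu.
Proof.
move=> [mu0 mu1] [_ _ fT].
have -> : step mu f x - f x - \sum_i mean mu i * f1 i x
    - 2^-1 * \sum_i \sum_j moment2 mu i j * f2 i j x =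
  \sum_(a <- mu) a.1 * (f (x + a.2) - f x - \sum_i a.2 0 i * f1 i x
       - 2^-1 * \sum_i \sum_j a.2 0 i * a.2 0 j * f2 i j x).
  have E1 : \sum_i mean mu i * f1 i x = \sum_(a <- mu) a.1 * \sum_i a.2 0 i * f1 i x.
    under eq_bigr do rewrite /mean mulr_suml.
    rewrite exchange_big /=; apply: eq_bigr => a _; rewrite mulr_sumr.
    by apply: eq_bigr => i _; rewrite mulrA.
  have E2 : \sum_i \sum_j moment2 mu i j * f2 i j x =
     \sum_(a <- mu) a.1 * \sum_i \sum_j a.2 0 i * a.2 0 j * f2 i j x.
    under eq_bigr => i _.
      under eq_bigr do rewrite /moment2 mulr_suml.
      rewrite exchange_big /=; over.
    rewrite exchange_big /=; apply: eq_bigr => a _; rewrite mulr_sumr.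
    by apply: eq_bigr => i _; rewrite mulr_sumr; apply: eq_bigr => j _; rewrite !mulrA.
  have E0 : f x = \sum_(a <- mu) a.1 * f x by rewrite -mulr_suml mu1 mul1r.
  rewrite E1 E2 [X in _ - X - _ - _]E0 /step mulr_sumr -!sumrB; apply: eq_bigr => a _.
  by rewrite !mulrBr (mulrCA 2^-1).
rewrite (le_trans (ler_norm_sum _ _ _))// /moment3 mulr_sumr big_seq [leRHS]big_seq.
apply: ler_sum => a amu; rewrite normrM ger0_norm ?mu0// mulrCA ler_wpM2l ?mu0//.
Qed.

Lemma step_compare mu mu' M f f1 f2 x : is_law mu -> is_law mu' -> smooth M f f1 f2 ->
  `|step mu f x - step mu' f x| <= M * (\sum_i `|mean mu i - mean mu' i|
    + \sum_i \sum_j `|moment2 mu i j - moment2 mu' i j|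
    + moment3 mu + moment3 mu').
Proof.
move=> hmu hmu' hf; have := step_taylor x hmu hf; have := step_taylor x hmu' hf.
case: hf => f1M f2M _.
set A1 := \sum_i mean mu' i * _; set B1 := \sum_i \sum_j moment2 mu' i j * _.
set A2 := \sum_i mean mu i * _; set B2 := \sum_i \sum_j moment2 mu i j * _.
move=> H1 H2.
have HA : `|A2 - A1| <= M * \sum_i `|mean mu i - mean mu' i|.
  rewrite -sumrB (le_trans (ler_norm_sum _ _ _))// mulr_sumr ler_sum// => i _.
  by rewrite -mulrBl normrM mulrC ler_wpM2r.
have HB : `|B2 - B1| <= M * \sum_i \sum_j `|moment2 mu i j - moment2 mu' i j|.
  rewrite -sumrB (le_trans (ler_norm_sum _ _ _))// mulr_sumr ler_sum// => i _.
  rewrite -sumrB (le_trans (ler_norm_sum _ _ _))// mulr_sumr ler_sum// => j _.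
  by rewrite -mulrBl normrM mulrC ler_wpM2r.
set a := \sum_i `|_ - _| in HA *; set b := \sum_i \sum_j `|_ - _| in HB *.
rewrite !mulrDr.
have b0 : 0 <= M * b by rewrite (le_trans _ HB).
move: H1 H2 HA HB; rewrite !ler_norml.
move=> /andP[? ?] /andP[? ?] /andP[? ?] /andP[? ?]; apply/andP; split; lra.
Qed.

Lemma lindeberg mu mu' M f f1 f2 n x : is_law mu -> is_law mu' -> smooth M f f1 f2 ->
  `|iter n (step mu) f x - iter n (step mu') f x| <=
   n%:R * (M * (\sum_i `|mean mu i - mean mu' i|
    + \sum_i \sum_j `|moment2 mu i j - moment2 mu' i j|
    + moment3 mu + moment3 mu')).
Proof.
move=> hmu hmu' hf; apply: trotter => // j _ y.
have [g1 [g2 hg]] : exists g1 g2, smooth M (iter j (step mu') f) g1 g2.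
  elim: j => [|j [g1 [g2 hg]]]; first by exists f1, f2.
  by eexists; eexists; apply: smooth_step; last exact: hg.
exact: step_compare hg.
Qed.

End multivariate_lindeberg.

(** * The law of a sum of independent coded variables *)

Section law_of_sums.
Context d d' (S : measurableType d) (E : measurableType d') (R : realType)
  (P : probability S R).

Lemma fine_probU (A B : set S) : measurable A -> measurable B -> A `&` B = set0 ->
  fine (P (A `|` B)) = fine (P A) + fine (P B).
Proof.
by move=> mA mB AB; rewrite measureU// fineD//; exact: fin_num_measure.
Qed.

Lemma fine_prob_sum (C : eqType) (h : S -> C) (A : set S) (s : seq C) : uniq s ->
  measurable A -> (forall a, measurable (h @^-1` [set a])) ->
  measurable (A `&` [set w | h w \in s]) /\
  fine (P (A `&` [set w | h w \in s])) = \sum_(a <- s) fine (P (A `&` h @^-1` [set a])).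
Proof.
move=> us mA mh; elim: s us => [_|a s IH /= /andP[nas us]].
  have -> : A `&` [set w | h w \in [::]] = set0 by rewrite -subset0 => w [].
  by rewrite measure0 big_nil; split.
have [m1 e1] := IH us.
have -> : A `&` [set w | h w \in a :: s] =
    (A `&` h @^-1` [set a]) `|` (A `&` [set w | h w \in s]).
  apply/seteqP; split=> w /=.
    by move=> [Aw]; rewrite inE => /orP[/eqP ha|hs]; [left|right].
  by move=> [[Aw ha]|[Aw hs]]; split => //; rewrite inE ?ha ?eqxx ?hs ?orbT.
split; first by apply: measurableU => //; exact: measurableI.
rewrite fine_probU ?big_cons ?e1//; first exact: measurableI.
rewrite -subset0 => w /= [[_ ->] [_ as_]].
by rewrite as_ in nas.
Qed.

Context (I : choiceType) (Z : I -> {RV P >-> E}).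
Hypothesis hind : mutually_independent P (fun i => Z i : S -> E).
Context (C : finType) (W : zmodType) (c : I -> E -> C) (V : I -> C -> W).
Hypothesis hc : forall i a, measurable (c i @^-1` [set a]).

(** The list is indexed by codes and not by values: distinct codes may carry the same value, and the
    weights remain correct. *)
Definition coded_law i : seq (R * W) :=
  [seq (fine (P (Z i @^-1` (c i @^-1` [set a]))), V i a) | a <- enum C].

Lemma measurable_code i a : measurable ((fun w => c i (Z i w)) @^-1` [set a]).
Proof. exact: (measurable_funPTI (Z i) (hc i a)). Qed.

Lemma fine_prob_code i (A : set S) : measurable A ->
  fine (P A) = \sum_(a : C) fine (P (A `&` (fun w => c i (Z i w)) @^-1` [set a])).
Proof.
move=> mA; have [_] := @fine_prob_sum C _ A (enum C) (enum_uniq _) mA (measurable_code i).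
rewrite big_enum => <-; congr (fine (P _)).
by apply/seteqP; split=> [w Aw|w []//]; split => //=; rewrite mem_enum.
Qed.

Lemma coded_law_law i : is_law (coded_law i).
Proof.
split; first by move=> _ /mapP[a _ ->] /=; rewrite fine_ge0.
rewrite big_map big_enum /= -[RHS]/(fine 1%E) -(@probability_setT _ _ _ P).
rewrite (fine_prob_code i measurableT); apply: eq_bigr => a _.
by rewrite setTI.
Qed.

Lemma measurable_coded_sum (F : W -> bool) (s : seq I) x :
  measurable [set w | F (x + \sum_(i <- s) V i (c i (Z i w)))].
Proof.
elim: s x => [|i s IH] x.
  have -> : [set w | F (x + \sum_(i <- [::]) V i (c i (Z i w)))] =
     if F x then setT else set0 :> set S.
    by apply/seteqP; split=> w /=; rewrite big_nil addr0; case: (F x).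
  by case: (F x).
have -> : [set w | F (x + \sum_(j <- i :: s) V j (c j (Z j w)))] =
  \big[setU/set0]_(a <- enum C) ((fun w => c i (Z i w)) @^-1` [set a] `&`
     [set w | F (x + V i a + \sum_(j <- s) V j (c j (Z j w)))]).
  rewrite -bigcup_seq; apply/seteqP; split=> w /=.
    rewrite big_cons addrA => H; exists (c i (Z i w)) => //=.
    by rewrite mem_enum.
  by move=> [a _ /= [ha H]]; rewrite big_cons addrA ha.
apply: bigsetU_measurable => a _; apply: measurableI; last exact: IH.
exact: measurable_code.
Qed.

(** The induction carries constraints [Z k] in [B k] on a finite set J of indices disjoint from s.
    Each step conditions on the code of one index and moves that index from s to J, so independence
    is only ever used on rectangles, the form in which it is assumed. *)
Lemma coded_sum_prob_gen (F : W -> bool) (s : seq I) (J : {fset I}) (B : I -> set E) x :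
  uniq s -> (forall i, i \in s -> i \notin J) -> (forall i, measurable (B i)) ->
  fine (P (\bigcap_(i in [set` J]) (Z i @^-1` B i) `&`
           [set w | F (x + \sum_(i <- s) V i (c i (Z i w)))])) =
  fine (P (\bigcap_(i in [set` J]) (Z i @^-1` B i))) *
  foldr (fun i => step (coded_law i)) (fun y => (F y)%:R) s x.
Proof.
have mcap (J' : {fset I}) (B' : I -> set E) : (forall i, measurable (B' i)) ->
    measurable (\bigcap_(i in [set` J']) (Z i @^-1` B' i)).
  move=> mB'; apply: fin_bigcap_measurable; first exact: finite_fset.
  by move=> i _; exact: (measurable_funPTI (Z i) (mB' i)).
elim: s J B x => [|i s IH] J B x us sJ mB /=.
  case Fx: (F x).
    rewrite (_ : [set w | F _] = setT) ?setIT ?mulr1//.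
    by apply/seteqP; split=> w //= _; rewrite big_nil addr0.
  rewrite (_ : [set w | F _] = set0) ?setI0 ?measure0 ?mulr0//.
  by apply/seteqP; split=> w //=; rewrite big_nil addr0 Fx.
have iJ : i \notin J by rewrite sJ// mem_head.
pose B' a k := if k == i then c i @^-1` [set a] else B k.
have mB' a k : measurable (B' a k) by rewrite /B'; case: ifP.
have capE a : \bigcap_(k in [set` (i |` J)%fset]) (Z k @^-1` B' a k) =
    \bigcap_(k in [set` J]) (Z k @^-1` B k) `&` (fun w => c i (Z i w)) @^-1` [set a].
  apply/seteqP; split=> w /=.
    move=> H; split; last first.
      by have := H i; rewrite /= fset1U1 /B' eqxx; apply.
    move=> k /= kJ; have := H k; rewrite /= fset1Ur// /B' ifF; first exact.
    by apply/negbTE; apply: contraNneq iJ => <-.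
  move=> [H1 H2] k /=; rewrite in_fset1U => /orP[/eqP ->|kJ].
    by rewrite /B' eqxx.
  rewrite /B' ifF; first exact: H1.
  by apply/negbTE; apply: contraNneq iJ => <-.
have PcapE a : fine (P (\bigcap_(k in [set` (i |` J)%fset]) (Z k @^-1` B' a k))) =
    fine (P (\bigcap_(k in [set` J]) (Z k @^-1` B k))) *
    fine (P (Z i @^-1` (c i @^-1` [set a]))).
  have h1 := hind (i |` J)%fset (mB' a).
  have h2 := hind J mB.
  rewrite /= in h1 h2; rewrite h1 h2 big_fsetU1//= {1}/B' eqxx.
  rewrite (_ : \prod_(i <- J) P (Z i @^-1` B' a i) = \prod_(i <- J) P (Z i @^-1` B i))%E.
    rewrite fineM 1?mulrC// -?h2; apply: fin_num_measure; last exact: mcap.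
    exact: (measurable_funPTI (Z i) (hc i a)).
  apply: eq_big_seq => k kJ; rewrite /B' ifF//.
  by apply/negbTE; apply: contraNneq iJ => <-.
have mX : measurable (\bigcap_(k in [set` J]) (Z k @^-1` B k) `&`
   [set w | F (x + \sum_(i <- i :: s) V i (c i (Z i w)))]).
  by apply: measurableI; [exact: mcap|exact: measurable_coded_sum].
rewrite (fine_prob_code i mX) {1}/step big_map big_enum /= mulr_sumr.
apply: eq_bigr => a _.
rewrite mulrA -PcapE.
move: us => /= /andP[nis us].
rewrite -IH//; last first.
  move=> k ks; rewrite in_fset1U negb_or sJ ?andbT ?in_cons ?ks ?orbT//.
  by apply: contraNneq nis => <-.
rewrite capE; congr (fine (P _)).
apply/seteqP; split=> w /=.
  by move=> [[H1]]; rewrite big_cons addrA => H2 H3; split => //; rewrite -H3.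
by move=> [[H1 H2] H3]; split => //; split => //; rewrite big_cons addrA H2.
Qed.

Lemma coded_sum_prob (F : W -> bool) (s : seq I) x : uniq s ->
  fine (P [set w | F (x + \sum_(i <- s) V i (c i (Z i w)))]) =
  foldr (fun i => step (coded_law i)) (fun y => (F y)%:R) s x.
Proof.
move=> us; have := @coded_sum_prob_gen F s fset0 (fun=> setT) x us.
rewrite (_ : \bigcap_(i in _) _ = setT); last first.
  by apply/seteqP; split=> w.
by rewrite setTI probability_setT mul1r; apply.
Qed.

End law_of_sums.

(** * Order statistics *)

Section order_statistics.
Context {R : realType} {d : nat}.
Implicit Types (r : 'rV[R]_d -> R) (x : nat -> 'rV[R]_d).

(* At most k sample points lie strictly above the (n-k)-th order statistic, and
   at least k + 1 lie at or above it. *)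
Lemma count_gt_order_statistic r x (n k : nat) : (k < n)%N ->
  (count (fun i => (order_statistic r x n (n - k) < r (x i))%R) (iota 0 n) <= k)%N.
Proof.
move=> kn; set s := sort <=%R [seq r (x l) | l <- iota 0 n].
have ss : size s = n by rewrite size_sort size_map size_iota.
have srt : sorted <=%R s by exact: sort_le_sorted.
have -> : count (fun i => order_statistic r x n (n - k) < r (x i))%R (iota 0 n) =
  count (fun y => nth 0 s (n - k).-1 < y)%R s.
  by rewrite count_sort count_map; apply: eq_count.
rewrite -[X in count _ X](cat_take_drop (n - k) s) count_cat.
rewrite (_ : count _ (take _ _) = 0%N) ?add0n; last first.
  apply/eqP; rewrite -leqn0 leqNgt -has_count; apply/hasPn => y.
  move=> /(nthP 0)[i]; rewrite size_take ss => ilt <-.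
  have {}ilt : (i < n - k)%N by move: ilt; case: ifP => // *; lia.
  rewrite nth_take// -leNgt.
  apply: (sorted_leq_nth le_trans le_refl 0 srt); rewrite ?inE ?ss.
  - by lia.
  - by lia.
  - by lia.
rewrite (leq_trans (count_size _ _))// size_drop ss subKn//; exact: ltnW.
Qed.

Lemma count_ge_order_statistic r x (n k : nat) : (k < n)%N ->
  (k < count (fun i => (order_statistic r x n (n - k) <= r (x i))%R) (iota 0 n))%N.
Proof.
move=> kn; set s := sort <=%R [seq r (x l) | l <- iota 0 n].
have ss : size s = n by rewrite size_sort size_map size_iota.
have srt : sorted <=%R s by exact: sort_le_sorted.
have -> : count (fun i => order_statistic r x n (n - k) <= r (x i))%R (iota 0 n) =
  count (fun y => nth 0 s (n - k).-1 <= y)%R s.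
  by rewrite count_sort count_map; apply: eq_count.
(* The statistic stands at position n - k - 1 counted from 0; dropping only [(n - k).-1] entries
   keeps it, which leaves k + 1 entries. *)
rewrite -[X in count _ X](cat_take_drop (n - k).-1 s) count_cat.
rewrite (leq_trans _ (leq_addl _ _))//.
rewrite (_ : count _ _ = size (drop (n - k).-1 s)); last first.
  apply/eqP; rewrite -all_count; apply/allP => y /(nthP 0)[i].
  rewrite size_drop ss => ilt <-; rewrite nth_drop.
  apply: (sorted_leq_nth le_trans le_refl 0 srt); rewrite ?inE ?ss ?leq_addr//.
    by lia.
  by lia.
by rewrite size_drop ss; lia.
Qed.

End order_statistics.

(** * Gaussian averages *)

Section gaussian.
Context {R : realType}.
Implicit Types (s t x y z : R) (f g : R -> R).
Local Notation leb := (@lebesgue_measure R).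

(** The Radon-Nikodym derivative of [normal_prob] and the explicit density have the same integral
    over every measurable set, hence agree almost everywhere. *)
Lemma ge0_normal_integral s (g : R -> \bar R) :
  measurable_fun setT g -> (forall y, 0 <= g y)%E ->
  (\int[normal_prob 0 s]_y g y = \int[leb]_y (g y * (normal_pdf 0 s y)%:E))%E.
Proof.
move=> mg g0.
have dom := normal_prob_dominates (0:R) s.
rewrite -(Radon_Nikodym_SigmaFinite.change_of_variables dom)//=.
apply: ae_eq_integral => //.
- apply: emeasurable_funM => //.
  exact: measurable_int (Radon_Nikodym_SigmaFinite.f_integrable dom).
- apply: emeasurable_funM => //.
  by apply/measurable_EFinP; exact: measurable_normal_pdf.
- apply: ae_eqe_mul2l.
  apply: integral_ae_eq => //=.
  + exact: (Radon_Nikodym_SigmaFinite.f_integrable dom).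
  + by apply/measurable_EFinP; exact: measurable_normal_pdf.
  + by move=> E _ mE; rewrite -Radon_Nikodym_SigmaFinite.f_integral.
Qed.

Lemma normal_integral_density s g : measurable_fun setT g -> (forall y, 0 <= g y) ->
  (\int[normal_prob 0 s]_y (g y)%:E = \int[leb]_y (g y * normal_pdf 0 s y)%:E)%E.
Proof.
move=> mg g0; rewrite ge0_normal_integral//; last exact/measurable_EFinP.
Qed.

Lemma normal_peakE s : 0 < s -> normal_peak s = s^-1 * normal_peak 1.
Proof.
move=> s0; rewrite /normal_peak expr1n mul1r -mulrnAr sqrtrM ?sqr_ge0//.
by rewrite sqrtr_sqr gtr0_norm// invfM.
Qed.

Lemma normal_peak1 : normal_peak (1 : R) <= 1.
Proof.
rewrite /normal_peak expr1n mul1r invf_le1; last first.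
  by rewrite sqrtr_gt0 mulrn_wgt0// pi_gt0.
rewrite -[leLHS]sqrtr1 ler_wsqrtr//.
have := pi_ge2 R; lra.
Qed.

(** Completing the square in y: given the sum z of two independent centred Gaussians, the first has
    mean z s^2 / r^2 and standard deviation s t / r. *)
Lemma normal_pdf_conv s t y z : 0 < s -> 0 < t ->
  let r := Num.sqrt (s ^+ 2 + t ^+ 2) in
  normal_pdf 0 s y * normal_pdf 0 t (z - y) =
  normal_pdf 0 r z * normal_pdf (z * s ^+ 2 / r ^+ 2) (s * t / r) y.
Proof.
move=> s0 t0 r.
have r2 : r ^+ 2 = s ^+ 2 + t ^+ 2 by rewrite sqr_sqrtr// addr_ge0// sqr_ge0.
have r0 : 0 < r by rewrite sqrtr_gt0 ltr_wpDl ?sqr_ge0// exprn_gt0.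
have q0 : 0 < s * t / r by rewrite divr_gt0// mulr_gt0.
rewrite !normal_pdfE ?gt_eqF//.
rewrite mulrACA [RHS]mulrACA; congr (_ * _).
  rewrite (normal_peakE s0) (normal_peakE t0) (normal_peakE r0) (normal_peakE q0).
  by field; rewrite !gt_eqF.
rewrite /normal_fun -!expRD; congr expR.
rewrite !subr0 -!(mulr_natl (_ ^+ 2)) (expr_div_n (s * t)) (exprMn _ s) r2.
have h : s ^+ 2 + t ^+ 2 != 0 by rewrite -r2 gt_eqF// exprn_gt0.
by field; rewrite h !gt_eqF.
Qed.

(* Invariance of the Lebesgue measure under translation and reflection, for
   continuous nonnegative functions. *)
Lemma ge0_integral_translate g x : continuous g -> (forall y, 0 <= g y) ->
  (\int[leb]_y (g y)%:E = \int[leb]_y (g (y + x))%:E)%E.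
Proof.
move=> cg g0.
have dF : (fun y : R => y + x)^`()%classic = cst 1.
  apply/funext => y; rewrite derive1E deriveD// derive_id derive_cst addr0//.
rewrite (@increasing_ge0_integration_by_substitutionT _ (fun y : R => y + x) g)//.
- by apply: eq_integral => y _; rewrite dF fctE/= mulr1.
- by move=> y z yz; rewrite ltrD2r.
- by rewrite dF => y; exact: cvg_cst.
- by rewrite dF; exact: is_cvg_cst.
- by rewrite dF; exact: is_cvg_cst.
- exact: cvg_addrr_Ny.
- exact: cvg_addrr.
Qed.

Lemma ge0_integral_reflect g : continuous g -> (forall y, 0 <= g y) ->
  (\int[leb]_y (g y)%:E = \int[leb]_y (g (- y))%:E)%E.
Proof.
have H (h : R -> R) : continuous h -> (forall y, 0 <= h y) ->
   (\int[leb]_y (h y)%:E = \int[leb]_(x in `[0%R, +oo[) (h (- x))%:E +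
      \int[leb]_(x in `[0%R, +oo[) (h x)%:E)%E.
  move=> ch h0.
  have mh : measurable_fun [set: R] h by exact: continuous_measurable_fun.
  rewrite -(setUv `[0%R, +oo[%classic) ge0_integral_setU//= ; last 4 first.
    exact: measurableC.
    by apply/measurable_EFinP; rewrite setUv.
    by move=> x _; rewrite lee_fin.
    exact/disj_setPCl.
  rewrite addeC; congr (_ + _)%E.
  rewrite setCitvr integral_itv_bndo_bndc; last exact/measurable_EFinP/measurable_funTS.
  rewrite -{1}oppr0 ge0_integration_by_substitutionNy//.
  exact: continuous_subspaceT.
move=> cg g0; rewrite (H g)// (H (g \o -%R)) /=; last 2 first.
- by move=> y; apply: continuous_comp; [exact: opp_continuous|exact: cg].
- by move=> y; exact: g0.
by rewrite addeC; congr (_ + _)%E; apply: eq_integral => y _; rewrite opprK.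
Qed.

Definition gauss_exp s y : R := expR (- y ^+ 2 / (s ^+ 2 *+ 2)).

Lemma normal_pdf_exp s y : 0 < s -> normal_pdf 0 s y = normal_peak s * gauss_exp s y.
Proof. by move=> s0; rewrite normal_pdfE ?gt_eqF// /normal_fun subr0. Qed.

Lemma is_derive_gauss_exp s y : 0 < s ->
  is_derive y 1 (gauss_exp s) (- y / s ^+ 2 * gauss_exp s y).
Proof.
move=> s0; rewrite /gauss_exp.
apply: is_derive_eq.
rewrite !scaler0 /GRing.scale /= -!(mulr_natl (_ ^+ 2)).
by field; rewrite gt_eqF.
Qed.

Lemma continuous_gauss_exp s : 0 < s -> continuous (gauss_exp s).
Proof.
move=> s0 y; apply/differentiable_continuous/derivable1_diffP.
by have [] := is_derive_gauss_exp y s0.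
Qed.

Lemma gauss_exp_ge0 s y : 0 <= gauss_exp s y. Proof. exact: expR_ge0. Qed.

Lemma cvg_poly_gauss_exp c s : 0 < s ->
  (y ^+ 2 + c) * gauss_exp s y @[y --> +oo] --> (0 : R).
Proof.
(* K comes from exp(-t) <= 6 t^-3 at t = y^2 / (2 s^2) and from |y^2 + c| <= (1 + |c|) y^2 for y >=
   1; the product decays like y^-4. *)
move=> s0; pose K : R := (1 + `|c|) * 6 * (s ^+ 2 *+ 2) ^+ 3.
have K0 : 0 <= K.
  by apply: mulr_ge0; [rewrite mulr_ge0// addr_ge0|rewrite exprn_ge0// mulrn_wge0// sqr_ge0].
apply: norm_cvg0.
apply: (@squeeze_cvgr _ _ _ _ (fun=> 0) (fun y => K * y^-1)).
- near=> y; rewrite normr_ge0 /= normrM (ger0_norm (gauss_exp_ge0 _ _)).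
  have y1 : 1 <= y by near: y; exact: nbhs_pinfty_ge.
  have y0 : 0 < y by exact: lt_le_trans y1.
  pose t := y ^+ 2 / (s ^+ 2 *+ 2).
  have t0 : 0 < t by rewrite divr_gt0 ?exprn_gt0// mulrn_wgt0// exprn_gt0.
  have et : gauss_exp s y <= 6 * t ^- 3.
    rewrite /gauss_exp mulNr -/t expRN -[leRHS]invrK lef_pV2 ?posrE ?expR_gt0//; last first.
      by rewrite invr_gt0 mulr_gt0// invr_gt0 exprn_gt0.
    rewrite invfM invrK mulrC; apply: le_trans (expR_ge1Dxn 2 (ltW t0)).
    by rewrite lerDr.
  have yc : `|y ^+ 2 + c| <= (1 + `|c|) * y ^+ 2.
    rewrite (le_trans (ler_normD _ _))// mulrDl mul1r ger0_norm ?sqr_ge0// lerD2l.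
    by rewrite ler_peMr// expr_ge1.
  apply: (@le_trans _ _ ((1 + `|c|) * y ^+ 2 * (6 * t ^- 3))).
    by apply: ler_pM => //; exact: gauss_exp_ge0.
  have -> : (1 + `|c|) * y ^+ 2 * (6 * t ^- 3) = K * y ^- 4.
    rewrite /t /K -!(mulr_natl (s ^+ 2)); field.
    by rewrite !gt_eqF.
  rewrite ler_wpM2l// lef_pV2 ?posrE ?exprn_gt0//.
  by rewrite -[leLHS]expr1 ler_weXn2l.
- exact: cvg_cst.
- rewrite -(mulr0 K); apply: cvgMr; apply/gtr0_cvgV0; last exact: cvg_id.
  exact: nbhs_pinfty_gt.
Unshelve. all: end_near. Qed.

Lemma normal_integral_even s g : 0 < s -> continuous g -> (forall y, 0 <= g y) ->
  (\int[normal_prob 0 s]_y (g y)%:E = \int[normal_prob 0 s]_y (g (- y))%:E)%E.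
Proof.
move=> s0 cg g0.
have cg' : continuous (g \o -%R).
  by move=> y; apply: continuous_comp; [exact: opp_continuous|exact: cg].
rewrite !normal_integral_density//; last 2 first.
- exact: continuous_measurable_fun.
- exact: continuous_measurable_fun.
rewrite ge0_integral_reflect.
- apply: eq_integral => y _; congr (_ * _)%:E.
  by rewrite !normal_pdf_exp// /gauss_exp sqrrN.
- move=> y; apply: cvgM; first exact: cg.
  by apply: continuous_normal_pdf; rewrite gt_eqF.
- by move=> y; rewrite mulr_ge0// normal_pdf_ge0.
Qed.

Lemma ge0_integral_even_half g : continuous g -> (forall y, 0 <= g y) ->
  (forall y, g (- y) = g y) ->
  (\int[leb]_y (g y)%:E = 2%:E * \int[leb]_(y in `[0%R, +oo[) (g y)%:E)%E.
Proof.
move=> cg g0 ge; rewrite ge0_symfun_integralT//; last by move=> y /=; rewrite ge.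
by rewrite -set_itvcy.
Qed.

Lemma half_moment3 s : 0 < s ->
  (\int[leb]_(y in `[0%R, +oo[) (`|y| ^+ 3 * gauss_exp s y)%:E = (2 * s ^+ 4)%:E)%E.
Proof.
move=> s0; pose F y := - s ^+ 2 * ((y ^+ 2 + 2 * s ^+ 2) * gauss_exp s y).
have dF y : is_derive y 1 F (y ^+ 3 * gauss_exp s y).
  have dg := is_derive_gauss_exp y s0.
  rewrite /F; apply: is_derive_eq.
  rewrite /GRing.scale /=; field; by rewrite gt_eqF.
have cq := continuous_gauss_exp s0.
transitivity (\int[leb]_(y in `[0%R, +oo[) (y ^+ 3 * gauss_exp s y)%:E)%E.
  apply: eq_integral => y; rewrite inE /= in_itv/= andbT => y0.
  by rewrite ger0_norm.
rewrite (@ge0_continuous_FTC2y _ _ F 0 0).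
- rewrite -EFinB sub0r /F /gauss_exp expr0n/= oppr0 mul0r expR0 add0r; congr (_%:E); ring.
- by move=> y y0; rewrite mulr_ge0 ?exprn_ge0 ?gauss_exp_ge0.
- apply: continuous_subspaceT => y; apply: cvgM; last exact: cq.
  exact: exprn_continuous.
- rewrite -(mulr0 (- s ^+ 2)); apply: cvgMr; exact: cvg_poly_gauss_exp.
- by move=> y _; have [] := dF y.
- apply: cvg_at_right_filter; apply/differentiable_continuous/derivable1_diffP.
  by have [] := dF 0.
- by move=> y _; rewrite derive1E; have [_ ->] := dF y.
Qed.

Lemma half_line_integralD f g : continuous f -> continuous g ->
  (forall y, 0 <= f y) -> (forall y, 0 <= g y) ->
  (\int[leb]_(y in `[0%R, +oo[) (f y)%:E + \int[leb]_(y in `[0%R, +oo[) (g y)%:E =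
   \int[leb]_(y in `[0%R, +oo[) (f y + g y)%:E)%E.
Proof.
move=> cf cg f0 g0; rewrite -ge0_integralD//.
- by move=> y _; rewrite lee_fin.
- by apply/measurable_EFinP/measurable_funTS; exact: continuous_measurable_fun.
- by move=> y _; rewrite lee_fin.
- by apply/measurable_EFinP/measurable_funTS; exact: continuous_measurable_fun.
Qed.

Lemma half_moment2 s : 0 < s ->
  (\int[leb]_(y in `[0%R, +oo[) (y ^+ 2 * gauss_exp s y)%:E =
   (s ^+ 2)%:E * \int[leb]_(y in `[0%R, +oo[) (gauss_exp s y)%:E)%E.
Proof.
(* (y^2 - s^2) q is the derivative of - s^2 y q; adding the auxiliary function
   s^2 e^(1/2 - y/s) >= s^2 q makes it nonnegative. *)
move=> s0; have cq := continuous_gauss_exp s0.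
pose h (y : R) := s ^+ 2 * expR (2^-1 - y / s).
have h0 y : 0 <= h y by rewrite mulr_ge0 ?sqr_ge0 ?expR_ge0.
have hq y : s ^+ 2 * gauss_exp s y <= h y.
  rewrite ler_wpM2l ?sqr_ge0// ler_expR -subr_ge0.
  rewrite (_ : _ - _ = 2^-1 * (y / s - 1) ^+ 2).
    by rewrite mulr_ge0// sqr_ge0.
  by rewrite -(mulr_natl (s ^+ 2)); field; rewrite gt_eqF.
pose H y := - (s ^+ 3 * expR (2^-1 - y / s)).
have dH y : is_derive y 1 H (h y).
  rewrite /H; apply: is_derive_eq.
  by rewrite /GRing.scale /h /=; field; rewrite gt_eqF.
have cvH : H y @[y --> +oo] --> (0 : R).
  rewrite -[X in _ --> X]oppr0 -(mulr0 (s ^+ 3 * expR 2^-1)); apply: cvgN.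
  have -> : (fun y : R => s ^+ 3 * expR (2^-1 - y / s)) =
            (fun y => s ^+ 3 * expR 2^-1 * expR (- (y / s))).
    by apply/funext => y; rewrite expRD mulrA.
  apply: cvgMr; apply: (@cvg_comp _ _ _ (fun y : R => y / s) (fun y => expR (- y)) _ +oo).
    by apply/gt0_cvgMly; [rewrite invr_gt0|exact: cvg_id].
  exact: cvgr_expR.
pose F y := - (s ^+ 2 * (y * gauss_exp s y)).
have dF y : is_derive y 1 F ((y ^+ 2 - s ^+ 2) * gauss_exp s y).
  have dg := is_derive_gauss_exp y s0.
  rewrite /F; apply: is_derive_eq.
  by rewrite /GRing.scale /=; field; rewrite gt_eqF.
have cvF : F y @[y --> +oo] --> (0 : R).
  apply: norm_cvg0.
  apply: (@squeeze_cvgr _ _ _ _ (fun=> 0) (fun y => s ^+ 2 * ((y ^+ 2 + 1) * gauss_exp s y))).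
  - near=> y; rewrite normr_ge0 /= normrN (normrM (s ^+ 2)) (normrM y) (ger0_norm (gauss_exp_ge0 _ _)).
    rewrite (ger0_norm (sqr_ge0 s)) ler_wpM2l ?sqr_ge0// ler_wpM2r ?gauss_exp_ge0//.
    have y0 : 0 <= y by near: y; exact: nbhs_pinfty_ge.
    by rewrite ger0_norm//; nra.
  - exact: cvg_cst.
  - by rewrite -(mulr0 (s ^+ 2)); apply: cvgMr; exact: cvg_poly_gauss_exp.
have ch : continuous h.
  move=> y; apply: cvgM; first exact: cvg_cst.
  apply: (cvg_comp _ expR); last exact: continuous_expR.
  by apply: cvgB; [exact: cvg_cst|apply: cvgMl; exact: cvg_id].
have cG : continuous (fun y => (y ^+ 2 - s ^+ 2) * gauss_exp s y + h y).
  move=> y; apply: cvgD; last exact: ch.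
  apply: cvgM; last exact: cq.
  by apply: cvgB; [exact: exprn_continuous|exact: cvg_cst].
have I1 : (\int[leb]_(y in `[0%R, +oo[) (h y)%:E = (s ^+ 3 * expR 2^-1)%:E)%E.
  rewrite (@ge0_continuous_FTC2y _ _ H 0 0)//.
  - by rewrite -EFinB sub0r /H mul0r subr0 opprK.
  - exact: continuous_subspaceT.
  - apply: cvg_at_right_filter; apply/differentiable_continuous/derivable1_diffP.
    by have [] := dH 0.
  - by move=> y _; rewrite derive1E; have [_ ->] := dH y.
have I2 : (\int[leb]_(y in `[0%R, +oo[) ((y ^+ 2 - s ^+ 2) * gauss_exp s y + h y)%:E
     = (s ^+ 3 * expR 2^-1)%:E)%E.
  have dFH y : is_derive y 1 (F \+ H) ((y ^+ 2 - s ^+ 2) * gauss_exp s y + h y).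
    exact: is_deriveD.
  rewrite (@ge0_continuous_FTC2y _ _ (F \+ H) 0 0)//.
  - by rewrite -EFinB sub0r /F /H /= !mul0r mulr0 subr0 oppr0 add0r opprK.
  - move=> y y0; rewrite mulrBl; have := hq y.
    have : 0 <= y ^+ 2 * gauss_exp s y by rewrite mulr_ge0 ?sqr_ge0 ?gauss_exp_ge0.
    lra.
  - exact: continuous_subspaceT.
  - by rewrite -(addr0 0); exact: cvgD.
  - apply: cvg_at_right_filter; apply/differentiable_continuous/derivable1_diffP.
    by have [] := dFH 0.
  - by move=> y _; rewrite derive1E; have [_ ->] := dFH y.
have E : (\int[leb]_(y in `[0%R, +oo[) ((y ^+ 2 - s ^+ 2) * gauss_exp s y + h y)%:E +
    \int[leb]_(y in `[0%R, +oo[) (s ^+ 2 * gauss_exp s y)%:E =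
    \int[leb]_(y in `[0%R, +oo[) (y ^+ 2 * gauss_exp s y)%:E +
    \int[leb]_(y in `[0%R, +oo[) (h y)%:E)%E.
  have cs : continuous (fun y => s ^+ 2 * gauss_exp s y).
    by move=> y; apply: cvgM; [exact: cvg_cst|exact: cq].
  have cy : continuous (fun y => y ^+ 2 * gauss_exp s y).
    by move=> y; apply: cvgM; [exact: exprn_continuous|exact: cq].
  apply: etrans (half_line_integralD cG cs _ _) _.
  - move=> y; rewrite mulrBl; have := hq y.
    have : 0 <= y ^+ 2 * gauss_exp s y by rewrite mulr_ge0 ?sqr_ge0 ?gauss_exp_ge0.
    lra.
  - by move=> y; rewrite mulr_ge0 ?sqr_ge0 ?gauss_exp_ge0.
  have y20 y : 0 <= y ^+ 2 * gauss_exp s y by rewrite mulr_ge0 ?sqr_ge0 ?gauss_exp_ge0.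
  apply: etrans (esym (half_line_integralD cy ch y20 h0)).
  by apply: eq_integral => y _; congr (_%:E); ring.
move: E; rewrite I1 I2 [RHS]addeC.
under [X in (_ + X)%E = _]eq_integral do rewrite EFinM.
rewrite ge0_integralZl//.
- move=> /(congr1 (fun z : \bar R => z - (s ^+ 3 * expR 2^-1)%:E)%E).
  by rewrite ![(_%:E + _)%E]addeC !addeK.
- by apply/measurable_EFinP/measurable_funTS; exact: continuous_measurable_fun.
- by move=> y _; rewrite lee_fin gauss_exp_ge0.
- by rewrite lee_fin sqr_ge0.
Unshelve. all: end_near. Qed.

Lemma normal_moment2 s : 0 < s ->
  (\int[normal_prob 0 s]_y (y ^+ 2)%:E = (s ^+ 2)%:E)%E.
Proof.
move=> s0; have cq := continuous_gauss_exp s0.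
have p0 : (0 <= (normal_peak s)%:E)%E by rewrite lee_fin normal_peak_ge0.
(* Total mass one gives the half-line integral, and so removes the normalizing constant from the
   second moment. *)
have half : ((normal_peak s)%:E * (2%:E * \int[leb]_(y in `[0%R, +oo[) (gauss_exp s y)%:E) = 1)%E.
  rewrite -ge0_integral_even_half//; first last.
  - by move=> y; rewrite /gauss_exp sqrrN.
  - by move=> y; exact: gauss_exp_ge0.
  rewrite -ge0_integralZl//; last 2 first.
  - by apply/measurable_EFinP; exact: continuous_measurable_fun.
  - by move=> y _; rewrite lee_fin gauss_exp_ge0.
  rewrite -[RHS](@integral_normal_pdf R 0 s); apply: eq_integral => y _.
  by rewrite -EFinM -normal_pdf_exp.
rewrite normal_integral_density//; last by move=> y; exact: sqr_ge0.
transitivity ((normal_peak s)%:E * \int[leb]_y (y ^+ 2 * gauss_exp s y)%:E)%E.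
  rewrite -ge0_integralZl//.
  - by apply: eq_integral => y _; rewrite -EFinM normal_pdf_exp// mulrCA.
  - apply/measurable_EFinP; apply: continuous_measurable_fun => y.
    by apply: cvgM; [exact: exprn_continuous|exact: cq].
  - by move=> y _; rewrite lee_fin mulr_ge0 ?sqr_ge0 ?gauss_exp_ge0.
rewrite ge0_integral_even_half.
- rewrite half_moment2// -[RHS]mule1 -half.
  by rewrite muleCA [RHS]muleCA muleCA; congr (_ * _)%E; rewrite muleCA.
- by move=> y; apply: cvgM; [exact: exprn_continuous|exact: cq].
- by move=> y; rewrite mulr_ge0 ?sqr_ge0 ?gauss_exp_ge0.
- by move=> y; rewrite /gauss_exp !sqrrN.
Qed.

(** The exact value is 4 s^3 times [normal_peak 1], and this peak is at most 1. *)
Lemma normal_moment3 s : 0 < s ->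
  (\int[normal_prob 0 s]_y (`|y| ^+ 3)%:E <= (4 * s ^+ 3)%:E)%E.
Proof.
move=> s0; have cq := continuous_gauss_exp s0.
have c3 : continuous (fun y : R => `|y| ^+ 3).
  by move=> y; apply: (cvg_comp _ (fun x => x ^+ 3)); [exact: (@norm_continuous _ R)|exact: exprn_continuous].
rewrite normal_integral_density//; last exact: continuous_measurable_fun.
rewrite (_ : (\int[leb]_y _)%E = ((normal_peak s)%:E * \int[leb]_y (`|y| ^+ 3 * gauss_exp s y)%:E)%E); last first.
  rewrite -ge0_integralZl//.
  - by apply: eq_integral => y _; rewrite -EFinM normal_pdf_exp// mulrCA.
  - apply/measurable_EFinP; apply: continuous_measurable_fun => y.
    by apply: cvgM; [exact: c3|exact: cq].
  - by move=> y _; rewrite lee_fin mulr_ge0 ?exprn_ge0 ?gauss_exp_ge0.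
  - by rewrite lee_fin normal_peak_ge0.
rewrite ge0_integral_even_half.
- rewrite half_moment3// -!EFinM lee_fin normal_peakE//.
  rewrite (_ : s^-1 * _ * _ = normal_peak 1 * (4 * s ^+ 3)); last first.
    by field; rewrite gt_eqF.
  rewrite ler_piMl ?normal_peak1// mulr_ge0// exprn_ge0//; exact: ltW.
- by move=> y; apply: cvgM; [exact: c3|exact: cq].
- by move=> y; rewrite mulr_ge0 ?exprn_ge0 ?gauss_exp_ge0.
- by move=> y; rewrite /gauss_exp !sqrrN normrN.
Qed.

End gaussian.

(** * Gaussian averaging operators *)

Section gaussian_averages.
Context {R : realType}.
Implicit Types (s t x y z M : R) (f g k : R -> R).
Local Notation leb := (@lebesgue_measure R).

Definition lip M f := forall x y, `|f x - f y| <= M * `|x - y|.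

Lemma lip_continuous M f : lip M f -> continuous f.
Proof.
move=> fM x; apply/cvgrPdist_le => e e0; near=> y.
rewrite (le_trans (fM x y))//.
have M1 : 0 < `|M| + 1 by rewrite ltr_wpDl.
rewrite (@le_trans _ _ ((`|M| + 1) * `|x - y|))//.
  by rewrite ler_wpM2r// (le_trans (ler_norm M))// lerDl.
rewrite mulrC -ler_pdivlMr//.
near: y; apply: (@cvgr_dist_le _ R^o) => //; exact: divr_gt0.
Unshelve. all: end_near. Qed.

(* Second order Taylor expansion with a cubic remainder; the Lipschitz
   conditions provide measurability of averages. *)
Record smooth1 M f f1 f2 : Prop := Smooth1 {
  smooth1_lip : lip M f ; smooth1_lip1 : lip M f1 ; smooth1_lip2 : lip M f2 ;
  smooth1_bd : forall x, `|f x| <= M ; smooth1_bd1 : forall x, `|f1 x| <= M ;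
  smooth1_bd2 : forall x, `|f2 x| <= M ;
  smooth1_taylor : forall x h,
    `|f (x + h) - f x - h * f1 x - h ^+ 2 / 2 * f2 x| <= M * `|h| ^+ 3 }.

(** The kernel k is the identity for a Gaussian increment and the square for a chi-squared
    increment; both averages then share the lemmas below. *)
Definition gavg s k f : R -> R := fun x => \int[normal_prob 0 s]_y f (x + k y).

Section integrable_lift.
Context d (T : measurableType d) (mu : {measure set T -> \bar R}).

Lemma integrable_addr (u v : T -> R) : mu.-integrable setT (EFin \o u) ->
  mu.-integrable setT (EFin \o v) -> mu.-integrable setT (EFin \o (fun a => u a + v a)).
Proof.
move=> Iu Iv; rewrite (_ : EFin \o _ = ((EFin \o u) \+ (EFin \o v))%E)//.
exact: integrableD.
Qed.

Lemma integrable_subr (u v : T -> R) : mu.-integrable setT (EFin \o u) ->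
  mu.-integrable setT (EFin \o v) -> mu.-integrable setT (EFin \o (fun a => u a - v a)).
Proof.
move=> Iu Iv; rewrite (_ : EFin \o _ = ((EFin \o u) \- (EFin \o v))%E)//.
exact: integrableB.
Qed.

Lemma integrable_mulr c (u : T -> R) : mu.-integrable setT (EFin \o u) ->
  mu.-integrable setT (EFin \o (fun a => c * u a)).
Proof.
move=> Iu; rewrite (_ : EFin \o _ = (fun a => c%:E * (EFin \o u) a)%E)//.
exact: integrableZl.
Qed.

End integrable_lift.

Section properties.
Variables (s : R) (k : R -> R).
Hypothesis (ck : continuous k).
Local Notation A := (gavg s k).

Lemma bounded_normal_integrable g M : continuous g -> (forall y, `|g y| <= M) ->
  (normal_prob 0 s).-integrable setT (EFin \o g).
Proof.
move=> cg gM; apply: measurable_bounded_integrable => //.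
- by rewrite (@le_lt_trans _ _ 1%E)// ?ltry// probability_le1.
- exact: continuous_measurable_fun.
- exists M; split; first exact: num_real.
  by move=> x Mx y _ /=; rewrite (le_trans (gM y))// ltW.
Qed.

Lemma continuous_shift_comp M f x : lip M f -> continuous (fun y => f (x + k y)).
Proof.
move=> fM y; apply: (cvg_comp _ f); last exact: (lip_continuous fM).
by apply: cvgD; [exact: cvg_cst|exact: ck].
Qed.

Lemma gavg_integrable M M' f x : lip M f -> (forall y, `|f y| <= M') ->
  (normal_prob 0 s).-integrable setT (EFin \o (fun y => f (x + k y))).
Proof.
by move=> fM fM'; apply: (@bounded_normal_integrable _ M') => //; exact: continuous_shift_comp fM.
Qed.

Lemma normal_Rintegral_cst c : \int[normal_prob 0 s]_y (fun=> c) y = c.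
Proof. by rewrite /Rintegral integral_cst//= probability_setT mule1. Qed.

Lemma normal_Rintegral_norm g M : continuous g -> (forall y, `|g y| <= M) ->
  `|\int[normal_prob 0 s]_y g y| <= M.
Proof.
move=> cg gM.
have ig := bounded_normal_integrable cg gM.
rewrite (le_trans (le_normr_Rintegral _ _))//.
rewrite -[leRHS]normal_Rintegral_cst; apply: le_Rintegral => //.
- apply: (@bounded_normal_integrable _ M).
    by move=> y; apply: cvg_norm; exact: cg.
  by move=> y; rewrite normr_id.
- by apply: (@bounded_normal_integrable _ `|M|) => // y; exact: cvg_cst.
Qed.

Lemma gavg_bound M M' f : lip M f -> (forall y, `|f y| <= M') -> forall x, `|A f x| <= M'.
Proof.
by move=> fM fM' x; apply: normal_Rintegral_norm => //; exact: continuous_shift_comp fM.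
Qed.

Lemma gavg_addr M M' f c x : lip M f -> (forall y, `|f y| <= M') ->
  A (fun y => f y + c) x = A f x + c.
Proof.
move=> fM fM'; rewrite /gavg RintegralD.
- by rewrite normal_Rintegral_cst.
- exact: measurableT.
- exact: (gavg_integrable _ fM fM').
- by apply: (@bounded_normal_integrable (cst c) `|c|) => // y; exact: cvg_cst.
Qed.

Lemma gavg_lip M M' f : lip M f -> (forall y, `|f y| <= M') -> lip M (A f).
Proof.
move=> fM fM' x x'.
rewrite /gavg -RintegralB//; try exact: (gavg_integrable _ fM fM').
apply: normal_Rintegral_norm => [y|y].
  by apply: cvgB; exact: (continuous_shift_comp fM).
by rewrite (le_trans (fM _ _))// opprD addrACA subrr addr0.
Qed.

Lemma gavg_smooth1 M f f1 f2 : smooth1 M f f1 f2 -> smooth1 M (A f) (A f1) (A f2).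
Proof.
move=> [l0 l1 l2 b0 b1 b2 T]; split.
- exact: (gavg_lip l0 b0).
- exact: (gavg_lip l1 b1).
- exact: (gavg_lip l2 b2).
- exact: (gavg_bound l0 b0).
- exact: (gavg_bound l1 b1).
- exact: (gavg_bound l2 b2).
move=> x h.
have i0 y := gavg_integrable y l0 b0.
have i1 : (normal_prob 0 s).-integrable setT (EFin \o (fun y => h * f1 (x + k y))).
  apply: (@bounded_normal_integrable _ (`|h| * M)).
    by move=> y; apply: cvgM; [exact: cvg_cst|exact: (continuous_shift_comp l1)].
  by move=> y; rewrite normrM ler_wpM2l.
have i2 : (normal_prob 0 s).-integrable setT (EFin \o (fun y => h ^+ 2 / 2 * f2 (x + k y))).
  apply: (@bounded_normal_integrable _ (`|h ^+ 2 / 2| * M)).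
    by move=> y; apply: cvgM; [exact: cvg_cst|exact: (continuous_shift_comp l2)].
  by move=> y; rewrite normrM ler_wpM2l.
have -> : A f (x + h) - A f x - h * A f1 x - h ^+ 2 / 2 * A f2 x =
  \int[normal_prob 0 s]_y (f (x + h + k y) - f (x + k y) - h * f1 (x + k y) -
     h ^+ 2 / 2 * f2 (x + k y)).
  have i01 := integrable_subr (i0 (x + h)) (i0 x).
  have i011 := integrable_subr i01 i1.
  rewrite /gavg RintegralB// RintegralB// RintegralB// RintegralZl//; last exact: (gavg_integrable _ l1 b1).
  by rewrite RintegralZl//; exact: (gavg_integrable _ l2 b2).
apply: normal_Rintegral_norm => y.
  apply: cvgB; last by apply: cvgM; [exact: cvg_cst|exact: (continuous_shift_comp l2)].
  apply: cvgB; last by apply: cvgM; [exact: cvg_cst|exact: (continuous_shift_comp l1)].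
  by apply: cvgB; exact: (continuous_shift_comp l0).
by rewrite (addrAC x h).
Qed.

End properties.

Lemma gavgE s k f x M M' : continuous k -> lip M f -> (forall y, `|f y| <= M') ->
  (\int[normal_prob 0 s]_y (f (x + k y))%:E = (gavg s k f x)%:E)%E.
Proof.
move=> ck l b; rewrite /gavg /Rintegral fineK//.
by apply: integrable_fin_num => //; exact: (gavg_integrable s ck x l b).
Qed.

Lemma gavg_idE s f x M M' : lip M f -> (forall y, `|f y| <= M') ->
  (\int[normal_prob 0 s]_y (f (x + y))%:E = (gavg s id f x)%:E)%E.
Proof. by move=> l b; apply: gavgE l b => y; exact: cvg_id. Qed.

(* The symmetry of the Gaussian law cancels the linear term. *)
Lemma gauss_taylor s M f f1 f2 x : 0 < s -> smooth1 M f f1 f2 ->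
  `|gavg s id f x - f x - s ^+ 2 / 2 * f2 x| <= 4 * M * s ^+ 3.
Proof.
move=> s0 sf; have [l0 _ _ b0 _ _ T] := sf.
have M0 : 0 <= M by rewrite (le_trans _ (b0 0)).
have cid_ : continuous (@id R) by move=> y; exact: cvg_id.
have copp : continuous (@GRing.opp R) by exact: opp_continuous.
have i2 : (normal_prob 0 s).-integrable setT (fun y => (y ^+ 2)%:E).
  apply/integrableP; split.
    by apply/measurable_EFinP; apply: continuous_measurable_fun; exact: exprn_continuous.
  under eq_integral do rewrite abse_EFin ger0_norm ?sqr_ge0//.
  by rewrite normal_moment2// ltry.
have i3 : (normal_prob 0 s).-integrable setT (fun y => (`|y| ^+ 3)%:E).
  apply/integrableP; split.
    apply/measurable_EFinP; apply: continuous_measurable_fun => y.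
    by apply: (cvg_comp _ (fun x => x ^+ 3)); [exact: (@norm_continuous _ R)|exact: exprn_continuous].
  under eq_integral do rewrite abse_EFin ger0_norm ?exprn_ge0//.
  by rewrite (le_lt_trans (normal_moment3 s0))// ltry.
have even : gavg s id f x = gavg s (@GRing.opp R) f x.
  (* Adding the bound M makes the integrand nonnegative, as the symmetry of the integral requires;
     the shift disappears in the comparison. *)
  have cf1 : continuous (fun y => f (x + y) + M).
    move=> y; apply: cvgD; last exact: cvg_cst.
    exact: (continuous_shift_comp cid_ l0).
  have f10 y : 0 <= f (x + y) + M.
    by have := b0 (x + y); rewrite ler_norml => /andP[]; lra.
  have := normal_integral_even s0 cf1 f10.
  have E k : continuous k -> (\int[normal_prob 0 s]_y (f (x + k y) + M)%:E)%E =
     (gavg s k f x + M)%:E.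
    move=> ck; under eq_integral do rewrite EFinD.
    rewrite integralD//; last 2 first.
    - exact: (gavg_integrable s ck x l0 b0).
    - by apply: (@bounded_normal_integrable s (cst M) `|M|) => // y; exact: cvg_cst.
    rewrite (gavgE s x ck l0 b0) EFinD; congr (_ + _)%E.
    by rewrite integral_cst//= probability_setT mule1.
  rewrite (E _ cid_) (E _ copp) => /(congr1 fine) /=; lra.
have I2 : \int[normal_prob 0 s]_y (y ^+ 2) = s ^+ 2.
  by rewrite /Rintegral normal_moment2.
have I3 : \int[normal_prob 0 s]_y (`|y| ^+ 3) <= 4 * s ^+ 3.
  rewrite /Rintegral -[leRHS]/(fine (4 * s ^+ 3)%:E) fine_le//.
    exact: integrable_fin_num.
  exact: normal_moment3.
have iA := gavg_integrable s cid_ x l0 b0.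
have iB := gavg_integrable s copp x l0 b0.
pose g y := 2^-1 * (f (x + y) + f (x + - y)) - f x - 2^-1 * f2 x * y ^+ 2.
have iAB := integrable_addr iA iB.
have iAB2 := integrable_mulr 2^-1 iAB.
have ic c : (normal_prob 0 s).-integrable setT (EFin \o (fun=> c)).
  by apply: (@bounded_normal_integrable s (cst c) `|c|) => // y; exact: cvg_cst.
have iq := @integrable_mulr _ _ (normal_prob 0 s) (2^-1 * f2 x) _ i2.
have iABc := integrable_subr iAB2 (ic (f x)).
have ig : (normal_prob 0 s).-integrable setT (EFin \o g) := integrable_subr iABc iq.
have -> : gavg s id f x - f x - s ^+ 2 / 2 * f2 x = \int[normal_prob 0 s]_y g y.
  rewrite /g RintegralB// RintegralB// RintegralZl//.
  rewrite RintegralD// RintegralZl// I2 normal_Rintegral_cst.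
  rewrite -/(gavg s (@GRing.opp R) f x) -even /gavg /=. lra.
rewrite (le_trans (le_normr_Rintegral _ _))//.
have gM y : `|g y| <= M * `|y| ^+ 3.
  have := T x y; have := T x (- y); rewrite normrN sqrrN /g.
  set a := f _; set b := f (x + y); set c := M * _.
  rewrite !ler_norml => /andP[? ?] /andP[? ?]; apply/andP; split; lra.
apply: (@le_trans _ _ (\int[normal_prob 0 s]_y (M * `|y| ^+ 3))).
  apply: le_Rintegral => //.
  - exact: (integrable_abse ig).
  - exact: (@integrable_mulr _ _ (normal_prob 0 s) M _ i3).
rewrite RintegralZl//.
rewrite (_ : 4 * M * s ^+ 3 = M * (4 * s ^+ 3)); last by ring.
by rewrite ler_wpM2l.
Qed.

(** After the substitution z = y + y' and an exchange of integrals, [normal_pdf_conv] factors out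
    the density of the sum and leaves in y a Gaussian density of mass one. *)
Lemma normal_semigroup s t g x : 0 < s -> 0 < t -> continuous g -> (forall y, 0 <= g y) ->
  (\int[normal_prob 0 s]_y \int[normal_prob 0 t]_y' (g (x + y + y'))%:E =
   \int[normal_prob 0 (Num.sqrt (s ^+ 2 + t ^+ 2))]_y (g (x + y))%:E)%E.
Proof.
move=> s0 t0 cg g0; set r := Num.sqrt _.
have r0 : 0 < r by rewrite sqrtr_gt0 ltr_wpDl ?sqr_ge0// exprn_gt0.
have cgx z : continuous (fun y => g (z + y)).
  move=> y; apply: (cvg_comp _ g); last exact: cg.
  by apply: cvgD; [exact: cvg_cst|exact: cvg_id].
have mgx z : measurable_fun setT (fun y => g (z + y)) by exact: continuous_measurable_fun.
have mpdf u := measurable_normal_pdf (0 : R) u.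
have cpz (y : R) : continuous (fun z : R => normal_pdf 0 t (z - y)).
  move=> z; apply: (@continuous_comp _ _ _ (fun z : R => z - y) (normal_pdf 0 t)).
    by apply: cvgB; [exact: cvg_id|exact: cvg_cst].
  by apply: continuous_normal_pdf; rewrite gt_eqF.
have mgp (y : R) : measurable_fun setT (fun z : R => g (x + z) * normal_pdf 0 t (z - y)).
  apply: continuous_measurable_fun => z; apply: cvgM; first exact: cgx.
  exact: cpz.
have inner y : (\int[normal_prob 0 t]_y' (g (x + y + y'))%:E =
    \int[leb]_z (g (x + z) * normal_pdf 0 t (z - y))%:E)%E.
  rewrite (normal_integral_density t (mgx (x + y)) (fun _ => g0 _)).
  rewrite (@ge0_integral_translate _ _ (- y)).
  - by apply: eq_integral => z _; congr (g _ * _)%:E; ring.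
  - move=> y'; apply: cvgM; first exact: cgx.
    by apply: continuous_normal_pdf; rewrite gt_eqF.
  - by move=> y'; rewrite mulr_ge0// normal_pdf_ge0.
pose H (a : R * R) := ((g (x + a.2) * normal_pdf 0 t (a.2 - a.1)) * normal_pdf 0 s a.1)%:E.
have mH : measurable_fun setT H.
  apply/measurable_EFinP; apply: measurable_funM.
    apply: measurable_funM; first exact: (measurableT_comp (mgx x) measurable_snd).
    apply: (measurableT_comp (mpdf t)).
    by apply: measurable_funB; [exact: measurable_snd|exact: measurable_fst].
  exact: (measurableT_comp (mpdf s) measurable_fst).
have H0 a : (0 <= H a)%E by rewrite lee_fin !mulr_ge0 ?normal_pdf_ge0.
under eq_integral do rewrite inner.
transitivity (\int[leb]_y \int[leb]_z H (y, z))%E.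
  have mF : measurable_fun setT (fun y =>
      \int[leb]_z (g (x + z) * normal_pdf 0 t (z - y))%:E)%E.
    apply: (@measurable_fun_fubini_tonelli_F _ _ _ _ _ leb
       (fun a : R * R => (g (x + a.2) * normal_pdf 0 t (a.2 - a.1))%:E)).
      apply/measurable_EFinP.
      apply: measurable_funM; first exact: (measurableT_comp (mgx x) measurable_snd).
      apply: (measurableT_comp (mpdf t)).
      by apply: measurable_funB; [exact: measurable_snd|exact: measurable_fst].
    by move=> a; rewrite lee_fin mulr_ge0 ?normal_pdf_ge0.
  rewrite ge0_normal_integral//; last by move=> y; apply: integral_ge0 => z _;
    rewrite lee_fin mulr_ge0// normal_pdf_ge0.
  apply: eq_integral => y _; rewrite -ge0_integralZr//.
  - by apply/measurable_EFinP; apply: mgp.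
  - by move=> z _; rewrite lee_fin mulr_ge0// normal_pdf_ge0.
  - by rewrite lee_fin normal_pdf_ge0.
transitivity (\int[leb]_z \int[leb]_y H (y, z))%E.
  exact: (@fubini_tonelli _ _ _ _ _ leb leb H mH H0).
rewrite (normal_integral_density r (mgx x) (fun _ => g0 _)).
apply: eq_integral => z _.
under eq_integral => y _ do
  rewrite /H/= -mulrA (mulrC (normal_pdf 0 t _)) normal_pdf_conv// mulrA EFinM.
rewrite ge0_integralZl//.
- by rewrite integral_normal_pdf mule1.
- by apply/measurable_EFinP; exact: measurable_normal_pdf.
- by move=> y _; rewrite lee_fin normal_pdf_ge0.
- by rewrite lee_fin mulr_ge0 ?normal_pdf_ge0.
Qed.

Lemma gavg_semigroup s t M f x : 0 < s -> 0 < t -> lip M f -> (forall y, `|f y| <= M) ->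
  gavg s id (gavg t id f) x = gavg (Num.sqrt (s ^+ 2 + t ^+ 2)) id f x.
Proof.
move=> s0 t0 l b.
have ci : continuous (@id R) by move=> y; exact: cvg_id.
have cg : continuous (fun y => f y + M).
  by move=> y; apply: cvgD; [exact: (lip_continuous l)|exact: cvg_cst].
have g0 y : 0 <= f y + M by have := b y; rewrite ler_norml => /andP[]; lra.
have lM : lip M (fun y => f y + M) by move=> y z; rewrite opprD addrACA subrr addr0.
have bM y : `|f y + M| <= M + M.
  have := b y; rewrite !ler_norml => /andP[? ?]; apply/andP; split; lra.
have lE u : lip M (gavg u id (fun y => f y + M)) by exact: (gavg_lip u ci lM bM).
have bE u y : `|gavg u id (fun y => f y + M) y| <= M + M by exact: (gavg_bound u ci lM bM).
have := normal_semigroup x s0 t0 cg g0; move: (Num.sqrt _) => u.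
under eq_integral => y _ do rewrite (gavg_idE t (x + y) lM bM).
move=> H; have := etrans (esym (gavg_idE s x (lE t) (bE t))) (etrans H (gavg_idE u x lM bM)).
move/(congr1 fine) => /=; rewrite (gavg_addr u ci M x l b).
rewrite (_ : gavg t id (fun y => f y + M) = fun y => gavg t id f y + M); last first.
  by apply/funext => y; exact: (gavg_addr t ci M y l b).
by rewrite (gavg_addr s ci M x (gavg_lip t ci l b) (gavg_bound t ci l b)) => /addIr.
Qed.

End gaussian_averages.

Opaque gavg.

(** * Normalized sums of random signs *)

Section rademacher.
Context {R : realType}.
Implicit Types (a s x y z M B : R) (f g : R -> R).

Definition radem (W : zmodType) (a : W) : seq (R * W) := [:: (2^-1, a); (2^-1, - a)].

Lemma radem_law (W : zmodType) (a : W) : is_law (radem a).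
Proof.
split; first by move=> c; rewrite !inE => /orP[] /eqP -> /=.
by rewrite /radem !big_cons big_nil /=; lra.
Qed.

Lemma step_radem (W : zmodType) (v w : W) (F : W -> R) :
  step (radem v) F w = 2^-1 * F (w + v) + 2^-1 * F (w - v).
Proof. by rewrite /step /radem !big_cons big_nil /= addr0. Qed.

Lemma radem_taylor a M f f1 f2 x : 0 < a -> smooth1 M f f1 f2 ->
  `|step (radem a) f x - f x - a ^+ 2 / 2 * f2 x| <= M * a ^+ 3.
Proof.
move=> a0 sf; have := smooth1_taylor sf x a; have := smooth1_taylor sf x (- a).
rewrite step_radem normrN sqrrN (gtr0_norm a0).
move: (f (x - a)) (f (x + a)) (M * a ^+ 3) => u v w.
by rewrite !ler_norml => /andP[? ?] /andP[? ?]; apply/andP; split; lra.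
Qed.

Lemma sqrt_scale a N : 0 < a -> 0 <= N ->
  Num.sqrt (a ^+ 2 + (a * Num.sqrt N) ^+ 2) = a * Num.sqrt (1 + N).
Proof.
move=> a0 N0; have -> : a ^+ 2 + (a * Num.sqrt N) ^+ 2 = a ^+ 2 * (1 + N).
  by rewrite exprMn sqr_sqrtr; [ring|exact: N0].
rewrite sqrtrM; last exact: sqr_ge0.
by rewrite sqrtr_sqr gtr0_norm.
Qed.

Lemma iter_gauss a M f n : 0 < a -> lip M f -> (forall y, `|f y| <= M) ->
  iter n.+1 (gavg a id) f = gavg (a * Num.sqrt n.+1%:R) id f.
Proof.
move=> a0 l b; elim: n => [|n IH]; first by rewrite /= sqrtr1 mulr1.
rewrite iterS IH; apply/funext => x.
rewrite (gavg_semigroup x a0 _ l b); last by rewrite mulr_gt0// sqrtr_gt0.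
by rewrite (sqrt_scale a0 (ler0n _ _)) -mulrS.
Qed.

(** By the semigroup property the average of deviation s is the n-th power of the average of
    deviation s / sqrt n. One sign step and one Gaussian step of that size agree up to cubic order,
    with constants 1 and 4, whence the 5. *)
Lemma rademacher_clt s n M f f1 f2 x : 0 < s -> (0 < n)%N -> smooth1 M f f1 f2 ->
  `|iter n (step (radem (s / Num.sqrt n%:R))) f x - gavg s id f x| <=
  5 * M * s ^+ 3 / Num.sqrt n%:R.
Proof.
move=> s0 n0 sf; set a := s / Num.sqrt n%:R.
have sn0 : 0 < Num.sqrt (n%:R : R) by rewrite sqrtr_gt0 ltr0n.
have a0 : 0 < a by rewrite divr_gt0.
have sfE : gavg s id f = iter n (gavg a id) f.
  have aE : a * Num.sqrt n%:R = s by apply: divfK; rewrite gt_eqF.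
  have := iter_gauss n.-1 a0 (smooth1_lip sf) (smooth1_bd sf).
  by rewrite (prednK n0) aE => ->.
rewrite sfE.
have ci : continuous (@id R) by move=> y; exact: cvg_id.
have -> : 5 * M * s ^+ 3 / Num.sqrt n%:R = n%:R * (5 * M * a ^+ 3).
  rewrite /a expr_div_n -[X in X * (5 * _ * _)](@sqr_sqrtr _ (n%:R : R))//.
  by field; rewrite gt_eqF.
apply: trotter; first exact: radem_law.
move=> j _ y.
have [g1 [g2 sg]] : exists g1 g2, smooth1 M (iter j (gavg a id) f) g1 g2.
  elim: j => [|j [g1 [g2 sg]]]; first by exists f1, f2.
  by eexists; eexists; rewrite iterS; exact: (gavg_smooth1 a ci sg).
have := radem_taylor y a0 sg; have := gauss_taylor y a0 sg.
move: (gavg a id _ y) (step _ _ y) (iter j _ f y) => u v w.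
rewrite !ler_norml => /andP[? ?] /andP[? ?]; apply/andP; split; lra.
Qed.

(** For functions vanishing where |x| >= b, all estimates need only be checked for |x| <= b + 1: the
    margin 1 ensures that an increment of size at most 1 from beyond it stays where they vanish. For
    |h| > 1 the remainder is at most 2 C + C |h| + C |h|^2 / 2, hence below 4 C |h|^3. *)
Lemma local_smooth1 b C g g1 g2 : 0 <= C ->
  (forall x, b <= `|x| -> [/\ g x = 0, g1 x = 0 & g2 x = 0]) ->
  (forall x, `|x| <= b + 1 -> [/\ `|g x| <= C, `|g1 x| <= C & `|g2 x| <= C]) ->
  (forall x y, `|x| <= b + 1 -> `|y| <= b + 1 -> [/\ `|g x - g y| <= C * `|x - y|,
     `|g1 x - g1 y| <= C * `|x - y| & `|g2 x - g2 y| <= C * `|x - y| ]) ->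
  (forall x h, `|x| <= b + 1 -> `|h| <= 1 ->
     `|g (x + h) - g x - h * g1 x - h ^+ 2 / 2 * g2 x| <= C * `|h| ^+ 3) ->
  smooth1 (4 * C) g g1 g2.
Proof.
move=> C0 V B L T.
have bd x : [/\ `|g x| <= C, `|g1 x| <= C & `|g2 x| <= C].
  have [/B//|xb] := leP `|x| (b + 1).
  have [|-> -> ->] := V x; last by rewrite normr0.
  by rewrite (le_trans _ (ltW xb))// lerDl.
have lipg (k : R -> R) : (forall x, b <= `|x| -> k x = 0) -> (forall x, `|k x| <= C) ->
   (forall x y, `|x| <= b + 1 -> `|y| <= b + 1 -> `|k x - k y| <= C * `|x - y|) ->
   lip (4 * C) k.
  move=> kV kB kL.
  have far x y : b + 1 < `|x| -> `|k x - k y| <= C * `|x - y|.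
    move=> xb; rewrite kV ?sub0r ?normrN; last by rewrite (le_trans _ (ltW xb))// lerDl.
    have [/kV ->|yb] := leP b `|y|; first by rewrite normr0 mulr_ge0.
    rewrite (le_trans (kB y))// -[leLHS]mulr1 ler_wpM2l//.
    have := lerB_dist x y; lra.
  move=> x y; apply: (@le_trans _ _ (C * `|x - y|)); last first.
    by rewrite ler_wpM2r// ler_peMl// ler1n.
  have [xb|xb] := leP `|x| (b + 1); last exact: far.
  have [yb|yb] := leP `|y| (b + 1); first exact: kL.
  by rewrite distrC (distrC x); exact: far.
split.
- apply: lipg => [x /V[]//|x|x y xb yb]; first by case: (bd x).
  by have [] := L x y xb yb.
- apply: lipg => [x /V[]//|x|x y xb yb]; first by case: (bd x).
  by have [] := L x y xb yb.
- apply: lipg => [x /V[]//|x|x y xb yb]; first by case: (bd x).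
  by have [] := L x y xb yb.
- by move=> x; have [? _ _] := bd x; lra.
- by move=> x; have [_ ? _] := bd x; lra.
- by move=> x; have [_ _ ?] := bd x; lra.
move=> x h.
have h3 : 0 <= `|h| ^+ 3 by rewrite exprn_ge0.
have [h1|h1] := leP `|h| 1.
  apply: (@le_trans _ _ (C * `|h| ^+ 3)); last first.
    by rewrite ler_wpM2r// ler_peMl// ler1n.
  have [xb|xb] := leP `|x| (b + 1); first exact: T.
  have [|-> -> ->] := V x; first by rewrite (le_trans _ (ltW xb))// lerDl.
  have [|-> _ _] := V (x + h).
    by have := lerB_normD x h; lra.
  by rewrite !mulr0 !subr0 normr0 mulr_ge0.
have [b0 b1 b2] := bd x; have [b0' _ _] := bd (x + h).
have e1 : `|h * g1 x| <= C * `|h| by rewrite normrM mulrC ler_wpM2r.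
have e2 : `|h ^+ 2 / 2 * g2 x| <= C * (`|h| ^+ 2 / 2).
  by rewrite normrM mulrC normrM normrX (@ger0_norm _ 2^-1)// ler_wpM2r// divr_ge0// exprn_ge0.
have h12 : `|h| <= `|h| ^+ 3 by rewrite -[leLHS]expr1 ler_weXn2l// ltW.
have h23 : `|h| ^+ 2 <= `|h| ^+ 3 by rewrite ler_weXn2l// ltW.
have h03 : 1 <= `|h| ^+ 3 by rewrite exprn_ege1// ltW.
have c1 : C * `|h| <= C * `|h| ^+ 3 by rewrite ler_wpM2l.
have c2 : C * (`|h| ^+ 2 / 2) <= C * `|h| ^+ 3 / 2.
  by rewrite -mulrA ler_wpM2l// ler_wpM2r.
have c3 : C <= C * `|h| ^+ 3 by rewrite ler_peMr.
move: c1 c2 c3 b0 b0' e1 e2; clear.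
move: (g (x + h)) (g x) (h * _) (h ^+ 2 / 2 * _) => u v w t c1 c2 c3.
rewrite !ler_norml => /andP[? ?] /andP[? ?] /andP[? ?] /andP[? ?].
apply/andP; split; lra.
Qed.

Lemma normr_mul_le (k : nat) (u v U V : R) : `|u| <= U -> `|v| <= V ->
  `|k%:R * u * v| <= k%:R * U * V.
Proof.
by move=> uU vV; rewrite !normrM normr_nat; apply: ler_pM => //; rewrite ler_wpM2l.
Qed.

(** As f vanishes right of B and z >= 0, the composite vanishes once |x| >= 1 + |B|. The unbounded
    derivatives of the square are thus seen on a bounded range only, and M' does not depend on z. *)
Lemma smooth1_sqr M B f f1 f2 : smooth1 M f f1 f2 ->
  (forall y, B <= y -> [/\ f y = 0, f1 y = 0 & f2 y = 0]) ->
  exists M', forall z, 0 <= z -> exists g1 g2, smooth1 M' (fun x => f (z + x ^+ 2)) g1 g2.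
Proof.
move=> sf fV; have [l0 l1 l2 b0 b1 b2 T] := sf.
have M0 : 0 <= M by rewrite (le_trans _ (b0 0)).
(* Each constant below has the form M p with p at most 2 (2 c + 1)^3; the cube comes from |(x + h)^2
   - x^2| <= (2 c + 1) |h| for |x| <= c and |h| <= 1. *)
pose b := 1 + `|B|; pose c := b + 1; pose C := 2 * M * (2 * c + 1) ^+ 3.
have c2 : 2 <= c by rewrite /c /b; have := normr_ge0 B; lra.
have C0 : 0 <= C by rewrite /C; apply: mulr_ge0; [exact: mulr_ge0|apply: exprn_ge0; lra].
exists (4 * C) => z z0.
exists (fun x => 2 * x * f1 (z + x ^+ 2)), (fun x => 4 * x ^+ 2 * f2 (z + x ^+ 2) + 2 * f1 (z + x ^+ 2)).
have MC (p : R) : p <= 2 * (2 * c + 1) ^+ 3 -> M * p <= C.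
  by move=> pc; rewrite /C (mulrC 2) -mulrA ler_wpM2l.
have sq x : `|x| <= c -> x ^+ 2 <= c ^+ 2.
  by move=> xc; rewrite -(real_normK (num_real x)) lerXn2r ?nnegrE//; lra.
have dsq x y : `|x| <= c -> `|y| <= c -> `|x ^+ 2 - y ^+ 2| <= 2 * c * `|x - y|.
  move=> xc yc; rewrite subr_sqr normrM mulrC ler_wpM2r//.
  by rewrite (le_trans (ler_normD _ _))//; lra.
apply: (@local_smooth1 b) => //.
- move=> x xb; have [|-> -> ->] := fV (z + x ^+ 2); last by rewrite !mulr0 addr0.
  have : b ^+ 2 <= x ^+ 2 by rewrite -(real_normK (num_real x)) lerXn2r ?nnegrE//; rewrite /b addr_ge0.
  have : B <= `|B| by exact: ler_norm.
  rewrite /b; have := normr_ge0 B; nra.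
- move=> x xc; split.
  + rewrite (le_trans (b0 _))// -[leLHS]mulr1 MC//; nra.
  + apply: (@le_trans _ _ (2 * c * M)); first exact: (@normr_mul_le 2).
    by rewrite mulrC; apply: MC; nra.
  + apply: (@le_trans _ _ (M * (4 * c ^+ 2 + 2))); last by apply: MC; nra.
    rewrite (le_trans (ler_normD _ _))// mulrDr lerD//.
      by rewrite [leRHS]mulrC; apply: (@normr_mul_le 4) => //; rewrite ger0_norm ?sqr_ge0// sq.
    by rewrite normrM normr_nat mulrC ler_wpM2r.
- move=> x y xc yc; have dxy := dsq x y xc yc.
  have F (k : R -> R) : lip M k -> `|k (z + x ^+ 2) - k (z + y ^+ 2)| <= M * (2 * c) * `|x - y|.
    move=> lk; rewrite (le_trans (lk _ _))// -mulrA ler_wpM2l//.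
    by rewrite opprD addrACA subrr add0r.
  have d0 := normr_ge0 (x - y).
  split.
  + by rewrite (le_trans (F _ l0))// ler_wpM2r// MC//; nra.
  + rewrite (_ : _ - _ = 2 * (x - y) * f1 (z + x ^+ 2) + 2 * y * (f1 (z + x ^+ 2) - f1 (z + y ^+ 2))); last by ring.
    apply: (@le_trans _ _ (M * (2 + 4 * c ^+ 2) * `|x - y|)); last first.
      by rewrite ler_wpM2r// MC//; nra.
    have e1 : `|2 * (x - y) * f1 (z + x ^+ 2)| <= 2 * `|x - y| * M.
      exact: (@normr_mul_le 2).
    have e2 : `|2 * y * (f1 (z + x ^+ 2) - f1 (z + y ^+ 2))| <= 2 * c * (M * (2 * c) * `|x - y|).
      by apply: (@normr_mul_le 2) => //; exact: F.
    rewrite (le_trans (ler_normD _ _))// (le_trans (lerD e1 e2))//.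
    by rewrite (_ : _ + _ = M * (2 + 4 * c ^+ 2) * `|x - y|)//; ring.
  + rewrite (_ : _ - _ = 4 * (x ^+ 2 - y ^+ 2) * f2 (z + x ^+ 2) +
       4 * y ^+ 2 * (f2 (z + x ^+ 2) - f2 (z + y ^+ 2)) +
       2 * (f1 (z + x ^+ 2) - f1 (z + y ^+ 2))); last by ring.
    apply: (@le_trans _ _ (M * (12 * c + 8 * c ^+ 3) * `|x - y|)); last first.
      by rewrite ler_wpM2r// MC//; nra.
    have e1 : `|4 * (x ^+ 2 - y ^+ 2) * f2 (z + x ^+ 2)| <= 4 * (2 * c * `|x - y|) * M.
      exact: (@normr_mul_le 4).
    have e2 : `|4 * y ^+ 2 * (f2 (z + x ^+ 2) - f2 (z + y ^+ 2))| <= 4 * c ^+ 2 * (M * (2 * c) * `|x - y|).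
      by apply: (@normr_mul_le 4); [rewrite ger0_norm ?sqr_ge0// sq|exact: F].
    have e3 : `|2 * (f1 (z + x ^+ 2) - f1 (z + y ^+ 2))| <= 2 * (M * (2 * c) * `|x - y|).
      by rewrite normrM normr_nat ler_wpM2l// F.
    rewrite (le_trans (ler_normD _ _))// (le_trans (lerD (ler_normD _ _) (lexx _)))//.
    rewrite (le_trans (lerD (lerD e1 e2) e3))//.
    by rewrite (_ : _ + _ + _ = M * (12 * c + 8 * c ^+ 3) * `|x - y|)//; ring.
- move=> x h xc h1.
  pose k := 2 * x * h + h ^+ 2.
  have -> : z + (x + h) ^+ 2 = z + x ^+ 2 + k by rewrite /k; ring.
  have := T (z + x ^+ 2) k.
  set y := z + x ^+ 2 => Tk.
  have h0 := normr_ge0 h.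
  have kh : `|k| <= (2 * c + 1) * `|h|.
    rewrite /k (_ : _ + _ = (2 * x + h) * h); last by ring.
    rewrite normrM ler_wpM2r// (le_trans (ler_normD _ _))// normrM.
    by rewrite (ger0_norm (ler0n _ 2)); rewrite lerD// ler_wpM2l.
  rewrite (_ : _ - _ = (f (y + k) - f y - k * f1 y - k ^+ 2 / 2 * f2 y) +
     (4 * x + h) / 2 * h ^+ 3 * f2 y); last by rewrite /k; field.
  apply: (@le_trans _ _ (M * ((2 * c + 1) ^+ 3 + (2 * c + 2^-1)) * `|h| ^+ 3)); last first.
    rewrite ler_wpM2r ?exprn_ge0// MC//.
    have : 1 <= (2 * c + 1) ^+ 2 by rewrite exprn_ege1//; lra.
    rewrite (exprS _ 2) => ?; nra.
  rewrite (le_trans (ler_normD _ _))// mulrDr mulrDl lerD//.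
    rewrite (le_trans Tk)// -mulrA ler_wpM2l// -exprMn lerXn2r ?nnegrE//.
    by rewrite mulr_ge0//; lra.
  rewrite (_ : M * _ * _ = (2 * c + 2^-1) * `|h| ^+ 3 * M); last by ring.
  rewrite normrM; apply: ler_pM => //; rewrite normrM normrX ler_wpM2r ?exprn_ge0//.
  rewrite normrM (@ger0_norm _ 2^-1)//.
  have : `|4 * x + h| <= 4 * c + 1.
    rewrite (le_trans (ler_normD _ _))// normrM (ger0_norm (ler0n _ 4)) lerD// ler_wpM2l//.
  lra.
Qed.

End rademacher.

Transparent gavg.

(** * Smooth cutoff functions *)

Section cutoff_functions.
Context {R : realType}.
Implicit Types (a d t x y z M B C : R) (f g : R -> R).

(** The Lipschitz bounds on f and f1 follow from the Taylor bounds at distance less than 1 and from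
    the sup bounds beyond. *)
Lemma mk_smooth1 C f f1 f2 : 0 <= C ->
  (forall x, `|f x| <= C) -> (forall x, `|f1 x| <= C) -> (forall x, `|f2 x| <= C) ->
  lip C f2 ->
  (forall x h, `|f1 (x + h) - f1 x - h * f2 x| <= C * `|h| ^+ 2) ->
  (forall x h, `|f (x + h) - f x - h * f1 x - h ^+ 2 / 2 * f2 x| <= C * `|h| ^+ 3) ->
  smooth1 (3 * C) f f1 f2.
Proof.
move=> C0 b0 b1 b2 l2 T1 T.
have far (k : R -> R) x y : (forall x, `|k x| <= C) -> 1 <= `|x - y| ->
    `|k x - k y| <= 3 * C * `|x - y|.
  move=> bk xy; have cxy : C <= C * `|x - y| by rewrite ler_peMr.
  rewrite (le_trans (ler_normB _ _))//.
  by have := bk x; have := bk y; lra.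
split.
- move=> x y; have [/(far _ _ _ b0)//|xy1] := leP 1 `|x - y|.
  have := T y (x - y); rewrite [y + _]addrC subrK.
  have xy0 := normr_ge0 (x - y).
  have e1 : `|(x - y) * f1 y| <= C * `|x - y| by rewrite normrM mulrC ler_wpM2r.
  have e2 : `|(x - y) ^+ 2 / 2 * f2 y| <= C / 2 * `|x - y|.
    rewrite (_ : C / 2 * _ = `|x - y| / 2 * C); last by ring.
    rewrite normrM; apply: ler_pM => //; rewrite normrM (@ger0_norm _ 2^-1)// ler_wpM2r//.
    by rewrite normrX expr2 ler_piMr// ltW.
  have e3 : C * `|x - y| ^+ 3 <= C * `|x - y|.
    by rewrite ler_wpM2l// exprS ler_piMr// exprn_ile1// ltW.
  move: e1 e2; move: ((x - y) * _) (_ / 2 * _) => u v.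
  rewrite !ler_norml => /andP[? ?] /andP[? ?] /andP[? ?]; apply/andP.
  have := mulr_ge0 C0 xy0; split; lra.
- move=> x y; have [/(far _ _ _ b1)//|xy1] := leP 1 `|x - y|.
  have := T1 y (x - y); rewrite [y + _]addrC subrK.
  have xy0 := normr_ge0 (x - y).
  have e1 : `|(x - y) * f2 y| <= C * `|x - y| by rewrite normrM mulrC ler_wpM2r.
  have e3 : C * `|x - y| ^+ 2 <= C * `|x - y|.
    by rewrite ler_wpM2l// exprS ler_piMr// exprn_ile1// ltW.
  move: e1; move: ((x - y) * _) => u.
  rewrite !ler_norml => /andP[? ?] /andP[? ?]; apply/andP.
  have := mulr_ge0 C0 xy0; split; lra.
- move=> x y; rewrite (le_trans (l2 x y))// ler_wpM2r//; lra.
- by move=> x; rewrite (le_trans (b0 x))//; lra.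
- by move=> x; rewrite (le_trans (b1 x))//; lra.
- by move=> x; rewrite (le_trans (b2 x))//; lra.
- move=> x h; rewrite (le_trans (T x h))// ler_wpM2r ?exprn_ge0//; lra.
Qed.

Definition pos x : R := Num.max 0 x.

Lemma posE x : (0 <= x /\ pos x = x) \/ (x <= 0 /\ pos x = 0).
Proof. by rewrite /pos; have [x0|x0] := ltP 0 x; [left; rewrite ltW|right]. Qed.

Lemma pos_lip x y : `|pos x - pos y| <= `|x - y|.
Proof.
have [[? ->]|[? ->]] := posE x; have [[? ->]|[? ->]] := posE y => //.
- by rewrite subr0 !ger0_norm//; lra.
- by rewrite sub0r normrN distrC !ger0_norm//; lra.
- by rewrite subrr normr0.
Qed.

Lemma pos_taylor2 x h : `|pos (x + h) ^+ 2 - pos x ^+ 2 - h * (2 * pos x)| <= `|h| ^+ 2.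
Proof.
rewrite real_normK ?num_real// ler_norml.
have [[? ->]|[? ->]] := posE x; have [[? ->]|[? ->]] := posE (x + h); apply/andP; split; nra.
Qed.

Lemma pos_taylor3 x h :
  `|pos (x + h) ^+ 3 - pos x ^+ 3 - h * (3 * pos x ^+ 2) - h ^+ 2 / 2 * (6 * pos x)|
   <= `|h| ^+ 3.
Proof.
have [[x0 ->]|[x0 ->]] := posE x; have [[xh ->]|[xh ->]] := posE (x + h).
- rewrite (_ : _ - _ = h ^+ 3) ?normrX//; by field.
- have h0 : h <= 0 by lra.
  rewrite (ler0_norm h0) (_ : _ - _ = - (x ^+ 3 + 3 * h * x ^+ 2 + 3 * h ^+ 2 * x)); last by field.
  rewrite normrN ler_norml; pose k := - h - x; have k0 : 0 <= k by rewrite /k; lra.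
  have -> : h = - x - k by rewrite /k; ring.
  have x3 : 0 <= x ^+ 3 by rewrite exprn_ge0.
  have k3 : 0 <= k ^+ 3 by rewrite exprn_ge0.
  have xk : 0 <= x * k by rewrite mulr_ge0.
  have xxk : 0 <= x * k * x by rewrite mulr_ge0.
  have xkk : 0 <= x * k * k by rewrite mulr_ge0.
  apply/andP; split; nra.
- rewrite !(expr0n, mulr0, subr0)/= ger0_norm ?exprn_ge0// lerXn2r ?nnegrE//.
  by rewrite (le_trans _ (ler_norm h))//; lra.
- by rewrite !(expr0n, mulr0, subr0)/= normr0 exprn_ge0.
Qed.

(* Cubic B-spline: third finite differences of truncated powers. *)
Definition diff3 (p : R -> R) x : R := p x - 3 * p (x - 1) + 3 * p (x - 2) - p (x - 3).
Definition spline x : R := diff3 (fun x => pos x ^+ 3) x / 6.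
Definition spline1 x : R := diff3 (fun x => 3 * pos x ^+ 2) x / 6.
Definition spline2 x : R := diff3 (fun x => 6 * pos x) x / 6.

(** The coefficients 1, 3, 3, 1 add up to 8, and 8 / 6 <= 2. *)
Lemma diff3_le (e : R) (p : R -> R) x : (forall x, `|p x| <= e) -> `|diff3 p x / 6| <= 2 * e.
Proof.
move=> pe; rewrite /diff3; have := pe x; have := pe (x - 1); have := pe (x - 2).
have := pe (x - 3); rewrite !ler_norml => /andP[? ?] /andP[? ?] /andP[? ?] /andP[? ?].
apply/andP; split; lra.
Qed.

(** Each polynomial piece is written in a local variable with values in [0, 1], measured backwards
    from 3 on the third one, so that the bounds only involve powers of such a variable. *)
Variant spline_spec x : R -> R -> R -> Prop :=
| Spline0 of x <= 0 : spline_spec x 0 0 0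
| Spline1 of 0 <= x & x <= 1 : spline_spec x (x ^+ 3 / 6) (x ^+ 2 / 2) x
| Spline2 s of 0 <= s & s <= 1 & x = 1 + s :
    spline_spec x ((1 + 3 * s + 3 * s ^+ 2 - 2 * s ^+ 3) / 6) ((1 + 2 * s - 2 * s ^+ 2) / 2) (1 - 2 * s)
| Spline3 s of 0 <= s & s <= 1 & x = 3 - s :
    spline_spec x (1 - s ^+ 3 / 6) (s ^+ 2 / 2) (- s)
| Spline4 of 3 <= x : spline_spec x 1 0 0.

Lemma splineP x : spline_spec x (spline x) (spline1 x) (spline2 x).
Proof.
rewrite /spline /spline1 /spline2 /diff3.
have pE y : 0 <= y -> pos y = y by move=> y0; have [[_ ->]|[y1 ->]] := posE y => //; lra.
have pE0 y : y <= 0 -> pos y = 0 by move=> y0; have [[y1 ->]|[_ ->]] := posE y => //; lra.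
have [x0|x0] := leP x 0.
  rewrite !pE0; [|lra|lra|lra|lra].
  rewrite !(expr0n, mulr0, subr0, addr0, mul0r)/=; exact: Spline0.
have [x1|x1] := leP x 1.
  rewrite (pE x) ?(pE0 (x - 1)) ?(pE0 (x - 2)) ?(pE0 (x - 3)); [|lra|lra|lra|lra].
  rewrite !(expr0n, mulr0, subr0, addr0)/=.
  rewrite (_ : 3 * x ^+ 2 / 6 = x ^+ 2 / 2); last by field.
  rewrite (_ : 6 * x / 6 = x); last by field.
  by apply: Spline1 => //; lra.
have [x2|x2] := leP x 2.
  rewrite (pE x) ?(pE (x - 1)) ?(pE0 (x - 2)) ?(pE0 (x - 3)); [|lra|lra|lra|lra].
  have -> : (x ^+ 3 - 3 * (x - 1) ^+ 3 + 3 * 0 ^+ 3 - 0 ^+ 3) / 6 =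
    (1 + 3 * (x - 1) + 3 * (x - 1) ^+ 2 - 2 * (x - 1) ^+ 3) / 6 by field.
  have -> : (3 * x ^+ 2 - 3 * (3 * (x - 1) ^+ 2) + 3 * (3 * 0 ^+ 2) - 3 * 0 ^+ 2) / 6 =
    (1 + 2 * (x - 1) - 2 * (x - 1) ^+ 2) / 2 by field.
  have -> : (6 * x - 3 * (6 * (x - 1)) + 3 * (6 * 0) - 6 * 0) / 6 = 1 - 2 * (x - 1) by field.
  by apply: Spline2; lra.
have [x3|x3] := leP x 3.
  rewrite (pE x) ?(pE (x - 1)) ?(pE (x - 2)) ?(pE0 (x - 3)); [|lra|lra|lra|lra].
  have -> : (x ^+ 3 - 3 * (x - 1) ^+ 3 + 3 * (x - 2) ^+ 3 - 0 ^+ 3) / 6 =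
    1 - (3 - x) ^+ 3 / 6 by field.
  have -> : (3 * x ^+ 2 - 3 * (3 * (x - 1) ^+ 2) + 3 * (3 * (x - 2) ^+ 2) - 3 * 0 ^+ 2) / 6 =
    (3 - x) ^+ 2 / 2 by field.
  have -> : (6 * x - 3 * (6 * (x - 1)) + 3 * (6 * (x - 2)) - 6 * 0) / 6 = - (3 - x) by field.
  by apply: Spline3; lra.
rewrite !pE; [|lra|lra|lra|lra].
have -> : (x ^+ 3 - 3 * (x - 1) ^+ 3 + 3 * (x - 2) ^+ 3 - (x - 3) ^+ 3) / 6 = 1 by field.
have -> : (3 * x ^+ 2 - 3 * (3 * (x - 1) ^+ 2) + 3 * (3 * (x - 2) ^+ 2) - 3 * (x - 3) ^+ 2) / 6 = 0.
  by field.
have -> : (6 * x - 3 * (6 * (x - 1)) + 3 * (6 * (x - 2)) - 6 * (x - 3)) / 6 = 0 by field.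
apply: Spline4; lra.
Qed.

Lemma spline_bounds x : 0 <= spline x <= 1 /\ (`|spline1 x| <= 1 /\ `|spline2 x| <= 1).
Proof.
rewrite !ler_norml; case: splineP => [x0|x0 x1|s s0 s1 _|s s0 s1 _|x3].
- by rewrite !lerN10 !ler01 lexx.
- have : 0 <= x ^+ 3 <= 1 by rewrite exprn_ge0// exprn_ile1.
  have : 0 <= x ^+ 2 <= 1 by rewrite exprn_ge0// exprn_ile1.
  move=> /andP[? ?] /andP[? ?]; do !split; apply/andP; split; lra.
- have : 0 <= s ^+ 3 <= s ^+ 2 by rewrite exprn_ge0// ler_wiXn2l.
  have : 0 <= s ^+ 2 <= s by rewrite exprn_ge0// -[leRHS]expr1 ler_wiXn2l.
  have : 0 <= (s - 1) ^+ 2 * (s + 2) by rewrite mulr_ge0 ?sqr_ge0//; lra.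
  rewrite (_ : _ * (s + 2) = s ^+ 3 - 3 * s + 2); last by ring.
  have : 0 <= (2 * s - 1) ^+ 2 by exact: sqr_ge0.
  rewrite (_ : (2 * s - 1) ^+ 2 = 4 * s ^+ 2 - 4 * s + 1); last by ring.
  move=> ? ? /andP[? ?] /andP[? ?]; do !split; apply/andP; split; lra.
- have : 0 <= s ^+ 3 <= 1 by rewrite exprn_ge0// exprn_ile1.
  have : 0 <= s ^+ 2 <= 1 by rewrite exprn_ge0// exprn_ile1.
  move=> /andP[? ?] /andP[? ?]; do !split; apply/andP; split; lra.
- by rewrite !lerN10 !ler01 lexx.
Qed.

(** A smooth substitute for the indicator of the half-line up to a. It is 1 up to a and 0 from a + 3
    d on, the spline rising from 0 to 1 over [0, 3]. *)
Definition cutoff a d x : R := 1 - spline ((x - a) / d).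

Lemma cutoff_le1 a d x : 0 <= cutoff a d x <= 1.
Proof.
by have [/andP[? ?] _] := spline_bounds ((x - a) / d); rewrite /cutoff; apply/andP; split; lra.
Qed.

Lemma cutoff_left a d x : 0 < d -> x <= a -> cutoff a d x = 1.
Proof.
move=> d0 xa; rewrite /cutoff; have : (x - a) / d <= 0 by rewrite pmulr_lle0 ?invr_gt0// subr_le0.
move: (_ / d) => t t0; have pE0 y : y <= 0 -> pos y = 0.
  by move=> y0; have [[y1 ->]|[_ ->]] := posE y => //; lra.
rewrite /spline /diff3 !pE0; [|lra|lra|lra|lra].
by rewrite !(expr0n, mulr0, subr0, addr0, mul0r).
Qed.

Definition cutoff1 a d x : R := - (spline1 ((x - a) / d) / d).
Definition cutoff2 a d x : R := - (spline2 ((x - a) / d) / d ^+ 2).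

Lemma cutoff_right a d x : 0 < d -> a + 3 * d <= x ->
  [/\ cutoff a d x = 0, cutoff1 a d x = 0 & cutoff2 a d x = 0].
Proof.
move=> d0 xa; rewrite /cutoff /cutoff1 /cutoff2.
have : 3 <= (x - a) / d by rewrite ler_pdivlMr// lerBrDl.
move: (_ / d) => t t3; have pE y : 0 <= y -> pos y = y.
  by move=> y0; have [[_ ->]|[y1 ->]] := posE y => //; lra.
rewrite /spline /spline1 /spline2 /diff3 !pE; [|lra|lra|lra|lra].
by split; field; rewrite ?gt_eqF.
Qed.

Lemma smooth1_spline : smooth1 36 spline spline1 spline2.
Proof.
have -> : 36 = 3 * 12 :> R by ring.
apply: mk_smooth1 => //.
- move=> x; have [/andP[? ?] _] := spline_bounds x; rewrite ger0_norm//; lra.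
- move=> x; have [_ [? _]] := spline_bounds x; lra.
- move=> x; have [_ [_ ?]] := spline_bounds x; lra.
- move=> x y; have -> : spline2 x - spline2 y =
     diff3 (fun t => 6 * (pos t - pos (t - (x - y)))) x / 6.
    rewrite /spline2 /diff3.
    have e k : x - k - (x - y) = y - k by ring.
    rewrite !e (_ : x - (x - y) = y); last by ring.
    by rewrite -mulrBl; congr (_ / 6); ring.
  rewrite (_ : 12 * _ = 2 * (6 * `|x - y|)); last by ring.
  apply: diff3_le => t; rewrite normrM normr_nat ler_wpM2l//.
  by rewrite (le_trans (pos_lip _ _))// opprB addrC subrK.
- move=> x h; have -> : spline1 (x + h) - spline1 x - h * spline2 x =
     diff3 (fun t => 3 * (pos (t + h) ^+ 2 - pos t ^+ 2 - h * (2 * pos t))) x / 6.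
    rewrite /spline1 /spline2 /diff3.
    by rewrite !(addrAC x h); field.
  apply: (@le_trans _ _ (2 * (3 * `|h| ^+ 2))).
    apply: diff3_le => t; rewrite normrM normr_nat ler_wpM2l//.
    exact: pos_taylor2.
  have := exprn_ge0 2 (normr_ge0 h); lra.
- move=> x h; have -> : spline (x + h) - spline x - h * spline1 x - h ^+ 2 / 2 * spline2 x =
     diff3 (fun t => pos (t + h) ^+ 3 - pos t ^+ 3 - h * (3 * pos t ^+ 2)
       - h ^+ 2 / 2 * (6 * pos t)) x / 6.
    rewrite /spline /spline1 /spline2 /diff3.
    by rewrite !(addrAC x h); field.
  apply: (@le_trans _ _ (2 * `|h| ^+ 3)); last by have := exprn_ge0 3 (normr_ge0 h); lra.
  by apply: diff3_le => t; exact: pos_taylor3.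
Qed.

Lemma smooth1_affine M f f1 f2 c b : 0 <= c -> smooth1 M f f1 f2 ->
  smooth1 (M * (1 + c) ^+ 3) (fun x => f (c * x + b)) (fun x => c * f1 (c * x + b))
    (fun x => c ^+ 2 * f2 (c * x + b)).
Proof.
move=> c0 [l0 l1 l2 b0 b1 b2 T].
have M0 : 0 <= M by rewrite (le_trans _ (b0 0)).
have pw n : (n <= 3)%N -> c ^+ n <= (1 + c) ^+ 3.
  move=> n3; apply: (@le_trans _ _ ((1 + c) ^+ n)); last by rewrite ler_weXn2l// lerDl.
  by rewrite lerXn2r ?nnegrE ?addr_ge0// lerDr.
have scale n u v : (n <= 3)%N -> 0 <= v -> `|u| <= M * v ->
    `|c ^+ n * u| <= M * (1 + c) ^+ 3 * v.
  move=> n3 v0 uv; rewrite normrM ger0_norm ?exprn_ge0//.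
  rewrite (_ : M * _ * v = (1 + c) ^+ 3 * (M * v)); last by ring.
  by apply: ler_pM => //; [exact: exprn_ge0|exact: pw].
have lipn (k : R -> R) n : (n < 3)%N -> lip M k -> lip (M * (1 + c) ^+ 3) (fun x => c ^+ n * k (c * x + b)).
  move=> n3 lk x y; rewrite -mulrBr normrM ger0_norm ?exprn_ge0//.
  apply: (@le_trans _ _ (c ^+ n * (M * (c * `|x - y|)))).
    rewrite ler_wpM2l ?exprn_ge0// (le_trans (lk _ _))// ler_wpM2l//.
    by rewrite opprD addrACA subrr addr0 -mulrBr normrM ger0_norm.
  rewrite (_ : c ^+ n * _ = M * c ^+ n.+1 * `|x - y|); last by rewrite exprS; ring.
  by rewrite ler_wpM2r// ler_wpM2l// pw.
split.
- by have := lipn f 0%N; under eq_fun do rewrite mul1r; apply.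
- exact: (lipn f1 1%N).
- exact: (lipn f2 2%N).
- by move=> x; have := scale 0%N (f (c * x + b)) 1; rewrite mul1r !mulr1; apply.
- by move=> x; have := scale 1%N (f1 (c * x + b)) 1; rewrite !mulr1; apply.
- by move=> x; have := scale 2%N (f2 (c * x + b)) 1; rewrite !mulr1; apply.
move=> x h; have := T (c * x + b) (c * h).
rewrite (_ : c * (x + h) + b = c * x + b + c * h); last by ring.
rewrite (_ : c * h * f1 _ = h * (c * f1 (c * x + b))); last by ring.
rewrite (_ : (c * h) ^+ 2 / 2 * f2 _ = h ^+ 2 / 2 * (c ^+ 2 * f2 (c * x + b))); last by ring.
move=> /le_trans; apply.
by rewrite normrM (ger0_norm c0) exprMn mulrA ler_wpM2r ?exprn_ge0// ler_wpM2l// pw.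
Qed.

Lemma smooth1_compl M f f1 f2 : smooth1 M f f1 f2 ->
  smooth1 (1 + M) (fun x => 1 - f x) (fun x => - f1 x) (fun x => - f2 x).
Proof.
move=> [l0 l1 l2 b0 b1 b2 T].
have M1 u : u <= M -> u <= 1 + M by move=> ?; lra.
have Mm (u v : R) : 0 <= v -> u <= M * v -> u <= (1 + M) * v.
  by move=> v0 /le_trans; apply; rewrite ler_wpM2r//; lra.
split.
- move=> x y; rewrite opprD addrACA subrr add0r opprK addrC.
  by apply: Mm => //; rewrite distrC l0 // distrC.
- move=> x y; rewrite opprK addrC; apply: Mm => //; rewrite distrC. exact: l1.
- move=> x y; rewrite opprK addrC; apply: Mm => //; rewrite distrC. exact: l2.
- by move=> x; rewrite (le_trans (ler_normB _ _))// normr1 lerD2l.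
- by move=> x; rewrite normrN M1.
- by move=> x; rewrite normrN M1.
move=> x h; rewrite -normrN; apply: Mm; first by rewrite exprn_ge0.
have -> : - (1 - f (x + h) - (1 - f x) - h * - f1 x - h ^+ 2 / 2 * - f2 x) =
  f (x + h) - f x - h * f1 x - h ^+ 2 / 2 * f2 x by ring.
exact: T.
Qed.

Lemma smooth1_cutoff a d : 0 < d -> exists M, smooth1 M (cutoff a d) (cutoff1 a d) (cutoff2 a d).
Proof.
move=> d0; have i0 : 0 <= d^-1 by rewrite invr_ge0 ltW.
have := smooth1_compl (smooth1_affine (- a / d) i0 smooth1_spline).
have E x : d^-1 * x + - a / d = (x - a) / d by rewrite (mulrC d^-1) -mulrDl.
set M := (M in smooth1 M) => H; exists M; move: H.
rewrite (_ : (fun x => 1 - spline _) = cutoff a d); last by apply/funext => x; rewrite E.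
rewrite (_ : (fun x => - (d^-1 * spline1 _)) = cutoff1 a d); last first.
  by apply/funext => x; rewrite E mulrC.
rewrite (_ : (fun x => - (d^-1 ^+ 2 * spline2 _)) = cutoff2 a d)//.
by apply/funext => x; rewrite E mulrC exprVn.
Qed.

End cutoff_functions.

(** * Chi-squared laws as iterated averages *)

Section chi_squared_limit.
Context {R : realType}.
Implicit Types (a d t x y z M B C : R) (f g : R -> R).

Definition sq_op f : R -> R := gavg 1 (fun y => y ^+ 2) f.

(** The discrete counterpart of [sq_op]: it adds the square of a normalized sum of n signs instead
    of the square of a standard normal variable. *)
Definition radem_sq_op n f : R -> R := fun z =>
  iter n (step (radem (Num.sqrt n%:R)^-1)) (fun s => f (z + s ^+ 2)) 0.

(* The test functions vanish on the right, hence only bounded arguments of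
   x |-> f (z + x ^ 2), z >= 0, matter. *)
Definition smooth1_left B M f :=
  exists f1 f2, smooth1 M f f1 f2 /\
    forall y, B <= y -> [/\ f y = 0, f1 y = 0 & f2 y = 0].

Lemma continuous_sq : continuous (fun y : R => y ^+ 2).
Proof. exact: exprn_continuous. Qed.

Lemma sq_op_eq0 B f : (forall y, B <= y -> f y = 0) -> forall y, B <= y -> sq_op f y = 0.
Proof.
move=> fB y By; rewrite /sq_op /gavg.
rewrite (@eq_Rintegral _ _ _ _ _ (fun=> 0)) ?normal_Rintegral_cst//.
by move=> u _; apply: fB; rewrite (le_trans By)// lerDl sqr_ge0.
Qed.

Lemma smooth1_left_sq_op B M f : smooth1_left B M f -> smooth1_left B M (sq_op f).
Proof.
move=> [f1 [f2 [sf fB]]]; exists (sq_op f1), (sq_op f2); split.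
  exact: (gavg_smooth1 1 continuous_sq sf).
move=> y By; split; apply: (@sq_op_eq0 B) => // u Bu; by have [] := fB u Bu.
Qed.

Lemma sq_opE f z : sq_op f z = gavg 1 id (fun x => f (z + x ^+ 2)) 0.
Proof. by rewrite /sq_op /gavg; apply: eq_Rintegral => u _; rewrite add0r. Qed.

Lemma radem_sq_op_cvg B M f : smooth1_left B M f ->
  exists C, forall n z, (0 < n)%N -> 0 <= z ->
    `|radem_sq_op n f z - sq_op f z| <= C / Num.sqrt n%:R.
Proof.
move=> [f1 [f2 [sf fB]]]; have [M' H] := smooth1_sqr sf fB.
exists (5 * M') => n z n0 z0; have [g1 [g2 sg]] := H z z0.
have := rademacher_clt 0 ltr01 n0 sg.
by rewrite expr1n mulr1 div1r -sq_opE.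
Qed.

Lemma radem_sq_opB n f g e : (forall z, 0 <= z -> `|f z - g z| <= e) ->
  forall z, 0 <= z -> `|radem_sq_op n f z - radem_sq_op n g z| <= e.
Proof.
move=> fg z z0; rewrite /radem_sq_op.
set T := step _; set F := fun s => f _; set G := fun s => g _.
have -> : iter n T F 0 - iter n T G 0 = iter n T (F \- G) 0 by rewrite iter_stepB.
apply: iter_step_bound; first exact: radem_law.
by move=> s; apply: fg; rewrite addr_ge0// sqr_ge0.
Qed.

(** [radem_sq_op n] is a contraction for the sup norm on [0, oo), squares being nonnegative, and
    [sq_op] preserves the class of test functions; the errors of the m factors therefore add up. *)
Lemma iter_radem_sq_op_cvg B M f m : smooth1_left B M f ->
  exists C, forall n z, (0 < n)%N -> 0 <= z ->
    `|iter m (radem_sq_op n) f z - iter m sq_op f z| <= C / Num.sqrt n%:R.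
Proof.
move=> sf; elim: m => [|m [C IH]].
  by exists 0 => n z n0 z0; rewrite subrr normr0 mul0r.
have sm : smooth1_left B M (iter m sq_op f).
  by elim: (m) => // k sk; rewrite iterS; exact: smooth1_left_sq_op.
have [C' H'] := radem_sq_op_cvg sm.
exists (C + C') => n z n0 z0; rewrite !iterS mulrDl.
rewrite (le_trans (ler_distD (radem_sq_op n (iter m sq_op f) z) _ _))// lerD//.
  by apply: radem_sq_opB => // y y0; exact: IH.
exact: H'.
Qed.

(** The square added last is integrated first; this replaces f by [sq_op f], again Lipschitz with
    values in [0, M], so the induction on m runs over all such f. *)
Lemma chi2_integral m M f : lip M f -> (forall x, 0 <= f x <= M) ->
  (\int[chi2 R m]_z (f z)%:E = (iter m sq_op f 0)%:E)%E.
Proof.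
elim: m f => [|m IH] f l b.
  rewrite /= integral_dirac//=; first by rewrite diracE in_setT mul1e.
  by apply/measurable_EFinP; exact: (continuous_measurable_fun (lip_continuous l)).
have b' y : `|f y| <= M by have /andP[? ?] := b y; rewrite ger0_norm.
have mf : measurable_fun setT f by exact: (continuous_measurable_fun (lip_continuous l)).
rewrite [chi2 R m.+1]/=.
have := @ge0_integral_distribution _ _ _ _ _
  [the probability _ R of (chi2 R m \x normal_prob (0 : R) 1)%E] (@add_sq R) (EFin \o f).
move=> ->; last 2 first.
- exact/measurable_EFinP.
- by move=> y; rewrite lee_fin; case/andP: (b y).
rewrite fubini_tonelli1; last 2 first.
- apply/measurable_EFinP; apply: measurableT_comp => //.
- by move=> y; rewrite lee_fin; case/andP: (b (add_sq y)).
rewrite iterSr -(IH (sq_op f)).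
- apply: eq_integral => z _; rewrite /fubini_F /=.
  exact: (gavgE 1 z continuous_sq l b').
- exact: (gavg_lip 1 continuous_sq l b').
- move=> x; rewrite /sq_op.
  have := gavg_bound 1 continuous_sq l b' x.
  rewrite ler_norml => /andP[_ ->]; rewrite andbT.
  by apply: Rintegral_ge0 => y _; case/andP: (b (x + y ^+ 2)).
Qed.

Lemma cutoff_prob (mu : probability (measurableTypeR R) R) a d : 0 < d ->
  (mu (`]-oo, a]%classic : set R) <= \int[mu]_z (cutoff a d z)%:E <=
   mu (`]-oo, (a + 3 * d)%R]%classic : set R))%E.
Proof.
move=> d0; have [M sf] := smooth1_cutoff a d0.
have mc : measurable_fun setT (EFin \o cutoff a d).
  by apply/measurable_EFinP; exact: (continuous_measurable_fun (lip_continuous (smooth1_lip sf))).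
have c0 x : (0 <= (cutoff a d x)%:E)%E by rewrite lee_fin; case/andP: (cutoff_le1 a d x).
have muE (A : set R) : measurable A -> (mu A = \int[mu]_z (\1_A z)%:E)%E.
  by move=> mA; rewrite integral_indic// setIT.
have mi (A : set R) : measurable A -> measurable_fun setT (fun z => (\1_A z : R)%:E).
  by move=> mA; apply/measurable_EFinP; exact: measurable_indic.
apply/andP; split.
  rewrite muE//; apply: ge0_le_integral => //.
  - exact: mi.
  - move=> z _; rewrite lee_fin indicE; case: (boolP (z \in _)) => /=; rewrite ?mem_setE ?in_itv/=.
      by move=> za; rewrite cutoff_left.
    by move=> _; case/andP: (cutoff_le1 a d z).
rewrite muE//; apply: ge0_le_integral => //.
- exact: mi.
- move=> z _; rewrite lee_fin indicE; case: (boolP (z \in _)) => /=; rewrite ?mem_setE ?in_itv/=.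
    by move=> za; case/andP: (cutoff_le1 a d z).
  by rewrite -ltNge => za; have [-> _ _] := cutoff_right d0 (ltW za).
Qed.

End chi_squared_limit.

(** * Central limit theorems *)

Section univariate_clt.
Context {R : realType}.
Implicit Types (mu : seq (R * R)) (x M : R).

Definition mean1 mu : R := \sum_(a <- mu) a.1 * a.2.
Definition var1 mu : R := \sum_(a <- mu) a.1 * a.2 ^+ 2.
Definition abs3 mu : R := \sum_(a <- mu) a.1 * `|a.2| ^+ 3.

Lemma step_taylor1 mu M f f1 f2 x : is_law mu -> smooth1 M f f1 f2 ->
  `|step mu f x - f x - mean1 mu * f1 x - var1 mu / 2 * f2 x| <= M * abs3 mu.
Proof.
move=> [mu0 mu1] sf; have T := smooth1_taylor sf.
have -> : step mu f x - f x - mean1 mu * f1 x - var1 mu / 2 * f2 x =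
  \sum_(a <- mu) a.1 * (f (x + a.2) - f x - a.2 * f1 x - a.2 ^+ 2 / 2 * f2 x).
  have E0 : f x = \sum_(a <- mu) a.1 * f x by rewrite -mulr_suml mu1 mul1r.
  rewrite [X in _ - X - _ - _]E0 /step /mean1 /var1 !mulr_suml -!sumrB.
  by apply: eq_bigr => a _; ring.
rewrite (le_trans (ler_norm_sum _ _ _))// /abs3 mulr_sumr big_seq [leRHS]big_seq.
apply: ler_sum => a amu; rewrite normrM ger0_norm ?mu0// mulrCA ler_wpM2l//.
exact: mu0.
Qed.

(** The n steps are compared with n Gaussian steps of deviation s / sqrt n, whose power is exactly
    the average of deviation s. The bound is explicit so that it applies to triangular arrays, where
    [mu] varies with n. *)
Lemma univariate_clt mu s n M f f1 f2 x : is_law mu -> 0 < s -> (0 < n)%N ->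
  smooth1 M f f1 f2 ->
  `|iter n (step mu) f x - gavg s id f x| <=
   M * (n%:R * `|mean1 mu| + `|n%:R * var1 mu - s ^+ 2| + n%:R * abs3 mu)
   + 4 * M * s ^+ 3 / Num.sqrt n%:R.
Proof.
move=> hmu s0 n0 sf; set a := s / Num.sqrt n%:R.
have M0 : 0 <= M by rewrite (le_trans _ (smooth1_bd sf 0)).
have sn0 : 0 < Num.sqrt (n%:R : R) by rewrite sqrtr_gt0 ltr0n.
have n0R : 0 < n%:R :> R by rewrite ltr0n.
have a0 : 0 < a by rewrite divr_gt0.
have aE : a * Num.sqrt n%:R = s by apply: divfK; rewrite gt_eqF.
have sfE : gavg s id f = iter n (gavg a id) f.
  have := iter_gauss n.-1 a0 (smooth1_lip sf) (smooth1_bd sf).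
  by rewrite (prednK n0) aE => ->.
have a2 : a ^+ 2 = s ^+ 2 / n%:R by rewrite /a expr_div_n sqr_sqrtr// ltW.
have n3 : n%:R * (4 * M * a ^+ 3) = 4 * M * s ^+ 3 / Num.sqrt n%:R.
  rewrite /a expr_div_n -[X in X * (4 * _ * _)](@sqr_sqrtr _ (n%:R : R))// ?ltW//.
  by field; rewrite gt_eqF.
rewrite sfE -n3.
have ci : continuous (@id R) by move=> y; exact: cvg_id.
rewrite (_ : _ + _ = n%:R * (M * (`|mean1 mu| + `|var1 mu - a ^+ 2| + abs3 mu) + 4 * M * a ^+ 3)); last first.
  rewrite [RHS]mulrDr; congr (_ + _).
  rewrite (_ : n%:R * var1 mu - s ^+ 2 = n%:R * (var1 mu - a ^+ 2)); last first.
    by rewrite a2; field; rewrite gt_eqF.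
  by rewrite normrM (ger0_norm (ltW n0R)); ring.
apply: trotter => // j _ y.
have [g1 [g2 sg]] : exists g1 g2, smooth1 M (iter j (gavg a id) f) g1 g2.
  elim: j => [|j [g1 [g2 sg]]]; first by exists f1, f2.
  by eexists; eexists; rewrite iterS; exact: (gavg_smooth1 a ci sg).
have := step_taylor1 y hmu sg; have := gauss_taylor y a0 sg.
have e1 : `|mean1 mu * g1 y| <= M * `|mean1 mu|.
  by rewrite normrM mulrC ler_wpM2r// (smooth1_bd1 sg).
have e2 : `|(var1 mu - a ^+ 2) * g2 y| <= M * `|var1 mu - a ^+ 2|.
  by rewrite normrM mulrC ler_wpM2r// (smooth1_bd2 sg).
move: e1 e2 (normr_ge0 (var1 mu - a ^+ 2)) => e1 e2 /(mulr_ge0 M0).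
move: e1 e2; rewrite mulrBl !mulrDr (mulrAC (a ^+ 2)) (mulrAC (var1 mu)).
move: (gavg a id _ y) (step _ _ y) (iter j _ f y) => u v w.
move: (mean1 mu * _) (var1 mu * _) (a ^+ 2 * _) (M * `|_|) (M * `|_|) (M * abs3 _) => p q t A B D.
rewrite !ler_norml => /andP[? ?] /andP[? ?] ? /andP[? ?] /andP[? ?]; apply/andP; split; lra.
Qed.

End univariate_clt.

(** * Smooth functions of the squared norm *)

Section radial_functions.
Context {R : realType} {m : nat}.
Local Notation W := 'rV[R]_m.
Implicit Types (x h : W).

Definition norm2 x : R := \sum_i x 0 i ^+ 2.

Lemma norm1_coord x i : `|x 0 i| <= norm1 x.
Proof. by rewrite /norm1 (bigD1 i)//= lerDl sumr_ge0. Qed.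

(** Three cases for the remainder: for [norm1 h] above 1 the sup bounds suffice; if a coordinate of
    x is large, it stays large after a small increment and every term vanishes; otherwise x is
    bounded and the one-dimensional expansion of f applies to the increment 2 p + q of the squared
    norm. *)
Lemma smooth_radial (M B : R) f : smooth1_left B M f ->
  exists M' F1 F2, 0 <= M' /\ smooth M' (fun x : W => f (norm2 x)) F1 F2.
Proof.
move=> [f1 [f2 [sf fV]]]; have [_ _ _ b0 b1 b2 T] := sf.
have M0 : 0 <= M by rewrite (le_trans _ (b0 0)).
pose b := 1 + `|B|; pose c := b + 1; pose C := 2 * M * (2 * c + 1) ^+ 3.
have c2 : 2 <= c by rewrite /c /b; have := normr_ge0 B; lra.
have C0 : 0 <= C by rewrite /C; apply: mulr_ge0; [exact: mulr_ge0|apply: exprn_ge0; lra].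
have MC (p : R) : p <= 2 * (2 * c + 1) ^+ 3 -> M * p <= C.
  by move=> pc; rewrite /C (mulrC 2) -mulrA ler_wpM2l.
pose F1 i x := 2 * x 0 i * f1 (norm2 x).
pose F2 i j x := 4 * (x 0 i * x 0 j) * f2 (norm2 x) + 2 * (i == j)%:R * f1 (norm2 x).
exists (4 * C), F1, F2; split; first by rewrite mulr_ge0.
have V x i : b <= `|x 0 i| -> [/\ f (norm2 x) = 0, f1 (norm2 x) = 0 & f2 (norm2 x) = 0].
  move=> xb; apply: fV; apply: (@le_trans _ _ (x 0 i ^+ 2)).
    have : b ^+ 2 <= x 0 i ^+ 2 by rewrite -(real_normK (num_real (x 0 i))) lerXn2r ?nnegrE//; rewrite /b addr_ge0.
    have : B <= `|B| by exact: ler_norm.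
    rewrite /b; have := normr_ge0 B; nra.
  by rewrite /norm2 (bigD1 i)//= lerDl sumr_ge0// => k _; exact: sqr_ge0.
have dich x : (forall i, `|x 0 i| <= c) \/ (exists i, c < `|x 0 i|).
  have [/existsP[i ?]|/existsPn H] := boolP [exists i, c < `|x 0 i|]; first by right; exists i.
  by left=> i; rewrite leNgt.
have B1 i x : `|F1 i x| <= C.
  have [xc|[k xk]] := dich x; last first.
    by have [|_ Ef1 _] := V x k; [rewrite (le_trans _ (ltW xk))// /c lerDl|rewrite /F1 Ef1 mulr0 normr0].
  apply: (@le_trans _ _ (2 * c * M)); first exact: (@normr_mul_le _ 2).
  by rewrite mulrC; apply: MC; nra.
have B2 i j x : `|F2 i j x| <= C.
  have [xc|[k xk]] := dich x; last first.
    have [|_ Ef1 Ef2] := V x k; first by rewrite (le_trans _ (ltW xk))// /c lerDl.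
    by rewrite /F2 Ef1 Ef2 !mulr0 addr0 normr0.
  apply: (@le_trans _ _ (M * (4 * (c * c) + 2 * 1))); last by apply: MC; nra.
  rewrite (le_trans (ler_normD _ _))// mulrDr lerD// [leRHS]mulrC.
    by apply: (@normr_mul_le _ 4) => //; rewrite normrM ler_pM.
  by apply: (@normr_mul_le _ 2) => //; case: eqP => _; rewrite ?normr1 ?normr0.
have B0 x : `|f (norm2 x)| <= C.
  by rewrite (le_trans (b0 _))// -[leLHS]mulr1 MC//; nra.
split.
- by move=> i x; rewrite (le_trans (B1 i x))//; lra.
- by move=> i j x; rewrite (le_trans (B2 i j x))//; lra.
move=> x h; set n := norm1 h.
have n0 : 0 <= n by exact: norm1_ge0.
have n30 : 0 <= n ^+ 3 by exact: exprn_ge0.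
have [n1|n1] := leP n 1; last first.
  have e1 : `|\sum_i h 0 i * F1 i x| <= C * n.
    rewrite (le_trans (ler_norm_sum _ _ _))// /n /norm1 mulr_sumr ler_sum// => i _.
    by rewrite normrM mulrC ler_wpM2r.
  have e2 : `|\sum_i \sum_j h 0 i * h 0 j * F2 i j x| <= C * n ^+ 2.
    rewrite (le_trans (ler_norm_sum _ _ _))// expr2 /n {1}/norm1 mulr_suml mulr_sumr ler_sum// => i _.
    rewrite (le_trans (ler_norm_sum _ _ _))// /norm1 mulr_sumr mulr_sumr ler_sum// => j _.
    by rewrite !normrM mulrC ler_wpM2r// mulr_ge0.
  have h12 : n <= n ^+ 3 by rewrite -[leLHS]expr1 ler_weXn2l// ltW.
  have h23 : n ^+ 2 <= n ^+ 3 by rewrite ler_weXn2l// ltW.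
  have h03 : 1 <= n ^+ 3 by rewrite exprn_ege1// ltW.
  have c1 : C * n <= C * n ^+ 3 by rewrite ler_wpM2l.
  have c2' : C * n ^+ 2 <= C * n ^+ 3 by rewrite ler_wpM2l.
  have c3 : C <= C * n ^+ 3 by rewrite ler_peMr.
  have := B0 x; have := B0 (x + h); move: e1 e2.
  move: (f _) (f _) (\sum_i _) (\sum_i \sum_j _) => u v w t.
  rewrite !ler_norml => /andP[? ?] /andP[? ?] /andP[? ?] /andP[? ?].
  apply/andP; split; lra.
apply: (@le_trans _ _ (C * n ^+ 3)); last by rewrite ler_wpM2r// ler_peMl// ler1n.
have [xc|[k xk]] := dich x; last first.
  have bk : b <= `|x 0 k| by rewrite (le_trans _ (ltW xk))// /c lerDl.
  have [-> Ef1 Ef2] := V x k bk.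
  have [|-> _ _] := V (x + h) k.
    rewrite mxE; have := lerB_normD (x 0 k) (h 0 k); have := norm1_coord h k.
    rewrite -/n /c in xk *; lra.
  rewrite big1 ?big1; last 2 first.
  - by move=> i _; rewrite big1// => j _; rewrite /F2 Ef1 Ef2 !mulr0 addr0 mulr0.
  - by move=> i _; rewrite /F1 Ef1 !mulr0.
  by rewrite mulr0 !subr0 normr0 mulr_ge0.
pose p := \sum_i x 0 i * h 0 i; pose q := \sum_i h 0 i ^+ 2.
have pn : `|p| <= c * n.
  rewrite (le_trans (ler_norm_sum _ _ _))// /n /norm1 mulr_sumr ler_sum// => i _.
  by rewrite normrM ler_wpM2r.
have q0 : 0 <= q by rewrite sumr_ge0// => i _; exact: sqr_ge0.
have qn : q <= n ^+ 2.
  rewrite expr2 {1}/n /norm1 mulr_suml ler_sum// => i _.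
  rewrite -(real_normK (num_real (h 0 i))) expr2 ler_wpM2l//; exact: norm1_coord.
have nE : norm2 (x + h) = norm2 x + (2 * p + q).
  rewrite /norm2 /p /q mulr_sumr -!big_split /=; apply: eq_bigr => i _; rewrite mxE; ring.
have E1 : \sum_i h 0 i * F1 i x = 2 * p * f1 (norm2 x).
  by rewrite /p mulr_sumr mulr_suml; apply: eq_bigr => i _; rewrite /F1; ring.
have E2 : \sum_i \sum_j h 0 i * h 0 j * F2 i j x = 4 * p ^+ 2 * f2 (norm2 x) + 2 * q * f1 (norm2 x).
  rewrite expr2 {1}/p /q mulr_suml !mulr_sumr !mulr_suml -big_split /=; apply: eq_bigr => i _.
  rewrite /p.
  transitivity (\sum_j (4 * (x 0 i * h 0 i) * f2 (norm2 x) * (x 0 j * h 0 j) +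
      (i == j)%:R * (2 * (h 0 i * h 0 j) * f1 (norm2 x)))).
    by apply: eq_bigr => j _; rewrite /F2; ring.
  rewrite big_split /=; congr (_ + _); first by rewrite -mulr_sumr; ring.
  rewrite (bigD1 i)//= eqxx mul1r big1 ?addr0; first by ring.
  by move=> j ji; rewrite eq_sym (negbTE ji) mul0r.
rewrite nE E1 E2; have := T (norm2 x) (2 * p + q).
set y := norm2 x; set k := 2 * p + q => Tk.
have kn : `|k| <= (2 * c + 1) * n.
  rewrite (le_trans (ler_normD _ _))// normrM normr_nat (ger0_norm q0).
  have : q <= n by rewrite (le_trans qn)// expr2 ler_piMr.
  lra.
rewrite (_ : _ - _ = (f (y + k) - f y - k * f1 y - k ^+ 2 / 2 * f2 y) +
     (2 * p + q / 2) * q * f2 y); last by rewrite /k; field.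
apply: (@le_trans _ _ (M * ((2 * c + 1) ^+ 3 + (2 * c + 2^-1)) * n ^+ 3)); last first.
  rewrite ler_wpM2r ?exprn_ge0// MC//.
  have : 1 <= (2 * c + 1) ^+ 2 by rewrite exprn_ege1//; lra.
  rewrite (exprS _ 2) => ?; nra.
rewrite (le_trans (ler_normD _ _))// mulrDr mulrDl lerD//.
  rewrite (le_trans Tk)// -mulrA ler_wpM2l// -exprMn lerXn2r ?nnegrE//.
  by rewrite mulr_ge0//; lra.
rewrite (_ : M * _ * _ = ((2 * c + 2^-1) * n) * n ^+ 2 * M); last by ring.
rewrite normrM; apply: ler_pM => //; rewrite normrM; apply: ler_pM => //.
  rewrite (le_trans (ler_normD _ _))// normrM normr_nat (@ger0_norm _ (q / 2)) ?divr_ge0//.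
  have : q <= n by rewrite (le_trans qn)// expr2 ler_piMr.
  lra.
by rewrite ger0_norm.
Qed.

End radial_functions.

Lemma cvg_inv_sqrt (R : realType) : (Num.sqrt n%:R)^-1 @[n --> \oo] --> (0 : R).
Proof.
apply/cvgrPdist_le => e e0; near=> n.
have en : e ^- 2 <= n%:R by near: n; exact: nbhs_infty_ger.
have n0 : 0 < n%:R :> R by rewrite (lt_le_trans _ en)// invr_gt0 exprn_gt0.
rewrite sub0r normrN ger0_norm ?invr_ge0 ?sqrtr_ge0//.
rewrite -[leRHS]invrK lef_pV2 ?posrE ?invr_gt0 ?sqrtr_gt0//.
by have := ler_wsqrtr en; rewrite -exprVn sqrtr_sqr ger0_norm// invr_ge0 ltW.
Unshelve. all: end_near. Qed.

Lemma cvg_bigsum (R : realType) (I : Type) (r : seq I) (u : I -> nat -> R) (l : I -> R) :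
  (forall i, u i n @[n --> \oo] --> l i) ->
  \sum_(i <- r) u i n @[n --> \oo] --> \sum_(i <- r) l i.
Proof.
move=> ul; elim: r => [|i r IH].
  by rewrite big_nil; under eq_fun do rewrite big_nil; exact: cvg_cst.
by rewrite big_cons; under eq_fun do rewrite big_cons; exact: cvgD.
Qed.

(** * Central limit theorem for the squared norm *)

Section multivariate_clt.
Context {R : realType} {m : nat}.
Local Notation W := 'rV[R]_m.
Implicit Types (x : W) (mu : seq (R * W)) (s : seq 'I_m) (a : R).

Definition basis_vec (l : 'I_m) : W := delta_mx 0 l.

(* Independent signs of size a on the coordinates in s. *)
Definition radem_vec a s : seq (R * W) :=
  foldr (fun l mu => conv (radem (a *: basis_vec l)) mu) [:: (1, 0)] s.

Lemma radem_vec_law a s : is_law (radem_vec a s).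
Proof.
elim: s => [|l s IH] /=; last by apply: conv_law => //; exact: radem_law.
by split; [move=> c; rewrite inE => /eqP ->|rewrite big_seq1].
Qed.

Lemma step_radem_vec a s F : step (radem_vec a s) F =
  foldr (fun l => step (radem (a *: basis_vec l))) F s.
Proof.
elim: s => [|l s IH] /=; last by rewrite step_conv /= IH.
by apply/funext => x; rewrite /step big_seq1 /= mul1r addr0.
Qed.

Lemma sum_radem_vec_cons a l s (F : W -> R) :
  \sum_(c <- radem_vec a (l :: s)) c.1 * F c.2 =
  2^-1 * (\sum_(c <- radem_vec a s) c.1 * F (a *: basis_vec l + c.2)) +
  2^-1 * (\sum_(c <- radem_vec a s) c.1 * F (- (a *: basis_vec l) + c.2)).
Proof. by rewrite /= sum_conv /radem !big_cons big_nil /= addr0. Qed.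

Lemma mean_radem_vec a s i : mean (radem_vec a s) i = 0.
Proof.
elim: s => [|l s IH]; first by rewrite /mean big_seq1 /= mxE mulr0.
rewrite /mean (sum_radem_vec_cons _ _ _ (fun v => v 0 i)).
have [_ m1] := radem_vec_law a s.
have E (b : W) : \sum_(c <- radem_vec a s) c.1 * (b + c.2) 0 i = b 0 i.
  under eq_bigr do rewrite mxE mulrDr.
  by rewrite big_split /= -mulr_suml m1 mul1r -[X in _ + X]/(mean (radem_vec a s) i) IH addr0.
by rewrite (E (a *: basis_vec l)) (E (- (a *: basis_vec l))) !mxE; ring.
Qed.

Lemma moment2_radem_vec a s i j : uniq s ->
  moment2 (radem_vec a s) i j = a ^+ 2 * ((i == j) && (i \in s))%:R.
Proof.
elim: s => [|l s IH]; first by rewrite /moment2 big_seq1 /= mxE in_nil andbF !mulr0 mul1r mul0r.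
move=> /= /andP[ls us]; rewrite /moment2 (sum_radem_vec_cons _ _ _ (fun v => v 0 i * v 0 j)).
have [_ m1] := radem_vec_law a s.
have E (b : W) : \sum_(c <- radem_vec a s) c.1 * ((b + c.2) 0 i * (b + c.2) 0 j) =
    b 0 i * b 0 j + moment2 (radem_vec a s) i j.
  transitivity (\sum_(c <- radem_vec a s) (c.1 * (b 0 i * b 0 j) +
      b 0 i * (c.1 * c.2 0 j) + b 0 j * (c.1 * c.2 0 i) + c.1 * (c.2 0 i * c.2 0 j))).
    by apply: eq_bigr => c _; rewrite !mxE; ring.
  rewrite !big_split /= -mulr_suml m1 -!mulr_sumr.
  have -> : \sum_(c <- radem_vec a s) c.1 * c.2 0 j = 0 by exact: mean_radem_vec.
  have -> : \sum_(c <- radem_vec a s) c.1 * c.2 0 i = 0 by exact: mean_radem_vec.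
  by rewrite !mulr0 !addr0 mul1r.
rewrite (E (a *: basis_vec l)) (E (- (a *: basis_vec l))) (IH us) !mxE /= in_cons.
have [<-|ij] := eqVneq i j; last first.
  have : (i == l)%:R * (j == l)%:R = 0 :> R.
    have [il|_] := eqVneq i l; last by rewrite mul0r.
    by rewrite mul1r -il eq_sym (negbTE ij).
  move: ((i == l)%:R) ((j == l)%:R) => u v uv.
  by rewrite !mulr0 !addr0 mulrNN (mulrACA a u a v) uv !mulr0 addr0.
have [il|il] /= := eqVneq i l; last by rewrite mulr0n !mulr0 oppr0 !add0r; field.
by rewrite il (negbTE ls) /= mulr0n mulr1n; field.
Qed.

Lemma norm1D x y : norm1 (x + y) <= norm1 x + norm1 y.
Proof. by rewrite /norm1 -big_split ler_sum// => i _; rewrite mxE ler_normD. Qed.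

Lemma norm1_basis a l : norm1 (a *: basis_vec l) = `|a|.
Proof.
rewrite /norm1 (bigD1 l)//= big1 ?addr0; first by rewrite !mxE !eqxx mulr1.
by move=> i il; rewrite !mxE (negbTE il) andbF mulr0 normr0.
Qed.

Lemma norm1N x : norm1 (- x) = norm1 x.
Proof. by apply: eq_bigr => i _; rewrite mxE normrN. Qed.

Lemma radem_vec_support a s c : 0 <= a -> c \in radem_vec a s -> norm1 c.2 <= (size s)%:R * a.
Proof.
move=> a0; elim: s c => [|l s IH] c /=.
  by rewrite inE => /eqP -> /=; rewrite mul0r /norm1 big1// => i _; rewrite mxE normr0.
rewrite /conv => /allpairsPdep[u [v [ul vs ->]]] /=.
rewrite (le_trans (norm1D _ _))// mulrS mulrDl mul1r lerD//; last exact: IH.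
move: ul; rewrite !inE => /orP[] /eqP -> /=; rewrite ?norm1N norm1_basis ger0_norm//.
Qed.

Lemma moment3_radem_vec a s : 0 <= a -> moment3 (radem_vec a s) <= ((size s)%:R * a) ^+ 3.
Proof.
move=> a0; have [m0 m1] := radem_vec_law a s.
apply: (@le_trans _ _ (\sum_(c <- radem_vec a s) c.1 * ((size s)%:R * a) ^+ 3)); last first.
  by rewrite -mulr_suml m1 mul1r.
rewrite /moment3 big_seq [leRHS]big_seq ler_sum// => c cs.
rewrite ler_wpM2l ?m0// lerXn2r ?nnegrE ?norm1_ge0// ?mulr_ge0//.
exact: radem_vec_support.
Qed.

(* Started at a point whose coordinates in s vanish, the signed walk on these
   coordinates only moves the squared norm. *)
Lemma iter_radem_vec_radial n s (f : R -> R) x : uniq s -> (forall l, l \in s -> x 0 l = 0) ->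
  foldr (fun l => iter n (step (radem ((Num.sqrt n%:R)^-1 *: basis_vec l))))
     (fun y => f (norm2 y)) s x = iter (size s) (radem_sq_op n) f (norm2 x).
Proof.
elim: s x => [//|l s IH] x /= /andP[ls us] xs.
set G := foldr _ _ s; set a := (Num.sqrt _)^-1.
have line (y : W) : iter n (step (radem (a *: basis_vec l))) G y =
    iter n (step (radem a)) (fun t => G (y + t *: basis_vec l)) 0.
  have gen k t : iter k (step (radem (a *: basis_vec l))) G (y + t *: basis_vec l) =
    iter k (step (radem a)) (fun t => G (y + t *: basis_vec l)) t.
    elim: k t => [//|k IHk] t; rewrite !iterS !step_radem -!IHk.
    by rewrite scalerDl addrA scalerBl addrA.
  by rewrite -gen scale0r addr0.
rewrite line /radem_sq_op; congr (iter n _ _ 0); apply/funext => t.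
rewrite /G IH//; last first.
  move=> k ks; rewrite !mxE (xs k) ?in_cons ?ks ?orbT//.
  have [kl|_] := eqVneq k l; first by rewrite -kl ks in ls.
  by rewrite andbF mulr0 addr0.
congr (iter _ _ _ _).
rewrite /norm2 (bigD1 l)//= [in RHS](bigD1 l)//= !mxE !eqxx mulr1.
rewrite (xs l) ?mem_head// add0r expr0n/= add0r addrC; congr (_ + _).
by apply: eq_bigr => k kl; rewrite !mxE (negbTE kl) andbF mulr0 addr0.
Qed.

(** Steps along different coordinates commute, so the power of their composition is the composition
    of their powers: n joint steps become one walk of n steps per coordinate. *)
Lemma iter_step_radem_vec a n s F : iter n (step (radem_vec a s)) F =
  foldr (fun l => iter n (step (radem (a *: basis_vec l)))) F s.
Proof.
have -> : step (radem_vec a s) =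
   fun G => foldr (fun l => step (radem (a *: basis_vec l))) G s.
  by apply/funext => G; exact: step_radem_vec.
elim: s F => [|l s IH] F /=; first by elim: n => // n IHn; rewrite iterS IHn.
rewrite -IH; apply: (iter_commute (S := step (radem (a *: basis_vec l)))
  (T := fun G => foldr (fun l => step (radem (a *: basis_vec l))) G s)).
move=> G; elim: s {IH} => //= k s IHs; by rewrite stepC IHs.
Qed.

(** Signs of size 1 / sqrt n have mean zero and covariance I / n, the limiting moments of [mu n], so
    Lindeberg replaces [mu n] by sign vectors. From the origin the sign walk is then evaluated
    exactly, as m applications of [radem_sq_op n]. *)
Lemma multivariate_clt (mu : nat -> seq (R * W)) (f : R -> R) (B M : R) :
  (forall n, is_law (mu n)) ->
  (forall i, n%:R * mean (mu n) i @[n --> \oo] --> (0 : R)) ->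
  (forall i j, n%:R * moment2 (mu n) i j @[n --> \oo] --> ((i == j)%:R : R)) ->
  n%:R * moment3 (mu n) @[n --> \oo] --> (0 : R) ->
  smooth1_left B M f ->
  iter n (step (mu n)) (fun x => f (norm2 x)) 0 @[n --> \oo] --> iter m sq_op f 0.
Proof.
move=> hmu h1 h2 h3 sf.
have [M' [F1 [F2 [M'0 sF]]]] := @smooth_radial _ m _ _ _ sf.
have [C HC] := iter_radem_sq_op_cvg m sf.
(* A sign vector has [norm1] at most m / sqrt n; n times the cube of this is the term m^3 / sqrt n.
   The last term is the error from the squares of sign sums to those of Gaussians. *)
pose g n : R := M' * (\sum_i `|n%:R * mean (mu n) i| +
   \sum_i \sum_j `|n%:R * moment2 (mu n) i j - (i == j)%:R| +
   n%:R * moment3 (mu n) + m%:R ^+ 3 * (Num.sqrt n%:R)^-1) + C * (Num.sqrt n%:R)^-1.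
have csqrt := @cvg_inv_sqrt R.
have g0 : g n @[n --> \oo] --> (0 : R).
  have cn (u : nat -> R) : u n @[n --> \oo] --> (0 : R) -> `|u n| @[n --> \oo] --> (0 : R).
    by move=> /cvg_norm; rewrite normr0.
  have e1 : \sum_i `|n%:R * mean (mu n) i| @[n --> \oo] --> (0 : R).
    have := @cvg_bigsum R 'I_m (index_enum _) (fun i n => `|n%:R * mean (mu n) i|)
      (fun=> 0) (fun i => cn _ (h1 i)).
    by rewrite big1.
  have e2 : \sum_i \sum_j `|n%:R * moment2 (mu n) i j - (i == j)%:R| @[n --> \oo] --> (0 : R).
    have h2' i j : `|n%:R * moment2 (mu n) i j - (i == j)%:R| @[n --> \oo] --> (0 : R).
      by apply: cn; rewrite -(subrr ((i == j)%:R : R)); apply: cvgB; [exact: h2|exact: cvg_cst].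
    have := @cvg_bigsum R 'I_m (index_enum _) (fun i n => \sum_j `|n%:R * moment2 (mu n) i j - (i == j)%:R|)
      (fun=> \sum_(j < m) 0) (fun i => @cvg_bigsum R 'I_m (index_enum _)
      (fun j n => `|n%:R * moment2 (mu n) i j - (i == j)%:R|) (fun=> 0) (h2' i)).
    by rewrite big1// => i _; rewrite big1.
  rewrite (_ : 0 = M' * (0 + 0 + 0 + m%:R ^+ 3 * 0) + C * 0); last by rewrite !mulr0 !addr0 mulr0.
  apply: cvgD; last exact: cvgMr.
  apply: cvgMr; apply: cvgD; last exact: cvgMr.
  by apply: cvgD => //; exact: cvgD.
apply/cvgrPdist_le => e e0; near=> n.
have n0 : (0 < n)%N by near: n; exact: nbhs_infty_gt.
apply: (@le_trans _ _ (g n)); last first.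
  rewrite (le_trans (ler_norm _))//; near: n.
  exact: (cvgr0_norm_le (FF := eventually_filter) _ g0).
have sn0 : 0 < Num.sqrt (n%:R : R) by rewrite sqrtr_gt0 ltr0n.
have n0R : 0 < n%:R :> R by rewrite ltr0n.
pose a : R := (Num.sqrt n%:R)^-1.
have a0 : 0 < a by rewrite invr_gt0.
have a2 : n%:R * a ^+ 2 = 1 by rewrite /a exprVn sqr_sqrtr ?ltW// divff// gt_eqF.
have a3 : n%:R * a ^+ 3 = a by rewrite exprS mulrCA a2 mulr1.
have ue : uniq (enum 'I_m) by exact: enum_uniq.
have L := lindeberg n 0 (hmu n) (radem_vec_law a (enum 'I_m)) sF.
have ER : iter n (step (radem_vec a (enum 'I_m))) (fun x => f (norm2 x)) 0 =
    iter m (radem_sq_op n) f 0.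
  rewrite iter_step_radem_vec iter_radem_vec_radial//; last by move=> l _; rewrite mxE.
  by rewrite size_enum_ord /norm2 big1// => i _; rewrite mxE expr0n.
rewrite ER in L; have := HC n 0 n0 (lexx 0).
rewrite distrC => HC'.
rewrite distrC (le_trans (ler_distD (iter m (radem_sq_op n) f 0) _ _))// /g lerD//; last first.
  by rewrite distrC.
rewrite (le_trans L)// mulrCA ler_wpM2l//.
rewrite !mulrDr; apply: lerD; first apply: lerD; first apply: lerD => //.
- rewrite mulr_sumr ler_sum// => i _; rewrite mean_radem_vec subr0.
  by rewrite normrM ger0_norm.
- rewrite mulr_sumr ler_sum// => i _; rewrite mulr_sumr ler_sum// => j _.
  rewrite moment2_radem_vec// mem_enum andbT.
  rewrite -[X in X * `|_|](ger0_norm (ltW n0R)) -normrM mulrBr.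
  by rewrite mulrA a2 mul1r.
- exact: lexx.
- apply: (@le_trans _ _ (n%:R * (m%:R * a) ^+ 3)); last by rewrite exprMn mulrCA a3.
  rewrite ler_wpM2l ?(ltW n0R)//.
  by have := moment3_radem_vec (enum 'I_m) (ltW a0); rewrite size_enum_ord.
Unshelve. all: end_near. Qed.

End multivariate_clt.

(** * Exponent measures *)

Section borel_sets.
Context {R : realType} {d : nat}.
Implicit Types (A B C : set 'rV[R]_d) (x : 'rV[R]_d) (s t : R).

Lemma borel_open A : open A -> borel A.
Proof. by move=> oA; exact: sub_sigma_algebra. Qed.

Lemma borelC A : borel A -> borel (~` A).
Proof. exact: (@measurableC _ (borel_rV R d)). Qed.

Lemma borel_closed A : closed A -> borel A.
Proof. move=> cA; have oA : open (~` A) by rewrite openC.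
by rewrite -(setCK A); exact: borelC (borel_open oA). Qed.

Lemma borelU A B : borel A -> borel B -> borel (A `|` B).
Proof. exact: (@measurableU _ (borel_rV R d)). Qed.

Lemma borelI A B : borel A -> borel B -> borel (A `&` B).
Proof. exact: (@measurableI _ (borel_rV R d)). Qed.

Lemma borelD A B : borel A -> borel B -> borel (A `\` B).
Proof. exact: (@measurableD _ (borel_rV R d)). Qed.

Lemma borel_bigcup (F : nat -> set 'rV[R]_d) :
  (forall i, borel (F i)) -> borel (\bigcup_i F i).
Proof. by move=> h; apply: (@bigcupT_measurable _ (borel_rV R d)). Qed.

Lemma borel_preimage (f : 'rV[R]_d -> 'rV[R]_d) B :
  continuous f -> borel B -> borel (f @^-1` B).
Proof.
move=> cf bB.
have mf : measurable_fun [set: borel_rV R d] (f : borel_rV R d -> borel_rV R d).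
  apply: (@measurability _ _ (borel_rV R d) (borel_rV R d) setT
    (f : borel_rV R d -> borel_rV R d) (@open 'rV[R]_d)) => // _ [U oU <-].
  rewrite setTI; apply: borel_open; apply: open_comp => // x _; exact: cf.
by rewrite -[X in borel X]setTI; exact: mf.
Qed.

Lemma dilationE t B : t != 0 -> dilation t B = ( *:%R t^-1) @^-1` B.
Proof.
move=> t0; apply/seteqP; split=> [x [y By <-]|x Bx] /=.
  by rewrite scalerA mulVf// scale1r.
by exists (t^-1 *: x) => //; rewrite scalerA divff// scale1r.
Qed.

Lemma borel_dilation t B : 0 < t -> borel B -> borel (dilation t B).
Proof.
move=> t0 bB; rewrite dilationE ?gt_eqF//; apply: borel_preimage => //.
exact: scaler_continuous.
Qed.

Lemma dilationM s t B : dilation s (dilation t B) = dilation (s * t) B.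
Proof.
apply/seteqP; split=> [_ [_ [x Bx <-] <-]|_ [x Bx <-]].
  by exists x => //; rewrite scalerA.
by exists (t *: x); [exists x|rewrite scalerA].
Qed.

Lemma dilation1 B : dilation 1 B = B.
Proof. by rewrite dilationE ?oner_eq0//; apply/seteqP; split=> x /=; rewrite invr1 scale1r. Qed.

Lemma dilationS t A B : A `<=` B -> dilation t A `<=` dilation t B.
Proof. by move=> AB _ [x /AB Bx <-]; exists x. Qed.

Lemma orthantZ t x : 0 <= t -> orthant x -> orthant (t *: x).
Proof. by move=> t0 ox j; rewrite mxE mulr_ge0. Qed.

Lemma dilation_orthant t B : 0 <= t -> B `<=` @orthant R d -> dilation t B `<=` orthant.
Proof. by move=> t0 Bo _ [x /Bo ox <-] j; rewrite mxE mulr_ge0. Qed.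

Lemma closed_orthant : closed (@orthant R d).
Proof.
have -> : @orthant R d = \bigcap_j ((fun x : 'rV[R]_d => x ord0 j) @^-1` [set y | 0 <= y]).
  by apply/seteqP; split=> [x h j _|x h j]; [exact: h|exact: (h j)].
apply: closed_bigI => j _; apply: preimage_closed; last exact: closed_ge.
by move=> x _; exact: coord_continuous.
Qed.

Definition cone_above (e : R) : set 'rV[R]_d := orthant `&` [set x | e <= `|x|].

Definition sphere (c : R) : set 'rV[R]_d := orthant `&` [set x | `|x| = c].

Lemma closed_cone_above e : closed (cone_above e).
Proof.
apply: closedI; first exact: closed_orthant.
apply: (@preimage_closed _ _ (fun x : 'rV[R]_d => `|x|) [set y | e <= y]); last exact: closed_ge.
by move=> x _; exact: norm_continuous.
Qed.

Lemma closed_sphere c : closed (sphere c).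
Proof.
apply: closedI; first exact: closed_orthant.
apply: (@preimage_closed _ _ (fun x : 'rV[R]_d => `|x|) [set c]); last exact: closed_eq.
by move=> x _; exact: norm_continuous.
Qed.

Lemma open_norm_gt c : open [set x : 'rV[R]_d | c < `|x|].
Proof.
apply: (@open_comp _ _ (fun x : 'rV[R]_d => `|x|) [set y | c < y]); last exact: open_gt.
by move=> x _; exact: norm_continuous.
Qed.

Lemma borel_outside_unit : borel (@outside_unit R d).
Proof. by apply: borelI; [apply: borel_closed; exact: closed_orthant|apply: borel_open; exact: open_norm_gt]. Qed.

Lemma borel_orthant : borel (@orthant R d).
Proof. by apply: borel_closed; exact: closed_orthant. Qed.

Lemma borel_cone_above e : borel (cone_above e).
Proof. by apply: borel_closed; exact: closed_cone_above. Qed.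

Lemma boundary_closed B : closed (boundary B).
Proof. by apply: closedI; exact: closed_closure. Qed.

Lemma boundaryU A B : boundary (A `|` B) `<=` boundary A `|` boundary B.
Proof.
move=> x []; rewrite closureU => -[Ax|Bx] h; [left|right]; split=> //.
  by apply: closure_subset h => y [oy ny]; split=> // Ay; apply: ny; left.
by apply: closure_subset h => y [oy ny]; split=> // Ay; apply: ny; right.
Qed.

Lemma boundaryD A B : A `<=` orthant -> boundary (A `\` B) `<=` boundary A `|` boundary B.
Proof.
move=> Ao x [Ax].
have -> : orthant `\` (A `\` B) = (orthant `\` A) `|` (orthant `&` B).
  apply/seteqP; split=> [y [oy ny]|y [[oy ny]|[oy By]]].
  - have [Ay|nA] := pselect (A y); last by left.
    by right; split=> //; apply: contrapT => nB; apply: ny.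
  - by split=> // -[].
  - by split=> // -[].
rewrite closureU => -[h|h]; [left|right]; split=> //.
- by apply: closure_subset Ax => y [].
- by apply: closure_subset h => y [].
- by apply: closure_subset Ax => y [/Ao oy nB].
Qed.

End borel_sets.

(** * Homogeneity, finiteness and null spheres *)

Section exponent_measure.
Context {R : realType} {d : nat} {dT : measure_display} {T : measurableType dT}.
Variables (P : probability T R) (X : {RV P >-> borel_rV R d}).
Variable nu : {measure set (borel_rV R d) -> \bar R}.
Hypothesis rv : regularly_varying X nu.

(** [rv_extension] only relates a set to an enlarged copy inside [outside_unit]. B and its dilate
    have such a copy in common, reached with the factors t and t s, and the two relations are
    divided. *)
Lemma nu_dilation s (B : set 'rV[R]_d) : 0 < s -> borel B -> B `<=` orthant ->
  bounded_away B -> nu (dilation s B) = ((s^-1)%:E * nu B)%E.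
Proof.
move=> s0 bB Bo [e e0 Be].
(* The bounds 1 and 1 / s make both factors t and t s admissible; e / 2 sends B strictly outside the
   unit ball. *)
pose t := Num.min (Num.min 1 s^-1) (e / 2).
have t0 : 0 < t by rewrite !lt_min ltr01 invr_gt0 s0 divr_gt0.
have [t1 ts te] : [/\ t <= 1, t <= s^-1 & t <= e / 2].
  by rewrite /t; split; rewrite !ge_min lexx ?orbT.
have sub : dilation t^-1 B `<=` outside_unit.
  move=> _ [x Bx <-]; split; first by apply: orthantZ; [rewrite invr_ge0 ltW|exact: Bo].
  have /= ex := Be x Bx; rewrite /= normrZ ger0_norm ?invr_ge0 ?(ltW t0)// ltr_pdivlMl// mulr1.
  by apply: le_lt_trans te _; lra.
have ts0 : 0 < t * s by rewrite mulr_gt0.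
have E : dilation (t * s)^-1 (dilation s B) = dilation t^-1 B.
  by rewrite dilationM invfM -mulrA mulVf ?gt_eqF// mulr1.
rewrite (rv_extension rv (t := t * s)) ?E//.
- rewrite (rv_extension rv (B := B) (t := t)) ?t0//.
  by rewrite muleA -EFinM invfM mulrC.
- by exists e.
- exact: borel_dilation.
- by apply: dilation_orthant => //; exact: ltW.
- exists (s * e); first exact: mulr_gt0.
  move=> _ [x /Be /= ex <-] /=; rewrite normrZ gtr0_norm// ler_pM2l//.
- by rewrite ts0/= -ler_pdivlMr// mul1r.
Qed.

Lemma nu_cone_above_lty e : 0 < e -> (nu (cone_above e) < +oo)%E.
Proof.
move=> e0; pose s := 2 / e.
have s0 : 0 < s by rewrite divr_gt0.
have ba : bounded_away (@cone_above R d e) by exists e => // x [].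
have := nu_dilation s0 (borel_cone_above e) (@subIsetl _ _ _) ba.
have : (nu (dilation s (cone_above e)) <= 1)%E.
  rewrite -(rv_prob rv); apply: le_measure; rewrite ?inE.
  - by apply: borel_dilation => //; exact: borel_cone_above.
  - exact: borel_outside_unit.
  - move=> _ [x [ox ex] <-]; split; first by move=> j; rewrite mxE mulr_ge0// ltW.
    rewrite /= normrZ gtr0_norm// /s mulrAC ltr_pdivlMr// mul1r.
    by move: ex => /=; lra.
move=> h E; rewrite E in h.
rewrite ltNge leye_eq; apply/negP => /eqP noo; move: h; rewrite noo.
by rewrite gt0_muley ?lte_fin ?invr_gt0// leye_eq.
Qed.

Lemma nu_fin e B : 0 < e -> borel B -> B `<=` cone_above e -> nu B \is a fin_num.
Proof.
move=> e0 bB Be; rewrite ge0_fin_numE//; apply: le_lt_trans (nu_cone_above_lty e0).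
by apply: le_measure; rewrite ?inE//; exact: borel_cone_above.
Qed.

(** If the unit sphere had mass e > 0, then with [outside_unit] it would form a set of mass 1 + e
    contained in the dilate of [outside_unit] by (1 + e / 2)^-1, whose mass is 1 + e / 2 by
    homogeneity. *)
Lemma nu_sphere1 : nu (sphere 1) = 0%E.
Proof.
have bS : borel (@sphere R d 1) by apply: borel_closed; exact: closed_sphere.
have Sc : @sphere R d 1 `<=` cone_above 1 by move=> x [ox /= x1]; split=> //=; rewrite x1.
have fS := nu_fin ltr01 bS Sc.
apply/eqP; rewrite -(fineK fS) eqe; apply/eqP/le_anti/andP; split; last exact: fine_ge0.
rewrite leNgt; apply/negP => e0; set e := fine _ in e0.
pose s := (1 + e / 2)^-1.
have s0 : 0 < s by rewrite invr_gt0; lra.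
have s1 : s < 1 by rewrite invf_lt1; lra.
have ba : bounded_away (@outside_unit R d) by exists 1 => // x [_ /= /ltW].
have := nu_dilation s0 (@borel_outside_unit R d) (@subIsetl _ _ _) ba.
rewrite (rv_prob rv) mule1 /s invrK => E.
have : (nu (sphere 1 `|` outside_unit) <= nu (dilation s outside_unit))%E.
  apply: le_measure; rewrite ?inE.
  - by apply: borelU => //; exact: borel_outside_unit.
  - by apply: borel_dilation => //; exact: borel_outside_unit.
  - move=> x h; rewrite dilationE ?gt_eqF//=; have ox : orthant x by case: h => -[].
    split; first by apply: orthantZ; [rewrite invr_ge0 ltW|exact: ox].
    have si0 : 0 < s^-1 by rewrite invr_gt0.
    change (1 < `|s^-1 *: x|); rewrite normrZ (gtr0_norm si0).
    rewrite -(@ltr_pM2l _ s)// mulrA divff ?gt_eqF// mulr1 mul1r.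
    apply: (lt_le_trans s1); by case: h => [[_ /= ->]|[_ /= /ltW]].
have -> : nu (sphere 1 `|` outside_unit) = (e + 1)%:E.
  rewrite EFinD fineK// -(rv_prob rv); apply: measureU => //.
    exact: borel_outside_unit.
  by rewrite -subset0 => x [[_ /= x1] [_ /= x2]]; rewrite x1 ltxx in x2.
rewrite /s E lee_fin => h.
by lra.
Qed.

Lemma nu_sphere c : 0 < c -> nu (sphere c) = 0%E.
Proof.
move=> c0; have -> : sphere c = dilation c (@sphere R d 1).
  apply/seteqP; split=> [x [ox xc]|_ [x [ox /= x1] <-]].
    rewrite dilationE ?gt_eqF//; split=> [j|].
      by rewrite mxE mulr_ge0 ?invr_ge0 ?(ltW c0)//; exact: ox.
    by rewrite /= normrZ gtr0_norm ?invr_gt0// xc mulVf ?gt_eqF.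
  split=> [j|]; first by rewrite mxE mulr_ge0// ltW.
  by rewrite /= normrZ gtr0_norm// x1 mulr1.
rewrite nu_dilation ?nu_sphere1 ?mule0//.
- by apply: borel_closed; exact: closed_sphere.
- by move=> x [].
- by exists 1 => // x [_ /= ->].
Qed.

End exponent_measure.

(** * Uniformity of the second-order condition *)

(* A Nikodym boundedness principle, by a gliding hump: on the algebra J of
   continuity sets, a pointwise bound by a n is uniform. Failure of uniformity is
   localized near a level set {g = rho} of the radial function g; humps chosen in
   disjoint shells shrinking to that (null) level set glue to a single element of J
   on which the pointwise bound fails. *)
Section gliding_hump.
Context {R : realType} {V : Type}.
Variables (J : set (set V)) (E : set V) (p : nat -> set V -> R) (v : set V -> R).
Variables (a : nat -> R) (g : V -> R) (T : R).

Definition sublevel (t : R) : set V := [set x | E x /\ g x <= t].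
Definition level (t : R) : set V := [set x | E x /\ g x = t].
(** The level {g = rho} is left out, so that the shells decrease to the empty set as d tends to 0
    and have small mass for each fixed n. *)
Definition shell (rho d : R) : set V :=
  [set x | [/\ E x, rho - d < g x, g x <= rho + d & g x <> rho]].

Hypothesis JU : forall A B, J A -> J B -> J (A `|` B).
Hypothesis JD : forall A B, J A -> J B -> J (A `\` B).
Hypothesis JE : forall A, J A -> A `<=` E.
Hypothesis Jsub : forall t, J (sublevel t).
Hypothesis Jlev : forall t, J (level t).
Hypothesis p0 : forall n A, J A -> 0 <= p n A.
Hypothesis v0 : forall A, J A -> 0 <= v A.
Hypothesis pU : forall n A B, J A -> J B -> A `&` B = set0 -> p n (A `|` B) = p n A + p n B.
Hypothesis vU : forall A B, J A -> J B -> A `&` B = set0 -> v (A `|` B) = v A + v B.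
Hypothesis vlev : forall t, v (level t) = 0.
Hypothesis a0 : forall n, 0 <= a n.
Hypothesis g0T : forall x, E x -> 0 <= g x <= T.
Hypothesis shell_small : forall rho n e, 0 < e ->
  exists2 d, 0 < d & p n (shell rho d) + v (shell rho d) < e.
(** J is not stable under countable unions. This weaker closure property suffices for humps that
    accumulate at a single level. *)
Hypothesis J_glue : forall rho B, B `<=` E ->
  (forall e, 0 < e -> exists d, [/\ 0 < d, d <= e & J (B `\` shell rho d)]) -> J B.
Hypothesis ptwise : forall B, J B -> exists c N, 0 <= c /\
  forall n, (N <= n)%N -> `|p n B - v B| <= c * a n.

Local Notation mu n B := (p n B - v B).

Lemma hump_splitI (A B : set V) : (A `\` B) `|` (A `&` B) = A.
Proof. by rewrite setUC; exact: setUIDK. Qed.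

Let JI A B : J A -> J B -> J (A `&` B).
Proof. by move=> JA JB; rewrite -setDD; apply: JD => //; exact: JD. Qed.

Let Jshell rho d : J (shell rho d).
Proof.
have -> : shell rho d = (sublevel (rho + d) `\` sublevel (rho - d)) `\` level rho.
  apply/seteqP; split=> [x [Ex h1 h2 h3]|x [[[Ex h1] h2] h3]].
    by split; [split=> //; move=> -[_]; rewrite leNgt h1|move=> -[]].
  split=> //; first by rewrite ltNge; apply/negP => h; apply: h2.
  by move=> h; apply: h3.
by apply: JD; [apply: JD|].
Qed.

Let le_p n A B : J A -> J B -> A `<=` B -> p n A <= p n B.
Proof.
move=> JA JB AB; have -> : B = (B `\` A) `|` A by rewrite setUC setDUK.
rewrite pU//; [by rewrite lerDr p0//; exact: JD|exact: JD|].
by rewrite setIC setDIK.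
Qed.

Let le_v A B : J A -> J B -> A `<=` B -> v A <= v B.
Proof.
move=> JA JB AB; have -> : B = (B `\` A) `|` A by rewrite setUC setDUK.
rewrite vU//; [by rewrite lerDr v0//; exact: JD|exact: JD|].
by rewrite setIC setDIK.
Qed.

Let mu_split n A B : J A -> J B -> mu n A = mu n (A `\` B) + mu n (A `&` B).
Proof.
move=> JA JB; rewrite -{1 2}(hump_splitI A B) pU ?vU//; try exact: JD; try exact: JI.
- by ring.
- by rewrite setDE -setIA (setIC (~` B)) -setIA setICr !setI0.
- by rewrite setDE -setIA (setIC (~` B)) -setIA setICr !setI0.
Qed.

Let mu_le n A B : J A -> J B -> A `<=` B -> `|mu n A| <= p n B + v B.
Proof.
move=> JA JB AB; rewrite (le_trans (ler_normB _ _))// !ger0_norm ?p0 ?v0//.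
by rewrite lerD ?le_p ?le_v.
Qed.

Definition uniformly_bounded W := exists c N, 0 <= c /\
  forall n, (N <= n)%N -> forall B, J B -> B `<=` W -> `|mu n B| <= c * a n.

Let ubS W W' : W `<=` W' -> uniformly_bounded W' -> uniformly_bounded W.
Proof.
move=> WW' [c [N [c0 H]]]; exists c, N; split=> // n Nn B JB BW.
by apply: H => // x /BW /WW'.
Qed.

Let ubU W W' : J W -> uniformly_bounded W -> uniformly_bounded W' ->
  uniformly_bounded (W `|` W').
Proof.
move=> JW [c [N [c0 H]]] [c' [N' [c'0 H']]]; exists (c + c'), (maxn N N').
split=> [|n]; first exact: addr_ge0.
rewrite geq_max => /andP[Nn N'n] B JB BWW'.
rewrite (mu_split n JB JW) addrC mulrDl (le_trans (ler_normD _ _))// lerD//.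
  by apply: H => //; exact: JI.
apply: H' => //; first exact: JD.
by move=> x [/BWW'[//|]].
Qed.

Let not_ub W : ~ uniformly_bounded W -> forall c N, 0 <= c ->
  exists n B, [/\ (N <= n)%N, J B, B `<=` W & c * a n < `|mu n B|].
Proof.
move=> nub c N c0; apply: contrapT => H; apply: nub; exists c, N; split=> // n Nn B JB BW.
by rewrite leNgt; apply/negP => h; apply: H; exists n, B.
Qed.

(** On a null level v vanishes and p n is monotone, so the pointwise bound at the level itself
    covers all its subsets. *)
Let ub_level t : uniformly_bounded (level t).
Proof.
have [c [N [c0 H]]] := ptwise (Jlev t); exists c, N; split=> // n Nn B JB BW.
have := H n Nn; rewrite vlev subr0 => {}H.
have vB : v B = 0.
  by apply/eqP; rewrite eq_le v0// andbT -(vlev t) le_v.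
rewrite vB subr0 (le_trans _ H)// !ger0_norm ?p0//; exact: le_p.
Qed.

Let shell_mono rho d d' : d <= d' -> shell rho d `<=` shell rho d'.
Proof. by move=> dd' x [Ex h1 h2 h3]; split => //; lra. Qed.

(** Let c be the pointwise constant of F. Inside the shell some B has |mu n B| above (c + i) a n, so
    adding B to F still leaves more than i a n. A thinner shell is then cut out of B: this frees the
    place for the later humps, and its masses are charged in advance so that these cannot undo the
    gain at n. *)
Let hump_step rho (F : set V) d (i : nat) :
  (forall d, 0 < d -> ~ uniformly_bounded (shell rho d)) ->
  J F -> 0 < d -> F `&` shell rho d = set0 ->
  exists F' d' n, [/\ J F', [/\ 0 < d', d' <= d & d' <= i.+1%:R^-1],
     F' `&` shell rho d' = set0, F' `\` shell rho d = F &
     (i <= n)%N /\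
     i%:R * a n < `|mu n F'| - (p n (shell rho d') + v (shell rho d'))].
Proof.
move=> bad JF d0 Fd.
have [c [N [c0 H]]] := ptwise JF.
have ci0 : 0 <= c + i%:R by rewrite addr_ge0.
have [n [B [Nn JB BV hB]]] := not_ub (bad d d0) (maxn N i) ci0.
move: Nn; rewrite geq_max => /andP[Nn in_].
(* Half of this excess pays for the part cut out of B, the other half for the masses of the new
   shell. *)
pose eta := `|mu n B| - (c + i%:R) * a n.
have eta0 : 0 < eta by rewrite subr_gt0.
have [d1 d10 hd1] := shell_small rho n (divr_gt0 eta0 (ltr0n R 2)).
pose d' := Num.min (Num.min d d1) i.+1%:R^-1.
have d'0 : 0 < d' by rewrite !lt_min d0 d10 invr_gt0 ltr0n.
have [d'd d'd1 d'i] : [/\ d' <= d, d' <= d1 & d' <= i.+1%:R^-1].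
  by rewrite /d'; split; rewrite !ge_min lexx ?orbT.
have small : p n (shell rho d') + v (shell rho d') < eta / 2.
  by apply: le_lt_trans hd1; rewrite lerD ?le_p ?le_v//; exact: shell_mono.
have JBd : J (B `\` shell rho d') by exact: JD.
exists (F `|` (B `\` shell rho d')), d', n; split=> //.
- exact: JU.
- rewrite setIUl -subset0 => x [[Fx sx]|[[_ nsx] sx]//].
  by rewrite -Fd; split=> //; exact: shell_mono sx.
- apply/seteqP; split=> x.
    by move=> [[//|[/BV Bx _]] nx].
  move=> Fx; split; first by left.
  by move=> sx; have : (F `&` shell rho d) x by []; rewrite Fd.
- split=> //.
  have disj : F `&` (B `\` shell rho d') = set0.
    by rewrite -subset0 => x [Fx [/BV sx _]]; rewrite -Fd.
  have -> : mu n (F `|` (B `\` shell rho d')) = mu n F + (mu n B - mu n (B `&` shell rho d')).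
    by rewrite pU// vU// (mu_split n JB (Jshell rho d')); ring.
  have h1 := H n Nn.
  have JBI : J (B `&` shell rho d') by exact: JI.
  have h2 : `|mu n (B `&` shell rho d')| <= eta / 2.
    by rewrite (le_trans _ (ltW small))//; apply: mu_le => // x [].
  have h3 : `|mu n B| <= `|mu n F + (mu n B - mu n (B `&` shell rho d'))|
      + `|mu n F| + `|mu n (B `&` shell rho d')|.
    rewrite -{1}[mu n B](_ : (mu n F + (mu n B - mu n (B `&` shell rho d'))) - mu n F +
        mu n (B `&` shell rho d') = _); last by ring.
    by rewrite (le_trans (ler_normD _ _))// lerD2r ler_normB.
  move: h3 h1 h2 small; rewrite /eta mulrDl.
  move: `|_| `|_| `|mu n B| `|_| => w1 w2 w3 w4; lra.
Qed.

Theorem gliding_hump : uniformly_bounded E.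
Proof.
apply: contrapT => bad.
(* The critical level is the supremum of the thresholds below which the bound is uniform. *)
pose S := [set t : R | uniformly_bounded (sublevel t)].
have T0 (t : R) : T <= t -> sublevel t = E.
  move=> Tt; apply/seteqP; split=> [x []//|x Ex]; split=> //.
  by have /andP[_ /le_trans] := g0T Ex; apply.
have Sub : ubound S T.
  move=> t St; rewrite leNgt; apply/negP => /ltW /T0 Et; apply: bad.
  by rewrite -Et.
have S0 : S !=set0.
  (* Since g >= 0 on E, nothing but the empty set lies below level -1, so S is inhabited. *)
  exists (-1); exists 0, 0%N; split=> // n _ B JB BW.
  have B0 : B = set0.
    rewrite -subset0 => x /BW[Ex gx].
    by have /andP[g0 _] := g0T Ex; have := le_trans g0 gx; rewrite ler0N1.
  have lv : v B = 0.
    by apply/eqP; rewrite eq_le v0// andbT -(vlev 0) le_v// B0.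
  have Jl := Jlev 0.
  have J0 : J set0 by rewrite -(setDv (level 0)); exact: JD.
  have p0' : p n set0 = 0.
    by have := pU n J0 J0 (setI0 _); rewrite setU0; lra.
  by rewrite B0 p0' -B0 lv subr0 normr0 mul0r.
have supS : has_sup S by split=> //; exists T.
pose rho := sup S.
(* A uniform bound on a shell around [rho] would combine with those on a sublevel just below [rho]
   and on the null level into a bound up to [rho + d], beyond the supremum. *)
have badshell d : 0 < d -> ~ uniformly_bounded (shell rho d).
  move=> d0 ubd.
  have [t St tr] := sup_adherent d0 supS.
  have : S (rho + d).
    apply: (@ubS _ ((sublevel t `|` level rho) `|` shell rho d)).
      move=> x [Ex gx].
      have [gt|gt] := leP (g x) t; first by left; left.
      have [gr|gr] := pselect (g x = rho); first by left; right.
      by right; split=> //; exact: lt_trans gt.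
    apply: ubU => //; first by apply: JU.
    by apply: ubU.
  move=> /(sup_upper_bound supS); rewrite -/rho => h.
  by have := lt_le_trans (ltr_pwDr d0 (lexx rho)) h; rewrite ltxx.
(* A state of the recursion consists of the set built so far, the width of the shell still free, the
   number of steps made and the index n of the last hump. *)
pose st := {s : (set V * R) * (nat * nat) | [/\ J s.1.1, 0 < s.1.2 & s.1.1 `&` shell rho s.1.2 = set0]}.
pose rel (s s' : st) := let: ((F, d), (i, _)) := sval s in let: ((F', d'), (i', n')) := sval s' in
  [/\ i' = i.+1, d' <= d /\ d' <= i.+1%:R^-1, F' `\` shell rho d = F, (i <= n')%N &
   i%:R * a n' < `|mu n' F'| - (p n' (shell rho d') + v (shell rho d'))].
have next (s : st) : {s' : st | rel s s'}.
  apply: cid; case: s => -[[F d] [i n]] /= [JF d0 Fd].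
  have [F' [d' [n' [JF' [d'0 d'd d'i] F'd' F'F [in' hn']]]]] := hump_step i badshell JF d0 Fd.
  have hs' : [/\ J (((F', d'), (i.+1, n')) : (set V * R) * (nat * nat)).1.1, 0 < d' & F' `&` shell rho d' = set0] by [].
  by exists (exist _ ((F', d'), (i.+1, n')) hs').
have Jset0 : J set0 by rewrite -(setDv (level 0)); exact: JD.
have hs0 : [/\ J ((((set0 : set V), 1 : R), (0%N, 0%N)) : (set V * R) * (nat * nat)).1.1, 0 < (1 : R) & (set0 : set V) `&` shell rho 1 = set0].
  by split=> //; rewrite set0I.
have [f [f0 fS]] := dependent_choice next (exist _ (((set0 : set V), 1 : R), (0%N, 0%N)) hs0).
pose F i := (sval (f i)).1.1; pose d i := (sval (f i)).1.2; pose nn i := (sval (f i)).2.2.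
have fi i : (sval (f i)).2.1 = i.
  elim: i => [|i IH]; first by rewrite f0.
  have := fS i; rewrite /rel; move: IH; case: (sval (f i)) => -[F1 d1] [i1 n1] /= ->.
  by case: (sval (f i.+1)) => -[F2 d2] [i2 n2] /= [->].
have prop i : [/\ J (F i), 0 < d i & F i `&` shell rho (d i) = set0] by exact: (svalP (f i)).
have succ i : [/\ d i.+1 <= d i, d i.+1 <= i.+1%:R^-1, F i.+1 `\` shell rho (d i) = F i, (i <= nn i.+1)%N &
   i%:R * a (nn i.+1) < `|mu (nn i.+1) (F i.+1)| - (p (nn i.+1) (shell rho (d i.+1)) + v (shell rho (d i.+1)))].
  have := fS i; rewrite /rel /F /d /nn; have := fi i; case: (sval (f i)) => -[F1 d1] [i1 n1] /= ->.
  by case: (sval (f i.+1)) => -[F2 d2] [i2 n2] /= [_ []].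
have dmono i j : (i <= j)%N -> d j <= d i.
  move=> /subnKC <-; elim: (j - i)%N => [|k IH]; first by rewrite addn0.
  by rewrite addnS; have [h _ _ _ _] := succ (i + k)%N; exact: le_trans IH.
have Fstab i j : (i <= j)%N -> F j `\` shell rho (d i) = F i.
  move=> /subnKC <-; elim: (j - i)%N => [|k IH].
    rewrite addn0; apply/seteqP; split=> [x []//|x Fx]; split=> // sx.
    by have [_ _ e] := prop i; have : (F i `&` shell rho (d i)) x by []; rewrite e.
  rewrite addnS -IH; have [_ _ <- _ _] := succ (i + k)%N.
  apply/seteqP; split=> [x [Fx nx]|x [[Fx nx] nx']]; split=> //; split=> // sx.
  by apply: nx; apply: shell_mono sx; apply: dmono; exact: leq_addr.
have Fmono i j : (i <= j)%N -> F i `<=` F j by move=> ij; rewrite -(Fstab i j ij) => x [].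
(* Off the shell of width [d i] the union already equals [F i]; this is what [J_glue] asks for. *)
pose B := \bigcup_i F i.
have Bstab i : B `\` shell rho (d i) = F i.
  apply/seteqP; split=> [x [[j _ Fx] nx]|x Fx].
    have [ij|ji] := leqP i j; first by rewrite -(Fstab i j ij).
    by apply: Fmono Fx; exact: ltnW.
  split; first by exists i.
  move=> sx; have [_ _ e] := prop i.
  by have : (F i `&` shell rho (d i)) x by []; rewrite e.
have JB : J B.
  apply: (@J_glue rho).
    by move=> x [i _ Fx]; have [/JE h _ _] := prop i; exact: h.
  move=> e e0; pose i := (Num.trunc e^-1).+1.
  exists (d i.+1); split; first by case: (prop i.+1).
  - have [_ h _ _ _] := succ i; rewrite (le_trans h)//.
    rewrite -[leRHS]invrK lef_pV2 ?posrE ?invr_gt0//.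
    have : e^-1 < i%:R by rewrite /i truncnS_gt.
    move=> /ltW /le_trans; apply; by rewrite ler_nat.
  - by rewrite Bstab; case: (prop i.+1).
have [c [N [c0 H]]] := ptwise JB.
(* With i beyond both N and c, the hump of step i + 1 contradicts the pointwise bound of B: whatever
   B has in excess of [F i.+1] lies in the shell whose masses were subtracted in [hi]. *)
pose i := maxn N (Num.trunc c).+1.
have [_ _ _ in' hi] := succ i.
have := H (nn i.+1) (leq_trans (leq_maxl _ _) in').
have JFi : J (F i.+1) by case: (prop i.+1).
rewrite leNgt => /negP; apply.
have ci : c <= i%:R.
  apply: (@le_trans _ _ (Num.trunc c).+1%:R); last by rewrite ler_nat leq_maxr.
  by rewrite ltW// truncnS_gt.
apply: (@le_lt_trans _ _ (i%:R * a (nn i.+1))); first by rewrite ler_wpM2r.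
apply: (lt_le_trans hi).
rewrite (mu_split (nn i.+1) JB (Jshell rho (d i.+1))) Bstab lerBlDr.
have h2 : `|mu (nn i.+1) (B `&` shell rho (d i.+1))| <=
    p (nn i.+1) (shell rho (d i.+1)) + v (shell rho (d i.+1)).
  by apply: mu_le => //; exact: JI.
rewrite -{1}[mu (nn i.+1) (F i.+1)](addrK (mu (nn i.+1) (B `&` shell rho (d i.+1)))).
by rewrite (le_trans (ler_normB _ _))// lerD2l.
Qed.

End gliding_hump.

Lemma fine_decreasing0 d (T : measurableType d) (R : realType)
    (mu : {measure set T -> \bar R}) (F : nat -> set T) :
  (mu (F 0%N) < +oo)%E -> (forall i, measurable (F i)) ->
  (forall i j, (i <= j)%N -> F j `<=` F i) -> \bigcap_i F i = set0 ->
  fine (mu (F i)) @[i --> \oo] --> (0 : R).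
Proof.
move=> F0 mF dF F00; rewrite -[0]/(fine 0%E); apply: fine_cvg.
rewrite -[X in _ --> X](measure0 mu) -F00.
apply: nonincreasing_cvg_mu => //; first by rewrite F00.
by move=> i j ij; apply/subsetPset; exact: dF.
Qed.

Lemma cvg0_ex (R : realType) (f : nat -> R) (e : R) :
  f n @[n --> \oo] --> (0 : R) -> 0 < e ->
  exists N, forall n, (N <= n)%N -> `|f n| < e.
Proof.
move=> f0 e0; have [N _ HN] := cvgr0_norm_lt (FF := eventually_filter) _ f0 _ e0.
by exists N => n; exact: HN.
Qed.

(** * Uniformity over continuity sets *)

Section second_order_uniform.
Context {R : realType} {d : nat} {dT : measure_display} {T : measurableType dT}.
Variables (P : probability T R) (X : {RV P >-> borel_rV R d}).
Variables (nu : {measure set (borel_rV R d) -> \bar R}) (a : R -> R).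
Hypothesis rv : regularly_varying X nu.
Implicit Types (B : set 'rV[R]_d).

Lemma measurable_scaled u B : borel B -> measurable [set w | B (u^-1 *: vec X w)].
Proof.
move=> bB; have : borel ( *:%R u^-1 @^-1` B).
  by apply: borel_preimage => //; exact: scaler_continuous.
by move=> h; exact: (measurable_funPTI X h).
Qed.

Lemma prob_scaled_ge0 u B : 0 <= prob_scaled X u B.
Proof. exact: fine_ge0. Qed.

Lemma norm_tail_ge0 u : 0 <= norm_tail X u.
Proof. exact: fine_ge0. Qed.

Lemma prob_scaledU u A B : borel A -> borel B -> A `&` B = set0 ->
  prob_scaled X u (A `|` B) = prob_scaled X u A + prob_scaled X u B.
Proof.
move=> bA bB AB; rewrite /prob_scaled -fineD ?fin_num_measure//;
  [|exact: measurable_scaled..].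
congr fine; apply: measureU; [exact: measurable_scaled..|].
rewrite -subset0 => w [h1 h2]; have : (A `&` B) (u^-1 *: vec X w) by [].
by rewrite AB.
Qed.

Variable e : R.
Hypothesis e0 : 0 < e.

Definition continuity_set B :=
  [/\ borel B, B `<=` cone_above e & nu (boundary B) = 0%E].

Let nuD A B : borel A -> borel B -> A `<=` B -> nu B = 0%E -> nu A = 0%E.
Proof. exact: subset_measure0. Qed.

Let nu_boundary B A A' : borel A -> borel A' -> nu A = 0%E -> nu A' = 0%E ->
  boundary B `<=` A `|` A' -> nu (boundary B) = 0%E.
Proof.
move=> bA bA' nA nA' sub; apply: (nuD _ _ sub).
- by apply: borel_closed; exact: boundary_closed.
- exact: borelU.
- by rewrite measureU0.
Qed.

Lemma borel_boundary B : borel (boundary B).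
Proof. by apply: borel_closed; exact: boundary_closed. Qed.

Lemma continuity_setU A B :
  continuity_set A -> continuity_set B -> continuity_set (A `|` B).
Proof.
move=> [bA Ae nA] [bB Be nB]; split; first exact: borelU.
  by rewrite subUset.
by apply: nu_boundary (@boundaryU _ _ A B) => //; exact: borel_boundary.
Qed.

Lemma continuity_setD A B :
  continuity_set A -> continuity_set B -> continuity_set (A `\` B).
Proof.
move=> [bA Ae nA] [bB Be nB]; split; first exact: borelD.
  by move=> x [/Ae].
apply: nu_boundary (@boundaryD _ _ A B _) => //; try exact: borel_boundary.
by move=> x /Ae[].
Qed.

Lemma continuity_set_null C : closed C -> C `<=` cone_above e -> nu C = 0%E ->
  continuity_set C.
Proof.
move=> cC Ce nC; split => //; first exact: borel_closed.
apply: (nuD _ _ _ nC); [exact: borel_boundary|exact: borel_closed|].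
by move=> x [+ _]; rewrite -(closure_id C).1.
Qed.

Definition cone_level (h : 'rV[R]_d -> R) t : set 'rV[R]_d :=
  [set x | cone_above e x /\ h x = t].
Definition cone_sublevel (h : 'rV[R]_d -> R) t : set 'rV[R]_d :=
  [set x | cone_above e x /\ h x <= t].

Lemma closed_cone_sublevel h t : continuous h -> closed (cone_sublevel h t).
Proof.
move=> ch; apply: closedI; first exact: closed_cone_above.
apply: (@preimage_closed _ _ h [set y | y <= t]); last exact: closed_le.
by move=> x _; exact: ch.
Qed.

Lemma closed_cone_level h t : continuous h -> closed (cone_level h t).
Proof.
move=> ch; apply: closedI; first exact: closed_cone_above.
apply: (@preimage_closed _ _ h [set t]); last exact: closed_eq.
by move=> x _; exact: ch.
Qed.

(** A boundary point lies on the level h = t or on the sphere of radius e, the inner edge of the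
    cone; both are null. *)
Lemma continuity_sublevel h t : continuous h -> nu (cone_level h t) = 0%E ->
  continuity_set (cone_sublevel h t).
Proof.
move=> ch nl; have cS := @closed_cone_sublevel h t ch; split.
- exact: borel_closed.
- by move=> x [].
- apply: (@nu_boundary _ (cone_level h t) (sphere e)) => //.
  + by apply: borel_closed; exact: (@closed_cone_level h t ch).
  + by apply: borel_closed; exact: closed_sphere.
  + by rewrite (nu_sphere rv e0).
  move=> x []; rewrite -(closure_id _).1// => -[[ox /= ex] hx] clo.
  have [xe|xe] := eqVneq `|x| e; first by right; split.
  have [xt|xt] := eqVneq (h x) t; first by left; split.
  have {}ex : e < `|x| by rewrite lt_neqAle eq_sym xe.
  have {}hx : h x < t by rewrite lt_neqAle xt.
  have nb : nbhs x ([set y | e < `|y|] `&` h @^-1` [set y | y < t]).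
    apply: open_nbhs_nbhs; split=> //; apply: openI; first exact: open_norm_gt.
    by apply: open_comp => [y _|]; [exact: ch|exact: open_lt].
  have [y [[oy ny] [ey hy]]] := clo _ nb.
  by exfalso; apply: ny; split; [split=> //; exact: ltW|exact: ltW].
Qed.

(* Any strictly monotone radial function continuous at 0 would do. *)
Definition radial (x : 'rV[R]_d) : R := expR (- `|x|).

Lemma radial_continuous : continuous radial.
Proof.
move=> x; apply: (@continuous_comp _ _ _ (fun x : 'rV[R]_d => - `|x|) expR).
  by apply: continuousN; exact: norm_continuous.
exact: continuous_expR.
Qed.

Lemma nu_radial_level t : nu (cone_level radial t) = 0%E.
Proof.
have [t0|t0] := leP t 0.
  suff -> : cone_level radial t = set0 by exact: measure0.
  rewrite -subset0 => x [_ h]; have := expR_gt0 (- `|x|).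
  by rewrite -[expR _]/(radial x) h ltNge t0.
have [lt0|lt0] := leP (- ln t) 0.
  suff -> : cone_level radial t = set0 by exact: measure0.
  rewrite -subset0 => x [[_ /= ex] h]; move: lt0; rewrite -h /radial expRK opprK.
  by rewrite leNgt (lt_le_trans e0 ex).
apply: (@nuD _ (sphere (- ln t))).
- by apply: borel_closed; apply: closed_cone_level; exact: radial_continuous.
- by apply: borel_closed; exact: closed_sphere.
- by move=> x [[ox ex] <-]; split=> //=; rewrite /radial expRK opprK.
- by rewrite (nu_sphere rv lt0).
Qed.

Lemma continuity_radial_level t : continuity_set (cone_level radial t).
Proof.
apply: continuity_set_null; last exact: nu_radial_level.
  by apply: closed_cone_level; exact: radial_continuous.
by move=> x [].
Qed.

Lemma continuity_radial_sublevel t : continuity_set (cone_sublevel radial t).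
Proof.
by apply: continuity_sublevel; [exact: radial_continuous|exact: nu_radial_level].
Qed.

Let radial_shell rho dl := shell (cone_above e) radial rho dl.

Lemma borel_radial_shell rho dl : borel (radial_shell rho dl).
Proof.
have -> : radial_shell rho dl =
    (cone_sublevel radial (rho + dl) `\` cone_sublevel radial (rho - dl)) `\`
    cone_level radial rho.
  apply/seteqP; split=> [x [Ex h1 h2 h3]|x [[[Ex h1] h2] h3]].
    by split; [split=> //; move=> -[_]; rewrite leNgt h1|move=> -[]].
  split=> //; first by rewrite ltNge; apply/negP => h; apply: h2.
  by move=> h; apply: h3.
apply: borelD; first by apply: borelD; case: (continuity_radial_sublevel (rho + dl));
  case: (continuity_radial_sublevel (rho - dl)).
by case: (continuity_radial_level rho).
Qed.

Lemma radial_shell_sub rho dl : radial_shell rho dl `<=` cone_above e.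
Proof. by move=> x []. Qed.

Lemma radial_shell_cap rho : \bigcap_i radial_shell rho i.+1%:R^-1 = set0.
Proof.
rewrite -subset0 => x h; have [_ _ _ /eqP nx] := h 0%N I.
have n0 : 0 < `|radial x - rho| by rewrite normr_gt0 subr_eq0.
have [i _ hi] := near_infty_natSinv_lt (PosNum n0).
have [_ h1 h2 _] := h i I; have /= := hi i (leqnn i).
move: h1 h2; move: i.+1%:R^-1 => b h1 h2.
rewrite ltNge => /negP; apply; rewrite ler_norml; apply/andP; split; lra.
Qed.

Lemma radial_shell_dec rho i j : (i <= j)%N ->
  radial_shell rho j.+1%:R^-1 `<=` radial_shell rho i.+1%:R^-1.
Proof.
move=> ij x [Ex h1 h2 h3].
have : (j.+1%:R^-1 : R) <= i.+1%:R^-1 by rewrite lef_pV2 ?posrE// ler_nat.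
by move: h1 h2; rewrite /radial_shell; move: j.+1%:R^-1 i.+1%:R^-1 => b c h1 h2 h; split=> //; lra.
Qed.

Lemma prob_scaled_shell rho u :
  prob_scaled X u (radial_shell rho i.+1%:R^-1) @[i --> \oo] --> (0 : R).
Proof.
apply: (@fine_decreasing0 _ _ _ P (fun i => [set w | radial_shell rho i.+1%:R^-1 (u^-1 *: vec X w)])).
- by rewrite -ge0_fin_numE// fin_num_measure//; apply: measurable_scaled; exact: borel_radial_shell.
- by move=> i; apply: measurable_scaled; exact: borel_radial_shell.
- by move=> i j ij w; exact: radial_shell_dec.
- rewrite -subset0 => w h; have : (\bigcap_i radial_shell rho i.+1%:R^-1) (u^-1 *: vec X w) by [].
  by rewrite radial_shell_cap.
Qed.

Lemma nu_radial_shell rho :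
  fine (nu (radial_shell rho i.+1%:R^-1)) @[i --> \oo] --> (0 : R).
Proof.
apply: fine_decreasing0.
- rewrite -ge0_fin_numE//; apply: (nu_fin rv e0); first exact: borel_radial_shell.
  exact: radial_shell_sub.
- by move=> i; exact: borel_radial_shell.
- exact: radial_shell_dec.
- exact: radial_shell_cap.
Qed.

(** A point off the level [rho] has a neighbourhood that misses some shell of the sequence, and
    there B coincides with B minus that shell. So the boundary of B is covered by countably many
    null boundaries and the null level. *)
Lemma continuity_glue rho B : B `<=` cone_above e ->
  (forall e', 0 < e' -> exists dl,
     [/\ 0 < dl, dl <= e' & continuity_set (B `\` radial_shell rho dl)]) ->
  continuity_set B.
Proof.
move=> BE H.
have {H} /choice[dl Hdl] : forall i : nat, exists dl : R,
    [/\ 0 < dl, dl <= i.+1%:R^-1 & continuity_set (B `\` radial_shell rho dl)].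
  by move=> i; apply: H; rewrite invr_gt0.
have away x : radial x <> rho -> exists i, dl i < `|radial x - rho|.
  move=> /eqP nx; have n0 : 0 < `|radial x - rho| by rewrite normr_gt0 subr_eq0.
  have [i _ hi] := near_infty_natSinv_lt (PosNum n0); exists i.
  by have [_ h _] := Hdl i; apply: le_lt_trans h _; exact: (hi i (leqnn i)).
split=> //.
- have -> : B = \bigcup_i (B `\` radial_shell rho (dl i)).
    apply/seteqP; split=> [x Bx|x [i _ []//]].
    have [e1|n1] := pselect (radial x = rho); first by exists 0%N => //; split=> // -[].
    have [i hi] := away x n1; exists i => //; split=> // -[_ h1 h2 _].
    by move: hi; rewrite ltNge => /negP; apply; rewrite ler_norml; apply/andP; split; lra.
  by apply: borel_bigcup => i; case: (Hdl i) => _ _ [].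
have bl : borel (cone_level radial rho) by case: (continuity_radial_level rho).
pose N := \bigcup_i boundary (B `\` radial_shell rho (dl i)).
have bN : borel N by apply: borel_bigcup => i; exact: borel_boundary.
apply: (@nu_boundary _ N (cone_level radial rho)) => //.
- apply/eqP; rewrite eq_le measure_ge0 andbT.
  have /le_trans := @measure_sigma_subadditive _ R (borel_rV R d) nu N
      (fun i => boundary (B `\` radial_shell rho (dl i)))
      (fun i => borel_boundary _) bN (@subset_refl _ N).
  apply.
  by rewrite eseries0// => i _ _; case: (Hdl i) => _ _ [].
- exact: nu_radial_level.
- move=> x [cB cC].
  have Ex : cone_above e x.
    by have := closure_subset BE cB; rewrite -(closure_id _).1//; exact: closed_cone_above.
  have [e1|n1] := pselect (radial x = rho); [by right|left].
  have [i hi] := away x n1; exists i => //; split; last first.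
    by apply: closure_subset cC => y [oy nB]; split=> // -[].
  move=> U nU.
  have nb : nbhs x ((fun y => `|radial y - rho|) @^-1` [set r | dl i < r]).
    have cf : continuous (fun y => `|radial y - rho|).
      move=> y; apply: (@continuous_comp _ _ _ (fun y => radial y - rho) (fun r : R => `|r|)).
        by apply: continuousB; [exact: radial_continuous|exact: cst_continuous].
      exact: norm_continuous.
    apply: open_nbhs_nbhs; split=> //; apply: open_comp => [y _|]; [exact: cf|exact: open_gt].
  have [y [By [Uy hy]]] := cB _ (filterI nU nb).
  exists y; split=> //; split=> // -[_ h1 h2 _].
  by move: hy; rewrite /= ltNge => /negP; apply; rewrite ler_norml; apply/andP; split; lra.
Qed.

Hypothesis so : second_order X nu a.

Lemma second_order_continuity (u : nat -> R) : u n @[n --> \oo] --> +oo ->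
  exists c N, 0 <= c /\ forall n, (N <= n)%N -> forall B, continuity_set B ->
    `|prob_scaled X (u n) B / norm_tail X (u n) - fine (nu B)| <= c * `|a (u n)|.
Proof.
move=> uoo.
pose p n B := prob_scaled X (u n) B / norm_tail X (u n).
have [|||||||||||||||c [N [c0 H]]] := @gliding_hump R _ continuity_set (cone_above e) p
    (fun B => fine (nu B)) (fun n => `|a (u n)|) radial 1.
- exact: continuity_setU.
- exact: continuity_setD.
- by move=> A [].
- exact: continuity_radial_sublevel.
- exact: continuity_radial_level.
- by move=> n A _; rewrite divr_ge0 ?norm_tail_ge0 ?prob_scaled_ge0.
- by move=> A _; exact: fine_ge0.
- by move=> n A B [bA _ _] [bB _ _] AB; rewrite /p prob_scaledU// mulrDl.
- move=> A B [bA Ae _] [bB Be _] AB.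
  by rewrite measureU// fineD ?(nu_fin rv e0).
- by move=> t; rewrite [level _ _ _]/(cone_level radial t) nu_radial_level.
- by [].
- by move=> x _; rewrite expR_ge0 -expR0 ler_expR oppr_le0 normr_ge0.
- move=> rho n e1 e10.
  have h : p n (radial_shell rho i.+1%:R^-1) + fine (nu (radial_shell rho i.+1%:R^-1))
      @[i --> \oo] --> (0 * (norm_tail X (u n))^-1 + 0 : R).
    by apply: cvgD; [apply: cvgMl; exact: prob_scaled_shell|exact: nu_radial_shell].
  rewrite mul0r addr0 in h.
  have [i hi] := cvg0_ex h e10.
  exists i.+1%:R^-1 => //.
  exact: le_lt_trans (ler_norm _) (hi i (leqnn i)).
- exact: continuity_glue.
- move=> B [bB Be nB]; have [_ /(_ e B e0 bB Be nB) /eqOP [c [_ H]]] := so.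
  (* The O provides every constant above c; a nonnegative one is selected. *)
  have H1 := H (Num.max c 0 + 1).
  have /H1 [M [_ HM]] : c < Num.max c 0 + 1 by rewrite ltr_pwDr// le_max lexx.
  have [N _ HN] := (cvgryPgt _).1 uoo M.
  exists (Num.max c 0 + 1), N; split; first by rewrite addr_ge0// le_max lexx orbT.
  by move=> n Nn; apply: HM; exact: HN.
- exists c, N; split=> // n Nn B cB; apply: H => //; by case: cB.
Qed.

End second_order_uniform.

(** Levels are disjoint and E has finite mass, so only finitely many levels have mass at least 1 /
    (i + 1). The levels of positive mass are countable and cannot fill an interval, which has
    positive Lebesgue measure. *)
Lemma null_level d (T : measurableType d) (R : realType)
    (mu : {measure set T -> \bar R}) (E : set T) (h : T -> R) (l r : R) :
  measurable E -> (mu E < +oo)%E -> (forall t, measurable (E `&` h @^-1` [set t])) ->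
  l < r -> exists t, [/\ l < t, t < r & mu (E `&` h @^-1` [set t]) = 0%E].
Proof.
move=> mE Eoo mh lr; apply: contrapT => H.
pose A i := [set t : R | (i.+1%:R^-1%:E <= mu (E `&` h @^-1` [set t]))%E].
have cA i : countable (A i).
  apply: finite_set_countable; apply: contrapT => /infiniteP/pcard_leP[f].
  pose F n := E `&` h @^-1` [set f n].
  have mF n : measurable (F n) by exact: mh.
  have tF : trivIset setT F.
    apply/trivIsetP => n m _ _ nm; rewrite -subset0 => x [[_ /= e1] [_ /= e2]].
    have e : f n = f m by rewrite -e1.
    by move/eqP: nm; apply; apply: ('inj_f); rewrite ?inE.
  have ge N : ((N%:R * i.+1%:R^-1)%:E <= mu E)%E.
    apply: (@le_trans _ _ (mu (\big[setU/set0]_(j < N) F j))); last first.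
      apply: le_measure; rewrite ?inE//; first exact: bigsetU_measurable.
      by rewrite -bigcup_mkord => x [j _ []].
    rewrite (measure_bigsetU mu mF tF).
    apply: (@le_trans _ _ (\sum_(j < N) i.+1%:R^-1%:E)%E).
      by rewrite sumEFin lee_fin sumr_const card_ord mulr_natl.
    by apply: lee_sum => j _; have := 'funS_f (I : setT (j : nat)).
  have fE : mu E \is a fin_num by rewrite ge0_fin_numE.
  have := ge (Num.Def.trunc (fine (mu E) * i.+1%:R)).+1.
  rewrite -(fineK fE) lee_fin ler_pdivrMr ?ltr0n//.
  by rewrite leNgt truncnS_gt.
have cU : countable (\bigcup_i A i) by apply: bigcup_countable => //.
have sub : `]l, r[%classic `<=` \bigcup_i A i.
  move=> t /=; rewrite in_itv/= => /andP[lt tr].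
  have p : (0 < mu (E `&` h @^-1` [set t]))%E.
    rewrite lt_neqAle measure_ge0 andbT eq_sym; apply/eqP => e0.
    by apply: H; exists t.
  have ft : mu (E `&` h @^-1` [set t]) \is a fin_num.
    rewrite ge0_fin_numE//; apply: le_lt_trans Eoo.
    by apply: le_measure; rewrite ?inE.
  have p' : 0 < fine (mu (E `&` h @^-1` [set t])) by rewrite -lte_fin fineK.
  have [i _ hi] := near_infty_natSinv_lt (PosNum p').
  exists i => //; rewrite /A/= -(fineK ft) lee_fin ltW//.
  exact: (hi i (leqnn i)).
have := countable_lebesgue_measure0 (sub_countable (subset_card_le sub) cU).
rewrite lebesgue_measure_itv/= lte_fin lr -EFinD => /eqP.
by rewrite eqe subr_eq0 gt_eqF.
Qed.

(** * The distance to a set *)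

Section distance_to_set.
Context {R : realType} {V : normedModType R}.
Variable A : set V.
Hypothesis A0 : A !=set0.

Definition set_dist (x : V) : R := inf [set `|x - y| | y in A].

Let lb x : has_lbound [set `|x - y| | y in A].
Proof. by exists 0 => _ [y _ <-]. Qed.

Let ne x : [set `|x - y| | y in A] !=set0.
Proof. by have [y Ay] := A0; exists `|x - y|; exists y. Qed.

Lemma set_dist_le x y : A y -> set_dist x <= `|x - y|.
Proof. by move=> Ay; apply: inf_lbound => //; exists y. Qed.

Lemma set_dist_lip x y : `|set_dist x - set_dist y| <= `|x - y|.
Proof.
have H z w : set_dist z - set_dist w <= `|z - w|.
  rewrite lerBlDl -lerBlDr; apply: lb_le_inf => // _ [a Aa <-].
  rewrite lerBlDr (le_trans (set_dist_le _ Aa))//.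
  by rewrite [leRHS]addrC (_ : z - a = (z - w) + (w - a)) ?ler_normD// addrA subrK.
by rewrite ler_norml lerNl opprB H distrC H.
Qed.

Lemma set_dist_continuous : continuous set_dist.
Proof.
move=> x; apply/cvgrPdist_lt => e e0; near=> y.
apply: le_lt_trans (set_dist_lip _ _) _; near: y.
exact: cvgr_dist_lt.
Unshelve. all: by end_near. Qed.

Lemma set_dist_gt0 x : closed A -> 0 < set_dist x <-> ~ A x.
Proof.
move=> cA; split=> [d0 Ax|nA].
  by have := set_dist_le x Ax; rewrite subrr normr0 leNgt d0.
have oA : open (~` A) by rewrite openC.
have /nbhs_ballP[e /= e0 He] := open_nbhs_nbhs (conj oA nA).
apply: (lt_le_trans e0); apply: lb_le_inf => // _ [y Ay <-].
by rewrite leNgt; apply/negP => h; apply: (He y) => //; rewrite -ball_normE.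
Qed.

End distance_to_set.

(** * Approximation of Borel sets by an algebra *)

Section approximation.
Context {R : realType} {d : nat} (lam : {measure set (borel_rV R d) -> \bar R}).
Variables (E : set 'rV[R]_d) (J : set (set 'rV[R]_d)).
Hypotheses (bE : borel E) (Eoo : (lam E < +oo)%E).
Hypothesis JE : forall C, J C -> borel C /\ C `<=` E.
Hypothesis JT : J E.
Hypothesis JU : forall A B, J A -> J B -> J (A `|` B).
Hypothesis JD : forall A B, J A -> J B -> J (A `\` B).
Hypothesis Jopen : forall U e, open U -> 0 < e ->
  exists2 C, J C & (lam ((U `&` E) `+` C) <= e%:E)%E.

Let borelY (A B : set 'rV[R]_d) : borel A -> borel B -> borel (A `+` B).
Proof. by move=> bA bB; rewrite setY_def; apply: borelU; exact: borelD. Qed.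

Let le_lam (A B : set 'rV[R]_d) : borel A -> borel B -> A `<=` B -> (lam A <= lam B)%E.
Proof. by move=> bA bB AB; apply: le_measure; rewrite ?inE. Qed.

Let lamU (A B : set 'rV[R]_d) : borel A -> borel B ->
  (lam (A `|` B) <= lam A + lam B)%E.
Proof. exact: measureU2. Qed.

(** The sets whose trace on E can be approximated form a sigma-algebra: complementation in E does
    not change the symmetric difference, and a countable union is truncated thanks to the finite
    mass of E, the finite part being approximated term by term with halved errors. *)
Lemma approx_borel B e : borel B -> 0 < e ->
  exists2 C, J C & (lam ((B `&` E) `+` C) <= e%:E)%E.
Proof.
pose D := [set B : set 'rV[R]_d | borel B /\ forall e, 0 < e ->
  exists2 C, J C & (lam ((B `&` E) `+` C) <= e%:E)%E].
suff H : sigma_algebra setT D.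
  move=> bB e0; suff [_ h] : D B by exact: h.
  apply: (@smallest_sub _ (sigma_algebra setT) (@open 'rV[R]_d) D) => //.
  by move=> U oU; split; [exact: borel_open|move=> e' e'0; exact: Jopen].
have J0 : J set0 by rewrite -(setDv E); exact: JD.
split.
- split; first exact: (@measurable0 _ (borel_rV R d)).
  by move=> e' e'0; exists set0 => //; rewrite set0I setYK measure0 lee_fin ltW.
- move=> A [bA HA]; split; first by rewrite setTD; exact: borelC.
  move=> e' e'0; have [C JC hC] := HA e' e'0; exists (E `\` C); first exact: JD.
  suff -> : ((setT `\` A) `&` E) `+` (E `\` C) = (A `&` E) `+` C by [].
  have [_ CE] := JE JC; rewrite !setY_def; apply/seteqP; split=> x.
    move=> [[[[_ nA] Ex] h]|[[Ex nC] h]].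
      right; split; last by move=> -[].
      by apply: contrapT => nC; apply: h.
    left; split=> //; split=> //; apply: contrapT => nA; by apply: h.
  move=> [[[Ax Ex] nC]|[Cx h]].
    by right; split=> // -[[_]].
  left; split; last by move=> -[].
  by split; [split=> // Ax; apply: h; split=> //; exact: CE|exact: CE].
- move=> F HF; have bF i : borel (F i) by case: (HF i).
  split; first exact: borel_bigcup.
  move=> e' e'0.
  pose G n := \big[setU/set0]_(i < n) F i.
  have bG n : borel (G n) by apply: (@bigsetU_measurable _ (borel_rV R d)) => i _; exact: bF.
  have GE n : G n = \bigcup_(i in `I_n) F i by rewrite /G -bigcup_mkord.
  have approxG n : forall e1, 0 < e1 -> exists2 C, J C & (lam ((G n `&` E) `+` C) <= e1%:E)%E.
    elim: n => [|n IH] e1 e10.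
      exists set0 => //; rewrite /G big_ord0 set0I setYK measure0 lee_fin ltW//.
    have [C1 JC1 h1] := IH (e1 / 2) (divr_gt0 e10 (ltr0n R 2)).
    have [_ /(_ (e1 / 2) (divr_gt0 e10 (ltr0n R 2)))[C2 JC2 h2]] := HF n.
    exists (C1 `|` C2); first exact: JU.
    have [bC1 _] := JE JC1; have [bC2 _] := JE JC2.
    have b1 : borel ((G n `&` E) `+` C1) by apply: borelY => //; exact: borelI.
    have b2 : borel ((F n `&` E) `+` C2) by apply: borelY => //; exact: borelI.
    apply: (@le_trans _ _ (lam (((G n `&` E) `+` C1) `|` ((F n `&` E) `+` C2)))).
      apply: le_lam; [|exact: borelU|].
        by apply: borelY; [apply: borelI|apply: borelU].
      rewrite /G big_ord_recr/= -/(G n) !setY_def => x.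
      move=> [[[[Gx|Fx] Ex] nC]|[[C1x|C2x] h]].
      + by left; left; split=> // C1x; apply: nC; left.
      + by right; left; split=> // C2x; apply: nC; right.
      + by left; right; split=> // -[Gx Ex]; apply: h; split=> //; left.
      + by right; right; split=> // -[Fx Ex]; apply: h; split=> //; right.
    apply: (le_trans (lamU b1 b2)).
    by rewrite [leRHS](_ : _ = (e1 / 2)%:E + (e1 / 2)%:E)%E ?leeD// -EFinD -splitr.
  have rest : fine (lam ((\bigcup_i F i `\` G n) `&` E)) @[n --> \oo] --> (0 : R).
    apply: fine_decreasing0.
    - apply: le_lt_trans Eoo; apply: le_lam => //.
      by apply: borelI => //; apply: borelD => //; exact: borel_bigcup.
    - by move=> n; apply: borelI => //; apply: borelD => //; exact: borel_bigcup.
    - move=> i j ij x [[Fx nG] Ex]; split=> //; split=> // Gx; apply: nG.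
      by move: Gx; rewrite !GE => -[k ki Fk]; exists k => //=; exact: leq_trans ki ij.
    - rewrite -subset0 => x h; have [[[i _ Fi] _] _] := h 0%N I.
      have [[_ nG] _] := h i.+1 I; apply: nG; rewrite GE; exists i => //=.
  have [n hn] := cvg0_ex rest (divr_gt0 e'0 (ltr0n R 2)).
  have {}hn := hn n (leqnn n).
  have [C JC hC] := approxG n _ (divr_gt0 e'0 (ltr0n R 2)).
  have [bC CE] := JE JC; exists C => //.
  have b1 : borel ((G n `&` E) `+` C) by apply: borelY => //; exact: borelI.
  have b2 : borel ((\bigcup_i F i `\` G n) `&` E).
    by apply: borelI => //; apply: borelD => //; exact: borel_bigcup.
  apply: (@le_trans _ _ (lam (((G n `&` E) `+` C) `|` ((\bigcup_i F i `\` G n) `&` E)))).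
    apply: le_lam; [|exact: borelU|].
      by apply: borelY => //; apply: borelI => //; exact: borel_bigcup.
    rewrite !setY_def => x [[[Fx Ex] nC]|[Cx h]].
      have [Gx|nG] := pselect (G n x); last by right.
      by left; left.
    left; right; split=> // -[Gx Ex]; apply: h; split=> //.
    by move: Gx; rewrite GE => -[k _ Fk]; exists k.
  apply: (le_trans (lamU b1 b2)).
  rewrite [leRHS](_ : _ = (e' / 2)%:E + (e' / 2)%:E)%E; last by rewrite -EFinD -splitr.
  rewrite leeD//.
  have fb2 : lam ((\bigcup_i F i `\` G n) `&` E) \is a fin_num.
    by rewrite ge0_fin_numE//; apply: le_lt_trans Eoo; apply: le_lam.
  by rewrite -(fineK fb2) lee_fin ltW// (le_lt_trans (ler_norm _)).
Qed.

End approximation.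

Lemma fine_measure_sub d (T : measurableType d) (R : realType)
    (mu : {measure set T -> \bar R}) (A B : set T) :
  measurable A -> measurable B -> (mu A < +oo)%E -> (mu B < +oo)%E ->
  `|fine (mu A) - fine (mu B)| <= fine (mu (A `+` B)).
Proof.
move=> mA mB Aoo Boo.
have mY : measurable (A `+` B) by rewrite setY_def; apply: measurableU; exact: measurableD.
have Yoo : (mu (A `+` B) < +oo)%E.
  rewrite setY_def (le_lt_trans (measureU2 _ _ _))//; try exact: measurableD.
  rewrite lte_add_pinfty//; [apply: le_lt_trans Aoo|apply: le_lt_trans Boo];
    apply: le_measure; rewrite ?inE; by [exact: measurableD| |move=> x []].
have H C D : measurable C -> measurable D -> C `+` D = A `+` B -> (mu D < +oo)%E ->
    (mu C < +oo)%E -> fine (mu C) - fine (mu D) <= fine (mu (A `+` B)).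
  move=> mC mD e Doo Coo; rewrite lerBlDl -lee_fin EFinD !fineK ?ge0_fin_numE//.
  apply: le_trans (measureU2 _ mD mY).
  apply: le_measure; rewrite ?inE//; first exact: measurableU.
  move=> x Cx; have [Dx|nD] := pselect (D x); [by left|right].
  by rewrite -e setY_def; left.
rewrite ler_norml lerNl opprB !H//.
by rewrite !setY_def setUC.
Qed.

(** * Uniformity over Borel sets *)

Section second_order_borel.
Context {R : realType} {d : nat} {dT : measure_display} {T : measurableType dT}.
Variables (P : probability T R) (X : {RV P >-> borel_rV R d}).
Variables (nu : {measure set (borel_rV R d) -> \bar R}) (a : R -> R).
Hypotheses (rv : regularly_varying X nu) (so : second_order X nu a).
Variable e : R.
Hypothesis e0 : 0 < e.

Definition scaled_rv (u : R) (w : T) : borel_rV R d := u^-1 *: vec X w.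

Lemma measurable_scaled_rv u : measurable_fun setT (scaled_rv u).
Proof.
move=> _ B mB; rewrite setTI.
exact: (@measurable_scaled _ _ _ _ P X u B mB).
Qed.

HB.instance Definition _ u :=
  isMeasurableFun.Build _ _ _ _ (scaled_rv u) (measurable_scaled_rv u).

Let E : set 'rV[R]_d := cone_above e.

Let continuityE : continuity_set nu e E.
Proof.
have -> : E = cone_sublevel e (@radial R d) 1; last exact: (continuity_radial_sublevel rv e0 1).
apply/seteqP; split=> [x Ex|x []//]; split=> //.
by rewrite /radial -expR0 ler_expR oppr_le0 normr_ge0.
Qed.

(** A single continuity set must be close to B for the law of X / u and for [nu], so the
    approximation is made in their sum [lam]. Inside an open set U, the points at distance more than
    t from the complement serve, with t small and such that the level t of the distance is null. *)
Lemma approx_continuity u B eta : borel B -> 0 < eta ->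
  exists2 C, continuity_set nu e C &
    `|prob_scaled X u (B `&` E) - prob_scaled X u C| <= eta /\
    `|fine (nu (B `&` E)) - fine (nu C)| <= eta.
Proof.
move=> bB eta0.
pose pm : {measure set (borel_rV R d) -> \bar R} := distribution P (scaled_rv u).
pose lam : {measure set (borel_rV R d) -> \bar R} := measure_add pm nu.
have lamE A : lam A = (pm A + nu A)%E := measure_addE pm nu A.
have bE : borel E := borel_cone_above e.
have pmoo B' : borel B' -> (pm B' < +oo)%E.
  by move=> bB'; rewrite -ge0_fin_numE// fin_num_measure.
have lamoo : (lam E < +oo)%E.
  by rewrite lamE lte_add_pinfty//; [exact: pmoo|exact: (nu_cone_above_lty rv e0)].
have Jopen (U : set 'rV[R]_d) e' : open U -> 0 < e' ->
  exists2 C, continuity_set nu e C & (lam ((U `&` E) `+` C) <= e'%:E)%E.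
  move=> oU e'0.
  (* The distance to the complement is an infimum over a nonempty set only if U is not the whole
     space. *)
  have [UT|/existsNP[y nUy]] := pselect (forall x, U x).
    exists E => //; rewrite (_ : _ `+` _ = set0) ?measure0 ?lee_fin ?ltW//.
    rewrite (_ : U `&` E = E) ?setYK//.
    by apply/seteqP; split=> [x []//|x Ex]; split.
  pose h := set_dist (~` U); have A0 : ~` U !=set0 by exists y.
  have cU : closed (~` U) by rewrite closedC.
  have ch : continuous h by exact: set_dist_continuous.
  have hP x : 0 < h x <-> U x.
    by rewrite set_dist_gt0//; split=> [/contrapT//|Ux]; exact.
  have bl t : borel (cone_sublevel e h t) by apply: borel_closed; exact: closed_cone_sublevel.
  pose F i := (U `&` E) `&` cone_sublevel e h i.+1%:R^-1.
  have bF i : borel (F i).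
    by apply: borelI => //; apply: borelI => //; exact: borel_open.
  have Foo i : (lam (F i) < +oo)%E.
    apply: le_lt_trans lamoo; apply: le_measure; rewrite ?inE//; first exact: bF.
    by move=> x [[]].
  have F0 : fine (lam (F i)) @[i --> \oo] --> (0 : R).
    apply: fine_decreasing0 => //.
    - move=> i j ij x [UEx [Ex hx]]; split=> //; split=> //; apply: (le_trans hx).
      by rewrite lef_pV2 ?posrE// ler_nat.
    - rewrite -subset0 => x H; have [[/hP hx0 _] _] := H 0%N I.
      have [i _ hi] := near_infty_natSinv_lt (PosNum hx0).
      have [_ [_]] := H i I.
      by rewrite leNgt (hi i (leqnn i)).
  have [i hi] := cvg0_ex F0 e'0; have {}hi := hi i (leqnn i).
  have [t [t0 ti nt]] : exists t, [/\ 0 < t, t < i.+1%:R^-1 & nu (E `&` h @^-1` [set t]) = 0%E].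
    apply: null_level => //; first exact: (nu_cone_above_lty rv e0).
    by move=> t; apply: (@borel_closed R d); exact: closed_cone_level.
  exists (E `\` cone_sublevel e h t).
    apply: continuity_setD => //; exact: (continuity_sublevel rv e0 ch nt).
  apply: (@le_trans _ _ (lam (F i))); last first.
    by rewrite -(fineK (x := lam (F i))) ?ge0_fin_numE// lee_fin ltW// (le_lt_trans (ler_norm _)).
  apply: le_measure; rewrite ?inE//.
  - rewrite setY_def; apply: borelU; apply: borelD => //;
    by [apply: borelI => //; exact: borel_open|exact: borelD].
  - exact: bF.
  - rewrite setY_def => x [[[Ux Ex] nC]|[[Ex nh] nU]]; last first.
      exfalso; apply: nU; split=> //; apply/hP; rewrite ltNge; apply/negP => hx.
      by apply: nh; split=> //; exact: le_trans hx (ltW t0).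
    split=> //; split=> //; rewrite leNgt; apply/negP => hx; apply: nC; split=> // -[_].
    by rewrite leNgt (lt_trans ti hx).
have [C JC hC] := @approx_borel R d lam E (continuity_set nu e) bE lamoo
  (fun C hC => let: And3 h1 h2 _ := hC in conj h1 h2) continuityE
  (@continuity_setU _ _ nu e) (@continuity_setD _ _ nu e) Jopen B eta bB eta0.
exists C => //; have [bC CE _] := JC.
have bBE : borel (B `&` E) by exact: borelI.
have bY : borel ((B `&` E) `+` C) by rewrite setY_def; apply: borelU; exact: borelD.
have YE : (B `&` E) `+` C `<=` E.
  by rewrite setY_def => x [[[]//]|[/CE]].
have fnu B' : borel B' -> B' `<=` E -> (nu B' < +oo)%E.
  by move=> bB' B'E; rewrite -ge0_fin_numE// (nu_fin rv e0).
move: hC; rewrite lamE -(fineK (x := pm _)) ?ge0_fin_numE ?pmoo//.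
rewrite -(fineK (x := nu _)) ?ge0_fin_numE ?fnu// -EFinD lee_fin => hC.
split.
- apply: le_trans (_ : fine (pm ((B `&` E) `+` C)) <= _).
    apply: (@fine_measure_sub _ (borel_rV R d) R pm) => //; exact: pmoo.
  by apply: le_trans hC; rewrite lerDl fine_ge0.
- apply: le_trans (_ : fine (nu ((B `&` E) `+` C)) <= _).
    by apply: (@fine_measure_sub _ (borel_rV R d) R nu) => //; apply: fnu.
  by apply: le_trans hC; rewrite lerDr fine_ge0.
Qed.

(** At a fixed n the bound c |a (u n)| is the same for all continuity sets, so it survives the
    approximation of B, where the approximating set depends on n and [eta]. *)
Lemma second_order_borel (u : nat -> R) : u n @[n --> \oo] --> +oo ->
  exists c N, 0 <= c /\ forall n, (N <= n)%N -> forall B, borel B -> B `<=` cone_above e ->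
    `|prob_scaled X (u n) B / norm_tail X (u n) - fine (nu B)| <= c * `|a (u n)|.
Proof.
move=> uoo; have [c [N [c0 H]]] := second_order_continuity rv e0 so uoo.
exists c, N; split=> // n Nn B bB BE; apply/ler_addgt0Pr => eta eta0.
(* The error on the scaled probability gets multiplied by t and the error on [nu] by 1; at size eta
   / (t + 1) they add up to [eta]. *)
pose t := (norm_tail X (u n))^-1.
have t0 : 0 <= t by rewrite invr_ge0 norm_tail_ge0.
have t10 : 0 < t + 1 by rewrite ltr_wpDl.
have [C JC] := approx_continuity (u n) bB (divr_gt0 eta0 t10).
rewrite (_ : B `&` E = B); last by apply/setIidl.
move=> [h1 h2]; have h3 := H n Nn C JC.
have e1 : `|(prob_scaled X (u n) B - prob_scaled X (u n) C) * t| <= eta / (t + 1) * t.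
  by rewrite normrM (ger0_norm t0) ler_wpM2r.
have e2 : eta / (t + 1) * t + eta / (t + 1) = eta by field; rewrite gt_eqF.
rewrite [X in `|X|](_ : _ = (prob_scaled X (u n) B - prob_scaled X (u n) C) * t +
  (prob_scaled X (u n) C / norm_tail X (u n) - fine (nu C)) -
  (fine (nu B) - fine (nu C))); last by rewrite /t; ring.
set x1 := (X in `|X + _ - _|); set x2 := (X in `|_ + X - _|); set x3 := (X in `|_ - X|).
rewrite -/x1 in e1; rewrite -/x2 in h3; rewrite -/x3 in h2.
have := ler_normB (x1 + x2) x3; have := ler_normD x1 x2.
move: e1 h2 h3 e2.
move: `|x1| `|x2| `|x3| `|x1 + x2| `|x1 + x2 - x3| (c * _) (eta / _) (eta / _ * t).
by move=> *; lra.
Qed.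

End second_order_borel.

(** * Exceedance counts *)

Lemma coord_le_norm (R : realType) d (x : 'rV[R]_d) j : `|x ord0 j| <= `|x|.
Proof.
change (`|x ord0 j| <= mx_norm x); rewrite mx_normrE.
exact: (le_bigmax _ (fun ij : 'I_1 * 'I_d => `|x ij.1 ij.2|) (ord0, j)).
Qed.

(** * Tail quantiles and expected counts *)

Section tail_quantile.
Context {R : realType} {d : nat} {dT : measure_display} {T : measurableType dT}.
Variables (P : probability T R) (X : {RV P >-> borel_rV R d}).
Variables (nu : {measure set (borel_rV R d) -> \bar R}) (a : R -> R).
Hypotheses (hd : (1 <= d)%N) (pareto : standard_pareto_margins X).
Hypotheses (X0 : orthant_valued X).
Hypotheses (rv : regularly_varying X nu) (so : second_order X nu a).

Lemma measurable_norm_tail u : measurable [set w | u < `|vec X w|].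
Proof. exact: (measurable_funPTI X (borel_open (@open_norm_gt R d u))). Qed.

Lemma norm_tail_mono u v : u <= v -> norm_tail X v <= norm_tail X u.
Proof.
move=> uv; rewrite /norm_tail fine_le ?fin_num_measure//; try exact: measurable_norm_tail.
apply: le_measure; rewrite ?inE; try exact: measurable_norm_tail.
by move=> w /=; exact: le_lt_trans.
Qed.

(** One Pareto coordinate already gives the tail 1 / u; this is what makes the tail quantile tend to
    infinity. *)
Lemma norm_tail_ge u : 1 <= u -> u^-1 <= norm_tail X u.
Proof.
move=> u1; have u0 : 0 < u by exact: lt_le_trans u1.
have := pareto (Ordinal hd) u1 => h.
have -> : u^-1 = fine (P [set w | u < vec X w ord0 (Ordinal hd)]) by rewrite h.
have mj : measurable [set w | u < vec X w ord0 (Ordinal hd)].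
  have oj : open [set x : 'rV[R]_d | u < x ord0 (Ordinal hd)].
    apply: (@open_comp _ _ (fun x : 'rV[R]_d => x ord0 (Ordinal hd)) [set y | u < y]).
      by move=> x _; exact: coord_continuous.
    exact: open_gt.
  exact: (measurable_funPTI X (borel_open oj)).
rewrite fine_le ?fin_num_measure//; try exact: measurable_norm_tail.
apply: le_measure; rewrite ?inE//; first exact: measurable_norm_tail.
move=> w /= h1; apply: (lt_le_trans h1); apply: le_trans (ler_norm _) (coord_le_norm _ _).
Qed.

Lemma norm_tail_lt0 u : u < 0 -> norm_tail X u = 1.
Proof.
move=> u0; rewrite /norm_tail (_ : [set w | _] = setT) ?probability_setT//.
by apply/seteqP; split=> // w _ /=; exact: lt_le_trans u0 (normr_ge0 _).
Qed.

Lemma norm_tail_cvg0 : norm_tail X i%:R @[i --> \oo] --> (0 : R).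
Proof.
apply: (@fine_decreasing0 _ _ _ P (fun i => [set w | i%:R < `|vec X w|])).
- by rewrite -ge0_fin_numE// fin_num_measure//; exact: measurable_norm_tail.
- by move=> i; exact: measurable_norm_tail.
- by move=> i j ij w /=; apply: le_lt_trans; rewrite ler_nat.
- rewrite -subset0 => w h.
  have := h (Num.Def.trunc `|vec X w|).+1 I.
  by rewrite /= ltNge ltW// truncnS_gt.
Qed.

Lemma tail_quantile_has_inf t : 1 < t -> has_inf [set u : R | norm_tail X u <= t^-1].
Proof.
move=> t1; have t0 : 0 < t by exact: lt_trans t1.
split.
  have ti0 : 0 < t^-1 by rewrite invr_gt0.
  have [N HN] := cvg0_ex norm_tail_cvg0 ti0.
  by exists N%:R => /=; rewrite ltW// (le_lt_trans (ler_norm _) (HN N (leqnn N))).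
exists 0 => u /= h; rewrite leNgt; apply/negP => /norm_tail_lt0 e1.
by move: h; rewrite e1 leNgt invf_lt1 ?t1.
Qed.

Lemma gt_tail_quantile t u : 1 < t -> tail_quantile X t < u -> norm_tail X u <= t^-1.
Proof.
move=> t1 h; have [ne lb] := tail_quantile_has_inf t1.
have [y /= hy yu] := inf_lt ne h; apply: le_trans hy.
by apply: norm_tail_mono; exact: ltW.
Qed.

Lemma lt_tail_quantile t u : 1 < t -> u < tail_quantile X t -> t^-1 < norm_tail X u.
Proof.
move=> t1 h; rewrite ltNge; apply/negP => h1.
have [ne lb] := tail_quantile_has_inf t1.
by have := ge_inf lb h1; rewrite leNgt h.
Qed.

Lemma tail_quantile_ge t M : 1 <= M -> M < t -> M <= tail_quantile X t.
Proof.
move=> M1 Mt; have [ne lb] := tail_quantile_has_inf (le_lt_trans M1 Mt).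
apply: lb_le_inf => // u /= h; rewrite leNgt; apply/negP => /ltW uM.
have := norm_tail_mono uM; rewrite leNgt => /negP; apply; apply: le_lt_trans h _.
apply: lt_le_trans (norm_tail_ge M1); rewrite ltf_pV2 ?posrE//.
  by apply: lt_trans Mt; apply: lt_le_trans M1.
exact: lt_le_trans M1.
Qed.

(** The set {|x| > 2} has exponent measure 1/2, so the ratio of the tails at 2 u and u tends to 1/2
    and eventually exceeds 1/3. *)
Lemma norm_tail2 (u : nat -> R) : u n @[n --> \oo] --> +oo ->
  exists N, forall n, (N <= n)%N -> norm_tail X (u n) <= 3 * norm_tail X (2 * u n).
Proof.
move=> uoo; have [c [N1 [c0 H]]] := second_order_borel rv so ltr01 uoo.
have au : a (u n) @[n --> \oo] --> (0 : R).
  by apply: (cvg_comp _ a) so.1.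
(* 1/6 is the gap between 1/2 and 1/3. *)
have d0 : 0 < 6^-1 / (c + 1) by rewrite divr_gt0 ?invr_gt0// ltr_wpDl.
have [N2 HN2] := cvg0_ex au d0.
have [N3 _ HN3] := (cvgryPgt _).1 uoo 0.
exists (maxn N1 (maxn N2 N3)) => n; rewrite !geq_max => /and3P[n1 n2 n3].
have u0 : 0 < u n := HN3 n n3.
pose B : set 'rV[R]_d := dilation 2 outside_unit.
have bB : borel B by apply: borel_dilation => //; exact: borel_outside_unit.
have BE x : B x <-> orthant x /\ 2 < `|x|.
  rewrite /B dilationE//; split=> -[ox hx]; split.
  - by move=> j; have := ox j; rewrite mxE pmulr_rge0 ?invr_gt0.
  - by move: hx; rewrite /= normrZ gtr0_norm ?invr_gt0// ltr_pdivlMl// mulr1.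
  - by apply: orthantZ; rewrite ?invr_ge0.
  - by rewrite /= normrZ gtr0_norm ?invr_gt0// ltr_pdivlMl// mulr1.
have B1 : B `<=` cone_above 1.
  by move=> x /BE[ox hx]; split=> //=; apply: ltW; apply: lt_trans hx; rewrite ltr1n.
have nB : fine (nu B) = 2^-1.
  rewrite (nu_dilation rv)//; first by rewrite (rv_prob rv) mule1.
  - exact: borel_outside_unit.
  - by move=> x [].
  - by exists 1 => // x [_ /ltW].
have pB : prob_scaled X (u n) B = norm_tail X (2 * u n).
  rewrite /prob_scaled /norm_tail; congr (fine (P _)); apply/seteqP; split=> w /=.
    move=> /BE[_]; rewrite normrZ gtr0_norm ?invr_gt0// ltr_pdivlMl//.
    by rewrite mulrC.
  move=> h; apply/BE; split; first by apply: orthantZ; [rewrite invr_ge0 ltW|exact: X0].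
  by rewrite normrZ gtr0_norm ?invr_gt0// ltr_pdivlMl// mulrC.
have := H n n1 B bB B1; rewrite pB nB => h.
have ha : c * `|a (u n)| <= 6^-1.
  have := HN2 n n2; rewrite ltr_pdivlMr ?ltr_wpDl// => h2.
  by apply: ltW; apply: le_lt_trans h2; rewrite mulrC ler_wpM2l// lerDl.
have [->|nt] := eqVneq (norm_tail X (u n)) 0.
  by rewrite mulr_ge0// norm_tail_ge0.
have ntp : 0 < norm_tail X (u n) by rewrite lt_neqAle eq_sym nt norm_tail_ge0.
have : 3^-1 <= norm_tail X (2 * u n) / norm_tail X (u n).
  move: (le_trans h ha); rewrite ler_norml => /andP[h1 _].
  by move: h1; move: (_ / _) => y; lra.
by rewrite ler_pdivlMr// => h1; rewrite -ler_pdivrMl.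
Qed.

Variable k : nat -> nat.
Hypothesis k0 : forall n, (0 < k n)%N.
Hypothesis kn : (k n)%:R / n%:R @[n --> \oo] --> (0 : R).

Definition quantile_level n := tail_quantile X (n%:R / (k n)%:R).

Definition mean_exceedances n := n%:R * norm_tail X (quantile_level n).

Hypothesis ka : Num.sqrt (k n)%:R * a (quantile_level n) @[n --> \oo] --> (0 : R).

Let kR0 n : 0 < (k n)%:R :> R.
Proof. by rewrite ltr0n. Qed.

Lemma ratio_large (M : R) : 0 < M -> exists N, forall n, (N <= n)%N ->
  (0 < n)%N /\ M < n%:R / (k n)%:R :> R.
Proof.
move=> M0; have Mi0 : 0 < M^-1 by rewrite invr_gt0.
have [N HN] := cvg0_ex kn Mi0.
exists (maxn 1 N) => n; rewrite geq_max => /andP[n0 Nn]; split=> //.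
have n0' : 0 < n%:R :> R by rewrite ltr0n.
have := HN n Nn; rewrite ger0_norm ?divr_ge0//.
by rewrite -[_ / _]invrK invf_div ltf_pV2 ?posrE ?invr_gt0 ?divr_gt0.
Qed.

Lemma quantile_level_cvg (s : R) : 0 < s -> s * quantile_level n @[n --> \oo] --> +oo.
Proof.
move=> s0; apply/cvgryPge => M.
pose M' := Num.max 1 (M / s).
have h1 : 1 <= M' by rewrite le_max lexx.
have [N HN] := ratio_large (lt_le_trans ltr01 h1).
exists N => // n /= /HN[_ h].
have := tail_quantile_ge h1 h; rewrite ge_max => /andP[_].
by rewrite ler_pdivrMr// mulrC.
Qed.

(** The tail may jump at its quantile, so n P(|X| > u_n) need not equal k_n. The quantile controls
    the tail strictly on either side, at u_n / 2 and at 2 u_n, and [norm_tail2] brings both bounds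
    to u_n at the cost of a factor 3. *)
Lemma mean_exceedances_bounds : exists N, forall n, (N <= n)%N ->
  [/\ 0 < quantile_level n, (k n)%:R <= 3 * mean_exceedances n &
      mean_exceedances n <= 3 * (k n)%:R].
Proof.
have h20 : 0 < 2^-1 :> R by rewrite invr_gt0.
have [N1 H1] := norm_tail2 (quantile_level_cvg h20).
have [N2 H2] := norm_tail2 (quantile_level_cvg ltr01).
have [N3 H3] := ratio_large ltr01.
have [N4 _ H4] := (cvgryPge _).1 (quantile_level_cvg ltr01) 1.
exists (maxn (maxn N1 N2) (maxn N3 N4)) => n; rewrite !geq_max.
move=> /andP[/andP[/H1 h1 /H2 h2] /andP[/H3[n0 h3] /H4]].
rewrite /= mul1r in h2; rewrite /= mul1r => h4.
have u0 : 0 < quantile_level n by exact: lt_le_trans h4.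
have n0' : 0 < n%:R :> R by rewrite ltr0n.
rewrite mulrA divff ?mul1r// in h1.
have l1 : norm_tail X (2 * quantile_level n) <= (n%:R / (k n)%:R)^-1.
  by apply: gt_tail_quantile => //; rewrite -/(quantile_level n); lra.
have l2 : (n%:R / (k n)%:R)^-1 < norm_tail X (2^-1 * quantile_level n).
  by apply: lt_tail_quantile => //; rewrite -/(quantile_level n); lra.
rewrite invf_div in l1 l2.
split=> //; rewrite /mean_exceedances.
- have := lt_le_trans l2 h1; rewrite ltr_pdivrMr// => /ltW.
  by rewrite (mulrC n%:R) mulrA.
- have := le_trans h2 (ler_wpM2l (ler0n _ 3) l1).
  by rewrite mulrA ler_pdivlMr// mulrC.
Qed.

(** The difference is [mean_exceedances n] times the second-order error, hence at most 3 k_n c |a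
    (u_n)|, which is sqrt k_n times a null sequence. *)
Lemma mean_count_rate e eta : 0 < e -> 0 < eta -> exists N, forall n, (N <= n)%N ->
  forall B, borel B -> B `<=` cone_above e ->
  `|n%:R * prob_scaled X (quantile_level n) B - mean_exceedances n * fine (nu B)| <=
    eta * Num.sqrt (k n)%:R.
Proof.
move=> e0 eta0; have [N1 H1] := mean_exceedances_bounds.
have uoo : quantile_level n @[n --> \oo] --> +oo.
  by have := quantile_level_cvg ltr01; under eq_fun do rewrite mul1r.
have [c [N2 [c0 H2]]] := second_order_borel rv so e0 uoo.
have t0 : 0 < eta / (3 * c + 1) by rewrite divr_gt0// ltr_wpDl// mulr_ge0.
have [N3 H3] := cvg0_ex ka t0.
exists (maxn N1 (maxn N2 N3)) => n; rewrite !geq_max => /and3P[/H1[u0 m1 m2] n2 /H3 h3] B bB Be.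
have h2 := H2 n n2 B bB Be.
have m0 : 0 < mean_exceedances n by have := kR0 n; lra.
have nt : norm_tail X (quantile_level n) != 0.
  by apply: contraTneq m0 => e1; rewrite /mean_exceedances e1 mulr0 ltxx.
rewrite (_ : n%:R * _ - _ = mean_exceedances n *
  (prob_scaled X (quantile_level n) B / norm_tail X (quantile_level n) - fine (nu B))); last first.
  by rewrite /mean_exceedances; field.
rewrite normrM gtr0_norm//; set y := `|_ - _| in h2 *.
set q := Num.sqrt (k n)%:R in h3 *.
have q0 : 0 <= q by exact: sqrtr_ge0.
have qq : q * q = (k n)%:R by rewrite -expr2 sqr_sqrtr.
rewrite normrM (ger0_norm q0) in h3.
apply: (@le_trans _ _ (3 * (q * q) * (c * `|a (quantile_level n)|))).
  by rewrite qq; apply: ler_pM; [exact: ltW|exact: normr_ge0|exact: m2|exact: h2].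
rewrite (_ : 3 * (q * q) * _ = (3 * c) * (q * `|a (quantile_level n)|) * q); last by ring.
apply: ler_wpM2r => //.
have c30 : 0 <= 3 * c by rewrite mulr_ge0.
apply: (@le_trans _ _ ((3 * c + 1) * (eta / (3 * c + 1)))).
  by apply: ler_pM => //; [rewrite mulr_ge0|rewrite lerDl|exact: ltW].
by rewrite mulrC divfK// gt_eqF// ltr_wpDl.
Qed.

End tail_quantile.

(** * Events of large probability *)

Section likely_events.
Context d (S : measurableType d) (R : realType) (P : probability S R).
Implicit Types (Q : nat -> set S) (eps : R).

(** Q n need not be measurable, whence the measurable G inside it. The level [eps] is kept fixed
    here because tightness statements hold with a bound that depends on it. *)
Definition likely eps Q := exists N, forall n, (N <= n)%N ->
  exists G, [/\ measurable G, G `<=` Q n & (P (~` G) <= eps%:E)%E].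

Definition whp Q := forall eps, 0 < eps -> likely eps Q.

Lemma likely_mono eps Q Q' :
  (exists N, forall n, (N <= n)%N -> Q n `<=` Q' n) -> likely eps Q -> likely eps Q'.
Proof.
move=> [N1 H1] [N2 H2]; exists (maxn N1 N2) => n; rewrite geq_max => /andP[n1 n2].
have [G [mG GQ PG]] := H2 n n2; exists G; split=> //.
by move=> w /GQ; exact: H1.
Qed.

Lemma likelyI e1 e2 Q1 Q2 : likely e1 Q1 -> likely e2 Q2 ->
  likely (e1 + e2) (fun n => Q1 n `&` Q2 n).
Proof.
move=> [N1 H1] [N2 H2]; exists (maxn N1 N2) => n; rewrite geq_max => /andP[n1 n2].
have [G1 [mG1 GQ1 PG1]] := H1 n n1; have [G2 [mG2 GQ2 PG2]] := H2 n n2.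
exists (G1 `&` G2); split; first exact: measurableI.
  by move=> w [/GQ1 ? /GQ2 ?].
rewrite setCI EFinD; apply: (le_trans (measureU2 _ _ _)); try exact: measurableC.
exact: leeD.
Qed.

Lemma likely_le e1 e2 Q : e1 <= e2 -> likely e1 Q -> likely e2 Q.
Proof.
move=> e12 [N H]; exists N => n /H[G [mG GQ PG]]; exists G; split=> //.
by apply: le_trans PG _; rewrite lee_fin.
Qed.

Lemma whp_mono Q Q' :
  (exists N, forall n, (N <= n)%N -> Q n `<=` Q' n) -> whp Q -> whp Q'.
Proof. by move=> H QQ e /QQ; exact: likely_mono. Qed.

Lemma whpI Q1 Q2 : whp Q1 -> whp Q2 -> whp (fun n => Q1 n `&` Q2 n).
Proof.
move=> H1 H2 e e0; have e20 : 0 < e / 2 by rewrite divr_gt0.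
by rewrite [e]splitr; apply: likelyI; [exact: H1|exact: H2].
Qed.

Lemma whpT : whp (fun=> setT).
Proof.
move=> e e0; exists 0%N => n _; exists setT; split => //.
by rewrite setCT measure0 lee_fin ltW.
Qed.

Lemma whp_forall (I : finType) (Q : I -> nat -> set S) : (forall i, whp (Q i)) ->
  whp (fun n => [set w | forall i, Q i n w]).
Proof.
move=> H; suff : whp (fun n => [set w | forall i, i \in enum I -> Q i n w]).
  by apply: whp_mono; exists 0%N => n _ w h i; apply: h; rewrite mem_enum.
elim: (enum I) => [|i s IH].
  by apply: whp_mono whpT; exists 0%N => n _ w _ i.
apply: whp_mono (whpI (H i) IH); exists 0%N => n _ w [h1 h2] j.
by rewrite inE => /orP[/eqP->//|]; exact: h2.
Qed.

End likely_events.

(** * Chebyshev bounds for counts *)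

Section counts.
Context d d' (S : measurableType d) (E : measurableType d') (R : realType)
  (P : probability S R) (I : choiceType) (Z : I -> {RV P >-> E}).
Hypothesis hind : mutually_independent P (fun i => Z i : S -> E).

Lemma coded_law_sum (C : finType) (W : zmodType) (c : I -> E -> C) (V : I -> C -> W) i
    (F : R * W -> R) : \sum_(a <- coded_law Z c V i) F a =
  \sum_(a : C) F (fine (P (Z i @^-1` (c i @^-1` [set a]))), V i a).
Proof. by rewrite big_map big_enum. Qed.

(** Averaging y^2 over a centred step adds the variance of that step. This is the additivity of
    variances for independent summands, in operator form and for any F below the square. *)
Lemma foldr_step_sqr (mu : I -> seq (R * R)) (v : R) (s : seq I) :
  (forall i, i \in s -> is_law (mu i) /\ mean1 (mu i) = 0 /\ var1 (mu i) <= v) ->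
  forall F : R -> R, (forall y, F y <= y ^+ 2) -> forall x,
  foldr (fun i => step (mu i)) F s x <= x ^+ 2 + (size s)%:R * v.
Proof.
move=> H F HF; elim: s H => [|i s IH] H x /=.
  by rewrite mul0r addr0; exact: HF.
have [mulaw [mu1 mu2]] := H i (mem_head _ _).
have {}IH := IH (fun j js => H j (mem_behead (s := i :: s) js)).
apply: le_trans (ler_step mulaw IH x) _.
have mass : \sum_(a <- mu i) a.1 = 1 by case: mulaw.
rewrite /step (_ : \sum_(a <- _) _ = x ^+ 2 * \sum_(a <- mu i) a.1 +
   2 * x * mean1 (mu i) + var1 (mu i) + (size s)%:R * v * \sum_(a <- mu i) a.1); last first.
  rewrite /mean1 /var1 !mulr_sumr -!big_split; apply: eq_bigr => a _ /=; ring.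
rewrite mass mu1 mulr0 addr0 !mulr1 -addrA lerD2l -[X in _ <= X * v]natr1 mulrDl mul1r addrC.
by rewrite lerD2l.
Qed.

Definition count_in (D : set E) (s : seq I) (w : S) : R := \sum_(i <- s) \1_D (Z i w).

Lemma count_chebyshev (D : set E) (p : R) (s : seq I) (t : R) : uniq s ->
  measurable D -> (forall i, i \in s -> P (Z i @^-1` D) = p%:E) -> 0 < t ->
  measurable [set w | t <= `|count_in D s w - (size s)%:R * p|] /\
  fine (P [set w | t <= `|count_in D s w - (size s)%:R * p|]) <= (size s)%:R * p / t ^+ 2.
Proof.
move=> us mD Dp t0.
pose c (i : I) (z : E) : bool := z \in D.
pose V (i : I) (b : bool) : R := b%:R - p.
have hc i a : measurable (c i @^-1` [set a]).
  case: a.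
  - rewrite (_ : _ @^-1` _ = D)//.
    by apply/seteqP; split=> z; [exact: set_mem|exact: mem_set].
  - rewrite (_ : _ @^-1` _ = ~` D); first exact: measurableC.
    by apply/seteqP; split=> z /=; rewrite /c; [move=> /negbT; rewrite notin_setE|
      move=> nD; apply/negbTE; rewrite notin_setE].
have E1 w : count_in D s w - (size s)%:R * p = 0 + \sum_(i <- s) V i (c i (Z i w)).
  rewrite add0r /V sumrB /count_in; congr (_ - _).
  by rewrite big_const_seq count_predT iter_addr_0 mulr_natl.
pose F (y : R) := t <= `|y|.
have -> : [set w | t <= `|count_in D s w - (size s)%:R * p|] =
    [set w | F (0 + \sum_(i <- s) V i (c i (Z i w)))].
  by apply/seteqP; split=> w /=; rewrite E1.
split; first exact: (@measurable_coded_sum _ _ _ _ _ P _ Z _ _ c V hc F s 0).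
rewrite (coded_sum_prob hind V hc)//.
have t20 : 0 < t ^+ 2 by exact: exprn_gt0.
have law i : i \in s -> mean1 (coded_law Z c V i) = 0 /\ var1 (coded_law Z c V i) = p * (1 - p).
  move=> si; rewrite /mean1 /var1 !coded_law_sum !big_bool/=.
  have e1 : fine (P (Z i @^-1` (c i @^-1` [set true]))) = p.
    rewrite (_ : _ @^-1` [set true] = D) ?Dp//.
    by apply/seteqP; split=> z; [exact: set_mem|exact: mem_set].
  have e2 : fine (P (Z i @^-1` (c i @^-1` [set false]))) = 1 - p.
    have := (coded_law_law Z V hc i).2.
    by rewrite coded_law_sum big_bool/= e1 => h; lra.
  have V1 : V i true = 1 - p by [].
  have V0 : V i false = 0 - p by [].
  by rewrite e1 e2 V1 V0; split; ring.
have p01 i : i \in s -> 0 <= p <= 1.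
  by move=> si; rewrite -!lee_fin -(Dp i si) measure_ge0 probability_le1//; exact: measurable_funPTI.
(* The empty list is treated apart: there nothing is known about p, but both sides are 0. *)
case: (s) us Dp law p01 => [|i0 s'] us Dp law p01.
  by rewrite /= /F normr0 [t <= 0]leNgt t0 !mul0r.
rewrite ler_pdivlMr//.
pose G y := t ^+ 2 * (F y)%:R.
have GF s1 x : t ^+ 2 * foldr (fun i => step (coded_law Z c V i)) (fun y => (F y)%:R) s1 x =
  foldr (fun i => step (coded_law Z c V i)) G s1 x.
  elim: s1 x => [//|i s1 IH] x /=.
  by rewrite -[LHS]/((fun x => t ^+ 2 * step _ _ x) x) -stepZ; congr (step _ _ x); apply/funext.
rewrite mulrC GF.
apply: le_trans (_ : 0 ^+ 2 + (size (i0 :: s'))%:R * (p * (1 - p)) <= _).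
  apply: foldr_step_sqr => [i si|y].
    have [h1 h2] := law i si; split; first exact: coded_law_law.
    by rewrite h1 h2.
  rewrite /G /F; case: (boolP (t <= _)) => h; rewrite ?mulr1 ?mulr0 ?sqr_ge0//.
  by rewrite -[y ^+ 2]real_normK ?num_real// lerXn2r ?nnegrE// ltW.
rewrite expr0n/= add0r ler_wpM2l// -[leRHS]mulr1.
have /andP[h1 h2] := p01 i0 (mem_head _ _).
by rewrite ler_wpM2l// gerBl.
Qed.

End counts.

(** * Replacing the random level *)

(** All that is kept of a boolean combination is that membership of a point of the orthant is
    decided by finitely many generators. The restriction to the orthant reflects that complements
    are taken there. *)
Lemma boolean_combination_generators (R : realType) d (G : set (set 'rV[R]_d)) A :
  boolean_combination G A -> exists (I : finType) (B : I -> set 'rV[R]_d),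
    (forall i, G (B i)) /\
    forall x y, orthant x -> orthant y -> (forall i, B i x <-> B i y) -> (A x <-> A y).
Proof.
elim=> [B GB|A1 A2 _ [I1 [B1 [G1 H1]]] _ [I2 [B2 [G2 H2]]]|A1 A2 _ [I1 [B1 [G1 H1]]] _ [I2 [B2 [G2 H2]]]|B _ [I [B1 [G1 H1]]]].
- by exists unit, (fun=> B); split=> // x y _ _ h; exact: (h tt).
- exists (I1 + I2)%type, (fun i => match i with inl a => B1 a | inr b => B2 b end).
  split=> [[i|i]//|x y ox oy h].
  have h1 := H1 x y ox oy (fun i => h (inl i)); have h2 := H2 x y ox oy (fun i => h (inr i)).
  by split=> -[?|?]; [left; tauto|right; tauto|left; tauto|right; tauto].
- exists (I1 + I2)%type, (fun i => match i with inl a => B1 a | inr b => B2 b end).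
  split=> [[i|i]//|x y ox oy h].
  have h1 := H1 x y ox oy (fun i => h (inl i)); have h2 := H2 x y ox oy (fun i => h (inr i)).
  by split=> -[? ?]; split; tauto.
- exists I, B1; split=> // x y ox oy h; have := H1 x y ox oy h.
  by move=> [h1 h2]; split=> -[_ nB]; split=> //; tauto.
Qed.

(** * Order statistics and radial sets *)

Section risk_geometry.
Context {R : realType} {d : nat}.
Variable r : 'rV[R]_d -> R.
Hypothesis hr : risk_functional r.
Implicit Types (A B : set 'rV[R]_d).

Local Notation Omega := (risk_region r).

Lemma borel_risk_region : borel Omega.
Proof.
have h := (risk_measurable hr : measurable_fun (orthant : set (borel_rV R d)) (r : borel_rV R d -> R))
  borel_orthant `]1, +oo[%classic (measurable_itv `]1, +oo[).
rewrite (_ : Omega = orthant `&` r @^-1` `]1, +oo[)//.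
by apply/seteqP; split=> x [ox /=]; rewrite ?in_itv/= ?andbT.
Qed.

Lemma dilation_risk_region s x : 0 < s -> orthant x -> dilation s Omega x <-> s < r x.
Proof.
move=> s0 ox; have os : orthant (s^-1 *: x) by apply: orthantZ => //; rewrite invr_ge0 ltW.
rewrite dilationE ?gt_eqF//=; split=> [[_ /=]|h].
  by rewrite (risk_homogeneous hr) ?invr_gt0// ltr_pdivlMl// mulr1.
by split=> //=; rewrite (risk_homogeneous hr) ?invr_gt0// ltr_pdivlMl// mulr1.
Qed.

Lemma radial_risk_region : radial_class r Omega.
Proof.
split=> //; first exact: borel_risk_region.
move=> t t1 _ [x [ox rx] <-]; have t0 : 0 < t by exact: lt_trans t1.
split; first by apply: orthantZ => //; exact: ltW.
rewrite /= (risk_homogeneous hr)//; apply: lt_trans t1 _.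
by rewrite -[ltLHS]mulr1 ltr_pM2l.
Qed.

Lemma radial_dilation_le B a b : radial_class r B -> 0 < a -> a <= b ->
  dilation b B `<=` dilation a B.
Proof.
move=> [_ _ H] a0; rewrite le_eqVlt => /predU1P[->//|ab].
have -> : b = a * (b / a) by rewrite mulrC divfK ?gt_eqF.
by rewrite -dilationM; apply: dilationS; apply: H; rewrite ltr_pdivlMr// mul1r.
Qed.

(** The generators of all the A_j are pooled and [risk_region r], itself radial, is added. In
    [option 'I_K] the index [None] stands for the whole region, which is then handled like the
    classes. *)
Lemma radial_family K (A : 'I_K -> set 'rV[R]_d) : admissible_partition r A ->
  exists (J : finType) (B : J -> set 'rV[R]_d),
    [/\ forall g, radial_class r (B g), exists g0, B g0 = Omega &
    forall (j : option 'I_K) x y, orthant x -> orthant y -> (forall g, B g x <-> B g y) ->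
      (oapp A Omega j x <-> oapp A Omega j y)].
Proof.
move=> [_ hA].
have /choice[F HF] : forall j, exists IB : {I : finType & I -> set 'rV[R]_d},
    (forall i, radial_class r (projT2 IB i)) /\
    forall x y, orthant x -> orthant y -> (forall i, projT2 IB i x <-> projT2 IB i y) ->
      (A j x <-> A j y).
  move=> j; have [I [B HB]] := boolean_combination_generators (hA j).
  by exists (existT _ I B).
pose J : finType := option {j : 'I_K & projT1 (F j)}.
pose B (g : J) : set 'rV[R]_d := oapp (fun s => projT2 (F (tag s)) (tagged s)) Omega g.
exists J, B; split=> [[[j i]|]||[j|] x y ox oy h].
- by have [h _] := HF j; exact: h.
- exact: radial_risk_region.
- by exists None.
- have [_ H] := HF j; apply: H => // i.
  exact: (h (Some (Tagged (fun j => projT1 (F j)) i))).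
- exact: (h None).
Qed.

Lemma order_statistic_gt (x : nat -> 'rV[R]_d) n k c : (k < n)%N ->
  (c < order_statistic r x n (n - k)) =
  (k < count (fun i => (c < r (x i))%R) (iota 0 n))%N.
Proof.
move=> kn; apply/idP/idP => h.
  apply: leq_trans (count_ge_order_statistic r x kn) _; apply: sub_count => i /=.
  exact: lt_le_trans.
rewrite ltNge; apply/negP => h1; move: h; rewrite ltnNge => /negP; apply.
apply: leq_trans (count_gt_order_statistic r x kn); apply: sub_count => i /=.
exact: le_lt_trans.
Qed.

Definition scaled_count (x : nat -> 'rV[R]_d) (u : R) n (D : set 'rV[R]_d) : R :=
  \sum_(i <- iota 0 n) \1_D (u^-1 *: x i).

Lemma indic_iff (V W : Type) (A : set V) (B : set W) y z : (A y <-> B z) ->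
  \1_A y = \1_B z :> R.
Proof.
move=> h; rewrite !indicE; case: (boolP (z \in B)) => [/set_mem/h/mem_set ->//|].
by rewrite notin_setE => nB; rewrite memNset// => /h.
Qed.

Lemma indicBD (V : Type) (A B : set V) z :
  \1_A z - \1_B z = \1_(A `\` B) z - \1_(B `\` A) z :> R.
Proof. by rewrite !indicE !in_setD; case: (z \in A); case: (z \in B); rewrite /= ?subrr ?subr0 ?sub0r. Qed.

Lemma scaled_countB x u n (A B : set 'rV[R]_d) :
  scaled_count x u n A - scaled_count x u n B =
  scaled_count x u n (A `\` B) - scaled_count x u n (B `\` A).
Proof.
by rewrite /scaled_count -!sumrB; apply: eq_bigr => i _; exact: indicBD.
Qed.

Lemma scaled_count_risk x u n s : 0 < u -> 0 < s -> (forall i, orthant (x i)) ->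
  scaled_count x u n (dilation s Omega) =
  (count (fun i => s * u < r (x i)) (iota 0 n))%:R.
Proof.
move=> u0 s0 ox; rewrite /scaled_count -sum1_count natr_sum [RHS]big_mkcond /=.
apply: eq_bigr => i _; rewrite indicE.
have oui : orthant (u^-1 *: x i) by apply: orthantZ => //; rewrite invr_ge0 ltW.
have e : dilation s Omega (u^-1 *: x i) <-> s * u < r (x i).
  rewrite dilation_risk_region// (risk_homogeneous hr) ?invr_gt0//.
  by rewrite ltr_pdivlMl// mulrC.
case: (boolP (s * u < _)) => [/e/mem_set ->//|h].
by rewrite memNset// => /e h1; rewrite h1 in h.
Qed.

Lemma order_statistic_scaled_gt x u n k s : 0 < u -> 0 < s -> (forall i, orthant (x i)) ->
  (k < n)%N -> (s * u < order_statistic r x n (n - k)) =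
  (k%:R < scaled_count x u n (dilation s Omega)).
Proof. by move=> u0 s0 ox kn; rewrite order_statistic_gt// scaled_count_risk// ltr_nat. Qed.

Lemma class_freq_scaled x u n k (A : set 'rV[R]_d) :
  0 < u -> 0 < order_statistic r x n (n - k) ->
  class_freq r x n k A =
  k%:R^-1 * scaled_count x u n (dilation (order_statistic r x n (n - k) / u) A).
Proof.
move=> u0; set Rh := order_statistic _ _ _ _ => R0; rewrite /class_freq -/Rh; congr (_ * _).
rewrite -(big_mkord xpredT (fun i => \1_(dilation Rh A) (x i))) /index_iota subn0.
apply: eq_bigr => i _; rewrite !dilationE ?gt_eqF ?divr_gt0//.
apply: indic_iff; rewrite /= scalerA invf_div mulrAC divff ?gt_eqF// mul1r.
by split.
Qed.

(** Generators shrink as the level grows. A point whose membership in the dilate of A differs at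
    levels a and b has therefore left some generator between a and c, and is counted in one of the
    differences on the right. *)
Lemma scaled_count_dilation_change (J : finType) (B : J -> set 'rV[R]_d) A x u n a b c :
  0 < u -> (forall i, orthant (x i)) -> (forall g, radial_class r (B g)) ->
  (forall y z, orthant y -> orthant z -> (forall g, B g y <-> B g z) -> (A y <-> A z)) ->
  0 < a -> a <= b -> b <= c ->
  `|scaled_count x u n (dilation b A) - scaled_count x u n (dilation a A)| <=
  \sum_(g : J) scaled_count x u n (dilation a (B g) `\` dilation c (B g)).
Proof.
move=> u0 ox rB HA a0 ab bc; have b0 : 0 < b by exact: lt_le_trans ab.
have c0 : 0 < c by exact: lt_le_trans bc.
rewrite /scaled_count exchange_big -sumrB (le_trans (ler_norm_sum _ _ _))//.
apply: ler_sum => i _; set z := _ *: _.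
have oz : orthant z by apply: orthantZ => //; rewrite invr_ge0 ltW.
have [[g hg]|H] := pselect (exists g, (dilation a (B g) `\` dilation c (B g)) z).
  apply: (@le_trans _ _ 1).
    by rewrite !indicE; case: (_ \in _); case: (_ \in _); rewrite ?subrr ?subr0 ?sub0r ?normrN ?normr1 ?normr0.
  rewrite (bigD1 g)//= [X in X + _]indicE (mem_set hg) lerDl.
  by apply: sumr_ge0 => *; rewrite indicE.
rewrite (_ : \1_(dilation b A) z = \1_(dilation a A) z) ?subrr ?normr0.
  by apply: sumr_ge0 => *; rewrite indicE.
have e : dilation b A z <-> dilation a A z.
  rewrite !dilationE ?gt_eqF//=; apply: HA; try by apply: orthantZ => //; rewrite invr_ge0 ltW.
  move=> g; have e1 t : 0 < t -> B g (t^-1 *: z) <-> dilation t (B g) z.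
    by move=> t0; rewrite dilationE ?gt_eqF.
  rewrite !e1//; split=> [|h]; first exact: radial_dilation_le.
  apply: contrapT => nb; apply: H; exists g; split=> // h1; apply: nb.
  by apply: radial_dilation_le h1.
exact: indic_iff.
Qed.

Lemma grid_step (Q : pred nat) L : Q 0%N -> ~~ Q L -> exists l, [/\ (l < L)%N, Q l & ~~ Q l.+1].
Proof.
elim: L => [->//|L IH] Q0 QL; case: (boolP (Q L)) => h; first by exists L.
by have [l [lL h1 h2]] := IH Q0 h; exists l; split=> //; exact: ltnW.
Qed.

Lemma scaled_count_ge0 x u n D : 0 <= scaled_count x u n D.
Proof. by apply: sumr_ge0 => i _; rewrite indicE. Qed.

(* Replacing the random level by a nearby deterministic one: the order statistic is
   trapped in a cell of the grid s, and the radial generators control what can change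
   inside the cell. *)
Lemma class_freq_deterministic (J : finType) (B : J -> set 'rV[R]_d) g0 A x u n k
    (s : nat -> R) L sstar (p b b' mv : R) :
  0 < u -> (forall i, orthant (x i)) -> (0 < k)%N -> (k < n)%N ->
  (forall g, radial_class r (B g)) -> B g0 = Omega ->
  (forall y z, orthant y -> orthant z -> (forall g, B g y <-> B g z) -> (A y <-> A z)) ->
  (forall l, (l <= L)%N -> 0 < s l) -> (forall l, (l < L)%N -> s l <= s l.+1) ->
  0 <= p <= 1 ->
  k%:R < scaled_count x u n (dilation (s 0%N) Omega) ->
  scaled_count x u n (dilation (s L) Omega) <= k%:R ->
  (forall g l, (l < L)%N ->
    scaled_count x u n (dilation (s l) (B g) `\` dilation (s l.+1) (B g)) <= b) ->
  (forall l, (l <= L)%N ->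
    `|scaled_count x u n (dilation (s l) A) - scaled_count x u n (dilation sstar A)
      - p * mv * ((s l)^-1 - sstar^-1)| <= b') ->
  (forall l, (l <= L)%N ->
    `|scaled_count x u n (dilation (s l) Omega) - scaled_count x u n (dilation sstar Omega)
      - mv * ((s l)^-1 - sstar^-1)| <= b') ->
  `|k%:R * (class_freq r x n k A - p) - (scaled_count x u n (dilation sstar A) -
     p * scaled_count x u n (dilation sstar Omega))| <= (#|J|%:R + 1) * b + 2 * b'.
Proof.
move=> u0 ox k0 kn rB Bg0 HA s0 smono p01 H0 HL H1 H2 H3.
set Rh := order_statistic r x n (n - k).
have Q0 : s 0%N * u < Rh by rewrite order_statistic_scaled_gt// s0.
have QL : ~~ (s L * u < Rh) by rewrite order_statistic_scaled_gt ?s0// -leNgt.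
have [l [lL Ql QSl]] := grid_step (Q := fun l => s l * u < Rh) Q0 QL.
have sl0 : 0 < s l by apply: s0; exact: ltnW.
have Rh0 : 0 < Rh by apply: le_lt_trans Ql; rewrite mulr_ge0// ltW.
have lb : s l <= Rh / u by rewrite ler_pdivlMr// ltW.
have bc : Rh / u <= s l.+1 by rewrite ler_pdivrMr// leNgt.
have kR : (k%:R : R) != 0 by rewrite pnatr_eq0 -lt0n.
rewrite mulrBr (class_freq_scaled A u0 Rh0) mulrA mulfV// mul1r -/Rh.
have h1 := scaled_count_dilation_change n u0 ox rB HA sl0 lb bc.
have h1' : \sum_(g : J) scaled_count x u n (dilation (s l) (B g) `\` dilation (s l.+1) (B g))
    <= #|J|%:R * b.
  by rewrite mulr_natl -sumr_const; apply: ler_sum => g _; exact: H1.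
have h2 := H2 l (ltnW lL); have h3 := H3 l (ltnW lL).
have h4 : k%:R < scaled_count x u n (dilation (s l) Omega).
  by rewrite -order_statistic_scaled_gt.
have h5 : scaled_count x u n (dilation (s l.+1) Omega) <= k%:R.
  by rewrite leNgt -order_statistic_scaled_gt// s0.
have h6 : scaled_count x u n (dilation (s l) Omega) <= k%:R + b.
  have := scaled_countB x u n (dilation (s l) Omega) (dilation (s l.+1) Omega).
  have := H1 g0 l lL; rewrite Bg0.
  have := scaled_count_ge0 x u n (dilation (s l.+1) Omega `\` dilation (s l) Omega).
  by move: h5; lra.
have := le_trans h1 h1'; move: h2 h3 h4 h6.
set xa := scaled_count x u n (dilation (Rh / u) A).
set xl := scaled_count x u n (dilation (s l) A).
set yl := scaled_count x u n (dilation (s l) Omega).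
set xs := scaled_count x u n (dilation sstar A).
set ys := scaled_count x u n (dilation sstar Omega).
move: ((s l)^-1 - sstar^-1) => t; move: (#|J|%:R) => M h2 h3 h4 h6 h7.
(* The terms are the change inside the cell, the linearizations of the two counts around [sstar],
   whose main parts cancel, and the defect between the count at the lower end of the cell and k. *)
rewrite (_ : xa - k%:R * p - (xs - p * ys) = (xa - xl) + (xl - xs - p * mv * t)
  - p * (yl - ys - mv * t) + p * (yl - k%:R)); last by ring.
have /andP[p0 p1] := p01.
have e1 : `|p * (yl - ys - mv * t)| <= b'.
  rewrite normrM (ger0_norm p0) -[leRHS]mul1r.
  by apply: ler_pM => //; exact: normr_ge0.
have e2 : `|p * (yl - k%:R)| <= b.
  have d0 : 0 <= yl - k%:R by rewrite subr_ge0 ltW.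
  rewrite normrM (ger0_norm p0) (ger0_norm d0) -[leRHS]mul1r.
  by apply: ler_pM => //; rewrite lerBlDl.
apply: le_trans (ler_normD _ _) _; rewrite mulrDl mul1r.
apply: le_trans (_ : (M * b + b' + b') + b <= _); last by lra.
apply: lerD => //; apply: le_trans (ler_normB _ _) _; apply: lerD => //.
by apply: le_trans (ler_normD _ _) _; apply: lerD.
Qed.

End risk_geometry.

Lemma measure_bigsetU_le d (T : measurableType d) (R : realType)
    (mu : {measure set T -> \bar R}) (J : Type) (s : seq J) (F : J -> set T) :
  (forall g, measurable (F g)) ->
  (mu (\big[setU/set0]_(g <- s) F g) <= \sum_(g <- s) mu (F g))%E.
Proof.
move=> mF; elim: s => [|g s IH]; first by rewrite !big_nil measure0.
rewrite !big_cons; apply: (le_trans (measureU2 _ _ _)) => //.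
  exact: bigsetU_measurable.
exact: leeD.
Qed.

Lemma fine_measureDI d (T : measurableType d) (R : realType)
    (mu : {measure set T -> \bar R}) (A B : set T) :
  measurable A -> measurable B -> (mu A < +oo)%E -> (mu B < +oo)%E ->
  fine (mu (A `\` B)) - fine (mu (B `\` A)) = fine (mu A) - fine (mu B).
Proof.
move=> mA mB Aoo Boo.
have fin C D : measurable C -> measurable D -> (mu C < +oo)%E -> D `<=` C -> mu D \is a fin_num.
  move=> mC mD Coo DC; rewrite ge0_fin_numE//; apply: le_lt_trans Coo.
  by apply: le_measure; rewrite ?inE.
rewrite (measureDI mu mA mB) (measureDI mu mB mA) [B `&` A]setIC.
have mAB := measurableD mA mB; have mBA := measurableD mB mA; have mI := measurableI _ _ mA mB.
rewrite !fineD.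
- ring.
- by apply: (fin B) => // x [].
- by apply: (fin A) => // x [].
- by apply: (fin A) => // x [].
- by apply: (fin A) => // x [].
Qed.

(** * Class frequencies of one sample *)

Section one_sample.
Context {R : realType} {d K : nat} {dT : measure_display} {T : measurableType dT}.
Variables (P0 : probability T R) (X : {RV P0 >-> borel_rV R d}).
Variables (nu : {measure set (borel_rV R d) -> \bar R}) (a : R -> R).
Hypotheses (hd : (1 <= d)%N) (pareto : standard_pareto_margins X).
Hypotheses (X0 : orthant_valued X).
Hypotheses (rv : regularly_varying X nu) (so : second_order X nu a).
Variables (r : 'rV[R]_d -> R) (A : 'I_K -> set 'rV[R]_d).
Hypotheses (hr : risk_functional r) (hA : admissible_partition r A).
Local Notation Omega := (risk_region r).
Hypothesis Opos : (0 < nu Omega)%E.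
Variable k : nat -> nat.
Hypothesis k0 : forall n, (0 < k n)%N.
Hypothesis koo : k n @[n --> \oo] --> \oo.
Hypothesis kn : (k n)%:R / n%:R @[n --> \oo] --> (0 : R).
Let q n : R := Num.sqrt (k n)%:R.
Let u n : R := quantile_level X k n.
Hypothesis ka : q n * a (u n) @[n --> \oo] --> (0 : R).
Let m n : R := mean_exceedances X k n.
Let v : R := fine (nu Omega).

(** The level s, in units of u_n, at which k_n exceedances are expected: by homogeneity the region
    dilated by s has mass v / s, and m n v / s = k_n. *)
Definition critical_level n : R := m n * v / (k n)%:R.
Local Notation sstar := critical_level.

Lemma sqrt_k_gt0 n : 0 < q n.
Proof. by rewrite sqrtr_gt0 ltr0n. Qed.

Lemma sqr_sqrt_k n : q n * q n = (k n)%:R.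
Proof. by rewrite -expr2 sqr_sqrtr. Qed.

Lemma sqrt_k_cvg M : exists N, forall n, (N <= n)%N -> M < q n.
Proof.
have := koo (nbhs_infty_ge (Num.Def.trunc (`|M| ^+ 2)).+1) => -[N _ HN].
exists N => n /HN /= h; have h1 : `|M| ^+ 2 < (k n)%:R.
  by apply: lt_le_trans (truncnS_gt _) _; rewrite ler_nat.
apply: le_lt_trans (ler_norm M) _.
rewrite -[X in X < _]sqrtr_sqr -[in X in X < _](real_normK (num_real M)).
by rewrite /q ltr_sqrt ?ltr0n.
Qed.

Lemma nu_dilation_fin c (B : set 'rV[R]_d) : 0 < c -> borel B -> B `<=` Omega ->
  (nu (dilation c B) < +oo)%E.
Proof.
move=> c0 bB BO; have [e e0 He] := risk_bounded_away hr.
rewrite -ge0_fin_numE//; apply: (nu_fin rv (mulr_gt0 c0 e0)); first exact: borel_dilation.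
move=> _ [x Bx <-]; have Ox := BO x Bx; split.
  by apply: orthantZ; [exact: ltW|case: Ox].
by rewrite /= normrZ gtr0_norm// ler_pM2l//; exact: He.
Qed.

Lemma fine_nu_dilation c (B : set 'rV[R]_d) : 0 < c -> borel B -> B `<=` Omega ->
  fine (nu (dilation c B)) = c^-1 * fine (nu B).
Proof.
move=> c0 bB BO; rewrite (nu_dilation rv)//.
- rewrite fineM//; have := nu_dilation_fin ltr01 bB BO.
  by rewrite dilation1 -ge0_fin_numE.
- by move=> x /BO[].
- have [e e0 He] := risk_bounded_away hr; exists e => // x /BO; exact: He.
Qed.

Lemma nu_risk_gt0 : 0 < v.
Proof.
have := nu_dilation_fin ltr01 (borel_risk_region hr) (@subset_refl _ _).
by rewrite dilation1 -ge0_fin_numE// => f; rewrite -lte_fin fineK.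
Qed.

Lemma critical_level_bounds : exists N, forall n, (N <= n)%N ->
  [/\ [/\ 0 < u n, 0 < sstar n & v / 3 <= sstar n], sstar n <= 3 * v, m n * v = (k n)%:R * sstar n,
     0 <= m n & (k n < n)%N].
Proof.
have [N1 H1] := mean_exceedances_bounds hd pareto X0 rv so k0 kn.
have [N2 H2] := ratio_large k0 kn ltr01.
exists (maxn N1 N2) => n; rewrite geq_max => /andP[/H1[h1 h2 h3] /H2[n0 h4]].
have v0 := nu_risk_gt0; have kR : 0 < (k n)%:R :> R by rewrite ltr0n.
have s3 : v / 3 <= sstar n.
  rewrite ler_pdivlMr// mulrAC [m n * v]mulrC -mulrA ler_pM2l// ler_pdivrMr//.
  by rewrite mulrC.
split=> //.
- by split=> //; apply: lt_le_trans s3; rewrite divr_gt0.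
- by rewrite /critical_level ler_pdivrMr// [leRHS]mulrAC ler_pM2r.
- by rewrite /critical_level [RHS]mulrC divfK// gt_eqF.
- by rewrite mulr_ge0 ?norm_tail_ge0.
- by move: h4; rewrite ltr_pdivlMr// mul1r ltr_nat.
Qed.

Let region (j : option 'I_K) := oapp A Omega j.

Lemma region_sub j : region j `<=` Omega.
Proof.
case: j => [j|//] x Ax; have [[<- _ _] _] := hA.
by exists j.
Qed.

Lemma borel_region j : borel (region j).
Proof.
case: j => [j|]; last exact: borel_risk_region.
have [_ /(_ j)] := hA => /=; elim=> [B []//|B C _ ? _ ?|B C _ ? _ ?|B _ ?].
- exact: borelU.
- exact: borelI.
- by apply: borelD => //; exact: borel_orthant.
Qed.

Context {dS : measure_display} {S : measurableType dS} {P : probability S R}.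
Variables (I : choiceType) (Z : I -> {RV P >-> borel_rV R d}) (idx : nat -> I).
Hypothesis hind : mutually_independent P (fun i => Z i : S -> borel_rV R d).
Hypothesis idx_inj : injective idx.
Hypothesis Z0 : forall i, orthant_valued (Z (idx i)).
Hypothesis Zlaw : forall i, same_law P P0 (Z (idx i)) X.

Definition level_count n (D : set 'rV[R]_d) (w : S) : R :=
  scaled_count (fun i => vec (Z (idx i)) w) (u n) n D.
Local Notation N n D w := (level_count n D w).
Local Notation pi n D := (n%:R * prob_scaled X (u n) D).

Lemma level_count_chebyshev n D t : borel D -> 0 < t ->
  exists G, [/\ measurable G, G `<=` [set w | `|N n D w - pi n D| < t] &
    (P (~` G) <= (pi n D / t ^+ 2)%:E)%E].
Proof.
move=> bD t0.
pose D' : set (borel_rV R d) := [set x | D ((u n)^-1 *: x)].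
have mD' : measurable D'.
  have : borel ( *:%R (u n)^-1 @^-1` D) by apply: borel_preimage => //; exact: scaler_continuous.
  by [].
pose s := [seq idx i | i <- iota 0 n].
have us : uniq s by rewrite map_inj_uniq ?iota_uniq.
have cE w : count_in Z D' s w = N n D w.
  rewrite /count_in /level_count /scaled_count big_map; apply: eq_bigr => i _.
  by rewrite !indicE; congr (_%:R); apply/idP/idP => /set_mem h; exact: mem_set.
have pE i : i \in s -> P (Z i @^-1` D') = (prob_scaled X (u n) D)%:E.
  move=> /mapP[j _ ->]; rewrite (Zlaw j mD') /prob_scaled fineK//.
  rewrite fin_num_measure//; exact: measurable_scaled.
have [h1 h2] := count_chebyshev hind us mD' pE t0.
exists (~` [set w | t <= `|count_in Z D' s w - (size s)%:R * prob_scaled X (u n) D|]).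
rewrite size_map size_iota in h1 h2 *; split; first exact: measurableC.
  by move=> w /=; rewrite cE => /negP; rewrite -ltNge.
by rewrite setCK -(fineK (x := P _)) ?lee_fin// fin_num_measure.
Qed.

(** The mean, hence the variance, is of order sqrt k_n only, so the deviations are negligible
    against sqrt k_n. This is the regime of differences of dilates at nearby levels. *)
Lemma level_count_dev (D : nat -> set 'rV[R]_d) c :
  (exists N, forall n, (N <= n)%N -> borel (D n) /\ pi n (D n) <= c * q n) ->
  forall eta, 0 < eta -> whp P (fun n => [set w | `|N n (D n) w - pi n (D n)| <= eta * q n]).
Proof.
move=> [N1 H1] eta eta0 eps eps0.
have [N2 H2] := sqrt_k_cvg (c / (eta ^+ 2 * eps)).
exists (maxn N1 N2) => n; rewrite geq_max => /andP[/H1[bD h1] /H2 h2].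
have q0 := sqrt_k_gt0 n; have t0 : 0 < eta * q n by exact: mulr_gt0.
have [G [mG GQ PG]] := level_count_chebyshev n bD t0.
exists G; split=> //; first by move=> w /GQ /ltW.
apply: (le_trans PG); rewrite lee_fin ler_pdivrMr ?exprn_gt0//.
apply: (le_trans h1); rewrite exprMn mulrA (expr2 (q n)) mulrA ler_pM2r//.
move: h2; rewrite ltr_pdivrMr ?mulr_gt0 ?exprn_gt0// => /ltW h2.
by apply: (le_trans h2); rewrite mulrC [eta ^+ 2 * _]mulrC.
Qed.

(** Here the mean may be of order k_n and the deviations of order sqrt k_n, so the failure
    probability is made small only by enlarging c. *)
Lemma level_count_bound (D : nat -> set 'rV[R]_d) c kappa : 0 < c ->
  (exists N, forall n, (N <= n)%N -> borel (D n) /\ pi n (D n) <= kappa * (k n)%:R) ->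
  likely P (kappa / c ^+ 2) (fun n => [set w | `|N n (D n) w - pi n (D n)| < c * q n]).
Proof.
move=> c0 [N1 H1]; exists N1 => n /H1[bD h1].
have q0 := sqrt_k_gt0 n; have t0 : 0 < c * q n by exact: mulr_gt0.
have [G [mG GQ PG]] := level_count_chebyshev n bD t0.
exists G; split=> //; apply: (le_trans PG); rewrite lee_fin ler_pdivrMr ?exprn_gt0//.
apply: (le_trans h1); rewrite exprMn mulrA divfK ?gt_eqF ?exprn_gt0//.
by rewrite (expr2 (q n)) sqr_sqrt_k.
Qed.

(** The value v / 6 is a lower bound for all levels in use: the critical level is at least v / 3,
    and the grid starts above half of it. One set bounded away from the origin thus contains all
    sets to be counted. *)
Lemma dilation_sub_risk c (B : set 'rV[R]_d) : v / 6 <= c -> B `<=` Omega ->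
  dilation c B `<=` dilation (v / 6) Omega.
Proof.
move=> c6 BO; have v60 : 0 < v / 6 by rewrite divr_gt0 ?nu_risk_gt0.
apply: subset_trans (dilationS BO) _.
exact: radial_dilation_le (radial_risk_region hr) v60 c6.
Qed.

Lemma mean_rate eta : 0 < eta -> exists N, forall n, (N <= n)%N ->
  forall D, borel D -> D `<=` dilation (v / 6) Omega ->
  `|pi n D - m n * fine (nu D)| <= eta * q n.
Proof.
move=> eta0; have [e e0 He] := risk_bounded_away hr.
have v60 : 0 < v / 6 by rewrite divr_gt0 ?nu_risk_gt0.
have [N1 H1] := mean_count_rate hd pareto X0 rv so k0 kn ka (mulr_gt0 v60 e0) eta0.
exists N1 => n /H1 h D bD sub; apply: h => // _ /sub[x Ox <-]; split.
  by apply: orthantZ; [exact: ltW|case: Ox].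
by rewrite /= normrZ gtr0_norm// ler_pM2l//; exact: He.
Qed.

Lemma inv_diff_le (s c b b' : R) : 0 < s -> 0 <= c -> s / 2 <= b -> b <= b' ->
  c * s * (b^-1 - b'^-1) <= 4 * c * (b' - b) / s.
Proof.
move=> s0 c0 sb bb'; have b0 : 0 < b by apply: lt_le_trans sb; rewrite divr_gt0.
have b'0 : 0 < b' by exact: lt_le_trans bb'.
have -> : c * s * (b^-1 - b'^-1) = c * (b' - b) * (s / (b * b')).
  by field; rewrite !gt_eqF.
have -> : 4 * c * (b' - b) / s = c * (b' - b) * (4 / s) by ring.
apply: ler_wpM2l; first by rewrite mulr_ge0// subr_ge0.
rewrite ler_pdivrMr ?mulr_gt0// mulrAC ler_pdivlMr//.
have s20 : 0 <= s / 2 by rewrite divr_ge0// ltW.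
have := ler_pM s20 s20 sb (le_trans sb bb'); lra.
Qed.

(** The levels are [critical_level n] times 1 + C tau / sqrt k_n, with tau running over L + 1
    equally spaced points of [-1, 1]. *)
Definition grid (C : R) L n l : R :=
  sstar n * (1 + C / q n * (l%:R * (2 / L%:R) - 1)).

Lemma gridS C L n l :
  grid C L n l.+1 - grid C L n l = sstar n * (C / q n * (2 / L%:R)).
Proof. by rewrite /grid -natr1; ring. Qed.

Lemma grid0 C L n : grid C L n 0 = sstar n * (1 - C / q n).
Proof. by rewrite /grid; ring. Qed.

Lemma gridL C L n : (0 < L)%N -> grid C L n L = sstar n * (1 + C / q n).
Proof.
move=> L0; rewrite /grid mulrCA mulfV ?pnatr_eq0 -?lt0n//; ring.
Qed.

Lemma grid_mono C L n l l' : 0 < sstar n -> 0 <= C -> (l <= l')%N ->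
  grid C L n l <= grid C L n l'.
Proof.
move=> s0 C0 ll'; rewrite /grid ler_pM2l// lerD2l; apply: ler_wpM2l.
  by rewrite divr_ge0// ltW// sqrt_k_gt0.
by rewrite lerD2r ler_wpM2r ?ler_nat.
Qed.

(** m n v (1/b - 1/b') is the expected number of points between the levels b and b', up to o(sqrt
    k_n). One cell has relative width 2 C / (L sqrt k_n), and the factor 4 of [inv_diff_le] gives 8
    C / L times sqrt k_n. *)
Lemma grid_facts C L : 0 < C -> (0 < L)%N -> exists N, forall n, (N <= n)%N ->
  [/\ v / 6 <= grid C L n 0 /\ sstar n / 2 <= grid C L n 0,
      grid C L n 0 <= sstar n <= grid C L n L,
      forall l, (l < L)%N ->
        m n * v * ((grid C L n l)^-1 - (grid C L n l.+1)^-1) <= 8 * C / L%:R * q n &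
      m n * v * ((grid C L n 0)^-1 - (grid C L n L)^-1) <= 8 * C * q n].
Proof.
move=> C0 L0; have [N1 H1] := critical_level_bounds.
have [N2 H2] := sqrt_k_cvg (2 * C).
exists (maxn N1 N2) => n; rewrite geq_max => /andP[/H1[[u0 s0 vs] _ mv m0 kn'] /H2 h].
have q0 := sqrt_k_gt0 n.
have th : C / q n <= 2^-1 by rewrite ler_pdivrMr//; lra.
have th0 : 0 < C / q n by rewrite divr_gt0.
have LR : 0 < L%:R :> R by rewrite ltr0n.
have g0 : sstar n / 2 <= grid C L n 0 by rewrite grid0 ler_pM2l//; lra.
have kq : (k n)%:R / q n = q n by rewrite -sqr_sqrt_k mulfK ?gt_eqF.
have step b b' c : sstar n / 2 <= b -> b <= b' -> b' - b = sstar n * c ->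
    m n * v * (b^-1 - b'^-1) <= 4 * (k n)%:R * c.
  move=> h1 h2 h3; rewrite mv; apply: le_trans (inv_diff_le s0 (ler0n _ _) h1 h2) _.
  by rewrite h3 mulrA [X in X / _]mulrAC mulfK ?gt_eqF.
split.
- by split=> //; lra.
- by rewrite grid0 gridL// -{2 3}[sstar n]mulr1 !ler_pM2l//; apply/andP; split; lra.
- move=> l lL; apply: le_trans (step _ _ _ _ _ (gridS _ _ _ _)) _.
  + by apply: le_trans g0 _; apply: grid_mono => //; exact: ltW.
  + by apply: grid_mono => //; exact: ltW.
  + by rewrite -{2}kq le_eqVlt; apply/orP; left; apply/eqP; field; rewrite !gt_eqF.
- apply: le_trans (step _ _ (2 * (C / q n)) _ _ _) _ => //.
  + by apply: grid_mono => //; exact: ltW.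
  + by rewrite grid0 gridL//; ring.
  + by rewrite -{2}kq le_eqVlt; apply/orP; left; apply/eqP; field; rewrite !gt_eqF.
Qed.

Lemma fine_nu_le (B D : set 'rV[R]_d) : borel B -> borel D -> B `<=` D ->
  (nu D < +oo)%E -> fine (nu B) <= fine (nu D).
Proof.
move=> bB bD BD Doo; have h : (nu B <= nu D)%E by apply: le_measure; rewrite ?inE.
by apply: fine_le => //; rewrite ge0_fin_numE//; exact: le_lt_trans h Doo.
Qed.

Lemma radial_diff_nu B b b' : radial_class r B -> 0 < b -> b <= b' ->
  fine (nu (dilation b B `\` dilation b' B)) <= v * (b^-1 - b'^-1).
Proof.
move=> rB b0 bb'; have [bB BO _] := rB; have b'0 : 0 < b' by exact: lt_le_trans bb'.
have := fine_measureDI (borel_dilation b0 bB) (borel_dilation b'0 bB)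
  (nu_dilation_fin b0 bB BO) (nu_dilation_fin b'0 bB BO).
rewrite (_ : dilation b' B `\` _ = set0); last first.
  by rewrite -subset0 => x [h nh]; apply: nh; exact: (radial_dilation_le rB b0 bb' h).
rewrite measure0 /= subr0 => ->; rewrite !fine_nu_dilation// -mulrBl mulrC.
apply: ler_wpM2r; first by rewrite subr_ge0 lef_pV2.
apply: fine_nu_le => //; first exact: borel_risk_region.
by have := nu_dilation_fin ltr01 (borel_risk_region hr) (@subset_refl _ _); rewrite dilation1.
Qed.

Section generators.
Context {J : finType} (B : J -> set 'rV[R]_d).
Hypothesis rB : forall g, radial_class r (B g).
Hypothesis HB : forall j x y, orthant x -> orthant y ->
  (forall g, B g x <-> B g y) -> (region j x <-> region j y).

(** The regions need not be monotone in the level; their change is covered by the changes of the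
    radial generators between [lo] and [hi], each of mass at most v (1/lo - 1/hi). *)
Lemma region_diff_nu j lo hi b b' : 0 < lo -> lo <= b -> b <= hi -> lo <= b' -> b' <= hi ->
  fine (nu (dilation b (region j) `\` dilation b' (region j))) <=
  #|J|%:R * (v * (lo^-1 - hi^-1)).
Proof.
move=> lo0 lob bhi lob' b'hi; have b0 : 0 < b by exact: lt_le_trans lob.
have b'0 : 0 < b' by exact: lt_le_trans lob'.
have hi0 : 0 < hi by exact: lt_le_trans bhi.
pose F g := dilation lo (B g) `\` dilation hi (B g).
have bF g : borel (F g).
  by have [bB _ _] := rB g; apply: borelD; exact: borel_dilation.
have Foo g : (nu (F g) < +oo)%E.
  have [bB BO _] := rB g; apply: le_lt_trans (nu_dilation_fin lo0 bB BO).
  by apply: le_measure; rewrite ?inE; [exact: bF|exact: borel_dilation|move=> x []].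
have sub : dilation b (region j) `\` dilation b' (region j) `<=`
    \big[setU/set0]_(g <- enum J) F g.
  move=> x [xb xb']; rewrite -bigcup_seq.
  have ox : orthant x.
    by move: xb => [y /(@region_sub j)[oy _] <-]; apply: orthantZ => //; exact: ltW.
  have [[g hg]|H] := pselect (exists g, F g x); first by exists g => //=; rewrite mem_enum.
  exfalso; move: xb xb'; rewrite !dilationE ?gt_eqF//= => xb; apply.
  suff [h _] : region j (b^-1 *: x) <-> region j (b'^-1 *: x) by exact: h.
  apply: HB; try by apply: orthantZ => //; rewrite invr_ge0 ltW.
  move=> g; have e1 t : 0 < t -> B g (t^-1 *: x) <-> dilation t (B g) x.
    by move=> t0; rewrite dilationE ?gt_eqF.
  rewrite !e1//; split=> h; apply: contrapT => nh; apply: H; exists g; split.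
  + exact: radial_dilation_le h.
  + by move=> h1; apply: nh; apply: radial_dilation_le h1.
  + exact: radial_dilation_le h.
  + by move=> h1; apply: nh; apply: radial_dilation_le h1.
have bR : borel (dilation b (region j) `\` dilation b' (region j)).
  by apply: borelD; apply: borel_dilation => //; exact: borel_region.
have h1 : (nu (dilation b (region j) `\` dilation b' (region j)) <=
    \sum_(g <- enum J) nu (F g))%E.
  apply: le_trans (measure_bigsetU_le nu (enum J) bF).
  by apply: le_measure; rewrite ?inE//; apply: bigsetU_measurable => g _; exact: bF.
have h2 : (\sum_(g <- enum J) nu (F g) = (\sum_(g <- enum J) fine (nu (F g)))%:E)%E.
  by rewrite -sumEFin; apply: eq_bigr => g _; rewrite fineK// ge0_fin_numE.
rewrite h2 in h1.
have h3 : fine (nu (dilation b (region j) `\` dilation b' (region j))) <=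
    \sum_(g <- enum J) fine (nu (F g)).
  rewrite -lee_fin fineK// ge0_fin_numE//; exact: le_lt_trans h1 (ltry _).
apply: (le_trans h3); rewrite big_enum/= mulr_natl -sumr_const.
apply: ler_sum => g _; apply: radial_diff_nu => //; exact: le_trans bhi.
Qed.

Lemma adjacent_mean C L eta : 0 < C -> (0 < L)%N -> 0 < eta ->
  exists N, forall n, (N <= n)%N -> forall g l, (l < L)%N ->
  let D := dilation (grid C L n l) (B g) `\` dilation (grid C L n l.+1) (B g) in
  borel D /\ pi n D <= (8 * C / L%:R + eta) * q n.
Proof.
move=> C0 L0 eta0; have [N1 H1] := grid_facts C0 L0; have [N2 H2] := mean_rate eta0.
have [N3 H3] := critical_level_bounds.
exists (maxn N1 (maxn N2 N3)) => n; rewrite !geq_max.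
move=> /and3P[/H1[[g6 g2] _ adj _] /H2 h2 /H3[[u0 s0 _] _ _ m0 _]] g l lL D.
have [bB BO _] := rB g.
have v60 : 0 < v / 6 by rewrite divr_gt0 ?nu_risk_gt0.
have gl : v / 6 <= grid C L n l by apply: le_trans g6 _; apply: grid_mono => //; exact: ltW.
have gl0 : 0 < grid C L n l by exact: lt_le_trans gl.
have gll : grid C L n l <= grid C L n l.+1 by apply: grid_mono => //; exact: ltW.
have bD : borel D.
  by apply: borelD; apply: borel_dilation => //; exact: lt_le_trans gll.
split=> //; have DO : D `<=` dilation (v / 6) Omega.
  by move=> x [+ _]; exact: dilation_sub_risk.
have := h2 D bD DO; rewrite ler_norml => /andP[_].
have := ler_wpM2l m0 (radial_diff_nu (rB g) gl0 gll); have := adj l lL.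
by rewrite -/D; lra.
Qed.

(** Both differences enter because the regions are not monotone in the level. Each has mean of order
    sqrt k_n, so that [level_count_dev] applies to it, and by homogeneity the difference of the
    means is linear in the inverse level. *)
Lemma region_mean C L eta : 0 < C -> (0 < L)%N -> 0 < eta ->
  exists N, forall n, (N <= n)%N -> forall j l, (l <= L)%N ->
  let D1 := dilation (grid C L n l) (region j) `\` dilation (sstar n) (region j) in
  let D2 := dilation (sstar n) (region j) `\` dilation (grid C L n l) (region j) in
  [/\ borel D1 /\ pi n D1 <= (#|J|%:R * (8 * C) + eta) * q n,
     borel D2 /\ pi n D2 <= (#|J|%:R * (8 * C) + eta) * q n &
     `|pi n D1 - pi n D2 - fine (nu (region j)) * m n * ((grid C L n l)^-1 - (sstar n)^-1)|
       <= 2 * eta * q n].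
Proof.
move=> C0 L0 eta0; have [N1 H1] := grid_facts C0 L0; have [N2 H2] := mean_rate eta0.
have [N3 H3] := critical_level_bounds.
exists (maxn N1 (maxn N2 N3)) => n; rewrite !geq_max.
move=> /and3P[/H1[[g6 g2] /andP[g0s sgL] _ tot] /H2 h2 /H3[[u0 s0 vs] _ _ m0 _]] j l lL D1 D2.
have bB := borel_region j; have BO := @region_sub j.
have v60 : 0 < v / 6 by rewrite divr_gt0 ?nu_risk_gt0.
have s6 : v / 6 <= sstar n by exact: le_trans g0s.
have g00 : 0 < grid C L n 0 by exact: lt_le_trans g6.
have g0l : grid C L n 0 <= grid C L n l by apply: grid_mono => //; exact: ltW.
have glL : grid C L n l <= grid C L n L by apply: grid_mono => //; exact: ltW.
have gl : v / 6 <= grid C L n l by exact: le_trans g0l.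
have gl0 : 0 < grid C L n l by exact: lt_le_trans gl.
have b1 : borel (dilation (grid C L n l) (region j)) by exact: borel_dilation.
have b2 : borel (dilation (sstar n) (region j)) by exact: borel_dilation.
have bD1 : borel D1 by exact: borelD.
have bD2 : borel D2 by exact: borelD.
have D1O : D1 `<=` dilation (v / 6) Omega by move=> x [+ _]; exact: dilation_sub_risk.
have D2O : D2 `<=` dilation (v / 6) Omega by move=> x [+ _]; exact: dilation_sub_risk.
have := h2 D1 bD1 D1O; rewrite ler_norml => /andP[l1 r1].
have := h2 D2 bD2 D2O; rewrite ler_norml => /andP[l2 r2].
have k1 := ler_wpM2l m0 (region_diff_nu j g00 g0l glL g0s sgL).
have k2 := ler_wpM2l m0 (region_diff_nu j g00 g0s sgL g0l glL).
have tot' := ler_wpM2l (ler0n R #|J|) tot.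
have t1 : m n * (#|J|%:R * (v * ((grid C L n 0)^-1 - (grid C L n L)^-1))) <=
    #|J|%:R * (8 * C * q n).
  by rewrite mulrCA [m n * (v * _)]mulrA.
have {}k1 := le_trans k1 t1; have {}k2 := le_trans k2 t1.
have e := fine_measureDI b1 b2 (nu_dilation_fin gl0 bB BO) (nu_dilation_fin s0 bB BO).
rewrite !fine_nu_dilation// -mulrBl in e.
have {e} := congr1 (fun y => m n * y) e; rewrite /= mulrBr => e.
split.
- split=> //; rewrite -/D1 in k1.
  by rewrite mulrDl -(mulrA #|J|%:R); move: k1 r1; lra.
- split=> //; rewrite -/D2 in k2.
  by rewrite mulrDl -(mulrA #|J|%:R); move: k2 r2; lra.
- rewrite ler_norml; move: e; rewrite -/D1 -/D2.
  rewrite (_ : m n * (_ * fine (nu (region j))) =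
    fine (nu (region j)) * m n * ((grid C L n l)^-1 - (sstar n)^-1)); last by ring.
  by move: l1 r1 l2 r2; move: (fine _ * m n * _) => y *; apply/andP; split; lra.
Qed.

End generators.

Let p j := class_prob nu r (A j).

Lemma class_probE j : p j * v = fine (nu (A j)).
Proof. by rewrite /p /class_prob divfK// gt_eqF// nu_risk_gt0. Qed.

Lemma class_prob01 j : 0 <= p j <= 1.
Proof.
have v0 := nu_risk_gt0; rewrite /p /class_prob divr_ge0 ?fine_ge0 ?(ltW v0)//=.
rewrite ler_pdivrMr// mul1r; apply: fine_nu_le.
- exact: (borel_region (Some j)).
- exact: borel_risk_region.
- exact: (@region_sub (Some j)).
- by have := nu_dilation_fin ltr01 (borel_risk_region hr) (@subset_refl _ _); rewrite dilation1.
Qed.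

(** With C = 2 c + 2 the mean count is at least k_n + (2 c + 1) sqrt k_n at the lowest level and at
    most k_n - c sqrt k_n at the highest, so deviations below c sqrt k_n cannot cross k_n. The
    numerators 3 and 2 come from the means being at most 3 k_n and 2 k_n. *)
Lemma extreme_levels c L : 0 < c -> (0 < L)%N ->
  likely P (3 / c ^+ 2 + 2 / c ^+ 2) (fun n => [set w |
    (k n)%:R < N n (dilation (grid (2 * c + 2) L n 0) Omega) w /\
    N n (dilation (grid (2 * c + 2) L n L) Omega) w <= (k n)%:R]).
Proof.
move=> c0 L0; pose C := 2 * c + 2; have C0 : 0 < C by rewrite /C; lra.
have facts : exists N, forall n, (N <= n)%N ->
   [/\ borel (dilation (grid C L n 0) Omega), borel (dilation (grid C L n L) Omega),
    (k n)%:R + C * q n - q n <= pi n (dilation (grid C L n 0) Omega) <= 3 * (k n)%:R &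
    pi n (dilation (grid C L n L) Omega) <= (k n)%:R - C * q n / 2 + q n /\
    pi n (dilation (grid C L n L) Omega) <= 2 * (k n)%:R].
  have [N1 H1] := grid_facts C0 L0; have [N2 H2] := mean_rate ltr01.
  have [N3 H3] := critical_level_bounds; have [N4 H4] := sqrt_k_cvg (2 * C + 1).
  exists (maxn (maxn N1 N2) (maxn N3 N4)) => n; rewrite !geq_max.
  move=> /andP[/andP[/H1[[g6 _] /andP[g0s sgL] _ _] /H2 h2] /andP[/H3[[u0 s0 _] _ mv m0 _] /H4 h4]].
  have v60 : 0 < v / 6 by rewrite divr_gt0 ?nu_risk_gt0.
  have gL6 : v / 6 <= grid C L n L by apply: le_trans g6 (le_trans g0s sgL).
  have bO := borel_risk_region hr.
  have g00 := lt_le_trans v60 g6; have gL0 := lt_le_trans v60 gL6.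
  have b1 : borel (dilation (grid C L n 0) Omega) by exact: borel_dilation.
  have b2 : borel (dilation (grid C L n L) Omega) by exact: borel_dilation.
  have := h2 _ b1 (dilation_sub_risk g6 (@subset_refl _ _)).
  have := h2 _ b2 (dilation_sub_risk gL6 (@subset_refl _ _)).
  rewrite !fine_nu_dilation// -/v.
  have q0 := sqrt_k_gt0 n; have kq := sqr_sqrt_k n.
  pose th := C / q n; have thq : th * q n = C by rewrite /th divfK ?gt_eqF.
  have th0 : 0 < th by rewrite divr_gt0.
  have th2 : th <= 2^-1 by rewrite /th ler_pdivrMr//; lra.
  have kth : (k n)%:R * th = C * q n by rewrite -kq -thq; ring.
  have E0 : m n * ((grid C L n 0)^-1 * v) = (k n)%:R / (1 - th).
    rewrite mulrC -mulrA [v * _]mulrC mv grid0 -/th; field.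
    by apply/andP; split; rewrite gt_eqF//; lra.
  have EL : m n * ((grid C L n L)^-1 * v) = (k n)%:R / (1 + th).
    rewrite mulrC -mulrA [v * _]mulrC mv gridL// -/th; field.
    by apply/andP; split; rewrite gt_eqF//; lra.
  have kR : 0 < (k n)%:R :> R by rewrite ltr0n.
  have i1 : (k n)%:R + C * q n <= (k n)%:R / (1 - th).
    rewrite -kth ler_pdivlMr; last by lra.
    by nra.
  have i2 : (k n)%:R / (1 - th) <= 2 * (k n)%:R.
    rewrite ler_pdivrMr; last by lra.
    by nra.
  have i3 : (k n)%:R / (1 + th) <= (k n)%:R - C * q n / 2.
    rewrite -kth ler_pdivrMr; last by lra.
    by nra.
  have i4 : q n <= (k n)%:R by rewrite -kq; nra.
  have i5 : 0 <= C * q n by rewrite mulr_ge0 ?ltW.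
  rewrite E0 EL mul1r !ler_norml => /andP[a1 a2] /andP[a3 a4].
  by split=> //; [apply/andP; split; lra|split; lra].
have [N1 H1] := facts.
apply: likely_mono (likelyI
  (@level_count_bound (fun n => dilation (grid C L n 0) Omega) c 3 c0 _)
  (@level_count_bound (fun n => dilation (grid C L n L) Omega) c 2 c0 _)).
- exists N1 => n /H1[_ _ /andP[a1 _] [a2 _]] w [/= h1 h2].
  have q0 := sqrt_k_gt0 n.
  move: h1 h2; rewrite !ltr_norml => /andP[h1 _] /andP[_ h2].
  have cq : 0 < c * q n by exact: mulr_gt0.
  have Cq : C * q n = 2 * (c * q n) + 2 * q n by rewrite /C; ring.
  by rewrite -/C; split; lra.
- by exists N1 => n /H1[? _ /andP[]].
- by exists N1 => n /H1[_ ? _ []].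
Qed.

Theorem one_sample delta : 0 < delta -> whp P (fun n => [set w | forall j : 'I_K,
  `|(k n)%:R * (class_freq r (fun i => vec (Z (idx i)) w) n (k n) (A j) - p j) -
    (N n (dilation (sstar n) (A j)) w - p j * N n (dilation (sstar n) Omega) w)| <= delta * q n]).
Proof.
move=> delta0 eps eps0.
have [J [B [rB [g0 Bg0] HB]]] := radial_family hr hA.
(* Order of the choices: c makes 5 / c^2 at most eps / 2, C follows from c, then L brings the
   contribution of a cell below delta / 2, and the denominator of [eta] turns (2 (M + 1) + 8) eta
   into delta / 2. *)
pose c := 20 / eps + 1; have c0 : 0 < c by rewrite ltr_wpDl// divr_ge0// ltW.
pose C := 2 * c + 2; have C0 : 0 < C by rewrite /C; lra.
pose M : R := #|J|%:R; have M0 : 0 <= M by [].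
pose L := (Num.Def.trunc ((M + 1) * 16 * C / delta)).+1; have L0 : (0 < L)%N by [].
pose eta := delta / (4 * (M + 1) + 16).
have den0 : 0 < 4 * (M + 1) + 16 by lra.
have eta0 : 0 < eta by rewrite divr_gt0.
have [N1 H1] := adjacent_mean rB C0 L0 eta0.
have [N2 H2] := region_mean rB HB C0 L0 eta0.
have [N3 H3] := critical_level_bounds.
have [N4 H4] := grid_facts C0 L0.
pose D g l n := dilation (grid C L n l) (B g) `\` dilation (grid C L n l.+1) (B g).
pose D1 j l n := dilation (grid C L n l) (region j) `\` dilation (sstar n) (region j).
pose D2 j l n := dilation (sstar n) (region j) `\` dilation (grid C L n l) (region j).
have G1 : whp P (fun n => [set w | forall gl : J * 'I_L,
    `|N n (D gl.1 gl.2 n) w - pi n (D gl.1 gl.2 n)| <= eta * q n]).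
  apply: whp_forall => -[g l]; apply: level_count_dev eta0.
  by exists N1 => n /H1 /(_ g l (ltn_ord l)); exact.
have G2 : whp P (fun n => [set w | forall jl : option 'I_K * 'I_L.+1,
    `|N n (D1 jl.1 jl.2 n) w - pi n (D1 jl.1 jl.2 n)| <= eta * q n]).
  apply: whp_forall => -[j l]; apply: level_count_dev eta0.
  by exists N2 => n /H2 /(_ j l (ltn_ord l))[h _ _]; exact: h.
have G3 : whp P (fun n => [set w | forall jl : option 'I_K * 'I_L.+1,
    `|N n (D2 jl.1 jl.2 n) w - pi n (D2 jl.1 jl.2 n)| <= eta * q n]).
  apply: whp_forall => -[j l]; apply: level_count_dev eta0.
  by exists N2 => n /H2 /(_ j l (ltn_ord l))[_ h _]; exact: h.
have G4 := extreme_levels c0 L0.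
have e2 : 0 < eps / 2 by rewrite divr_gt0.
have le : 3 / c ^+ 2 + 2 / c ^+ 2 + eps / 2 <= eps.
  have : 5 / c ^+ 2 <= eps / 2.
    rewrite ler_pdivrMr ?exprn_gt0//.
    have : eps * c = 20 + eps by rewrite /c mulrDr mulr1 mulrC divfK ?gt_eqF.
    have c1 : 1 <= c by rewrite /c lerDr divr_ge0// ltW.
    rewrite expr2 => h; apply: (@le_trans _ _ (eps / 2 * c)); first by lra.
    by rewrite ler_pM2l// -[leLHS]mulr1 ler_pM2l.
  by rewrite -[3 / _ + _]mulrDl (_ : 3 + 2 = 5 :> R); [lra|ring].
apply: likely_le le _.
apply: likely_mono (likelyI G4 (whpI G1 (whpI G2 G3) e2)).
exists (maxn (maxn N1 N2) (maxn N3 N4)) => n; rewrite !geq_max.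
move=> /andP[/andP[/H1 h1 /H2 h2] /andP[/H3[[u0 s0 _] _ _ m0 kn'] /H4[[g6 _] _ _ _]]].
move=> w [[E1 E2] [/= a1 [/= a2 a3]]] j.
have q0 := sqrt_k_gt0 n.
have v60 : 0 < v / 6 by rewrite divr_gt0 ?nu_risk_gt0.
have g00 : 0 < grid C L n 0 by exact: lt_le_trans g6.
have gl0 l : 0 < grid C L n l by apply: lt_le_trans g00 _; apply: grid_mono => //; exact: ltW.
pose x i := vec (Z (idx i)) w.
have ox i : orthant (x i) by exact: Z0.
have reg j' l : (l <= L)%N ->
    `|N n (dilation (grid C L n l) (region j')) w - N n (dilation (sstar n) (region j')) w
      - fine (nu (region j')) * m n * ((grid C L n l)^-1 - (sstar n)^-1)| <= 4 * eta * q n.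
  move=> lL; have [_ _] := h2 j' l lL; have lL1 : (l < L.+1)%N by [].
  have := a2 (j', Ordinal lL1); have := a3 (j', Ordinal lL1); rewrite /=.
  rewrite -/(D1 j' l n) -/(D2 j' l n) scaled_countB -/(N n (D1 j' l n) w) -/(N n (D2 j' l n) w).
  move: (N n _ w) (N n _ w) (pi n _) (pi n _) (fine _ * _ * _) => y1 y2 z1 z2 t.
  by rewrite !ler_norml => /andP[? ?] /andP[? ?] /andP[? ?]; apply/andP; split; lra.
have := @class_freq_deterministic R d r hr J B g0 (A j) x (u n) n (k n) (grid C L n) L (sstar n)
  (p j) ((8 * C / L%:R + 2 * eta) * q n) (4 * eta * q n) (m n * v) u0 ox (k0 n) kn' rB Bg0
  (HB (Some j)) (fun l _ => gl0 l).
move=> /(_ (fun l _ => grid_mono L s0 (ltW C0) (leqnSn l)) (class_prob01 j) E1 E2).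
move=> H; apply: le_trans (H _ _ _) _.
- move=> g l lL; have [_ b1] := h1 g l lL; have := a1 (g, Ordinal lL); rewrite /= ler_norml.
  by move=> /andP[_]; rewrite -/(D g l n) in b1 *; rewrite -/(N n (D g l n) w); lra.
- move=> l lL; have := reg (Some j) l lL; rewrite /= -class_probE.
  by rewrite -[p j * v * m n]mulrA [v * m n]mulrC.
- by move=> l lL; have := reg None l lL; rewrite /= -/v [v * m n]mulrC.
rewrite (_ : _ + _ = ((M + 1) * (8 * C / L%:R) + (2 * (M + 1) + 8) * eta) * q n); last first.
  by rewrite /M; ring.
rewrite ler_pM2r//.
have LR : 0 < L%:R :> R by rewrite ltr0n.
have l1 : (M + 1) * (8 * C / L%:R) <= delta / 2.
  have : (M + 1) * 16 * C / delta < L%:R by exact: truncnS_gt.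
  rewrite ltr_pdivrMr// => h; rewrite mulrA ler_pdivrMr//; lra.
have l2 : (2 * (M + 1) + 8) * eta = delta / 2.
  by rewrite /eta; field; rewrite gt_eqF//; lra.
by lra.
Qed.

End one_sample.

(** * Expansion of the divergence *)

Section symmetrized_log_ratio.
Context {R : realType}.
Implicit Types x y p q h l t : R.

Lemma ln_le_sub1 x : 0 < x -> ln x <= x - 1.
Proof.
move=> x0; rewrite -[in ln x](_ : 1 + (x - 1) = x); last by ring.
by apply: le_ln1Dx; lra.
Qed.

Lemma lnB_le x y : 0 < x -> 0 < y -> ln x - ln y <= (x - y) / y.
Proof.
move=> x0 y0; rewrite -ln_div ?posrE//.
by rewrite (le_trans (ln_le_sub1 (divr_gt0 x0 y0)))// mulrBl divff// gt_eqF.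
Qed.

Definition log_gap x y := (x - y) * (ln x - ln y).

(** The slope of the logarithm between x and y lies between 1/M and 1/m. *)
Lemma log_gap_bounds x y m M : 0 < m -> m <= x <= M -> m <= y <= M ->
  (x - y) ^+ 2 / M <= log_gap x y <= (x - y) ^+ 2 / m.
Proof.
move=> m0 /andP[mx xM] /andP[my yM]; rewrite /log_gap.
have x0 : 0 < x by exact: lt_le_trans mx.
have y0 : 0 < y by exact: lt_le_trans my.
have M0 : 0 < M by exact: lt_le_trans xM.
have h1 := lnB_le x0 y0.
have h2 : (x - y) / x <= ln x - ln y.
  by have := lnB_le y0 x0; rewrite -(opprB x y) mulNr; lra.
have inv z : m <= z -> z <= M -> M^-1 <= z^-1 <= m^-1.
  move=> mz zM; have z0 : 0 < z by exact: lt_le_trans mz.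
  by rewrite !lef_pV2 ?posrE// zM mz.
have /andP[ix1 ix2] := inv x mx xM; have /andP[iy1 iy2] := inv y my yM.
have xi : 0 < x^-1 by rewrite invr_gt0.
have yi : 0 < y^-1 by rewrite invr_gt0.
move: h1 h2 ix1 ix2 iy1 iy2 xi yi; rewrite expr2.
move: (ln x - ln y) (x^-1) (y^-1) (M^-1) (m^-1) => L a b c e h1 h2 ix1 ix2 iy1 iy2 a0 b0.
have key t L' a' b' : 0 <= t -> t * b' <= L' -> L' <= t * a' -> c <= b' -> a' <= e ->
    t * t * c <= t * L' <= t * t * e.
  move=> t0 l1 l2 cb ae; rewrite -!mulrA; apply/andP; split; apply: ler_wpM2l => //.
    by apply: le_trans l1; exact: ler_wpM2l.
  by apply: le_trans l2 _; exact: ler_wpM2l.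
have [yx|xy] := leP y x; first by apply: key h2 h1 _ _; rewrite ?subr_ge0.
have -> : (x - y) * (x - y) = (y - x) * (y - x) by ring.
have -> : (x - y) * L = (y - x) * - L by ring.
apply: (key _ _ a b) => //; first by rewrite subr_ge0 ltW.
  by rewrite -(opprB x y) mulNr lerN2.
by rewrite -(opprB x y) mulNr lerN2.
Qed.

Lemma ln1_approx t : `|t| <= 2^-1 -> `|ln (1 + t) - t| <= 2 * t ^+ 2.
Proof.
rewrite ler_norml => /andP[t1 t2]; have t0 : 0 < 1 + t by lra.
have h1 : ln (1 + t) <= t by apply: le_ln1Dx; lra.
have h2 : t / (1 + t) <= ln (1 + t).
  by have := lnB_le ltr01 t0; rewrite ln1 sub0r opprD addNKr mulNr lerN2.
have h3 : t - 2 * t ^+ 2 <= t / (1 + t).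
  rewrite ler_pdivlMr// expr2.
  rewrite (_ : (t - 2 * (t * t)) * (1 + t) = t - t * t * (1 + 2 * t)); last by ring.
  by rewrite gerBl mulr_ge0//; [rewrite -expr2 sqr_ge0|lra].
rewrite ler_norml; apply/andP; split; first by lra.
by have := sqr_ge0 t; lra.
Qed.

(** The coefficients of h and l are the partial derivatives, that is the entries of [kl_grad]. The
    quadratic error has three sources: the curvature of each logarithm and the product of the
    increments of the two factors. *)
Lemma log_gap_linear p q : 0 < p -> 0 < q ->
  exists2 C, 0 <= C & forall h l, `|h| <= p / 2 -> `|l| <= q / 2 ->
    `|log_gap (p + h) (q + l) - log_gap p q - (ln (p / q) + 1 - q / p) * h
       - (ln (q / p) + 1 - p / q) * l| <= C * (`|h| + `|l|) ^+ 2.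
Proof.
move=> p0 q0; pose a := p^-1; pose b := q^-1.
have a0 : 0 < a by rewrite invr_gt0.
have b0 : 0 < b by rewrite invr_gt0.
pose C := 2 * (`|p - q| * (2 * (a + b) ^+ 2)) + 2 * (a + b).
have ab0 : 0 <= a + b by rewrite addr_ge0// ltW.
exists C; first by rewrite /C addr_ge0 ?mulr_ge0 ?exprn_ge0.
move=> h l hp lq.
have hl0 : 0 <= `|h| + `|l| by rewrite addr_ge0.
have norm_t c c0 t : 0 < c -> c0 = c^-1 -> `|t| <= c / 2 -> `|t * c0| <= 2^-1.
  move=> c00 -> tc; have ci : 0 < c^-1 by rewrite invr_gt0.
  by rewrite normrM (gtr0_norm ci) ler_pdivrMr// mulrC; lra.
have th := norm_t p a h p0 erefl hp; have tl := norm_t q b l q0 erefl lq.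
have rh := ln1_approx th; have rl := ln1_approx tl.
have pos c t : 0 < c -> `|t| <= c / 2 -> 0 < c + t.
  by move=> c0; rewrite ler_norml => /andP[? ?]; lra.
have lnE c c0 t : 0 < c -> c0 = c^-1 -> `|t| <= c / 2 -> ln (c + t) = ln c + ln (1 + t * c0).
  move=> c00 -> tc; have ct := pos c t c00 tc.
  have e1 : c + t = c * (1 + t / c) by rewrite mulrDr mulr1 mulrCA divff ?mulr1 ?gt_eqF.
  have e2 : 0 < 1 + t / c by rewrite -(pmulr_rgt0 _ c00) -e1.
  by rewrite e1 lnM ?posrE.
rewrite /log_gap (lnE p a h)// (lnE q b l)// !ln_div ?posrE//.
have sq c t : 0 <= c -> c <= a + b -> `|t| <= `|h| + `|l| ->
    2 * (t * c) ^+ 2 <= 2 * (a + b) ^+ 2 * (`|h| + `|l|) ^+ 2.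
  move=> c0 cab thl; rewrite -mulrA ler_pM2l// -[(t * c) ^+ 2]real_normK ?num_real//.
  rewrite normrM (ger0_norm c0) exprMn mulrC; apply: ler_pM; rewrite ?sqr_ge0//.
    by rewrite lerXn2r ?nnegrE.
  by rewrite lerXn2r ?nnegrE.
set L1 := ln (1 + h * a) in rh *; set L2 := ln (1 + l * b) in rl *.
have ha : `|h| <= `|h| + `|l| by rewrite lerDl.
have la : `|l| <= `|h| + `|l| by rewrite lerDr.
have aab : a <= a + b by rewrite lerDl ltW.
have bab : b <= a + b by rewrite lerDr ltW.
have r1 := le_trans rh (sq a h (ltW a0) aab ha).
have r2 := le_trans rl (sq b l (ltW b0) bab la).
have L1b : `|L1| <= 2 * `|h| * a.
  have := ler_normD (L1 - h * a) (h * a); rewrite subrK => e.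
  apply: (le_trans e); rewrite [ `|h * a| ]normrM (gtr0_norm a0) in th *.
  have : 2 * (h * a) ^+ 2 <= `|h| * a.
    rewrite -[(h * a) ^+ 2]real_normK ?num_real// normrM (gtr0_norm a0) expr2.
    have y0 : 0 <= `|h| * a by rewrite mulr_ge0// ltW.
    by move: y0 th; move: (`|h| * a) => y; clear; nra.
  by lra.
have L2b : `|L2| <= 2 * `|l| * b.
  have := ler_normD (L2 - l * b) (l * b); rewrite subrK => e.
  apply: (le_trans e); rewrite [ `|l * b| ]normrM (gtr0_norm b0) in tl *.
  have : 2 * (l * b) ^+ 2 <= `|l| * b.
    rewrite -[(l * b) ^+ 2]real_normK ?num_real// normrM (gtr0_norm b0) expr2.
    have y0 : 0 <= `|l| * b by rewrite mulr_ge0// ltW.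
    by move: y0 tl; move: (`|l| * b) => y; clear; nra.
  by lra.
rewrite (_ : _ - _ - _ - _ = (p - q) * (L1 - h * a) - (p - q) * (L2 - l * b)
   + (h - l) * (L1 - L2)); last by rewrite /a /b; field; rewrite !gt_eqF.
have e1 : `|(p - q) * (L1 - h * a)| <= `|p - q| * (2 * (a + b) ^+ 2 * (`|h| + `|l|) ^+ 2).
  by rewrite normrM ler_wpM2l.
have e2 : `|(p - q) * (L2 - l * b)| <= `|p - q| * (2 * (a + b) ^+ 2 * (`|h| + `|l|) ^+ 2).
  by rewrite normrM ler_wpM2l.
have e3 : `|(h - l) * (L1 - L2)| <= 2 * (a + b) * (`|h| + `|l|) ^+ 2.
  rewrite normrM expr2 mulrA [_ * (_ + _)]mulrC; apply: ler_pM => //; first exact: ler_normB.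
  apply: le_trans (ler_normB _ _) _; apply: le_trans (lerD L1b L2b) _.
  rewrite -!mulrA -mulrDr ler_pM2l// mulrDl !mulrDr.
  have := mulr_ge0 (ltW a0) (normr_ge0 l); have := mulr_ge0 (ltW b0) (normr_ge0 h).
  clear; lra.
apply: le_trans (ler_normD _ _) _; apply: le_trans (lerD (ler_normB _ _) e3) _.
rewrite [leRHS](_ : _ = `|p - q| * (2 * (a + b) ^+ 2 * (`|h| + `|l|) ^+ 2) +
  `|p - q| * (2 * (a + b) ^+ 2 * (`|h| + `|l|) ^+ 2) + 2 * (a + b) * (`|h| + `|l|) ^+ 2).
  by rewrite lerD2r; exact: lerD.
by rewrite /C; ring.
Qed.

(** The function ln x + 1 - 1/x is strictly increasing; its value at p_j / q_j is
    [kl_grad p q j]. *)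
Lemma log_slope_inj x y : 0 < x -> 0 < y ->
  ln x + 1 - x^-1 = ln y + 1 - y^-1 -> x = y.
Proof.
have H (z w : R) : 0 < z -> z < w -> ln z + 1 - z^-1 < ln w + 1 - w^-1.
  move=> z0 zw; have w0 : 0 < w by exact: lt_trans zw.
  have := ltr_ln z0 w0; rewrite zw => l1.
  have : w^-1 < z^-1 by rewrite ltf_pV2.
  by lra.
move=> x0 y0 e; have [xy|yx|//] := ltgtP x y.
  by have := H x y x0 xy; rewrite e ltxx.
by have := H y x y0 yx; rewrite e ltxx.
Qed.

End symmetrized_log_ratio.

(** * The asymptotic variance and its positivity *)

Section kl_variance.
Context {R : realType} {K : nat}.
Implicit Types p q g : 'I_K -> R.

Lemma sqr_sum (a : 'I_K -> R) : (\sum_j a j) ^+ 2 =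
  \sum_j a j ^+ 2 + 2 * \sum_(j1 < K) \sum_(j2 < K | (j1 < j2)%N) a j1 * a j2.
Proof.
have -> : (\sum_j a j) ^+ 2 = \sum_(j1 < K) \sum_(j2 < K) a j1 * a j2.
  by rewrite expr2 mulr_suml; apply: eq_bigr => j1 _; rewrite mulr_sumr.
have -> : \sum_(j1 < K) \sum_(j2 < K) a j1 * a j2 =
  \sum_(j1 < K) (a j1 ^+ 2 + \sum_(j2 < K | (j1 < j2)%N) a j1 * a j2 +
   \sum_(j2 < K | (j2 < j1)%N) a j1 * a j2).
  apply: eq_bigr => j1 _; rewrite (bigD1 j1)//= -expr2 -addrA; congr (_ + _).
  rewrite (bigID (fun j2 : 'I_K => (j1 < j2)%N))/=; congr (_ + _); apply: eq_bigl => j2.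
    by case: ltngtP => //; rewrite ?andbF ?andbT // -val_eqE/= => h; rewrite ?(gtn_eqF h).
  by rewrite -leqNgt ltn_neqAle -val_eqE.
rewrite !big_split/= -addrA; congr (_ + _).
rewrite mulr2n mulrDl !mul1r; congr (_ + _).
rewrite (exchange_big_dep xpredT)//=; apply: eq_bigr => j1 _.
by apply: eq_bigr => j2 _; rewrite mulrC.
Qed.

Definition weighted_mean p g : R := \sum_j p j * g j.

Lemma weighted_variance p g : \sum_j p j = 1 ->
  \sum_j p j * (g j - weighted_mean p g) ^+ 2 = \sum_j p j * g j ^+ 2 - weighted_mean p g ^+ 2.
Proof.
move=> p1; set mu := weighted_mean p g.
rewrite (eq_bigr (fun j => p j * g j ^+ 2 - 2 * mu * (p j * g j) + mu ^+ 2 * p j)); last first.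
  by move=> j _; ring.
rewrite big_split/= sumrB -!mulr_sumr p1 -/(weighted_mean p g) -/mu; ring.
Qed.

(** The stated formula is the variance of the gradient under the two multinomial laws; written as
    sums of weighted squares it is visibly nonnegative. *)
Lemma kl_varianceE p q : \sum_j p j = 1 -> \sum_j q j = 1 ->
  kl_variance p q =
  \sum_j p j * (kl_grad p q j - weighted_mean p (kl_grad p q)) ^+ 2 +
  \sum_j q j * (kl_grad q p j - weighted_mean q (kl_grad q p)) ^+ 2.
Proof.
move=> p1 q1; rewrite !weighted_variance// /kl_variance /weighted_mean !sqr_sum.
rewrite (eq_bigr (fun j => (p j * kl_grad p q j ^+ 2 - (p j * kl_grad p q j) ^+ 2) +
   (q j * kl_grad q p j ^+ 2 - (q j * kl_grad q p j) ^+ 2))); last by move=> j _; ring.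
rewrite !big_split/= !sumrN.
rewrite [X in _ - 2 * X = _](_ : _ =
  (\sum_(j1 < K) \sum_(j2 < K | (j1 < j2)%N) (p j1 * kl_grad p q j1) * (p j2 * kl_grad p q j2)) +
  (\sum_(j1 < K) \sum_(j2 < K | (j1 < j2)%N) (q j1 * kl_grad q p j1) * (q j2 * kl_grad q p j2))).
  by ring.
rewrite -big_split; apply: eq_bigr => j1 _; rewrite -big_split; apply: eq_bigr => j2 _ /=; ring.
Qed.

(** Zero variance makes [kl_grad p q] constant in j, hence also the ratio p_j / q_j, by injectivity
    of the slope; as both vectors have sum 1, the ratio is 1. *)
Lemma kl_variance_gt0 p q : (forall j, 0 < p j) -> (forall j, 0 < q j) ->
  \sum_j p j = 1 -> \sum_j q j = 1 -> (exists j, p j <> q j) -> 0 < kl_variance p q.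
Proof.
move=> p0 q0 p1 q1 [j0 pq0]; rewrite kl_varianceE//.
set mu := weighted_mean p _; set mu' := weighted_mean q _.
have h2 : 0 <= \sum_j q j * (kl_grad q p j - mu') ^+ 2.
  by apply: sumr_ge0 => j _; rewrite mulr_ge0 ?sqr_ge0// ltW.
have t0 j : 0 <= p j * (kl_grad p q j - mu) ^+ 2 by rewrite mulr_ge0 ?sqr_ge0// ltW.
have h1 : 0 <= \sum_j p j * (kl_grad p q j - mu) ^+ 2 by apply: sumr_ge0 => j _; exact: t0.
suff h3 : \sum_j p j * (kl_grad p q j - mu) ^+ 2 != 0.
  by rewrite ltr_wpDr// lt_neqAle eq_sym h3.
apply/eqP => /eqP; rewrite psumr_eq0// => /allP H; apply: pq0.
have const j : kl_grad p q j = mu.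
  have := H j (mem_index_enum j); rewrite /= mulf_eq0 gt_eqF//= sqrf_eq0 subr_eq0.
  by move/eqP.
have ratio j : p j = (p j0 / q j0) * q j.
  have e : p j / q j = p j0 / q j0.
    apply: log_slope_inj; rewrite ?divr_gt0// !invf_div.
    by rewrite -![ln _ + _ - _]/(kl_grad p q _) !const.
  by rewrite -e divfK ?gt_eqF.
have c1 : p j0 / q j0 = 1.
  by rewrite -[RHS]p1 -[LHS]mulr1 -q1 mulr_sumr; apply: eq_bigr => j _; rewrite -ratio.
by have := ratio j0; rewrite c1 mul1r.
Qed.

End kl_variance.

(** * A Householder reflection *)

Section householder.
Context {R : realType} {m : nat}.
Variable s : 'I_m.+1 -> R.
Hypotheses (s1 : \sum_j s j ^+ 2 = 1) (sm : s ord_max < 1).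

Let w (j : 'I_m.+1) : R := s j - (j == ord_max)%:R.
(** This is the Householder factor 2 / |w|^2, since |w|^2 = 2 (1 - s ord_max) for a unit vector
    s. *)
Let c : R := (1 - s ord_max)^-1.

(* The reflection exchanging s and the last basis vector. *)
Definition reflection (i j : 'I_m.+1) : R := (i == j)%:R - c * w i * w j.

Let cE : c * (1 - s ord_max) = 1.
Proof. by rewrite mulVf// gt_eqF// subr_gt0. Qed.

Let sum_delta (f : 'I_m.+1 -> R) i : \sum_j (i == j)%:R * f j = f i.
Proof.
rewrite (bigD1 i)//= eqxx mul1r big1 ?addr0// => j ji.
by rewrite eq_sym (negbTE ji) mul0r.
Qed.

Let sum_w (f : 'I_m.+1 -> R) : \sum_j w j * f j = \sum_j s j * f j - f ord_max.
Proof.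
rewrite -(sum_delta f ord_max) -sumrB; apply: eq_bigr => j _.
by rewrite /w (eq_sym ord_max) mulrBl.
Qed.

Let sum_ww : \sum_j w j * w j = 2 * (1 - s ord_max).
Proof.
rewrite sum_w; under eq_bigr do rewrite mulrC; rewrite sum_w.
under eq_bigr do rewrite -expr2; rewrite s1 /w eqxx /=; ring.
Qed.

Lemma sum_reflection (f : 'I_m.+1 -> R) i :
  \sum_j reflection i j * f j = f i - c * w i * \sum_j w j * f j.
Proof.
rewrite (eq_bigr (fun j => (i == j)%:R * f j - c * w i * (w j * f j))); last first.
  by move=> j _; rewrite /reflection; ring.
by rewrite sumrB sum_delta -mulr_sumr.
Qed.

Lemma reflection_orthonormal i i' :
  \sum_j reflection i j * reflection i' j = (i == i')%:R.
Proof.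
rewrite sum_reflection; under eq_bigr do rewrite mulrC.
rewrite sum_reflection sum_ww /reflection (eq_sym i').
rewrite (_ : _ - _ = (i == i')%:R - c * w i * w i' * (2 - 2 * (c * (1 - s ord_max)))); last by ring.
by rewrite cE mulr1 subrr mulr0 subr0.
Qed.

Lemma reflection_kernel (i : 'I_m.+1) : i != ord_max -> \sum_j reflection i j * s j = 0.
Proof.
move=> im; rewrite sum_reflection sum_w; under eq_bigr do rewrite -expr2.
rewrite s1 /w (negbTE im) subr0 (_ : _ - _ = s i * (1 - c * (1 - s ord_max))); last by ring.
by rewrite cE subrr mulr0.
Qed.

(** The last row of the reflection is s, so the last coordinate of the image of a vector orthogonal
    to s vanishes and the first m coordinates carry the whole norm. *)
Lemma reflection_isometry (z : 'I_m.+1 -> R) : \sum_j s j * z j = 0 ->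
  \sum_(l < m) (\sum_j reflection (widen_ord (leqnSn m) l) j * z j) ^+ 2 = \sum_j z j ^+ 2.
Proof.
move=> sz.
have all : \sum_(i < m.+1) (\sum_j reflection i j * z j) ^+ 2 = \sum_j z j ^+ 2.
  set B := \sum_j w j * z j.
  rewrite (eq_bigr (fun i => z i ^+ 2 - 2 * c * B * (w i * z i) + (c * B) ^+ 2 * (w i * w i))).
    rewrite big_split/= sumrB -!mulr_sumr sum_ww -/B.
    rewrite (_ : _ + _ = \sum_j z j ^+ 2 + 2 * c * B ^+ 2 * (c * (1 - s ord_max) - 1)); last by ring.
    by rewrite cE subrr mulr0 addr0.
  by move=> i _; rewrite sum_reflection -/B; ring.
rewrite -all big_ord_recr/= (_ : \sum_j reflection ord_max j * z j = 0) ?expr0n ?addr0//=.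
rewrite sum_reflection sum_w sz sub0r /w eqxx /=.
rewrite (_ : _ - _ = z ord_max * (1 - c * (1 - s ord_max))); last by ring.
by rewrite cE subrr mulr0.
Qed.

End householder.

(** * Convergence in distribution *)

Section slutsky.
Context d (S : measurableType d) (R : realType) (P : probability S R).
Variable mu : probability (measurableTypeR R) R.

Local Notation F x := (fine (mu (`]-oo, x]%classic : set R))).

Let Ffin x : mu (`]-oo, x]%classic : set R) \is a fin_num.
Proof. by rewrite fin_num_measure. Qed.

(* Convergence in the Levy metric, together with the measurability it presupposes. *)
Definition law_close (Y : nat -> S -> R) := forall a e, 0 < e ->
  exists N, forall n, (N <= n)%N ->
    [/\ measurable [set w | Y n w <= a],
      fine (P [set w | Y n w <= a]) <= F (a + e) + e &
      F (a - e) - e <= fine (P [set w | Y n w <= a])].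

Lemma slutsky (U Y : nat -> S -> R) :
  (forall n x, measurable [set w | U n w <= x]) -> law_close Y ->
  (forall e, 0 < e -> whp P (fun n => [set w | `|U n w - Y n w| <= e])) ->
  cvg_in_distribution P U mu.
Proof.
move=> mU HY HUY x cx.
have finP A : measurable A -> P A \is a fin_num by move=> mA; rewrite fin_num_measure.
rewrite -(fineK (Ffin x)); apply/fine_cvgP; split; first by near=> n; exact: finP.
apply/cvgrPdist_le => e e0.
have cF : F y @[y --> x] --> F x by apply: fine_cvg; rewrite fineK//; exact: cx.
have e40 : 0 < e / 4 by rewrite divr_gt0.
move/cvgrPdist_le: (cF) => /(_ _ e40) /nbhs_ballP[eta /= eta0 Heta].
(* F gets evaluated at x + 2 t and x - 2 t: one t is spent on replacing U by Y, the other on the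
   closeness of the law of Y. Both points stay within [eta] of x. *)
pose t := Num.min (eta / 4) (e / 4).
have t0 : 0 < t by rewrite lt_min !divr_gt0.
have [te t4] : t <= eta / 4 /\ t <= e / 4 by rewrite /t; split; rewrite ge_min lexx ?orbT.
have near_F y : `|x - y| < eta -> `|F x - F y| <= e / 4.
  by move=> h; apply: Heta; rewrite -ball_normE.
have H1 := near_F (x + t + t); have H2 := near_F (x - t - t).
have [N1 {}HN1] := HY (x + t) t t0; have [N2 {}HN2] := HY (x - t) t t0.
have [N3 {}HN3] := HUY t t0 (e / 4) e40.
exists (maxn N1 (maxn N2 N3)) => // n /=; rewrite !geq_max.
move=> /and3P[/HN1[mY1 up _] /HN2[mY2 _ lo] /HN3[G [mG GQ PG]]].
have mUx := mU n x.
have PG' : fine (P (~` G)) <= e / 4 by rewrite -lee_fin fineK// finP//; exact: measurableC.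
have l1 : fine (P [set w | U n w <= x]) <= fine (P [set w | Y n w <= x + t]) + fine (P (~` G)).
  have mG' := measurableC mG.
  rewrite -fineD ?finP//; apply: fine_le; rewrite ?finP ?fin_numD ?finP//.
  apply: le_trans (measureU2 _ mY1 mG').
  apply: le_measure; rewrite ?inE//; first exact: measurableU.
  move=> w /= Ux; have [Gw|nG] := pselect (G w); [left|by right].
  by move: Ux (GQ w Gw); rewrite /= ler_norml; clear - P mu => ? /andP[? ?]; lra.
have l2 : fine (P [set w | Y n w <= x - t]) <= fine (P [set w | U n w <= x]) + fine (P (~` G)).
  have mG' := measurableC mG.
  rewrite -fineD ?finP//; apply: fine_le; rewrite ?finP ?fin_numD ?finP//.
  apply: le_trans (measureU2 _ mUx mG').
  apply: le_measure; rewrite ?inE//; first exact: measurableU.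
  move=> w /= Yx; have [Gw|nG] := pselect (G w); [left|by right].
  by move: Yx (GQ w Gw); rewrite /= ler_norml; clear - P mu => ? /andP[? ?]; lra.
have h1 : `|F x - F (x + t + t)| <= e / 4.
  by apply: H1; rewrite opprD opprD !addrA subrr sub0r -opprD normrN ger0_norm; move: t0 te eta0; clear - P mu; lra.
have h2 : `|F x - F (x - t - t)| <= e / 4.
  by apply: H2; rewrite (_ : x - (x - t - t) = t + t) ?ger0_norm; [move: t0 te eta0; clear - P mu; lra|lra|ring].
move: up lo l1 l2 PG' t4 h1 h2; rewrite !ler_norml; clear - P mu => ? ? ? ? ? ? /andP[? ?] /andP[? ?].
by apply/andP; split; lra.
Unshelve. all: by end_near. Qed.

(** Indicators are squeezed between cutoffs, whose averages converge. The width is t = e / 3 because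
    [cutoff a t] reaches 0 at a + 3 t. *)
Lemma law_close_steps (W : zmodType) (nu : nat -> seq (R * W)) (g : W -> R)
    (T : nat -> S -> W) (I : R -> R -> R) :
  (forall n, is_law (nu n)) ->
  (forall n a, measurable [set w | g (T n w) <= a] /\
    fine (P [set w | g (T n w) <= a]) =
    iter n (step (nu n)) (fun y => (g y <= a)%R%:R) 0) ->
  (forall a e, 0 < e -> iter n (step (nu n)) (fun y => cutoff a e (g y)) 0 @[n --> \oo] --> I a e) ->
  (forall a e, 0 < e -> (\int[mu]_z (cutoff a e z)%:E = (I a e)%:E)%E) ->
  law_close (fun n w => g (T n w)).
Proof.
move=> lawn HP HI Hint a e e0; pose t := e / 3.
have t0 : 0 < t by rewrite divr_gt0.
have t3 : 3 * t = e by rewrite /t; field.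
have c1 := HI a t t0; have c2 := HI (a - e) t t0.
move/cvgrPdist_le: c1 => /(_ _ e0)[N1 _ HN1].
move/cvgrPdist_le: c2 => /(_ _ e0)[N2 _ HN2].
exists (maxn N1 N2) => n; rewrite geq_max => /andP[n1 n2].
have [mY ->] := HP n a; split=> //.
- have /andP[_] := cutoff_prob mu a t0; rewrite Hint// t3 -(fineK (Ffin (a + e))) lee_fin => h.
  have := HN1 n n1; rewrite /= ler_norml => /andP[h1 _].
  have : iter n (step (nu n)) (fun y => (g y <= a)%R%:R) 0 <=
    iter n (step (nu n)) (fun y => cutoff a t (g y)) 0.
    apply: ler_iter_step => // y; case: (boolP (g y <= a)) => ga.
      by rewrite cutoff_left.
    by have /andP[] := cutoff_le1 a t (g y).
  by lra.
- have /andP[+ _] := cutoff_prob mu (a - e) t0.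
  rewrite Hint// -(fineK (Ffin (a - e))) lee_fin => h.
  have := HN2 n n2; rewrite /= ler_norml => /andP[_ h1].
  have : iter n (step (nu n)) (fun y => cutoff (a - e) t (g y)) 0 <=
    iter n (step (nu n)) (fun y => (g y <= a)%R%:R) 0.
    apply: ler_iter_step => // y; case: (leP (g y) a) => ga.
      by have /andP[] := cutoff_le1 (a - e) t (g y).
    have [|-> _ _//] := @cutoff_right _ (a - e) t (g y) t0.
    by rewrite t3 subrK ltW.
  by lra.
Qed.

End slutsky.

(** * Scores *)

Section tightness.
Context d (S : measurableType d) (R : realType) (P : probability S R).

Definition tight (f : nat -> S -> R) := forall eps, 0 < eps ->
  exists B, likely P eps (fun n => [set w | `|f n w| <= B]).

Lemma tight_forall (I : finType) (f : I -> nat -> S -> R) : (forall i, tight (f i)) ->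
  forall eps, 0 < eps -> exists B, 0 <= B /\
    likely P eps (fun n => [set w | forall i, `|f i n w| <= B]).
Proof.
move=> H; suff : forall s : seq I, forall eps, 0 < eps -> exists B, 0 <= B /\
    likely P eps (fun n => [set w | forall i, i \in s -> `|f i n w| <= B]).
  move=> /(_ (enum I)) h eps /h[B [B0 HB]]; exists B; split=> //.
  by apply: likely_mono HB; exists 0%N => n _ w h' i; apply: h'; rewrite mem_enum.
elim=> [|i s IH] eps eps0.
  exists 0; split=> //; have := whpT P eps0.
  by apply: likely_mono; exists 0%N => n _ w _ i.
have e2 : 0 < eps / 2 by rewrite divr_gt0.
have [B1 [B10 H1]] := IH _ e2; have [B2 H2] := H i _ e2.
exists (B1 + `|B2|); split; first by rewrite addr_ge0.
rewrite [eps]splitr; apply: likely_mono (likelyI H1 H2).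
exists 0%N => n _ w [/= h1 h2] j; rewrite inE => /orP[/eqP->|/h1 h].
  by rewrite (le_trans h2)// (le_trans (ler_norm _))// lerDr.
by rewrite (le_trans h)// lerDl.
Qed.

Lemma tightD f g : tight f -> tight g -> tight (fun n w => f n w + g n w).
Proof.
move=> Hf Hg eps eps0; have e2 : 0 < eps / 2 by rewrite divr_gt0.
have [B1 H1] := Hf _ e2; have [B2 H2] := Hg _ e2; exists (B1 + B2).
rewrite [eps]splitr; apply: likely_mono (likelyI H1 H2).
exists 0%N => n _ w [/= h1 h2]; exact: le_trans (ler_normD _ _) (lerD h1 h2).
Qed.

Lemma tightZ c f : tight f -> tight (fun n w => c * f n w).
Proof.
move=> Hf eps eps0; have [B HB] := Hf _ eps0; exists (`|c| * B).
by apply: likely_mono HB; exists 0%N => n _ w /= h; rewrite normrM ler_wpM2l.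
Qed.

Lemma tight_bounded (f : nat -> R) B :
  (exists N, forall n, (N <= n)%N -> `|f n| <= B) -> tight (fun n _ => f n).
Proof.
move=> [N H] eps eps0; exists B; have := whpT P eps0.
by apply: likely_mono; exists N => n /H h w _.
Qed.

End tightness.

Lemma big_option (R : Type) (idx : R) (op : Monoid.com_law idx) (I : finType)
    (F : option I -> R) :
  \big[op/idx]_(c : option I) F c = op (F None) (\big[op/idx]_(i : I) F (Some i)).
Proof.
rewrite (bigD1 None)//=; congr (op _ _).
rewrite (reindex_omap Some id) => [|[i|]//]; apply: eq_bigl => i.
by rewrite eqxx.
Qed.

(** * Cells of the partition at the critical level *)

Section cells.
Context {R : realType} {d K : nat} {dT : measure_display} {T : measurableType dT}.
Variables (P0 : probability T R) (X : {RV P0 >-> borel_rV R d}).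
Variables (nu : {measure set (borel_rV R d) -> \bar R}) (a : R -> R).
Hypotheses (hd : (1 <= d)%N) (pareto : standard_pareto_margins X).
Hypotheses (X0 : orthant_valued X).
Hypotheses (rv : regularly_varying X nu) (so : second_order X nu a).
Variables (r : 'rV[R]_d -> R) (A : 'I_K -> set 'rV[R]_d).
Hypotheses (hr : risk_functional r) (hA : admissible_partition r A).
Local Notation Omega := (risk_region r).
Hypothesis Opos : (0 < nu Omega)%E.
Variable k : nat -> nat.
Hypothesis k0 : forall n, (0 < k n)%N.
Hypothesis koo : k n @[n --> \oo] --> \oo.
Hypothesis kn : (k n)%:R / n%:R @[n --> \oo] --> (0 : R).
Local Notation q n := (Num.sqrt (k n)%:R : R).
Local Notation u n := (quantile_level X k n).
Hypothesis ka : q n * a (u n) @[n --> \oo] --> (0 : R).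
Local Notation m n := (mean_exceedances X k n).
Local Notation sstar n := (critical_level X nu r k n).
Local Notation p j := (class_prob nu r (A j)).

(** [None] stands for a point outside the dilated risk region. It is also the default for a
    nonpositive critical level, which occurs for finitely many n at most; the code is thus
    measurable for every n. *)
Definition cell n (z : borel_rV R d) : option 'I_K :=
  if 0 < sstar n then [pick j | `[< dilation (sstar n) (A j) ((u n)^-1 *: (z : 'rV[R]_d)) >]]
  else None.

Lemma cellP n z j : 0 < sstar n ->
  cell n z = Some j <-> dilation (sstar n) (A j) ((u n)^-1 *: (z : 'rV[R]_d)).
Proof.
move=> s0; rewrite /cell s0; case: pickP => [l /asboolP Al|H].
  split=> [[<-]//|Aj]; congr Some.
  have [[_ tA _] _] := hA; apply: (tA l j I I).
  by exists ((sstar n)^-1 *: ((u n)^-1 *: (z : 'rV[R]_d))); move: Al Aj; rewrite !dilationE ?gt_eqF.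
by split=> // Aj; have := H j; rewrite (asboolT Aj).
Qed.

Lemma cell_risk n z : 0 < sstar n ->
  cell n z <> None <-> dilation (sstar n) Omega ((u n)^-1 *: (z : 'rV[R]_d)).
Proof.
move=> s0; have [[UA _ _] _] := hA; split.
  case e : (cell n z) => [j|//] _; have /cellP := e; move=> /(_ s0).
  apply: dilationS; exact: (@region_sub _ _ _ _ _ hA (Some j)).
rewrite dilationE ?gt_eqF//= -UA => -[j _ Aj] e.
have : cell n z = Some j by apply/cellP => //; rewrite dilationE ?gt_eqF.
by rewrite e.
Qed.

Lemma measurable_scaled_dilation n (B : set 'rV[R]_d) : 0 < sstar n -> borel B ->
  borel [set z | dilation (sstar n) B ((u n)^-1 *: z)].
Proof.
move=> s0 bB; have h : borel (dilation (sstar n) B) by exact: borel_dilation.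
have : borel ( *:%R (u n)^-1 @^-1` dilation (sstar n) B).
  by apply: borel_preimage => //; exact: scaler_continuous.
by [].
Qed.

Lemma measurable_cell n c : measurable (cell n @^-1` [set c]).
Proof.
have [s0|s0] := boolP (0 < sstar n); last first.
  have e z : cell n z = None by rewrite /cell (negbTE s0).
  case: c => [j|].
    by rewrite (_ : _ @^-1` _ = set0)// -subset0 => z /=; rewrite e.
  by rewrite (_ : _ @^-1` _ = setT)//; apply/seteqP; split=> z //= _; rewrite e.
case: c => [j|].
  rewrite (_ : _ @^-1` _ = [set z : 'rV[R]_d | dilation (sstar n) (A j) ((u n)^-1 *: z)]).
    by apply: measurable_scaled_dilation => //; exact: (borel_region hr hA (Some j)).
  by apply/seteqP; split=> z /=; rewrite cellP.
rewrite (_ : _ @^-1` _ = ~` [set z : 'rV[R]_d | dilation (sstar n) Omega ((u n)^-1 *: z)]).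
  apply: borelC; apply: measurable_scaled_dilation => //; exact: borel_risk_region.
apply/seteqP; split=> z /=; rewrite -cell_risk//.
  by move=> e; rewrite e; apply.
by move=> h; apply: contrapT => e; apply: h.
Qed.

Definition cell_weight n (c : option 'I_K) : R :=
  fine (P0 (X @^-1` (cell n @^-1` [set c]))).


(** At the critical level the main term m n nu(s A_j) is exactly k_n p_j, so only the second-order
    error remains. *)
Lemma cell_weight_rate eta : 0 < eta -> exists N, forall n, (N <= n)%N ->
  forall j, `|n%:R * cell_weight n (Some j) - (k n)%:R * p j| <= eta * q n.
Proof.
move=> eta0.
have [N1 H1] := critical_level_bounds hd pareto X0 rv so hr Opos k0 kn.
have [N2 H2] := mean_rate hd pareto X0 rv so hr Opos k0 kn ka eta0.
exists (maxn N1 N2) => n; rewrite geq_max => /andP[/H1[[u0 s0 vs] _ mv m0 _] /H2 h2] j.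
have v0 := nu_risk_gt0 rv hr Opos.
have s6 : fine (nu Omega) / 6 <= sstar n by lra.
have bA := borel_region hr hA (Some j); have AO := @region_sub _ _ _ _ _ hA (Some j).
have := h2 _ (borel_dilation s0 bA) (dilation_sub_risk rv hr Opos s6 AO).
have pE : p j * fine (nu Omega) = fine (nu (A j)) by rewrite /class_prob divfK// gt_eqF.
rewrite (fine_nu_dilation rv hr)//= -pE.
rewrite (_ : m n * _ = m n * fine (nu Omega) / sstar n * p j); last by ring.
rewrite mv mulfK ?gt_eqF// (_ : prob_scaled X (u n) (dilation (sstar n) (A j)) = cell_weight n (Some j))//.
rewrite /prob_scaled /cell_weight; congr (fine (P0 _)).
by apply/seteqP; split=> w /=; rewrite cellP.
Qed.

Definition cell_score j (c : option 'I_K) : R :=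
  (c == Some j)%:R - p j * (c != None)%:R.

Context {dS : measure_display} {S : measurableType dS} {P : probability S R}.
Variables (I : choiceType) (Z : I -> {RV P >-> borel_rV R d}) (idx : nat -> I).
Hypothesis hind : mutually_independent P (fun i => Z i : S -> borel_rV R d).
Hypothesis idx_inj : injective idx.
Hypothesis Z0 : forall i, orthant_valued (Z (idx i)).
Hypothesis Zlaw : forall i, same_law P P0 (Z (idx i)) X.

Lemma cell_weightE n i c :
  fine (P (Z (idx i) @^-1` (cell n @^-1` [set c]))) = cell_weight n c.
Proof. by rewrite (Zlaw i (measurable_cell n c)). Qed.

Definition score_sum n j (w : S) : R :=
  \sum_(i <- iota 0 n) cell_score j (cell n (Z (idx i) w)).

Lemma score_sumE n j w : 0 < sstar n ->
  score_sum n j w = level_count X k Z idx n (dilation (sstar n) (A j)) w -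
    p j * level_count X k Z idx n (dilation (sstar n) Omega) w.
Proof.
move=> s0; rewrite /score_sum /level_count /scaled_count mulr_sumr -sumrB.
apply: eq_bigr => i _; rewrite /cell_score !indicE /vec; set z := Z (idx i) w.
have -> : (cell n z == Some j) = ((u n)^-1 *: (z : 'rV[R]_d) \in dilation (sstar n) (A j)).
  by apply/eqP/idP => [/cellP h|/set_mem/cellP ->//]; apply: mem_set; exact: h.
have -> // : (cell n z != None) = ((u n)^-1 *: (z : 'rV[R]_d) \in dilation (sstar n) Omega).
have h := cell_risk z s0; apply/idP/idP => [/eqP/h|/set_mem/h]; first exact: mem_set.
by move/eqP.
Qed.

Theorem class_freq_scores delta : 0 < delta -> whp P (fun n => [set w | forall j : 'I_K,
  `|q n * (class_freq r (fun i => vec (Z (idx i)) w) n (k n) (A j) - p j) -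
    score_sum n j w / q n| <= delta]).
Proof.
move=> delta0.
have [N1 H1] := critical_level_bounds hd pareto X0 rv so hr Opos k0 kn.
apply: whp_mono (one_sample hd pareto X0 rv so hr hA Opos k0 koo kn ka hind idx_inj Z0 Zlaw delta0).
exists N1 => n /H1[[_ s0 _] _ _ _ _] w /= h j; have := h j.
have q0 := @sqrt_k_gt0 R k k0 n; have qq := @sqr_sqrt_k R k n.
rewrite -score_sumE//; set f := class_freq _ _ _ _ _ - _.
set Q := q n in q0 qq *; set b := (k n)%:R in qq *.
rewrite (_ : Q * f - score_sum n j w / Q = (b * f - score_sum n j w) / Q); last first.
  by rewrite -qq; field; rewrite gt_eqF.
by rewrite normrM normfV (gtr0_norm q0) ler_pdivrMr.
Qed.

(** The counts in A_j and in the whole region deviate from their means by order sqrt k_n, by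
    Chebyshev. Their means are k_n p_j and k_n up to sqrt k_n, so the main terms cancel in the
    score. *)
Theorem score_sum_tight j : tight P (fun n w => score_sum n j w / q n).
Proof.
have [N1 H1] := critical_level_bounds hd pareto X0 rv so hr Opos k0 kn.
have [N2 H2] := mean_rate hd pareto X0 rv so hr Opos k0 kn ka ltr01.
have v0 := nu_risk_gt0 rv hr Opos.
pose D (l : option 'I_K) n := dilation (sstar n) (oapp A Omega l).
have facts l : exists N, forall n, (N <= n)%N -> [/\ borel (D l n),
   n%:R * prob_scaled X (u n) (D l n) <= 2 * (k n)%:R &
   `|n%:R * prob_scaled X (u n) (D l n) - (k n)%:R * (fine (nu (oapp A Omega l)) / fine (nu Omega))| <= q n].
  have [N3 H3] := sqrt_k_cvg k0 koo (1 : R).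
  exists (maxn N1 (maxn N2 N3)) => n; rewrite !geq_max => /and3P[/H1[[u0 s0 vs] _ mv m0 _] /H2 h2 /H3 q1].
  have bA := borel_region hr hA l; have AO := @region_sub _ _ _ _ _ hA l.
  have s6 : fine (nu Omega) / 6 <= sstar n by lra.
  have bD : borel (D l n) by exact: borel_dilation.
  have := h2 _ bD (dilation_sub_risk rv hr Opos s6 AO).
  rewrite (fine_nu_dilation rv hr)// mul1r.
  rewrite (_ : m n * _ = m n * fine (nu Omega) / sstar n * (fine (nu (oapp A Omega l)) / fine (nu Omega))); last first.
    by field; rewrite !gt_eqF.
  rewrite mv mulfK ?gt_eqF// => h; split=> //.
  have l1 : fine (nu (oapp A Omega l)) / fine (nu Omega) <= 1.
    rewrite ler_pdivrMr// mul1r; apply: fine_nu_le => //; first exact: borel_risk_region.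
    by have := nu_dilation_fin rv hr ltr01 (borel_risk_region hr) (@subset_refl _ _); rewrite dilation1.
  have kR : 0 < (k n)%:R :> R by rewrite ltr0n.
  have : (k n)%:R * (fine (nu (oapp A Omega l)) / fine (nu Omega)) <= (k n)%:R.
    by rewrite -[leRHS]mulr1 ler_pM2l.
  have : q n <= (k n)%:R.
    by have := @sqr_sqrt_k R k n; move: q1; move: (q n) => Q q1 <-; nra.
  by move: h; rewrite ler_norml => /andP[_]; lra.
have cnt l : tight P (fun n w => (level_count X k Z idx n (D l n) w -
    n%:R * prob_scaled X (u n) (D l n)) / q n).
  move=> eps eps0; pose c := 2 / eps + 1.
  have c1 : 1 <= c by rewrite /c lerDr divr_ge0// ltW.
  have c0 : 0 < c by exact: lt_le_trans c1.
  have [N3 H3] := facts l; exists c.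
  have h : exists N, forall n, (N <= n)%N -> borel (D l n) /\
      n%:R * prob_scaled X (u n) (D l n) <= 2 * (k n)%:R.
    by exists N3 => n /H3[].
  have le : 2 / c ^+ 2 <= eps.
    rewrite ler_pdivrMr ?exprn_gt0// expr2.
    have : eps * c = 2 + eps by rewrite /c mulrDr mulr1 mulrC divfK ?gt_eqF.
    move=> e; apply: (@le_trans _ _ (eps * c)); first by lra.
    by rewrite ler_pM2l// -[leLHS]mulr1 ler_pM2l.
  apply: likely_le le _.
  apply: likely_mono (level_count_bound k0 hind idx_inj Zlaw c0 h).
  exists 0%N => n _ w /= h1; have q0 := @sqrt_k_gt0 R k k0 n.
  by rewrite normrM normfV (gtr0_norm q0) ler_pdivrMr// ltW.
have det : tight P (fun n _ => (n%:R * prob_scaled X (u n) (D (Some j) n) -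
    p j * (n%:R * prob_scaled X (u n) (D None n))) / q n).
  have [N3 H3] := facts (Some j); have [N4 H4] := facts None.
  apply: (@tight_bounded _ _ _ _ _ 2); exists (maxn N3 N4) => n; rewrite geq_max.
  move=> /andP[/H3[_ _ h3] /H4[_ _]]; rewrite /= divff ?gt_eqF// mulr1 => h4.
  have q0 := @sqrt_k_gt0 R k k0 n; rewrite normrM normfV (gtr0_norm q0) ler_pdivrMr//.
  have /andP[p0 p1] := class_prob01 rv hr hA Opos j.
  move: h3; rewrite /= -/(p j) => h3.
  rewrite (_ : _ - _ = (n%:R * prob_scaled X (u n) (D (Some j) n) - (k n)%:R * p j) -
    p j * (n%:R * prob_scaled X (u n) (D None n) - (k n)%:R)); last by ring.
  apply: le_trans (ler_normB _ _) _; rewrite mulrDl mul1r; apply: lerD => //.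
  by rewrite normrM (ger0_norm p0) -[leRHS]mul1r; apply: ler_pM.
move=> eps eps0.
have [B HB] := tightD (tightD (cnt (Some j)) (tightZ (- p j) (cnt None))) det eps0.
exists B; apply: likely_mono HB; exists N1 => n /H1[[_ s0 _] _ _ _ _] w /=.
rewrite score_sumE//; congr (`|_| <= _).
by rewrite -/(D (Some j) n) -/(D None n); ring.
Qed.

End cells.

(** * Moments of a convolution *)

Section convolution_moments.
Context {R : realType}.

Lemma law_sum_cst (W : zmodType) (mu : seq (R * W)) c : is_law mu ->
  \sum_(a <- mu) a.1 * c = c.
Proof. by move=> [_ m1]; rewrite -mulr_suml m1 mul1r. Qed.

Lemma conv_sum_add (W : zmodType) (mu mu' : seq (R * W)) (F : W -> R) :
  is_law mu -> is_law mu' -> {morph F : x y / x + y} ->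
  \sum_(c <- conv mu mu') c.1 * F c.2 =
  \sum_(a <- mu) a.1 * F a.2 + \sum_(b <- mu') b.1 * F b.2.
Proof.
move=> l l' FD; rewrite sum_conv; set m := \sum_(b <- mu') _.
rewrite -[m in RHS](law_sum_cst _ l) -big_split; apply: eq_bigr => a _ /=.
rewrite -mulrDr; congr (_ * _); rewrite -[F a.2](law_sum_cst _ l') -big_split.
by apply: eq_bigr => b _ /=; rewrite FD mulrDr.
Qed.

Lemma conv_sum_bilin (W : zmodType) (mu mu' : seq (R * W)) (F G : W -> R) :
  is_law mu -> is_law mu' -> {morph F : x y / x + y} -> {morph G : x y / x + y} ->
  \sum_(c <- conv mu mu') c.1 * (F c.2 * G c.2) =
  \sum_(a <- mu) a.1 * (F a.2 * G a.2) + \sum_(b <- mu') b.1 * (F b.2 * G b.2) +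
  (\sum_(a <- mu) a.1 * F a.2) * (\sum_(b <- mu') b.1 * G b.2) +
  (\sum_(a <- mu) a.1 * G a.2) * (\sum_(b <- mu') b.1 * F b.2).
Proof.
move=> l l' FD GD; rewrite (sum_conv mu mu' (fun x => F x * G x)).
set m1 := \sum_(b <- mu') b.1 * G b.2; set m2 := \sum_(b <- mu') b.1 * F b.2.
set m3 := \sum_(b <- mu') b.1 * (F b.2 * G b.2).
have E a : \sum_(b <- mu') b.1 * (F (a + b.2) * G (a + b.2)) =
   F a * G a + F a * m1 + G a * m2 + m3.
  rewrite -[F a * G a](law_sum_cst _ l') /m1 /m2 /m3 !mulr_sumr -!big_split.
  by apply: eq_bigr => b _ /=; rewrite FD GD; ring.
under eq_bigr => a _ do rewrite E.
rewrite -[m3 in RHS](law_sum_cst _ l) !mulr_suml -!big_split.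
by apply: eq_bigr => a _ /=; ring.
Qed.

(** For x, y >= 0, 4 x^3 + 4 y^3 - (x + y)^3 = 3 (x + y) (x - y)^2. A general subadditive F serves
    both [norm1] and the absolute value. *)
Lemma conv_sum_cube (W : zmodType) (mu mu' : seq (R * W)) (F : W -> R) :
  is_law mu -> is_law mu' -> (forall x, 0 <= F x) -> (forall x y, F (x + y) <= F x + F y) ->
  \sum_(c <- conv mu mu') c.1 * F c.2 ^+ 3 <=
  4 * (\sum_(a <- mu) a.1 * F a.2 ^+ 3 + \sum_(b <- mu') b.1 * F b.2 ^+ 3).
Proof.
move=> l l' F0 Fsub; rewrite (sum_conv mu mu' (fun x => F x ^+ 3)).
set t := \sum_(b <- mu') b.1 * F b.2 ^+ 3.
have cube (x y z : R) : 0 <= x -> 0 <= y -> 0 <= z -> z <= x + y ->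
    z ^+ 3 <= 4 * x ^+ 3 + 4 * y ^+ 3.
  move=> x0 y0 z0 zxy; apply: (@le_trans _ _ ((x + y) ^+ 3)).
    by rewrite lerXn2r ?nnegrE// addr_ge0.
  rewrite -subr_ge0 (_ : _ - _ = 3 * ((x + y) * (x - y) ^+ 2)); last by ring.
  by rewrite mulr_ge0// mulr_ge0 ?sqr_ge0// addr_ge0.
have E a : \sum_(b <- mu') b.1 * F (a + b.2) ^+ 3 <= 4 * F a ^+ 3 + 4 * t.
  rewrite -[4 * F a ^+ 3](law_sum_cst _ l') /t mulr_sumr -big_split.
  rewrite big_seq [leRHS]big_seq; apply: ler_sum => b bmu /=.
  rewrite [4 * (b.1 * _)]mulrCA -mulrDr; apply: ler_wpM2l; first exact: l'.1.
  exact: cube.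
rewrite mulrDr -[4 * t](law_sum_cst _ l) mulr_sumr -big_split.
rewrite big_seq [leRHS]big_seq; apply: ler_sum => a amu /=.
by rewrite [4 * (a.1 * _)]mulrCA -mulrDr; apply: ler_wpM2l => //; exact: l.1.
Qed.

End convolution_moments.

(** * Limits of the moments of one observation *)

Section cell_law.
Context {R : realType} {K : nat}.

Definition cell_law (W : Type) (w : option 'I_K -> R) (V : option 'I_K -> W) : seq (R * W) :=
  [seq (w c, V c) | c <- enum {: option 'I_K}].

Lemma cell_law_sum (W : Type) w (V : option 'I_K -> W) (F : R * W -> R) :
  \sum_(a <- cell_law w V) F a = F (w None, V None) + \sum_j F (w (Some j), V (Some j)).
Proof. by rewrite /cell_law big_map big_enum/= big_option. Qed.

Variables (w : nat -> option 'I_K -> R) (p : 'I_K -> R) (k : nat -> nat).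
Hypothesis k0 : forall n, (0 < k n)%N.
Hypothesis koo : k n @[n --> \oo] --> \oo.
Local Notation q n := (Num.sqrt (k n)%:R : R).
Hypothesis rate : forall eta, 0 < eta -> exists N, forall n, (N <= n)%N ->
  forall j, `|n%:R * w n (Some j) - (k n)%:R * p j| <= eta * q n.
Implicit Type h : 'I_K -> R.

Lemma rate_sum h eta : 0 < eta -> exists N, forall n, (N <= n)%N ->
  `|n%:R * (\sum_j w n (Some j) * h j) - (k n)%:R * \sum_j p j * h j| <= eta * q n.
Proof.
move=> eta0; pose H := 1 + \sum_j `|h j|.
have H0 : 0 < H by rewrite ltr_pwDl// sumr_ge0.
have [N HN] := rate (divr_gt0 eta0 H0); exists N => n /HN {}HN.
have q0 := @sqrt_k_gt0 R k k0 n.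
rewrite !mulr_sumr -sumrB (le_trans (ler_norm_sum _ _ _))//.
apply: (@le_trans _ _ (\sum_j eta / H * q n * `|h j|)).
  apply: ler_sum => j _; rewrite !mulrA -mulrBl normrM.
  exact: ler_wpM2r.
rewrite -mulr_sumr mulrAC -ler_pdivlMr// mulfK ?gt_eqF// -mulrA.
apply: ler_piMr; first exact: ltW.
by rewrite mulrC ler_pdivrMr// mul1r /H lerDr.
Qed.

Lemma inv_sqrt_k_cvg : (q n)^-1 @[n --> \oo] --> (0 : R).
Proof.
apply/cvgrPdist_le => e e0; have [N HN] := @sqrt_k_cvg R k k0 koo e^-1.
exists N => // n /= /HN h; have q0 := @sqrt_k_gt0 R k k0 n.
rewrite sub0r normrN normfV gtr0_norm// -[leRHS]invrK lef_pV2 ?posrE ?invr_gt0//; exact: ltW.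
Qed.

(** Here the rate o(sqrt k_n) is used at full strength: the sum of n means is divided by sqrt k_n
    only, so a bias of order sqrt k_n would survive in the limit. *)
Lemma mean_cvg h : \sum_j p j * h j = 0 ->
  n%:R * (\sum_j w n (Some j) * (h j / q n)) @[n --> \oo] --> (0 : R).
Proof.
move=> h0; apply/cvgrPdist_le => e e0; have [N HN] := rate_sum h e0.
exists N => // n /= /HN; rewrite h0 mulr0 subr0 sub0r normrN => hn.
have q0 := @sqrt_k_gt0 R k k0 n.
under eq_bigr do rewrite mulrA; rewrite -mulr_suml mulrA normrM normfV (gtr0_norm q0).
by rewrite ler_pdivrMr.
Qed.

Lemma second_cvg h :
  n%:R * (\sum_j w n (Some j) * (h j / (k n)%:R)) @[n --> \oo] --> \sum_j p j * h j.
Proof.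
apply/cvgrPdist_le => e e0; have [N1 H1] := rate_sum h e0.
have [N2 H2] := @sqrt_k_cvg R k k0 koo (1 : R).
exists (maxn N1 N2) => // n /=; rewrite geq_max => /andP[/H1 h1 /H2 h2].
have kR : 0 < (k n)%:R :> R by rewrite ltr0n.
have q0 := @sqrt_k_gt0 R k k0 n; have qq := @sqr_sqrt_k R k n.
rewrite [X in _ - _ * X](_ : _ = (\sum_j w n (Some j) * h j) / (k n)%:R); last first.
  by rewrite mulr_suml; apply: eq_bigr => j _; rewrite mulrA.
rewrite mulrA distrC -[X in _ - X](mulfK (lt0r_neq0 kR)) -mulrBl normrM normfV (gtr0_norm kR) ler_pdivrMr//.
rewrite [_ * (k n)%:R]mulrC; apply: le_trans h1 _; rewrite ler_pM2l// -[leRHS]qq.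
by rewrite -[leLHS]mulr1 ler_pM2l// ltW.
Qed.

Lemma third_cvg h :
  n%:R * (\sum_j w n (Some j) * (h j / q n ^+ 3)) @[n --> \oo] --> (0 : R).
Proof.
have : (n%:R * (\sum_j w n (Some j) * (h j / (k n)%:R))) * (q n)^-1 @[n --> \oo]
    --> (\sum_j p j * h j) * 0.
  by apply: cvgM; [exact: second_cvg|exact: inv_sqrt_k_cvg].
rewrite mulr0 (_ : (fun n => _ / _) =
  fun n => n%:R * (\sum_j w n (Some j) * (h j / q n ^+ 3)))//.
apply/funext => n; rewrite -mulrA; congr (_ * _); rewrite mulr_suml; apply: eq_bigr => j _.
have q0 := @sqrt_k_gt0 R k k0 n; have qq := @sqr_sqrt_k R k n.
set Q := q n in q0 qq *; rewrite -qq; field; by rewrite gt_eqF.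
Qed.

End cell_law.

Lemma cvg_of_scaled0 (R : realType) (x : nat -> R) :
  n%:R * x n @[n --> \oo] --> (0 : R) -> x n @[n --> \oo] --> (0 : R).
Proof.
move=> h; apply/cvgrPdist_le => e e0; have [N HN] := cvg0_ex h e0.
exists (maxn N 1) => // n /=; rewrite geq_max => /andP[/HN h1 n1].
rewrite sub0r normrN (le_trans _ (ltW h1))// normrM ger0_norm// ler_peMl// ler1n //.
Qed.

(** * Interleaving the two samples *)

Section paired_indices.
Context {R : realType} {W : zmodType}.

(** Interleaving turns each pair of observations, one per sample, into a single step of a
    convolution law. The total is then the n-th power of one operator, as the comparison of powers
    requires. *)
Definition paired_iota n : seq (nat + nat) := flatten [seq [:: inl i; inr i] | i <- iota 0 n].

Lemma uniq_paired_iota n : uniq (paired_iota n).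
Proof.
have mem (s : seq nat) x : (x \in flatten [seq [:: inl i; inr i] | i <- s]) =
    match x with inl j => j \in s | inr j => j \in s end.
  elim: s => [|j s IH]; first by case: x.
  by rewrite /= !inE IH; case: x {IH} => l; rewrite inE /= ?orbF ?orFb.
rewrite /paired_iota; have := iota_uniq 0 n; elim: (iota 0 n) => //= i s IH /andP[ni us].
by rewrite inE /= !mem ni/= IH.
Qed.

Lemma sum_paired_iota n (f : nat + nat -> W) :
  \sum_(i <- paired_iota n) f i = \sum_(i <- iota 0 n) f (inl i) + \sum_(i <- iota 0 n) f (inr i).
Proof.
rewrite /paired_iota -big_split; elim: (iota 0 n) => [|i s IH]; first by rewrite !big_nil.
by rewrite !big_cons IH addrA.
Qed.

Lemma foldr_paired_iota n (L : nat + nat -> seq (R * W)) (mu mu' : seq (R * W)) F :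
  (forall i, L (inl i) = mu) -> (forall i, L (inr i) = mu') ->
  foldr (fun i => step (L i)) F (paired_iota n) = iter n (step (conv mu mu')) F.
Proof.
move=> h h'; rewrite /paired_iota -[in RHS](size_iota 0 n).
by elim: (iota 0 n) => //= i s IH; rewrite h h' IH step_conv.
Qed.

End paired_indices.

(** * The delta method *)

Section delta_method.
Context {R : realType}.

(** Deterministic form of the expansion under the null hypothesis: x and y lie within a factor 1 - t
    to 1 + t of p, and [log_gap_bounds] then pinches the summand around its quadratic part. The
    tolerances depend on the bound B for the scores but not on the sample. *)
Lemma log_gap_close (p B delta : R) : 0 < p -> 0 <= B -> 0 < delta ->
  exists dl Q, [/\ 0 < dl, 0 < Q & forall q x y X Y, Q <= q ->
    `|q * (x - p) - X| <= dl -> `|q * (y - p) - Y| <= dl -> `|X| <= B -> `|Y| <= B ->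
    [/\ 0 < x, 0 < y & `|q ^+ 2 / 2 * log_gap x y - (X - Y) ^+ 2 / (2 * p)| <= delta]].
Proof.
move=> p0 B0 delta0; pose b := B + 1; have b0 : 0 < b by rewrite /b; lra.
(* The bound on t makes (2 b)^2 t / p at most delta / 2; the next line chooses [dl] so that
   replacing D by X - Y costs 2 dl times 4 b / (2 p), again at most delta / 2. *)
pose t := Num.min 2^-1 (delta * p / (8 * b ^+ 2)).
pose dl := Num.min 1 (delta * p / (8 * b)).
have t0 : 0 < t by rewrite lt_min invr_gt0 ltr0n divr_gt0 ?mulr_gt0 ?exprn_gt0.
have dl0 : 0 < dl by rewrite lt_min ltr01 divr_gt0 ?mulr_gt0.
have [t2 tb] : t <= 2^-1 /\ t <= delta * p / (8 * b ^+ 2).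
  by rewrite /t; split; rewrite ge_min lexx ?orbT.
have [dl1 dlb] : dl <= 1 /\ dl <= delta * p / (8 * b).
  by rewrite /dl; split; rewrite ge_min lexx ?orbT.
exists dl, (b / (t * p)); split=> //; first by rewrite divr_gt0 ?mulr_gt0.
move=> q x y X Y qQ hx hy hX hY.
have q0 : 0 < q by apply: lt_le_trans qQ; rewrite divr_gt0 ?mulr_gt0.
have near z Z : `|q * (z - p) - Z| <= dl -> `|Z| <= B -> `|q * (z - p)| <= b /\
    p * (1 - t) <= z <= p * (1 + t).
  move=> h1 h2; have h3 : `|q * (z - p)| <= b.
    by have := ler_normD (q * (z - p) - Z) Z; rewrite subrK /b; lra.
  split=> //; move: qQ h3; rewrite ler_pdivrMr ?mulr_gt0// normrM (gtr0_norm q0) => h4 h5.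
  have : `|z - p| <= t * p.
    by rewrite -(ler_pM2l q0); apply: le_trans h5 _.
  by rewrite ler_norml => /andP[? ?]; apply/andP; split; lra.
have [ux mx] := near x X hx hX; have [uy my] := near y Y hy hY.
have m0 : 0 < p * (1 - t) by rewrite mulr_gt0//; lra.
have M0 : 0 < p * (1 + t) by rewrite mulr_gt0//; lra.
have x0 : 0 < x by case/andP: mx => h _; exact: lt_le_trans h.
have y0 : 0 < y by case/andP: my => h _; exact: lt_le_trans h.
split=> //; have /andP[g1 g2] := log_gap_bounds m0 mx my.
pose D := q * (x - y); have DE : D = q * (x - p) - q * (y - p) by rewrite /D; ring.
have Db : `|D| <= 2 * b by rewrite DE (le_trans (ler_normB _ _))//; move: ux uy; clear; lra.
have D2 : D ^+ 2 <= (2 * b) ^+ 2.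
  by rewrite -[D ^+ 2]real_normK ?num_real// lerXn2r ?nnegrE//; lra.
have q20 : 0 < q ^+ 2 / 2 by rewrite divr_gt0 ?exprn_gt0.
have p20 : 0 < 2 * p by rewrite mulr_gt0.
have l1 : D ^+ 2 / (2 * p) - D ^+ 2 * t / p <= q ^+ 2 / 2 * log_gap x y.
  apply: le_trans (_ : q ^+ 2 / 2 * ((x - y) ^+ 2 / (p * (1 + t))) <= _); last by rewrite ler_pM2l.
  rewrite (_ : q ^+ 2 / 2 * _ = D ^+ 2 / (2 * p) * (1 + t)^-1); last first.
    by rewrite /D; field; rewrite !gt_eqF//; move: t0 t2; clear; lra.
  rewrite (_ : D ^+ 2 / (2 * p) - _ = D ^+ 2 / (2 * p) * (1 - 2 * t)); last first.
    by field; rewrite gt_eqF.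
  apply: ler_wpM2l; first by rewrite divr_ge0 ?sqr_ge0// ltW.
  by rewrite -div1r ler_pdivlMr; move: t0 t2; clear; nra.
have l2 : q ^+ 2 / 2 * log_gap x y <= D ^+ 2 / (2 * p) + D ^+ 2 * t / p.
  apply: (@le_trans _ _ (q ^+ 2 / 2 * ((x - y) ^+ 2 / (p * (1 - t))))); first by rewrite ler_pM2l.
  rewrite (_ : q ^+ 2 / 2 * _ = D ^+ 2 / (2 * p) * (1 - t)^-1); last first.
    by rewrite /D; field; rewrite !gt_eqF//; move: t0 t2; clear; lra.
  rewrite (_ : D ^+ 2 / (2 * p) + _ = D ^+ 2 / (2 * p) * (1 + 2 * t)); last first.
    by field; rewrite gt_eqF.
  apply: ler_wpM2l; first by rewrite divr_ge0 ?sqr_ge0// ltW.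
  by rewrite -div1r ler_pdivrMr; move: t0 t2; clear; nra.
have l3 : D ^+ 2 * t / p <= delta / 2.
  rewrite ler_pdivrMr//; apply: (@le_trans _ _ ((2 * b) ^+ 2 * (delta * p / (8 * b ^+ 2)))).
    by apply: ler_pM => //; [exact: sqr_ge0|exact: ltW].
  by rewrite le_eqVlt; apply/orP; left; apply/eqP; field; rewrite gt_eqF.
have l4 : `|D ^+ 2 / (2 * p) - (X - Y) ^+ 2 / (2 * p)| <= delta / 2.
  rewrite -mulrBl normrM normfV (gtr0_norm p20) ler_pdivrMr//.
  rewrite subr_sqr normrM.
  have e1 : `|D - (X - Y)| <= 2 * dl.
    have -> : D - (X - Y) = (q * (x - p) - X) - (q * (y - p) - Y) by rewrite DE; ring.
    by rewrite (le_trans (ler_normB _ _))//; move: hx hy; clear; lra.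
  have e2 : `|D + (X - Y)| <= 4 * b.
    apply: le_trans (ler_normD _ _) _; have := ler_normB X Y; move: Db hX hY; rewrite /b; clear; lra.
  apply: (@le_trans _ _ (2 * (delta * p / (8 * b)) * (4 * b))).
    by apply: ler_pM => //; move: e1 e2 dlb; clear; lra.
  by rewrite le_eqVlt; apply/orP; left; apply/eqP; field; rewrite gt_eqF.
move: l1 l2 l3 l4; rewrite !ler_norml.
move: (D ^+ 2 / (2 * p)) (D ^+ 2 * t / p) ((X - Y) ^+ 2 / _) (_ * log_gap x y) => a1 a2 a3 a4.
by clear; move=> ? ? ? /andP[? ?]; apply/andP; split; lra.
Qed.

Lemma log_gap_linear_close (p p' B delta : R) : 0 < p -> 0 < p' -> 0 <= B -> 0 < delta ->
  exists dl Q, [/\ 0 < dl, 0 < Q & forall q x y X Y, Q <= q ->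
    `|q * (x - p) - X| <= dl -> `|q * (y - p') - Y| <= dl -> `|X| <= B -> `|Y| <= B ->
    [/\ 0 < x, 0 < y & `|q * (log_gap x y - log_gap p p') -
      ((ln (p / p') + 1 - p' / p) * X + (ln (p' / p) + 1 - p / p') * Y)| <= delta]].
Proof.
move=> p0 p'0 B0 delta0; have [C C0 HC] := log_gap_linear p0 p'0.
set d1 := ln (p / p') + 1 - p' / p in HC *; set d2 := ln (p' / p) + 1 - p / p' in HC *.
pose b := B + 1; have b0 : 0 < b by rewrite /b; lra.
pose s := `|d1| + `|d2| + 1; have s0 : 0 < s by rewrite /s; have := normr_ge0 d1; have := normr_ge0 d2; lra.
pose dl := Num.min 1 (delta / (2 * s)).
have dl0 : 0 < dl by rewrite lt_min ltr01 divr_gt0 ?mulr_gt0.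
have [dl1 dlb] : dl <= 1 /\ dl <= delta / (2 * s).
  by rewrite /dl; split; rewrite ge_min lexx ?orbT.
(* The first two terms keep x and y within p / 2 and p' / 2 of p and p', where the expansion is
   valid; the third makes the quadratic error 4 (C + 1) b^2 / q at most delta / 2. *)
pose Q := 2 * b / p + 2 * b / p' + 8 * (C + 1) * b ^+ 2 / delta.
have C10 : 0 < C + 1 by lra.
have Q1 : 0 < 2 * b / p by rewrite divr_gt0 ?mulr_gt0.
have Q2 : 0 < 2 * b / p' by rewrite divr_gt0 ?mulr_gt0.
have Q3 : 0 < 8 * (C + 1) * b ^+ 2 / delta by rewrite divr_gt0 ?mulr_gt0 ?exprn_gt0.
exists dl, Q; split=> //; first by rewrite /Q; lra.
move=> q x y X Y qQ hx hy hX hY; rewrite /Q in qQ.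
have q0 : 0 < q by lra.
have near z Z c : 0 < c -> 2 * b / c <= q -> `|q * (z - c) - Z| <= dl -> `|Z| <= B ->
    q * `|z - c| <= b /\ `|z - c| <= c / 2.
  move=> c0; rewrite ler_pdivrMr// => qc h1 h2.
  have h3 : q * `|z - c| <= b.
    by rewrite -[q in X in X <= _](gtr0_norm q0) -normrM; have := ler_normD (q * (z - c) - Z) Z; rewrite subrK /b; lra.
  split=> //; rewrite -(ler_pM2l q0); apply: le_trans h3 _; lra.
have [ux nx] := near x X p p0 (ltac:(lra)) hx hX.
have [uy ny] := near y Y p' p'0 (ltac:(lra)) hy hY.
have pos (z c : R) : 0 < c -> `|z - c| <= c / 2 -> 0 < z.
  by move=> c0; rewrite ler_norml => /andP[? ?]; lra.
split; [exact: pos nx|exact: pos ny|].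
have := HC (x - p) (y - p') nx ny; rewrite [p + _]addrC subrK [p' + _]addrC subrK => h.
set E := log_gap x y - log_gap p p' - d1 * (x - p) - d2 * (y - p') in h.
rewrite (_ : _ - (_ + _) = q * E + d1 * (q * (x - p) - X) + d2 * (q * (y - p') - Y)); last first.
  by rewrite /E; ring.
have e1 : `|q * E| <= delta / 2.
  rewrite normrM (gtr0_norm q0) -(ler_pM2l q0).
  apply: (@le_trans _ _ (C * (q * (`|x - p| + `|y - p'|)) ^+ 2)).
    rewrite (_ : C * _ = q * (q * (C * (`|x - p| + `|y - p'|) ^+ 2))); last by ring.
    by rewrite !ler_pM2l.
  apply: (@le_trans _ _ ((C + 1) * (2 * b) ^+ 2)).
    apply: ler_pM => //; [exact: sqr_ge0|by rewrite lerDl|].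
    rewrite lerXn2r ?nnegrE ?mulr_ge0 ?addr_ge0 ?(ltW q0)//.
    by move: ux uy; clear; lra.
  have : 8 * (C + 1) * b ^+ 2 / delta <= q by lra.
  rewrite ler_pdivrMr// => h8.
  by rewrite exprMn; move: h8; move: (b ^+ 2) => b2; lra.
have e2 : `|d1 * (q * (x - p) - X)| <= `|d1| * dl by rewrite normrM ler_wpM2l.
have e3 : `|d2 * (q * (y - p') - Y)| <= `|d2| * dl by rewrite normrM ler_wpM2l.
have e4 : (`|d1| + `|d2|) * dl <= delta / 2.
  apply: (@le_trans _ _ (s * (delta / (2 * s)))).
    by apply: ler_pM; [exact: addr_ge0|exact: ltW|rewrite /s lerDl|exact: dlb].
  by rewrite le_eqVlt; apply/orP; left; apply/eqP; field; rewrite gt_eqF.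
apply: le_trans (ler_normD _ _) _; apply: le_trans (lerD (ler_normD _ _) e3) _.
by move: e1 e2 e4; rewrite mulrDl; lra.
Qed.

Lemma common_tolerance K (G : 'I_K -> R -> R -> Prop) :
  (forall j dl Q dl' Q', G j dl Q -> dl' <= dl -> Q <= Q' -> G j dl' Q') ->
  (forall j, exists dl Q, [/\ 0 < dl, 0 < Q & G j dl Q]) ->
  exists dl Q, [/\ 0 < dl, 0 < Q & forall j, G j dl Q].
Proof.
move=> mono /choice[dl /choice[Q H]].
have s0 : 0 <= \sum_j (dl j)^-1 by apply: sumr_ge0 => j _; rewrite invr_ge0; case: (H j) => /ltW.
have S0 : 0 <= \sum_j Q j by apply: sumr_ge0 => j _; case: (H j) => _ /ltW.
have s10 : 0 < 1 + \sum_j (dl j)^-1 by rewrite ltr_pwDl.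
(* These are bounds below every [dl j] and above every [Q j] that remain positive even for an empty
   family. *)
exists (1 + \sum_j (dl j)^-1)^-1, (1 + \sum_j Q j); split.
- by rewrite invr_gt0.
- by rewrite ltr_pwDl.
move=> j; have [d0 Q0 Gj] := H j; apply: mono Gj _ _.
  rewrite -[leRHS]invrK lef_pV2 ?posrE ?invr_gt0//.
  rewrite (bigD1 j)//= addrCA lerDl addr_ge0// sumr_ge0// => i _.
  by rewrite invr_ge0; case: (H i) => /ltW.
rewrite (bigD1 j)//= addrCA lerDl addr_ge0// sumr_ge0// => i _.
by case: (H i) => _ /ltW.
Qed.

End delta_method.

(** * The two samples *)

Section two_samples.
Context d d' (S : measurableType d) (E : measurableType d') (R : realType)
  (P : probability S R) (K : nat) (Z : nat + nat -> {RV P >-> E}).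
Hypothesis hind : mutually_independent P (fun i => Z i : S -> E).
Variables (cX cY : nat -> E -> option 'I_K) (wX wY : nat -> option 'I_K -> R).
Hypothesis mX : forall n c, measurable (cX n @^-1` [set c]).
Hypothesis mY : forall n c, measurable (cY n @^-1` [set c]).
Hypothesis wXE : forall n i c, fine (P (Z (inl i) @^-1` (cX n @^-1` [set c]))) = wX n c.
Hypothesis wYE : forall n i c, fine (P (Z (inr i) @^-1` (cY n @^-1` [set c]))) = wY n c.
Variables (p p' : 'I_K -> R) (k : nat -> nat).
Hypothesis k0 : forall n, (0 < k n)%N.
Hypothesis koo : k n @[n --> \oo] --> \oo.
Local Notation q n := (Num.sqrt (k n)%:R : R).
Hypothesis rateX : forall eta, 0 < eta -> exists N, forall n, (N <= n)%N ->
  forall j, `|n%:R * wX n (Some j) - (k n)%:R * p j| <= eta * q n.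
Hypothesis rateY : forall eta, 0 < eta -> exists N, forall n, (N <= n)%N ->
  forall j, `|n%:R * wY n (Some j) - (k n)%:R * p' j| <= eta * q n.

Let code n (i : nat + nat) : E -> option 'I_K := match i with inl _ => cX n | inr _ => cY n end.

Section totals.
Variable W : zmodType.
Variables (vX vY : nat -> option 'I_K -> W).

Definition paired_sum n (w : S) : W :=
  \sum_(i <- iota 0 n) vX n (cX n (Z (inl i) w)) + \sum_(i <- iota 0 n) vY n (cY n (Z (inr i) w)).

Definition paired_law n : seq (R * W) := conv (cell_law (wX n) (vX n)) (cell_law (wY n) (vY n)).

Let value n (i : nat + nat) : option 'I_K -> W :=
  match i with inl _ => vX n | inr _ => vY n end.

Let mcode n i c : measurable (code n i @^-1` [set c]).
Proof. by case: i => i; [exact: mX|exact: mY]. Qed.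

Let lawX n i : coded_law Z (code n) (value n) (inl i) = cell_law (wX n) (vX n).
Proof. by rewrite /coded_law /cell_law; apply: eq_map => c /=; rewrite wXE. Qed.

Let lawY n i : coded_law Z (code n) (value n) (inr i) = cell_law (wY n) (vY n).
Proof. by rewrite /coded_law /cell_law; apply: eq_map => c /=; rewrite wYE. Qed.

Lemma cell_lawX n : is_law (cell_law (wX n) (vX n)).
Proof. by rewrite -(lawX n 0); apply: coded_law_law; exact: mcode. Qed.

Lemma cell_lawY n : is_law (cell_law (wY n) (vY n)).
Proof. by rewrite -(lawY n 0); apply: coded_law_law; exact: mcode. Qed.

Lemma paired_law_law n : is_law (paired_law n).
Proof. exact: conv_law (cell_lawX n) (cell_lawY n). Qed.

Lemma paired_sum_prob n (F : W -> bool) :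
  measurable [set w | F (paired_sum n w)] /\
  fine (P [set w | F (paired_sum n w)]) =
  iter n (step (paired_law n)) (fun y => (F y)%:R) 0.
Proof.
have e w : paired_sum n w = 0 + \sum_(i <- paired_iota n) value n i (code n i (Z i w)).
  by rewrite add0r sum_paired_iota.
have -> : [set w | F (paired_sum n w)] =
    [set w | F (0 + \sum_(i <- paired_iota n) value n i (code n i (Z i w)))].
  by apply/seteqP; split=> w /=; rewrite e.
split; first exact: (@measurable_coded_sum _ _ _ _ _ P _ Z _ _ (code n) (value n) (mcode n) F).
rewrite (coded_sum_prob hind (value n) (mcode n) F 0 (uniq_paired_iota n)).
by rewrite (foldr_paired_iota n _ (lawX n) (lawY n)).
Qed.

End totals.

Lemma smooth1_left_cutoff (a e : R) : 0 < e -> exists B M, smooth1_left B M (cutoff a e).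
Proof.
move=> e0; have [M sf] := smooth1_cutoff a e0; exists (a + 3 * e), M.
by exists (cutoff1 a e), (cutoff2 a e); split=> // y; exact: cutoff_right.
Qed.

(** Scores are centred in each sample, and the covariances of the two samples add up to the
    identity. Convolution adds second moments up to products of means, which vanish in the limit. *)
Lemma paired_chi2 (m : nat) (fX fY : 'I_K -> 'rV[R]_m) :
  (forall l, \sum_j p j * fX j 0 l = 0) -> (forall l, \sum_j p' j * fY j 0 l = 0) ->
  (forall l l', \sum_j p j * (fX j 0 l * fX j 0 l') + \sum_j p' j * (fY j 0 l * fY j 0 l')
     = (l == l')%:R) ->
  law_close P (chi2 R m) (fun n w => norm2 (paired_sum
     (fun n c => (q n)^-1 *: oapp fX 0 c) (fun n c => (q n)^-1 *: oapp fY 0 c) n w)).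
Proof.
move=> hX hY h2; set vX := fun n c => _ *: oapp fX 0 c; set vY := fun n c => _ *: oapp fY 0 c.
have coordD l : {morph (fun x : 'rV[R]_m => x 0 l) : x y / x + y} by move=> x y; rewrite mxE.
have lX n := cell_lawX vX vY n; have lY n := cell_lawY vX vY n.
have mean0 (w : nat -> option 'I_K -> R) (pp : 'I_K -> R) (f : 'I_K -> 'rV[R]_m) l :
    (forall eta, 0 < eta -> exists N, forall n, (N <= n)%N ->
      forall j, `|n%:R * w n (Some j) - (k n)%:R * pp j| <= eta * q n) ->
    \sum_j pp j * f j 0 l = 0 ->
    n%:R * mean (cell_law (w n) (fun c => (q n)^-1 *: oapp f 0 c)) l @[n --> \oo] --> (0 : R).
  move=> rate h0; have := mean_cvg k0 rate (h := fun j => f j 0 l) h0.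
  under eq_fun => n.
    rewrite (_ : \sum_j _ = mean (cell_law (w n) (fun c => (q n)^-1 *: oapp f 0 c)) l); last first.
      rewrite /mean cell_law_sum/= scaler0 mxE mulr0 add0r; apply: eq_bigr => j _.
      by rewrite mxE [_^-1 * _]mulrC.
    over.
  by [].
have moment0 (w : nat -> option 'I_K -> R) (pp : 'I_K -> R) (f : 'I_K -> 'rV[R]_m) l l' :
    (forall eta, 0 < eta -> exists N, forall n, (N <= n)%N ->
      forall j, `|n%:R * w n (Some j) - (k n)%:R * pp j| <= eta * q n) ->
    n%:R * moment2 (cell_law (w n) (fun c => (q n)^-1 *: oapp f 0 c)) l l' @[n --> \oo] -->
      \sum_j pp j * (f j 0 l * f j 0 l').
  move=> rate; have := second_cvg k0 koo rate (h := fun j => f j 0 l * f j 0 l').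
  under eq_fun => n.
    rewrite (_ : \sum_j _ = moment2 (cell_law (w n) (fun c => (q n)^-1 *: oapp f 0 c)) l l'); last first.
      rewrite /moment2 cell_law_sum/= scaler0 !mxE mul0r mulr0 add0r; apply: eq_bigr => j _.
      have q0 := @sqrt_k_gt0 R k k0 n; have qq := @sqr_sqrt_k R k n.
      rewrite !mxE; set Q := q n in q0 qq *; rewrite -qq; field; by rewrite gt_eqF.
    over.
  by [].
have third0 (w : nat -> option 'I_K -> R) (pp : 'I_K -> R) (f : 'I_K -> 'rV[R]_m) :
    (forall eta, 0 < eta -> exists N, forall n, (N <= n)%N ->
      forall j, `|n%:R * w n (Some j) - (k n)%:R * pp j| <= eta * q n) ->
    n%:R * moment3 (cell_law (w n) (fun c => (q n)^-1 *: oapp f 0 c)) @[n --> \oo] --> (0 : R).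
  move=> rate; have := third_cvg k0 koo rate (fun j => norm1 (f j) ^+ 3).
  under eq_fun => n.
    rewrite (_ : \sum_j _ = moment3 (cell_law (w n) (fun c => (q n)^-1 *: oapp f 0 c))); last first.
      rewrite /moment3 cell_law_sum/= scaler0 /norm1.
      rewrite [X in _ * X ^+ 3 + _](_ : _ = 0); last by apply: big1 => i _; rewrite mxE normr0.
      rewrite expr0n mulr0 add0r; apply: eq_bigr => j _; congr (_ * _).
      have q0 := @sqrt_k_gt0 R k k0 n.
      rewrite -exprVn -exprMn mulrC mulr_sumr; congr (_ ^+ 3); apply: eq_bigr => i _.
      by rewrite mxE normrM gtr0_norm// invr_gt0.
    over.
  by [].
have step0 (f : R -> R) B M : smooth1_left B M f ->
    iter n (step (paired_law vX vY n)) (fun x => f (norm2 x)) 0 @[n --> \oo] --> iter m sq_op f 0.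
  apply: multivariate_clt.
  - exact: paired_law_law.
  - move=> l; rewrite -[X in _ --> X](addr0 (0 : R)).
    have c1 : n%:R * mean (cell_law (wX n) (vX n)) l + n%:R * mean (cell_law (wY n) (vY n)) l
        @[n --> \oo] --> (0 + 0 : R).
      by apply: cvgD; [exact: mean0 rateX (hX l)|exact: mean0 rateY (hY l)].
    move: c1; apply: cvg_trans; apply: near_eq_cvg; near=> n.
    by rewrite -mulrDr -(conv_sum_add (lX n) (lY n) (coordD l)).
  - move=> l l'; rewrite -h2.
    have mX1 l1 := mean0 wX p fX l1 rateX (hX l1).
    (* In a cross term n times mean times mean, one mean absorbs the factor n and still tends to 0;
       the other then only has to converge to 0 by itself. *)
    have mY1 l1 := cvg_of_scaled0 (mean0 wY p' fY l1 rateY (hY l1)).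
    have c2 : n%:R * moment2 (cell_law (wX n) (vX n)) l l' +
        n%:R * moment2 (cell_law (wY n) (vY n)) l l' +
        n%:R * mean (cell_law (wX n) (vX n)) l * mean (cell_law (wY n) (vY n)) l' +
        n%:R * mean (cell_law (wX n) (vX n)) l' * mean (cell_law (wY n) (vY n)) l
      @[n --> \oo] --> (\sum_j p j * (fX j 0 l * fX j 0 l') +
         \sum_j p' j * (fY j 0 l * fY j 0 l') + 0 * 0 + 0 * 0 : R).
      apply: cvgD; [apply: cvgD|]; [apply: cvgD; exact: moment0|apply: cvgM|apply: cvgM];
      by [exact: mX1|exact: mY1].
    rewrite !mulr0 !addr0 in c2; move: c2; apply: cvg_trans; apply: near_eq_cvg.
    near=> n; rewrite /= [in RHS]/moment2 (conv_sum_bilin (lX n) (lY n) (coordD l) (coordD l')).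
    by rewrite /moment2 /mean; ring.
  - have c1 : 4 * (n%:R * moment3 (cell_law (wX n) (vX n)) +
        n%:R * moment3 (cell_law (wY n) (vY n))) @[n --> \oo] --> (4 * (0 + 0) : R).
      by apply: cvgMr; apply: cvgD; [exact: third0 rateX|exact: third0 rateY].
    rewrite addr0 mulr0 in c1.
    apply: (@squeeze_cvgr _ _ _ _ (fun=> 0) _ _ _ _ _ c1); last exact: cvg_cst.
    near=> n; apply/andP; split.
      apply: mulr_ge0 => //; rewrite /moment3 big_seq; apply: sumr_ge0 => c cl.
      by rewrite mulr_ge0 ?exprn_ge0 ?norm1_ge0//; exact: (conv_law (lX n) (lY n)).1 cl.
    rewrite -mulrDr mulrCA; apply: ler_wpM2l => //.
    apply: (conv_sum_cube (lX n) (lY n)); first exact: norm1_ge0.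
    by move=> x y; rewrite /norm1 -big_split; apply: ler_sum => i _; rewrite mxE ler_normD.
apply: (@law_close_steps _ _ _ _ _ _ (paired_law vX vY) (@norm2 R m) _
   (fun a e => iter m sq_op (cutoff a e) 0)).
- exact: paired_law_law.
- move=> n a; exact: (paired_sum_prob vX vY n (fun y => norm2 y <= a)).
- by move=> a e e0; have [B [M sf]] := smooth1_left_cutoff a e0; exact: step0 sf.
(* A single constant must bound both the Lipschitz slope and the values of the cutoff, hence the
   maximum with 1. *)
- move=> a e e0; have [M sf] := smooth1_cutoff a e0; apply: (@chi2_integral _ m (Num.max M 1)).
    by move=> x y; apply: le_trans (smooth1_lip sf x y) _; rewrite ler_wpM2r// le_max lexx.
  by move=> x; have /andP[-> h] := cutoff_le1 a e x; rewrite le_max h orbT.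
Unshelve. all: by end_near. Qed.

(** The scores are real here, so the univariate theorem compares directly with Gaussian steps; the
    limit variance is the sum of the two weighted second moments. *)
Lemma paired_normal (gX gY : 'I_K -> R) (sigma : R) : 0 < sigma ->
  \sum_j p j * gX j = 0 -> \sum_j p' j * gY j = 0 ->
  \sum_j p j * gX j ^+ 2 + \sum_j p' j * gY j ^+ 2 = sigma ^+ 2 ->
  law_close P (normal_prob 0 sigma) (paired_sum
     (fun n c => oapp gX 0 c / q n) (fun n c => oapp gY 0 c / q n)).
Proof.
move=> s0 hX hY h2; set vX := fun n c => oapp gX 0 c / _; set vY := fun n c => oapp gY 0 c / _.
have lX n := cell_lawX vX vY n; have lY n := cell_lawY vX vY n.
have sumE (w : nat -> option 'I_K -> R) (f : 'I_K -> R) (F : R -> R) n : F 0 = 0 ->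
    \sum_(c <- cell_law (w n) (fun c => oapp f 0 c / q n)) c.1 * F c.2 =
    \sum_j w n (Some j) * F (f j / q n).
  by move=> F0; rewrite cell_law_sum/= mul0r F0 mulr0 add0r.
have idD : {morph (fun x : R => x) : x y / x + y} by [].
have third0 (w : nat -> option 'I_K -> R) (pp : 'I_K -> R) (f : 'I_K -> R) :
    (forall eta, 0 < eta -> exists N, forall n, (N <= n)%N ->
      forall j, `|n%:R * w n (Some j) - (k n)%:R * pp j| <= eta * q n) ->
    n%:R * abs3 (cell_law (w n) (fun c => oapp f 0 c / q n)) @[n --> \oo] --> (0 : R).
  move=> rate; have := third_cvg k0 koo rate (fun j => `|f j| ^+ 3).
  apply: cvg_trans; apply: near_eq_cvg; near=> n; rewrite /= /abs3.
  rewrite (sumE _ _ (fun x => `|x| ^+ 3)); last by rewrite normr0 expr0n.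
  congr (_ * _); apply: eq_bigr => j _; congr (_ * _).
  have q0 := @sqrt_k_gt0 R k k0 n.
  by rewrite normrM normfV (gtr0_norm q0) exprMn exprVn.
have second0 (w : nat -> option 'I_K -> R) (pp : 'I_K -> R) (f : 'I_K -> R) :
    (forall eta, 0 < eta -> exists N, forall n, (N <= n)%N ->
      forall j, `|n%:R * w n (Some j) - (k n)%:R * pp j| <= eta * q n) ->
    n%:R * var1 (cell_law (w n) (fun c => oapp f 0 c / q n)) @[n --> \oo] -->
      \sum_j pp j * f j ^+ 2.
  move=> rate; have := second_cvg k0 koo rate (h := fun j => f j ^+ 2).
  apply: cvg_trans; apply: near_eq_cvg; near=> n; rewrite /= /var1.
  rewrite (sumE _ _ (fun x => x ^+ 2)); last by rewrite expr0n.
  congr (_ * _); apply: eq_bigr => j _; congr (_ * _).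
  have q0 := @sqrt_k_gt0 R k k0 n; have qq := @sqr_sqrt_k R k n.
  set Q := q n in q0 qq *; rewrite -qq; field; by rewrite gt_eqF.
have mean0 (w : nat -> option 'I_K -> R) (pp : 'I_K -> R) (f : 'I_K -> R) :
    (forall eta, 0 < eta -> exists N, forall n, (N <= n)%N ->
      forall j, `|n%:R * w n (Some j) - (k n)%:R * pp j| <= eta * q n) ->
    \sum_j pp j * f j = 0 ->
    n%:R * mean1 (cell_law (w n) (fun c => oapp f 0 c / q n)) @[n --> \oo] --> (0 : R).
  move=> rate h0; have := mean_cvg k0 rate (h := f) h0.
  apply: cvg_trans; apply: near_eq_cvg; near=> n; rewrite /= /mean1.
  by rewrite (sumE _ _ (fun x => x)).
have mX1 := mean0 wX p gX rateX hX; have mY1 := mean0 wY p' gY rateY hY.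
have m1 : n%:R * mean1 (paired_law vX vY n) @[n --> \oo] --> (0 : R).
  have c1 : n%:R * mean1 (cell_law (wX n) (vX n)) + n%:R * mean1 (cell_law (wY n) (vY n))
      @[n --> \oo] --> (0 + 0 : R) by apply: cvgD; [exact: mX1|exact: mY1].
  rewrite addr0 in c1; move: c1; apply: cvg_trans; apply: near_eq_cvg; near=> n.
  by rewrite -mulrDr -(conv_sum_add (lX n) (lY n) idD).
have m2 : n%:R * var1 (paired_law vX vY n) @[n --> \oo] --> sigma ^+ 2.
  have c2 : n%:R * var1 (cell_law (wX n) (vX n)) + n%:R * var1 (cell_law (wY n) (vY n)) +
      2 * (n%:R * mean1 (cell_law (wX n) (vX n)) * mean1 (cell_law (wY n) (vY n)))
    @[n --> \oo] --> (\sum_j p j * gX j ^+ 2 + \sum_j p' j * gY j ^+ 2 + 2 * (0 * 0) : R).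
    apply: cvgD; first by apply: cvgD; exact: second0.
    by apply: cvgMr; apply: cvgM; [exact: mX1|exact: cvg_of_scaled0 mY1].
  rewrite !mulr0 addr0 h2 in c2; move: c2; apply: cvg_trans; apply: near_eq_cvg.
  near=> n; rewrite /= [in RHS]/var1; under [in RHS]eq_bigr do rewrite expr2.
  rewrite (conv_sum_bilin (lX n) (lY n) idD idD) /var1 /mean1.
  under eq_bigr do rewrite expr2; under [\sum_(a <- cell_law (wY n) _) _]eq_bigr do rewrite expr2.
  by ring.
have m3 : n%:R * abs3 (paired_law vX vY n) @[n --> \oo] --> (0 : R).
  have c1 : 4 * (n%:R * abs3 (cell_law (wX n) (vX n)) +
      n%:R * abs3 (cell_law (wY n) (vY n))) @[n --> \oo] --> (4 * (0 + 0) : R).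
    by apply: cvgMr; apply: cvgD; [exact: third0 rateX|exact: third0 rateY].
  rewrite addr0 mulr0 in c1.
  apply: (@squeeze_cvgr _ _ _ _ (fun=> 0) _ _ _ _ _ c1); last exact: cvg_cst.
  near=> n; apply/andP; split.
    apply: mulr_ge0 => //; rewrite /abs3 big_seq; apply: sumr_ge0 => c cl.
    by rewrite mulr_ge0 ?exprn_ge0//; exact: (conv_law (lX n) (lY n)).1 cl.
  rewrite -mulrDr mulrCA; apply: ler_wpM2l => //.
  by apply: (conv_sum_cube (lX n) (lY n)); [exact: normr_ge0|exact: ler_normD].
have step0 (f f1 f2 : R -> R) M : smooth1 M f f1 f2 ->
    iter n (step (paired_law vX vY n)) f 0 @[n --> \oo] --> gavg sigma id f 0.
  move=> sf; pose bd n := M * (`|n%:R * mean1 (paired_law vX vY n)| +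
    `|n%:R * var1 (paired_law vX vY n) - sigma ^+ 2| + n%:R * abs3 (paired_law vX vY n)) +
    4 * M * sigma ^+ 3 * (Num.sqrt n%:R)^-1.
  have bd0 : bd n @[n --> \oo] --> (0 : R).
    have c1 : bd n @[n --> \oo] --> (M * (`|0 : R| + `|sigma ^+ 2 - sigma ^+ 2 : R| + 0) + 4 * M * sigma ^+ 3 * 0 : R).
      apply: cvgD; last by apply: cvgMr; exact: cvg_inv_sqrt.
      apply: cvgMr; apply: cvgD; last exact: m3.
      apply: cvgD; first by apply: cvg_norm; exact: m1.
      by apply: cvg_norm; apply: cvgB; [exact: m2|exact: cvg_cst].
    by move: c1; rewrite subrr !normr0 !addr0 !mulr0 addr0.
  apply/cvgrPdist_le => e e0; have [N HN] := cvg0_ex bd0 e0.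
  exists (maxn N 1) => // n /=; rewrite geq_max => /andP[/HN h n1].
  rewrite distrC; apply: le_trans (univariate_clt 0 (paired_law_law vX vY n) s0 n1 sf) _.
  by rewrite -[n%:R * `|_|](_ : `|n%:R * mean1 (paired_law vX vY n)| = _);
    [exact: le_trans (ler_norm _) (ltW h)|rewrite normrM ger0_norm].
apply: (@law_close_steps _ _ _ _ _ _ (paired_law vX vY) id _
   (fun a e => gavg sigma id (cutoff a e) 0)).
- exact: paired_law_law.
- move=> n a; exact: (paired_sum_prob vX vY n (fun y => y <= a)).
- by move=> a e e0; have [M sf] := smooth1_cutoff a e0; exact: step0 sf.
- move=> a e e0; have [M sf] := smooth1_cutoff a e0.
  rewrite -(gavg_idE sigma 0 (smooth1_lip sf) (smooth1_bd sf)).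
  by apply: eq_integral => y _; rewrite add0r.
Unshelve. all: by end_near. Qed.

End two_samples.

(** The rows of the reflection other than the last one form an orthonormal basis of the complement
    of s. The unit norm of s excludes K = 0. *)
Lemma orthonormal_complement (R : realType) K (s : 'I_K -> R) :
  \sum_j s j ^+ 2 = 1 -> (forall j, s j < 1) ->
  exists H : 'I_(K - 1) -> 'I_K -> R, [/\ forall l, \sum_j H l j * s j = 0,
    forall l l', \sum_j H l j * H l' j = (l == l')%:R &
    forall z : 'I_K -> R, \sum_j s j * z j = 0 ->
      \sum_l (\sum_j H l j * z j) ^+ 2 = \sum_j z j ^+ 2].
Proof.
case: K s => [|m] s s1 sm; first by move/eqP: s1; rewrite big_ord0 eq_sym oner_eq0.
rewrite subn1 /=; exists (fun l j => reflection s (widen_ord (leqnSn m) l) j); split.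
- move=> l; apply: (reflection_kernel s1 (sm ord_max)).
  by rewrite -val_eqE /= ltn_eqF.
- by move=> l l'; rewrite (reflection_orthonormal s1 (sm ord_max)).
- by move=> z sz; exact: (reflection_isometry s1 (sm ord_max) sz).
Qed.

(** * Linear combinations of scores *)

Section scores.
Context {R : realType} {d K : nat} {dT : measure_display} {T : measurableType dT}.
Variables (P0 : probability T R) (X : {RV P0 >-> borel_rV R d}).
Variable nu : {measure set (borel_rV R d) -> \bar R}.
Variables (r : 'rV[R]_d -> R) (A : 'I_K -> set 'rV[R]_d).
Local Notation p j := (class_prob nu r (A j)).

Lemma sum_class_prob : regularly_varying X nu -> risk_functional r ->
  admissible_partition r A -> (0 < nu (risk_region r))%E -> \sum_j p j = 1.
Proof.
move=> rv hr hA Opos; have v0 := nu_risk_gt0 rv hr Opos.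
have bA j : borel (A j) := borel_region hr hA (Some j).
have AO j : A j `<=` risk_region r := @region_sub _ _ _ _ _ hA (Some j).
have finA j : nu (A j) \is a fin_num.
  have := nu_dilation_fin rv hr ltr01 (bA j) (AO j).
  by rewrite dilation1 ge0_fin_numE.
have [[UA tA _] _] := hA.
have e : nu (risk_region r) = (\sum_j nu (A j))%E.
  have h : risk_region r = \big[setU/set0]_j A j.
    rewrite -UA; apply/seteqP; split=> [x [j _ Ax]|x].
      by rewrite (bigD1 j)//=; left.
    by rewrite -bigcup_seq => -[j _ Ax]; exists j.
  by rewrite h (@measure_bigsetU_ord _ _ (borel_rV R d)).
rewrite /class_prob -mulr_suml -[X in X / _]/(fine (\sum_j fine (nu (A j)))%:E).
rewrite -sumEFin (eq_bigr (fun j => nu (A j))); last by move=> j _; rewrite fineK.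
by rewrite -e divff// gt_eqF.
Qed.

(** A linear combination of scores depends on the cell alone: it is the coefficient of the cell
    minus the weighted mean, and 0 outside the region. It is therefore centred with respect to the
    class probabilities. *)
Lemma sum_cell_score (al : 'I_K -> R) c :
  \sum_j al j * cell_score nu r A j c =
  oapp (fun j => al j - weighted_mean (fun j => p j) al) 0 c.
Proof.
rewrite /cell_score; case: c => [l|] /=; last first.
  by rewrite big1// => j _; rewrite mulr0 subr0 mulr0.
rewrite (eq_bigr (fun j => al j * (l == j)%:R - p j * al j)); last first.
  by move=> j _; rewrite (_ : (Some l == Some j) = (l == j))//= mulr1 mulrBr [p j * _]mulrC.
rewrite sumrB -/(weighted_mean _ al); congr (_ - _).
rewrite (bigD1 l)//= eqxx mulr1 big1 ?addr0// => j jl.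
by rewrite eq_sym (negbTE jl) mulr0.
Qed.

Lemma sum_score_sum k dS (S : measurableType dS) (P : probability S R) (I : choiceType)
    (Z : I -> {RV P >-> borel_rV R d}) (idx : nat -> I) (al : 'I_K -> R) Q n w :
  \sum_j al j * (score_sum X nu r A k Z idx n j w / Q) =
  \sum_(i <- iota 0 n)
    oapp (fun j => al j - weighted_mean (fun j => p j) al) 0 (cell X nu r A k n (Z (idx i) w)) / Q.
Proof.
rewrite -mulr_suml; under eq_bigr do rewrite mulrA; rewrite -mulr_suml; congr (_ / _).
under eq_bigr do rewrite mulr_sumr; rewrite exchange_big /=.
by apply: eq_bigr => i _; rewrite sum_cell_score.
Qed.

End scores.

(** * The limit laws *)

Section limits.
Context {R : realType} {d K : nat} (hd : (1 <= d)%N).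
Context {dX : measure_display} {TX : measurableType dX} {PX : probability TX R}.
Variables (X : {RV PX >-> borel_rV R d}) (nuX : {measure set (borel_rV R d) -> \bar R}).
Context {dY : measure_display} {TY : measurableType dY} {PY : probability TY R}.
Variables (Y : {RV PY >-> borel_rV R d}) (nuY : {measure set (borel_rV R d) -> \bar R}).
Variables aX aY : R -> R.
Hypotheses (X0 : orthant_valued X) (Y0 : orthant_valued Y).
Hypotheses (paretoX : standard_pareto_margins X) (paretoY : standard_pareto_margins Y).
Hypotheses (rvX : regularly_varying X nuX) (rvY : regularly_varying Y nuY).
Hypotheses (soX : second_order X nuX aX) (soY : second_order Y nuY aY).
Variables (r : 'rV[R]_d -> R) (A : 'I_K -> set 'rV[R]_d).
Hypotheses (hr : risk_functional r) (hA : admissible_partition r A).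
Hypotheses (OX : (0 < nuX (risk_region r))%E) (OY : (0 < nuY (risk_region r))%E).
Local Notation p j := (class_prob nuX r (A j)).
Local Notation p' j := (class_prob nuY r (A j)).
Hypotheses (p01 : forall j, 0 < p j < 1) (p'01 : forall j, 0 < p' j < 1).
Hypothesis K0 : (0 < K)%N.
Variable k : nat -> nat.
Hypothesis k0 : forall n, (0 < k n)%N.
Hypothesis koo : k n @[n --> \oo] --> \oo.
Hypothesis kn : (k n)%:R / n%:R @[n --> \oo] --> (0 : R).
Local Notation q n := (Num.sqrt (k n)%:R : R).
Hypothesis kaX : q n * aX (quantile_level X k n) @[n --> \oo] --> (0 : R).
Hypothesis kaY : q n * aY (quantile_level Y k n) @[n --> \oo] --> (0 : R).
Context {dS : measure_display} {S : measurableType dS} {P : probability S R}.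
Variable Z : nat + nat -> {RV P >-> borel_rV R d}.
Hypothesis hind : mutually_independent P (fun i => Z i : S -> borel_rV R d).
Hypotheses (ZX0 : forall i, orthant_valued (Z (inl i))) (ZY0 : forall i, orthant_valued (Z (inr i))).
Hypotheses (ZX : forall i, same_law P PX (Z (inl i)) X) (ZY : forall i, same_law P PY (Z (inr i)) Y).
Variable Dhat : nat -> {RV P >-> measurableTypeR R}.
Hypothesis hD : forall n w, is_empirical_kl r A n (k n)
  (fun i => vec (Z (inl i)) w) (fun i => vec (Z (inr i)) w) (Dhat n w).

Let WX j n w : R := score_sum X nuX r A k Z inl n j w / q n.
Let WY j n w : R := score_sum Y nuY r A k Z inr n j w / q n.
Let fX j n w : R := class_freq r (fun i => vec (Z (inl i)) w) n (k n) (A j).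
Let fY j n w : R := class_freq r (fun i => vec (Z (inr i)) w) n (k n) (A j).

Let inlI : injective (@inl nat nat). Proof. by move=> ? ? []. Qed.
Let inrI : injective (@inr nat nat). Proof. by move=> ? ? []. Qed.

(** Reduces an approximation in probability to a deterministic implication. Tightness first fixes a
    bound B on all scores, off an event of probability eps / 2; the tolerance [dl] may then depend
    on B, and frequencies follow scores within [dl] off another such event. *)
Let whp_close (E : nat -> set S) :
  (forall B, 0 <= B -> exists dl Q, 0 < dl /\ forall n w, Q <= q n -> (k n < n)%N ->
    (forall j, `|q n * (fX j n w - p j) - WX j n w| <= dl) ->
    (forall j, `|q n * (fY j n w - p' j) - WY j n w| <= dl) ->
    (forall j, `|WX j n w| <= B) -> (forall j, `|WY j n w| <= B) -> E n w) ->
  whp P E.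
Proof.
move=> H eps eps0; have e2 : 0 < eps / 2 by rewrite divr_gt0.
have e4 : 0 < eps / 2 / 2 by rewrite divr_gt0.
have tX j : tight P (WX j).
  exact: (score_sum_tight hd paretoX X0 rvX soX hr hA OX k0 koo kn kaX hind inlI ZX j).
have tY j : tight P (WY j).
  exact: (score_sum_tight hd paretoY Y0 rvY soY hr hA OY k0 koo kn kaY hind inrI ZY j).
have [B1 [B10 H1]] := tight_forall tX e4; have [B2 [B20 H2]] := tight_forall tY e4.
have [dl [Q [dl0 {}H]]] := H (B1 + B2) (addr_ge0 B10 B20).
have cX := class_freq_scores hd paretoX X0 rvX soX hr hA OX k0 koo kn kaX hind inlI ZX0 ZX dl0.
have cY := class_freq_scores hd paretoY Y0 rvY soY hr hA OY k0 koo kn kaY hind inrI ZY0 ZY dl0.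
have [N1 HN1] := sqrt_k_cvg k0 koo Q.
have [N2 HN2] := critical_level_bounds hd paretoX X0 rvX soX hr OX k0 kn.
have -> : eps = eps / 2 / 2 + eps / 2 / 2 + eps / 2 by lra.
apply: likely_mono (likelyI (likelyI H1 H2) (whpI cX cY e2)).
exists (maxn N1 N2) => n; rewrite geq_max => /andP[/HN1 hq /HN2[_ _ _ _ hk]].
move=> w [[/= h1 h2] [/= h3 h4]]; apply: H => //; first exact: ltW.
  by move=> j; apply: le_trans (h1 j) _; rewrite lerDl.
by move=> j; apply: le_trans (h2 j) _; rewrite lerDr.
Qed.

(** The estimator is prescribed only where no frequency vanishes; positivity of the frequencies is
    part of what the delta method delivers. *)
Let DhatE n w : (k n < n)%N -> (forall j, 0 < fX j n w /\ 0 < fY j n w) ->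
  Dhat n w = \sum_j log_gap (fX j n w) (fY j n w) :> R.
Proof.
move=> hk pos; apply: (hD hk) => j; have [h1 h2] := pos j.
by rewrite !gt_eqF.
Qed.

Let sum_tol e : \sum_(j < K) e / K%:R = e :> R.
Proof. by rewrite sumr_const card_ord -[LHS]mulr_natr divfK// pnatr_eq0 -lt0n. Qed.

Let measurable_level (f : S -> R) x : measurable_fun setT (f : S -> measurableTypeR R) ->
  measurable [set w | f w <= x].
Proof.
move=> mf; rewrite (_ : [set _ | _] = setT `&` f @^-1` `]-oo, x]%classic).
  by apply: mf => //; exact: measurable_itv.
by rewrite setTI; apply/seteqP; split=> w /=; rewrite in_itv.
Qed.

Theorem kl_chi2 : (forall j, p j = p' j) ->
  cvg_in_distribution P (fun n w => (k n)%:R / 2 * (Dhat n w : R)) (chi2 R (K - 1)).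
Proof.
move=> pp; have s1 := sum_class_prob rvX hr hA OX.
have pos j : 0 < p j by have /andP[] := p01 j.
have [|j|H [Hk Ho Hi]] := @orthonormal_complement R K (fun j => Num.sqrt (p j)).
- by rewrite -s1; apply: eq_bigr => j _; rewrite sqr_sqrtr// ltW.
- by have /andP[_] := p01 j; move=> p1; rewrite -[ltRHS](@sqrtr1 R) ltr_sqrt.
(* These are the coefficients of the rotated vector z_j = (W^X_j - W^Y_j) / sqrt (2 p_j). The 2
   accounts for the two samples, whose covariances add up. *)
pose al (l : 'I_(K - 1)) j := H l j / Num.sqrt (2 * p j).
have sq2 j : Num.sqrt (2 * p j) = Num.sqrt 2 * Num.sqrt (p j) by rewrite sqrtrM.
have spos j : 0 < Num.sqrt (p j) by rewrite sqrtr_gt0.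
have s2 : 0 < Num.sqrt 2 :> R by rewrite sqrtr_gt0.
have spE j : Num.sqrt (p j) * Num.sqrt (p j) = p j by rewrite -expr2 sqr_sqrtr// ltW.
have s2E : Num.sqrt 2 * Num.sqrt 2 = 2 :> R by rewrite -expr2 sqr_sqrtr.
have mean_al l : \sum_j p j * al l j = 0.
  rewrite (eq_bigr (fun j => (Num.sqrt 2)^-1 * (H l j * Num.sqrt (p j)))).
    by rewrite -mulr_sumr Hk mulr0.
  move=> j _; rewrite /al sq2; have := spE j; have := spos j.
  by move: (Num.sqrt (p j)) => s s0 <-; field; rewrite !gt_eqF.
pose gX j : 'rV[R]_(K - 1) := \row_l al l j; pose gY j : 'rV[R]_(K - 1) := \row_l - al l j.
pose sX n (c : option 'I_K) := (q n)^-1 *: oapp gX 0 c.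
pose sY n (c : option 'I_K) := (q n)^-1 *: oapp gY 0 c.
pose ps := paired_sum Z (cell X nuX r A k) (cell Y nuY r A k) sX sY.
have close : law_close P (chi2 R (K - 1)) (fun n w => norm2 (ps n w)).
  apply: (@paired_chi2 _ _ _ _ _ _ _ _ hind _ _ (cell_weight X nuX r A k) (cell_weight Y nuY r A k)
    _ _ _ _ (fun j => p j) (fun j => p' j) _ k0 koo).
  - by move=> n c; exact: measurable_cell.
  - by move=> n c; exact: measurable_cell.
  - by move=> n i c; exact: (cell_weightE _ hr hA k ZX).
  - by move=> n i c; exact: (cell_weightE _ hr hA k ZY).
  - exact: (cell_weight_rate hd paretoX X0 rvX soX hr hA OX k0 kn kaX).
  - exact: (cell_weight_rate hd paretoY Y0 rvY soY hr hA OY k0 kn kaY).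
  - by move=> l; rewrite -[RHS](mean_al l); apply: eq_bigr => j _; rewrite mxE.
  - move=> l; rewrite -[RHS]oppr0 -[in RHS](mean_al l) -sumrN.
    by apply: eq_bigr => j _; rewrite mxE -pp mulrN.
  move=> l l'; rewrite -Ho -big_split; apply: eq_bigr => j _; rewrite !mxE -pp /= /al sq2.
  have := spE j; have := spos j; move: (Num.sqrt (p j)) => s s0 <-.
  move: s2E (s2); move: (Num.sqrt 2) => t tt t0.
  rewrite [LHS](_ : _ = 2 / (t * t) * (H l j * H l' j)); last by field; rewrite !gt_eqF.
  by rewrite tt divff// mul1r.
have psE n w : norm2 (ps n w) = \sum_j (WX j n w - WY j n w) ^+ 2 / (2 * p j).
  pose z j := (WX j n w - WY j n w) / Num.sqrt (2 * p j).
  (* The scores of one observation sum to 0 over j, as the p_j sum to 1. So z is orthogonal to the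
     vector of the sqrt p_j, and the rotation keeps its norm with one coordinate fewer. *)
  have one : \sum_j Num.sqrt (p j) * z j = 0.
    rewrite (eq_bigr (fun j => (Num.sqrt 2)^-1 * (1 * WX j n w - 1 * WY j n w))).
      rewrite -mulr_sumr sumrB /WX /WY !sum_score_sum /weighted_mean.
      under [\sum_j p j * 1]eq_bigr do rewrite mulr1.
      under [\sum_j p' j * 1]eq_bigr do rewrite mulr1.
      rewrite s1 (sum_class_prob rvY hr hA OY).
      rewrite !big1 ?subrr ?mulr0//; by move=> i _; case: cell => [j|] /=; rewrite ?subrr mul0r.
    move=> j _; rewrite /z sq2 !mul1r; have := spos j.
    by move: (Num.sqrt (p j)) => s s0; field; rewrite !gt_eqF.
  have c l : ps n w 0 l = \sum_j H l j * z j.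
    rewrite (eq_bigr (fun j => al l j * WX j n w + (- al l j) * WY j n w)); last first.
      by move=> j _; rewrite /z /al; ring.
    rewrite big_split/= /WX /WY !sum_score_sum /ps /paired_sum mxE !summxE.
    have m' : weighted_mean (fun j => p' j) (fun j => - al l j) = 0.
      rewrite /weighted_mean -[RHS]oppr0 -[in RHS](mean_al l) -sumrN.
      by apply: eq_bigr => j _; rewrite -pp mulrN.
    have m0 : weighted_mean (fun j => p j) (al l) = 0 by exact: mean_al.
    rewrite m0 m'; congr (_ + _); apply: eq_bigr => i _; rewrite mxE mulrC.
      by case: cell => [j|] /=; rewrite mxE ?subr0.
    by case: cell => [j|] /=; rewrite mxE ?subr0.
  rewrite /norm2; under eq_bigr do rewrite c; rewrite Hi//.
  by apply: eq_bigr => j _; rewrite /z exprMn exprVn sqr_sqrtr// mulr_ge0// ltW.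
apply: (slutsky _ close).
  move=> n x; apply: measurable_level; apply: measurable_funM; first exact: measurable_cst.
  have mD : measurable_fun setT (Dhat n : S -> measurableTypeR R) by exact: measurable_funP.
  exact: mD.
move=> e e0; apply: whp_close => B B0.
have eK : 0 < e / K%:R by rewrite divr_gt0 ?ltr0n.
have [|j|dl [Q [dl0 Q0 HQ]]] := @common_tolerance R K (fun j dl Q => forall q x y X Y, Q <= q ->
    `|q * (x - p j) - X| <= dl -> `|q * (y - p j) - Y| <= dl -> `|X| <= B -> `|Y| <= B ->
    [/\ 0 < x, 0 < y & `|q ^+ 2 / 2 * log_gap x y - (X - Y) ^+ 2 / (2 * p j)| <= e / K%:R]).
- move=> j dl Q dl' Q' h l1 l2 q x y X1 Y1 Qq hx hy; apply: h.
  + exact: le_trans l2 Qq.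
  + exact: le_trans hx l1.
  + exact: le_trans hy l1.
- exact: log_gap_close.
exists dl, Q; split=> // n w Qq hk h1 h2 h3 h4.
have h j : [/\ 0 < fX j n w, 0 < fY j n w & `|q n ^+ 2 / 2 * log_gap (fX j n w) (fY j n w) -
    (WX j n w - WY j n w) ^+ 2 / (2 * p j)| <= e / K%:R].
  by apply: HQ Qq (h1 j) _ (h3 j) (h4 j); rewrite pp.
rewrite /= psE DhatE//; last by move=> j; have [] := h j.
have qq := @sqr_sqrt_k R k n; rewrite -qq -expr2 mulr_sumr -sumrB.
apply: le_trans (ler_norm_sum _ _ _) _; rewrite -[leRHS]sum_tol.
by apply: ler_sum => j _; have [] := h j.
Qed.

Local Notation pp' := (fun j => p j).
Local Notation qq' := (fun j => p' j).

Theorem kl_normal : (exists j, p j <> p' j) ->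
  cvg_in_distribution P (fun n w => q n * ((Dhat n w : R) - kl_divergence pp' qq'))
    (normal_prob 0 (Num.sqrt (kl_variance pp' qq'))).
Proof.
move=> ne; have s1 := sum_class_prob rvX hr hA OX; have s2 := sum_class_prob rvY hr hA OY.
have pos j : 0 < p j by have /andP[] := p01 j.
have pos' j : 0 < p' j by have /andP[] := p'01 j.
have V0 : 0 < kl_variance pp' qq' by exact: kl_variance_gt0.
set sigma := Num.sqrt _; have sg0 : 0 < sigma by rewrite sqrtr_gt0.
pose D1 := kl_grad pp' qq'; pose D2 := kl_grad qq' pp'.
(* By [sum_cell_score] these centred gradients are the values on the cells of the linear part of the
   divergence. *)
pose gX j := D1 j - weighted_mean pp' D1; pose gY j := D2 j - weighted_mean qq' D2.
have mean0 (pr f : 'I_K -> R) : \sum_j pr j = 1 ->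
    \sum_j pr j * (f j - weighted_mean pr f) = 0.
  move=> e1; under eq_bigr do rewrite mulrBr.
  by rewrite sumrB -mulr_suml e1 mul1r subrr.
pose ps := paired_sum Z (cell X nuX r A k) (cell Y nuY r A k)
  (fun n c => oapp gX 0 c / q n) (fun n c => oapp gY 0 c / q n).
have close : law_close P (normal_prob 0 sigma) ps.
  apply: (@paired_normal _ _ _ _ _ _ _ _ hind _ _ (cell_weight X nuX r A k) (cell_weight Y nuY r A k)
    _ _ _ _ pp' qq' _ k0 koo).
  - by move=> n c; exact: measurable_cell.
  - by move=> n c; exact: measurable_cell.
  - by move=> n i c; exact: (cell_weightE _ hr hA k ZX).
  - by move=> n i c; exact: (cell_weightE _ hr hA k ZY).
  - exact: (cell_weight_rate hd paretoX X0 rvX soX hr hA OX k0 kn kaX).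
  - exact: (cell_weight_rate hd paretoY Y0 rvY soY hr hA OY k0 kn kaY).
  - exact: sg0.
  - exact: mean0.
  - exact: mean0.
  by rewrite sqr_sqrtr ?(ltW V0)// kl_varianceE.
have psE n w : ps n w = \sum_j (D1 j * WX j n w + D2 j * WY j n w).
  by rewrite big_split/= /WX /WY !sum_score_sum.
apply: (slutsky _ close).
  move=> n x; apply: measurable_level; apply: measurable_funM; first exact: measurable_cst.
  have mD : measurable_fun setT (Dhat n : S -> measurableTypeR R) by exact: measurable_funP.
  by apply: measurable_funB; [exact: mD|exact: measurable_cst].
move=> e e0; apply: whp_close => B B0.
have eK : 0 < e / K%:R by rewrite divr_gt0 ?ltr0n.
have [|j|dl [Q [dl0 Q0 HQ]]] := @common_tolerance R K (fun j dl Q => forall q x y X Y, Q <= q ->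
    `|q * (x - p j) - X| <= dl -> `|q * (y - p' j) - Y| <= dl -> `|X| <= B -> `|Y| <= B ->
    [/\ 0 < x, 0 < y & `|q * (log_gap x y - log_gap (p j) (p' j)) - (D1 j * X + D2 j * Y)| <= e / K%:R]).
- move=> j dl Q dl' Q' h l1 l2 q x y X1 Y1 Qq hx hy; apply: h.
  + exact: le_trans l2 Qq.
  + exact: le_trans hx l1.
  + exact: le_trans hy l1.
- exact: log_gap_linear_close.
exists dl, Q; split=> // n w Qq hk h1 h2 h3 h4.
have h j := HQ j _ _ _ _ _ Qq (h1 j) (h2 j) (h3 j) (h4 j).
rewrite /= psE DhatE//; last by move=> j; have [] := h j.
rewrite /kl_divergence -sumrB mulr_sumr -sumrB.
apply: le_trans (ler_norm_sum _ _ _) _; rewrite -[leRHS]sum_tol.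
by apply: ler_sum => j _; have [] := h j.
Qed.

End limits.

Unset Implicit Arguments.

Theorem theorem2 (R : realType) (d K : nat) (hd : (1 <= d)%N) (hK : (2 <= K)%N)
  (* X and Y *)
  (dX : measure_display) (TX : measurableType dX) (PX : probability TX R)
  (X : {RV PX >-> borel_rV R d})
  (dY : measure_display) (TY : measurableType dY) (PY : probability TY R)
  (Y : {RV PY >-> borel_rV R d})
  (hX0 : orthant_valued X) (hY0 : orthant_valued Y)
  (hXpareto : standard_pareto_margins X) (hYpareto : standard_pareto_margins Y)
  (nuX nuY : {measure set (borel_rV R d) -> \bar R})
  (hXrv : regularly_varying X nuX) (hYrv : regularly_varying Y nuY)
  (aX aY : R -> R)
  (hX2 : second_order X nuX aX) (hY2 : second_order Y nuY aY)
  (* risk functional and partition *)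
  (r : 'rV[R]_d -> R) (hr : risk_functional r)
  (A : 'I_K -> set 'rV[R]_d) (hA : admissible_partition r A)
  (hAX : forall j, nuX (boundary (A j)) = 0%E)
  (hAY : forall j, nuY (boundary (A j)) = 0%E)
  (hOX : nuX (boundary (risk_region r)) = 0%E)
  (hOY : nuY (boundary (risk_region r)) = 0%E)
  (hOXpos : (0 < nuX (risk_region r))%E) (hOYpos : (0 < nuY (risk_region r))%E)
  (p q : 'I_K -> R)
  (hpE : forall j, p j = class_prob nuX r (A j))
  (hqE : forall j, q j = class_prob nuY r (A j))
  (hp : forall j, 0 < p j < 1) (hq : forall j, 0 < q j < 1)
  (* number of exceedances *)
  (k : nat -> nat) (hk0 : forall n, (0 < k n)%N)
  (hkoo : k n @[n --> \oo] --> \oo)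
  (hkn : (k n)%:R / n%:R @[n --> \oo] --> (0 : R))
  (hkX : Num.sqrt (k n)%:R * aX (tail_quantile X (n%:R / (k n)%:R))
           @[n --> \oo] --> (0 : R))
  (hkY : Num.sqrt (k n)%:R * aY (tail_quantile Y (n%:R / (k n)%:R))
           @[n --> \oo] --> (0 : R))
  (* samples *)
  (dS : measure_display) (S : measurableType dS) (P : probability S R)
  (Xs Ys : nat -> {RV P >-> borel_rV R d})
  (hXs0 : forall i, orthant_valued (Xs i))
  (hYs0 : forall i, orthant_valued (Ys i))
  (hXs : forall i, same_law P PX (Xs i) X)
  (hYs : forall i, same_law P PY (Ys i) Y)
  (hindep : mutually_independent P (pooled (fun i => Xs i : S -> borel_rV R d)
                                           (fun i => Ys i : S -> borel_rV R d)))
  (* empirical divergence *)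
  (Dhat : nat -> {RV P >-> measurableTypeR R})
  (hDhat : forall n w, is_empirical_kl r A n (k n)
             (fun i => vec (Xs i) w) (fun i => vec (Ys i) w) (Dhat n w)) :
  ((forall j, p j = q j) ->
     cvg_in_distribution P (fun n w => (k n)%:R / 2 * (Dhat n w : R))
       (chi2 R (K - 1)))
  /\
  ((exists j, p j <> q j) ->
     cvg_in_distribution P
       (fun n w => Num.sqrt (k n)%:R * ((Dhat n w : R) - kl_divergence p q))
       (normal_prob 0 (Num.sqrt (kl_variance p q)))).
Proof.
pose Z (i : nat + nat) := match i with inl l => Xs l | inr l => Ys l end.
have hind : mutually_independent P (fun i => Z i : S -> borel_rV R d).
  rewrite (_ : (fun i => _) = pooled (fun i => Xs i : S -> borel_rV R d)
    (fun i => Ys i : S -> borel_rV R d))//.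
  by apply: funext => -[].
have eq1 : p = fun j => class_prob nuX r (A j) by exact/funext.
have eq2 : q = fun j => class_prob nuY r (A j) by exact/funext.
have hp' j : 0 < class_prob nuX r (A j) < 1 by rewrite -hpE.
have hq' j : 0 < class_prob nuY r (A j) < 1 by rewrite -hqE.
have K0 : (0 < K)%N by exact: ltn_trans hK.
split=> [pq|pq].
  apply: (kl_chi2 hd hX0 hY0 hXpareto hYpareto hXrv hYrv hX2 hY2 hr hA hOXpos hOYpos hp' K0
    hk0 hkoo hkn hkX hkY hind hXs0 hYs0 hXs hYs hDhat).
  by move=> j; rewrite -hpE -hqE.
rewrite eq1 eq2.
apply: (kl_normal hd hX0 hY0 hXpareto hYpareto hXrv hYrv hX2 hY2 hr hA hOXpos hOYpos hp' hq' K0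
    hk0 hkoo hkn hkX hkY hind hXs0 hYs0 hXs hYs hDhat).
by have [j] := pq; rewrite hpE hqE; exists j.
Qed.
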